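(* Let $M$ be a complete Kähler manifold of real dimension $2n$, and let $\rho : M \to [0,\infty)$ be a nonnegative weight function such that $M$ has property $\mathcal{P}(\rho)$. Let $p>1$ and let $u$ be a (real-valued) pluriharmonic function on $M$ with $\int_M |\nabla u|^p \, dV<\infty$. Assume that the Ricci curvature of $M$ satisfies $$\mathrm{Ric}_M \geq -k\rho$$ where $k$ is a constant with $k<\frac{4}{p}$ if $p\geq 2$ and $k<\frac{4p}{(4-p)^2}$ if $1<p<2$. Then $u$ is a constant function.
   Context: Manifolds are connected. A complete Riemannian manifold $M$ has property $\mathcal{P}(\rho)$, for a nonnegative weight function $\rho$ on $M$, if the weighted Poincaré inequality $\int_M \rho\,\phi^2\,dV \leq \int_M |\nabla\phi|^2\,dV$ holds for every compactly supported smooth function $\phi$ on $M$. The condition $\mathrm{Ric}_M\ge -k\rho$ means $\mathrm{Ric}_M(X,X)\ge -k\rho(x)|X|^2$ for all $x\in M$ and $X\in T_xM$. A function $u$ is pluriharmonic if $\partial\bar\partial u=0$. *)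

(* Defs.v *)
From HB Require Import structures.
From mathcomp Require Import all_boot all_order all_algebra.
From mathcomp Require Import all_classical all_reals all_analysis.
From mathcomp Require Import complex.

Set Implicit Arguments.
Unset Strict Implicit.
Unset Printing Implicit Defensive.

Import Order.TTheory GRing.Theory Num.Theory.
Import numFieldNormedType.Exports.

Local Open Scope classical_set_scope.
Local Open Scope ring_scope.

Section Euclidean.
Context {R : realType} {m : nat}.
Implicit Types (f : 'rV[R]_m -> R) (V : set 'rV[R]_m).

Definition partial (a : 'I_m) f : 'rV[R]_m -> R :=
  fun y => 'D_(delta_mx ord0 a) f y.

Definition partials (s : seq 'I_m) f : 'rV[R]_m -> R := foldr partial f s.

(* Meant for an open set V. *)
Definition Ck_on (N : nat) V f : Prop :=
  forall s, (size s <= N)%N -> forall y, V y ->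
    {for y, continuous (partials s f)} /\
    ((size s < N)%N -> forall a, derivable (partials s f) y (delta_mx ord0 a)).

Definition smooth_on V f : Prop := forall N, Ck_on N V f.

End Euclidean.

(* The Lebesgue integral over R^m of a nonnegative function, as an iterated
   integral (Tonelli). *)
Fixpoint integral_rV {R : realType} (m : nat) : ('rV[R]_m -> \bar R) -> \bar R :=
  match m return ('rV[R]_m -> \bar R) -> \bar R with
  | 0 => fun f => f 0
  | m'.+1 => fun f => (\int[@lebesgue_measure R]_(t in [set: R])
      integral_rV (fun v : 'rV[R]_m' => f (row_mx (t%:M : 'rV[R]_1) v)))%E
  end.

(* C^n is represented by R^(n+n): the first n coordinates are the real parts
   and the last n the imaginary parts of the complex coordinates. *)
Section Wirtinger.
Context {R : realType} {n : nat}.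
Implicit Types f : 'rV[R]_(n + n) -> R[i].

Definition partialC (a : 'I_(n + n)) f : 'rV[R]_(n + n) -> R[i] :=
  fun y => Complex (partial a (fun z => complex.Re (f z)) y)
                   (partial a (fun z => complex.Im (f z)) y).

Definition d_z (j : 'I_n) f : 'rV[R]_(n + n) -> R[i] :=
  fun y => 2^-1 * (partialC (lshift n j) f y - 'i%C * partialC (rshift n j) f y).

Definition d_zbar (j : 'I_n) f : 'rV[R]_(n + n) -> R[i] :=
  fun y => 2^-1 * (partialC (lshift n j) f y + 'i%C * partialC (rshift n j) f y).

Definition holomorphic_on (V : set 'rV[R]_(n + n))
    (F : 'rV[R]_(n + n) -> 'rV[R]_(n + n)) : Prop :=
  (forall a, smooth_on V (fun y => F y ord0 a)) /\
  forall (l k : 'I_n) y, V y ->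
    d_zbar k (fun z => Complex (F z ord0 (lshift n l)) (F z ord0 (rshift n l))) y
    = 0.

(* Tangent vectors are row vectors: v *m Jmx is the complex structure applied
   to v, so that d/dx_j is sent to d/dy_j and d/dy_j to - d/dx_j. *)
Definition Jmx : 'M[R]_(n + n) := block_mx 0 1%:M (- 1%:M) 0.

End Wirtinger.

(* Connected Hausdorff complex manifolds of complex dimension n. Second
   countability is expressed by the countability of the atlas; a chart may have
   an empty domain. *)
Record complexManifold (R : realType) (n : nat) (M : ptopologicalType) :=
  ComplexManifold {
    chart_dom : nat -> set M;
    chart_cod : nat -> set 'rV[R]_(n + n);
    chart : nat -> M -> 'rV[R]_(n + n);
    chart_inv : nat -> 'rV[R]_(n + n) -> M;
    manifold_connected : connected [set: M];
    manifold_hausdorff : hausdorff_space M;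
    chart_cover : forall x, exists i, chart_dom i x;
    chart_dom_open : forall i, open (chart_dom i);
    chart_cod_open : forall i, open (chart_cod i);
    chart_to : forall i x, chart_dom i x -> chart_cod i (chart i x);
    chart_inv_to : forall i y, chart_cod i y -> chart_dom i (chart_inv i y);
    chartK : forall i x, chart_dom i x -> chart_inv i (chart i x) = x;
    chart_invK : forall i y, chart_cod i y -> chart i (chart_inv i y) = y;
    chart_continuous : forall i x, chart_dom i x -> {for x, continuous (chart i)};
    chart_inv_continuous : forall i y, chart_cod i y ->
      {for y, continuous (chart_inv i)};
    transition_holomorphic : forall i j,
      holomorphic_on (chart_cod i `&` chart_inv i @^-1` chart_dom j)
                     (chart j \o chart_inv i) }.

Section Metric.
Context {R : realType} {m : nat}.
Implicit Types (g : 'rV[R]_m -> 'M[R]_m) (y v w : 'rV[R]_m).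

Definition bilin (A : 'M[R]_m) v w : R := (v *m A *m w^T) ord0 ord0.

Definition dmetric g (a b c : 'I_m) y : R := partial a (fun z => g z b c) y.

(* christoffel g c a b is Gamma^c_{ab}. *)
Definition christoffel g (c a b : 'I_m) y : R :=
  2^-1 * \sum_(d < m) invmx (g y) c d *
    (dmetric g a b d y + dmetric g b a d y - dmetric g d a b y).

(* The sign is the one for which round spheres have positive Ricci curvature. *)
Definition ricci g y : 'M[R]_m := \matrix_(a, b)
  (\sum_(c < m) (partial c (christoffel g c a b) y
                 - partial b (christoffel g c a c) y)
   + \sum_(c < m) \sum_(d < m)
       (christoffel g c c d y * christoffel g d a b y
        - christoffel g c b d y * christoffel g d a c y)).

End Metric.

(* metric i y is the Gram matrix of the Riemannian metric in the real
   coordinates of the i-th chart. The last two fields say that the metric is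
   Hermitian and that its fundamental form g(J_, _) is closed. *)
Record kahlerMetric (R : realType) (n : nat) (M : ptopologicalType)
    (X : complexManifold R n M) := KahlerMetric {
  metric : nat -> 'rV[R]_(n + n) -> 'M[R]_(n + n);
  metric_smooth : forall i a b, smooth_on (chart_cod X i) (fun y => metric i y a b);
  metric_sym : forall i y, chart_cod X i y -> (metric i y)^T = metric i y;
  metric_pos : forall i y, chart_cod X i y ->
    forall v, v != 0 -> 0 < bilin (metric i y) v v;
  metric_compat : forall i j y,
    chart_cod X i y -> chart_dom X j (chart_inv X i y) ->
    let F := chart X j \o chart_inv X i in
    metric i y = 'J F y *m metric j (F y) *m ('J F y)^T;
  metric_hermitian : forall i y, chart_cod X i y ->
    Jmx *m metric i y *m Jmx^T = metric i y;
  metric_kahler : forall i y, chart_cod X i y -> forall a b c,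
    let omega := fun z => Jmx *m metric i z in
    dmetric omega a b c y + dmetric omega b c a y + dmetric omega c a b y = 0 }.

Section Manifold.
Context {R : realType} {n : nat} {M : ptopologicalType}.
Context {X : complexManifold R n M} (g : kahlerMetric X).
Implicit Types (f u : M -> R) (x y : M).

(* The least index of a chart around x. *)
Definition chart_at x : nat :=
  xget 0%N [set i | chart_dom X i x /\ forall j, chart_dom X j x -> (i <= j)%N].

(* The Riemannian volume measure: sqrt (det g) times Lebesgue measure in each chart, M being
   cut into the disjoint Borel pieces where chart_at is constant. *)
Definition volume (A : set (g_sigma_algebraType (@open M))) : \bar R :=
  (\sum_(0 <= i <oo) integral_rV (fun z =>
     (if `[< chart_cod X i z /\ chart_at (chart_inv X i z) = i /\
             A (chart_inv X i z) >]
      then Num.sqrt (\det (metric g i z)) else 0)%:E))%E.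

Definition Ck_function (N : nat) f : Prop :=
  forall i, Ck_on N (chart_cod X i) (f \o chart_inv X i).

Definition smooth_function f : Prop := forall N, Ck_function N f.

Definition norm_grad f x : R :=
  let i := chart_at x in
  let df := \row_a partial a (f \o chart_inv X i) (chart X i x) in
  Num.sqrt (bilin (invmx (metric g i (chart X i x))) df df).

(* d_z j (d_zbar k u) is the coefficient of dz_j /\ dzbar_k in ddbar u; u is
   assumed C^2 only, the least regularity for which ddbar u makes sense. *)
Definition pluriharmonic u : Prop :=
  Ck_function 2 u /\
  forall i z, chart_cod X i z -> forall j k : 'I_n,
    d_z j (d_zbar k (fun w => Complex (u (chart_inv X i w)) 0)) z = 0.

(* Curves are parametrized by [0, 1] and C^1 in a neighbourhood of it; the
   values of c far from [0, 1] are irrelevant. *)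
Definition C1_curve (c : R -> M) : Prop :=
  forall t, 0 <= t <= 1 -> {for t, continuous c} /\
    forall i, chart_dom X i (c t) ->
      (\forall s \near t, derivable (chart X i \o c : R -> 'rV[R]_(n + n)) s 1) /\
      {for t, continuous (fun s => 'D_1 (chart X i \o c : R -> 'rV[R]_(n + n)) s)}.

Definition speed (c : R -> M) (t : R) : R :=
  let i := chart_at (c t) in
  let v := 'D_1 (chart X i \o c : R -> 'rV[R]_(n + n)) t in
  Num.sqrt (bilin (metric g i (chart X i (c t))) v v).

Definition curve_length (c : R -> M) : \bar R :=
  (\int[@lebesgue_measure R]_(t in `[0%R, 1%R]) (speed c t)%:E)%E.

Inductive piecewise_length : M -> M -> \bar R -> Prop :=
| piecewise_one c : C1_curve c ->
    piecewise_length (c 0) (c 1) (curve_length c)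
| piecewise_cat x y z l l' : piecewise_length x y l -> piecewise_length y z l' ->
    piecewise_length x z (l + l')%E.

Definition riemannian_dist x y : \bar R :=
  ereal_inf [set l | piecewise_length x y l].

Definition complete_manifold : Prop :=
  forall s : nat -> M,
    (forall e : R, 0 < e -> exists N, forall j k, (N <= j)%N -> (N <= k)%N ->
       (riemannian_dist (s j) (s k) < e%:E)%E) ->
    exists x, s @ \oo --> x.

Definition weighted_poincare (rho : M -> R) : Prop :=
  forall phi : M -> R, smooth_function phi ->
    compact (closure [set x | phi x != 0]) ->
    (\int[volume]_x (rho x * phi x ^+ 2)%:E
       <= \int[volume]_x (norm_grad phi x ^+ 2)%:E)%E.

Definition ricci_ge (h : M -> R) : Prop :=
  forall i z, chart_cod X i z -> forall v : 'rV[R]_(n + n),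
    h (chart_inv X i z) * bilin (metric g i z) v v
      <= bilin (ricci (metric g i) z) v v.

End Manifold.

(* Main.v *)
From HB Require Import structures.
Require Import Defs.
From mathcomp Require Import all_boot all_order all_algebra.
From mathcomp Require Import fingroup perm finmap.
From mathcomp Require Import all_classical all_reals all_analysis.
From mathcomp Require Import measurable_realfun complex ring lra.
Import Order.TTheory GRing.Theory Num.Theory.
Import numFieldNormedType.Exports.
Local Open Scope classical_set_scope.
Local Open Scope ring_scope.
Set Implicit Arguments.
Unset Strict Implicit.
Unset Printing Implicit Defensive.

(* With G = |du|^2, pluriharmonicity improves Kato's inequality in the Bochner formula to
   Delta G / 2 >= |dG|^2 / (2 G) + Ric(du, du). Testing it with phi^2 (G + e)^(p/2 - 1), and the weighted Poincare
   inequality with phi (G + e)^(p/4), bounds the integral of phi^2 G^(p/2 - 2) |dG|^2 by that of G^(p/2) |dphi|^2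
   as soon as k < 4/p, which both hypotheses on k imply. On a complete manifold there are compactly supported phi
   with |dphi| <= 1 and arbitrarily large value at a given point, so finite energy forces dG = 0. If G is a positive
   constant, the volume is finite, and pairing du with d(phi atan u) gives a contradiction; hence du = 0.
   The cutoffs phi are obtained without smoothing the distance, by applying Ekeland's principle to the supremum of
   the admissible functions; the weak Bochner formula needs no more than first derivatives of G. *)

(** Three regularity issues shape the development. The function u is only C^2, so |du|^2 is only
    C^1, while the Bochner formula formally involves third derivatives of u. It is therefore proved
    as an integral identity, and the commutation of derivatives behind it is obtained for C^1
    functions from difference quotients and translation invariance. The weight rho is not even
    assumed measurable, so integrals against it are lower integrals: continuous minorants are
    integrated instead, and test functions are approximated from above. Finally, [volume] is a bare
    set function made of iterated integrals in charts; its independence of the charts needs the full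
    change of variables formula, which is proved by bisection of boxes. The factor 1/2 in the
    Bochner inequality comes from the complex structure J: the Hessian of a pluriharmonic function
    is J-anti-invariant, so it acts with equal strength on the gradient and on its image under J.
    The threshold 4/p is the condition for a positive coefficient of |dG|^2 after the two tests are
    combined: with q = p/2 this coefficient is q/2 - k q^2/4. *)

Section Lines.
Context {R : realType} {U W : normedModType R}.
Implicit Types (f : U -> W) (y v : U).

Lemma is_derive_line f y v (t : R) (l : W) :
  is_derive (y + t *: v) v f l -> is_derive t 1 (fun s => f (y + s *: v)) l.
Proof.
move=> [df <-]; have E : (fun h => h^-1 *: (((fun s => f (y + s *: v)) \o shift t) (h *: 1)
    - f (y + t *: v))) = (fun h => h^-1 *: ((f \o shift (y + t *: v)) (h *: v) - f (y + t *: v))).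
  by apply/funext => h /=; rewrite [h *: 1]mulr1 scalerDl addrA [h *: v + _]addrC addrAC.
by split; rewrite /derivable /derive E.
Qed.

Lemma derivable_lineP f y v :
  derivable f y v <-> derivable (fun s : R => f (y + s *: v)) 0 1.
Proof.
split=> [/derivableP df|H].
  by have [] := @is_derive_line f y v 0 ('D_v f y); rewrite ?scale0r ?addr0.
by apply/derivable1P; under eq_fun do rewrite addrC.
Qed.

End Lines.

(** * Differentiability of functions of several real variables *)

Section RowVectors.
Context {R : realType} {m : nat}.
Implicit Types (y z v : 'rV[R]_m) (f : 'rV[R]_m -> R).

Lemma coord_le_norm v (a : 'I_m) : `|v ord0 a| <= `|v|.
Proof.
rewrite [leRHS]/Num.Def.normr/= mx_normrE.
exact: (le_bigmax _ (fun ij : 'I_1 * 'I_m => `|v ij.1 ij.2|) (ord0, a)).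
Qed.

Lemma norm_le_coord v (e : R) : 0 <= e ->
  (forall a, `|v ord0 a| <= e) -> `|v| <= e.
Proof.
move=> e0 ve; rewrite [leLHS]/Num.Def.normr/= mx_normrE.
by apply/bigmax_leP; split=> // -[i a] _ /=; rewrite (ord1 i).
Qed.

Lemma norm_delta_le (a : 'I_m) : `|delta_mx ord0 a : 'rV[R]_m| <= 1.
Proof.
by apply: norm_le_coord => // b; rewrite mxE eqxx /=; case: eqP; rewrite ?normr1 ?normr0.
Qed.

Lemma MVT_line f (df : R -> R) y v :
  (forall t : R, 0 <= t <= 1 -> is_derive (y + t *: v) v f (df t)) ->
  exists2 t : R, 0 <= t <= 1 & f (y + v) - f y = df t.
Proof.
move=> fD; have D (t : R) : 0 <= t <= 1 -> is_derive t 1 (fun s => f (y + s *: v)) (df t).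
  by move=> /fD /is_derive_line.
have [|t |t tI E] := @MVT_segment R (fun s => f (y + s *: v)) df 0 1 ler01.
- by move=> t; rewrite in_itv /= => /andP[/ltW a /ltW b]; apply: D; rewrite a.
- apply: derivable_within_continuous => s; rewrite in_itv /= => sI.
  by have [] := D s sI.
- exists t; first by move: tI; rewrite in_itv.
  by move: E; rewrite scale1r scale0r addr0 subr0 mulr1.
Qed.

(** The segment is parametrized by [0, 1] and rescaled by c, so c may have either sign or vanish,
    and only the derivative along one coordinate axis enters. *)
Lemma MVT_delta f y (a : 'I_m) (c : R) :
  (forall t : R, 0 <= t <= 1 -> derivable f (y + (t * c) *: delta_mx ord0 a) (delta_mx ord0 a)) ->
  exists2 t : R, 0 <= t <= 1 &
    f (y + c *: delta_mx ord0 a) - f y = c * partial a f (y + (t * c) *: delta_mx ord0 a).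
Proof.
move=> fD; pose g t := f (y + (t * c) *: delta_mx ord0 a).
have D (t : R) : 0 <= t <= 1 ->
    is_derive t 1 g (partial a f (y + (t * c) *: delta_mx ord0 a) * c).
  move=> tI; apply: (@is_derive1_comp R (fun s => f (y + s *: delta_mx ord0 a)) (fun t => t * c)).
    by apply: is_derive_line; apply/derivableP/fD.
  have -> : (fun t : R => t * c) = c *: id by apply/funext => s; rewrite mulrC.
  by rewrite -[X in is_derive _ _ _ X]mulr1; apply: is_deriveZ.
have [|t |t tI E] := @MVT_segment R g (fun t => partial a f (y + (t * c) *: delta_mx ord0 a) * c) 0 1 ler01.
- by move=> t; rewrite in_itv /= => /andP[/ltW a' /ltW b]; apply: D; rewrite a'.
- apply: derivable_within_continuous => s; rewrite in_itv /= => sI.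
  by have [] := D s sI.
- exists t; first by move: tI; rewrite in_itv.
  by move: E; rewrite /g mul1r mul0r scale0r addr0 subr0 mulr1 mulrC.
Qed.

Lemma nbhs_rV y (P : set 'rV[R]_m) :
  nbhs y P <-> exists2 r : R, 0 < r & forall z, `|z - y| < r -> P z.
Proof.
split=> [/nbhs_ballP[r r0 H]|[r r0 H]].
  by exists r => // z zr; apply: H; rewrite -ball_normE /= distrC.
by apply/nbhs_ballP; exists r => // z; rewrite -ball_normE /= distrC => /H.
Qed.

Lemma continuous_rVP f y : {for y, continuous f} <->
  forall e : R, 0 < e -> exists2 r : R, 0 < r & forall z, `|z - y| < r -> `|f z - f y| < e.
Proof.
split=> [/cvgrPdist_lt H e /H /nbhs_rV[r r0 Hr]|H].
  by exists r => // z /Hr; rewrite distrC.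
by apply/(@cvgrPdist_lt _ R _ (nbhs y) _ f (f y)) => e /H [r r0 Hr]; apply/nbhs_rV; exists r => // z /Hr; rewrite distrC.
Qed.

Definition linform (l v : 'rV[R]_m) : R := \sum_a l ord0 a * v ord0 a.

Lemma linform_is_linear l : linear (linform l).
Proof.
move=> c v w; rewrite -[c *: linform l v]/(c * linform l v) /linform mulr_sumr -big_split /=.
by apply: eq_bigr => a _; rewrite !mxE; ring.
Qed.
HB.instance Definition _ l := GRing.isLinear.Build R 'rV[R]_m R _ (linform l) (linform_is_linear l).

Lemma linform_bound l v : `|linform l v| <= (\sum_a `|l ord0 a|) * `|v|.
Proof.
rewrite mulr_suml (le_trans (ler_norm_sum _ _ _)) //; apply: ler_sum => a _.
by rewrite normrM ler_wpM2l ?coord_le_norm.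
Qed.

(** A linear form on row vectors is continuous by [linform_bound], so the epsilon estimate is
    Fréchet differentiability, and uniqueness of the differential identifies the form. *)
Lemma differentiable_linform f y l :
  (forall e : R, 0 < e -> exists2 r : R, 0 < r &
     forall z, `|z - y| < r -> `|f z - f y - linform l (z - y)| <= e * `|z - y|) ->
  differentiable f y /\ 'd f y = linform l :> ('rV[R]_m -> R).
Proof.
move=> H.
have lc : continuous (linform l).
  move=> v; apply/continuous_rVP => e e0.
  have C0 : 0 < (\sum_a `|l ord0 a|) + 1 by rewrite ltr_wpDl ?sumr_ge0.
  exists (e / ((\sum_a `|l ord0 a|) + 1)); first by rewrite divr_gt0.
  move=> z; rewrite ltr_pdivlMr // => Hz; rewrite -linearB /=.
  rewrite (le_lt_trans (linform_bound _ _)) //; apply: le_lt_trans Hz.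
  by rewrite mulrC ler_wpM2l // lerDl.
have E : 'd f y = linform l :> ('rV[R]_m -> R).
  apply: diff_unique => //; apply/eqaddoP => e /H[r r0 Hr]; apply/nbhs_rV; exists r => // z.
  rewrite subr0 => zr.
  by have := Hr (z + y); rewrite addrK => /(_ zr); rewrite /= opprD addrA.
split=> //; apply/diff_locallyP; rewrite E; split=> //.
apply/eqaddoP => e /H[r r0 Hr]; apply/nbhs_rV; exists r => // z; rewrite subr0 => zr.
by have := Hr (z + y); rewrite addrK => /(_ zr); rewrite /= opprD addrA.
Qed.

(* The increment is split along the path changing one coordinate at a time. *)
Lemma C1_differentiable f y (V : set 'rV[R]_m) : open V -> V y ->
  (forall a z, V z -> derivable f z (delta_mx ord0 a)) ->
  (forall a, {for y, continuous (partial a f)}) ->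
  differentiable f y /\ 'd f y = linform (\row_a partial a f y) :> ('rV[R]_m -> R).
Proof.
move=> oV Vy fD fC; apply: differentiable_linform => e e0.
have [r1 r10 H1] : exists2 r : R, 0 < r & forall z, `|z - y| < r -> V z.
  by apply/nbhs_rV; exact: open_nbhs_nbhs.
(* The error is shared among the m coordinate steps; m + 1 keeps the quotient meaningful for m =
   0. *)
pose e' := e / m.+1%:R.
have e'0 : 0 < e' by rewrite divr_gt0.
have [r2 r20 H2] : exists2 r : R, 0 < r & forall z, `|z - y| < r ->
    forall a, `|partial a f z - partial a f y| < e'.
  apply/nbhs_rV.
  apply: (@filter_forall _ _ (fun a z => `|partial a f z - partial a f y| < e') (nbhs y)) => a.
  apply/nbhs_rV.
  by have /continuous_rVP := fC a; apply.
exists (Num.min r1 r2); first by rewrite lt_min r10.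
move=> z; rewrite lt_min => /andP[z1 z2].
pose p k := \row_(a < m) (if (a < k)%N then z ord0 a else y ord0 a).
have p0 : p 0%N = y by apply/rowP => a; rewrite mxE.
have pm : p m = z by apply/rowP => a; rewrite mxE ltn_ord.
have pS (a : 'I_m) : p a.+1 = p a + (z - y) ord0 a *: delta_mx ord0 a.
  apply/rowP => b; rewrite !mxE eqxx /= ltnS leq_eqVlt.
  have [->|ba] := eqVneq b a; first by rewrite eqxx ltnn mulr1 addrC subrK.
  by rewrite (inj_eq val_inj) (negPf ba) mulr0 addr0.
have near_p (a : 'I_m) (t : R) : 0 <= t <= 1 ->
    `|p a + (t * (z - y) ord0 a) *: delta_mx ord0 a - y| <= `|z - y|.
  move=> /andP[t0 t1]; apply: norm_le_coord => // b; rewrite !mxE eqxx /=.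
  have := coord_le_norm (z - y) b; rewrite !mxE => Hb.
  have [->|ba] := eqVneq b a.
    rewrite ltnn mulr1 addrC addKr normrM (ger0_norm t0).
    by rewrite (le_trans _ (coord_le_norm _ a)) // !mxE ler_piMl.
  by rewrite mulr0 addr0; case: ifP => // _; rewrite subrr normr0.
have -> : f z - f y = \sum_(a < m) (f (p a.+1) - f (p a)).
  by rewrite -(big_mkord xpredT (fun k => f (p k.+1) - f (p k))) telescope_sumr // p0 pm.
rewrite /linform -sumrB (le_trans (ler_norm_sum _ _ _)) //.
apply: (@le_trans _ _ (\sum_(a < m) (e' * `|z - y|))); last first.
  rewrite sumr_const card_ord -mulr_natl mulrA ler_wpM2r // /e' mulrCA.
  by rewrite ler_piMr ?(ltW e0) // ler_pdivrMr // mul1r ler_nat.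
apply: ler_sum => a _; rewrite pS.
have [|t tI ->] := @MVT_delta f (p a) a ((z - y) ord0 a).
  by move=> t tI; apply/fD/H1; exact: le_lt_trans (near_p _ _ tI) _.
have HP := H2 _ (le_lt_trans (near_p _ _ tI) z2) a.
rewrite [(\row__ _) _ _]mxE [partial a f y * _]mulrC -mulrBr normrM mulrC.
by rewrite ler_pM ?coord_le_norm // ltW.
Qed.

End RowVectors.

Lemma continuous_near (T U : topologicalType) (f g : T -> U) (y : T) :
  (\forall z \near y, f z = g z) -> {for y, continuous f} -> {for y, continuous g}.
Proof.
move=> E Hf; rewrite /prop_for /continuous_at -(nbhs_singleton E).
by apply: cvg_trans Hf; exact: near_eq_cvg.
Qed.

Lemma near_eq_open (T : topologicalType) (U : Type) (V : set T) (f g : T -> U) (y : T) :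
  open V -> V y -> {in V, f =1 g} -> \forall z \near y, f z = g z.
Proof.
move=> oV Vy fg; apply: (@filterS _ (nbhs y) _ V) => [z Vz|]; last exact: open_nbhs_nbhs.
by apply: fg; rewrite inE.
Qed.

(** * Functions of class C^N on subsets of R^m *)

Section Ck.
Context {R : realType} {m : nat}.
Implicit Types (V W : set 'rV[R]_m) (f g : 'rV[R]_m -> R) (y : 'rV[R]_m).

(* An inductive copy of [Ck_on]: failing unification must not unfold the iterated derivatives. *)
Variant isCk (N : nat) V f : Prop := IsCk of Ck_on N V f.

Lemma isCkP N V f : isCk N V f <-> Ck_on N V f.
Proof. by split=> [[]|]. Qed.

Lemma isCk0 V f : isCk 0 V f <-> (forall y, V y -> {for y, continuous f}).
Proof.
split=> [[H] y Vy|H]; first by have [] := H [::] isT y Vy.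
by split=> -[|a s] // _ y Vy; split=> //; exact: H.
Qed.

Lemma isCkS N V f : isCk N.+1 V f <->
  [/\ forall y, V y -> {for y, continuous f},
      forall y, V y -> forall a, derivable f y (delta_mx ord0 a)
    & forall a, isCk N V (partial a f)].
Proof.
split=> [[H]|[H1 H2 H3]].
  split=> [y Vy|y Vy a|a]; last split=> s sN y Vy.
  - by have [] := H [::] isT y Vy.
  - by have [_] := H [::] isT y Vy; apply.
  - have := H (rcons s a); rewrite size_rcons /partials foldr_rcons => /(_ sN y Vy).
    by rewrite ltnS.
split=> s; case/lastP: s => [_ y Vy|s a]; first by split=> [|_ a]; [exact: H1|exact: H2].
by rewrite size_rcons /partials foldr_rcons !ltnS => sN y Vy; have [H4] := H3 a; exact: H4.
Qed.

Lemma Ck_continuous N V f : isCk N V f -> forall y, V y -> {for y, continuous f}.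
Proof. by move=> [H] y Vy; have [] := H [::] isT y Vy. Qed.

Lemma Ck_derivable N V f : isCk N.+1 V f ->
  forall y, V y -> forall a, derivable f y (delta_mx ord0 a).
Proof. by case/isCkS. Qed.

Lemma Ck_partial N V f : isCk N.+1 V f -> forall a, isCk N V (partial a f).
Proof. by case/isCkS. Qed.

Lemma Ck_le N N' V f : (N' <= N)%N -> isCk N V f -> isCk N' V f.
Proof.
move=> NN [H]; split=> s sN y Vy; have [Hc Hd] := H s (leq_trans sN NN) y Vy.
by split=> // sN'; apply: Hd; exact: leq_trans NN.
Qed.

Lemma Ck_sub N V W f : W `<=` V -> isCk N V f -> isCk N W f.
Proof. by move=> WV [H]; split=> s sN y /WV; exact: H. Qed.

(** The condition at a point involves only the germ there, so regularity may be checked with a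
    different set around each point. Functions cut off by bumps are handled in this way: one set
    where the formula holds, one where the function vanishes. *)
Lemma Ck_bigcup N V f : (forall y, V y -> exists2 W, W y & isCk N W f) -> isCk N V f.
Proof. by move=> H; split=> s sN y /H[W Wy [H']]; apply: H'. Qed.

Lemma partial_ext V f g : open V -> {in V, f =1 g} ->
  forall a y, V y -> partial a f y = partial a g y.
Proof.
by move=> oV fg a y Vy; apply: near_eq_derive; exact: (near_eq_open oV).
Qed.

Lemma Ck_ext N V f g : open V -> {in V, f =1 g} -> isCk N V f -> isCk N V g.
Proof.
move=> oV; elim: N f g => [|N IH] f g fg.
  move/isCk0 => H; apply/isCk0 => y Vy.
  by apply: continuous_near (H y Vy); exact: (near_eq_open oV).
case/isCkS => H1 H2 H3; apply/isCkS; split.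
- by move=> y Vy; apply: continuous_near (H1 y Vy); exact: (near_eq_open oV).
- by move=> y Vy a; apply: near_eq_derivable (H2 y Vy a); exact: (near_eq_open oV).
- by move=> a; apply: IH (H3 a) => y; rewrite inE => Vy; exact: (partial_ext oV).
Qed.

Lemma Ck_differentiable N V f y : open V -> isCk N.+1 V f -> V y ->
  differentiable f y /\ 'd f y = linform (\row_a partial a f y) :> ('rV[R]_m -> R).
Proof.
move=> oV /isCkS[_ H2 H3] Vy; apply: (C1_differentiable oV Vy) => [a z Vz|a].
  exact: H2.
exact: Ck_continuous (H3 a) _ Vy.
Qed.

Lemma Ck1P V f : open V -> isCk 1 V f <->
  (forall y, V y -> forall a, derivable f y (delta_mx ord0 a)) /\
  (forall a y, V y -> {for y, continuous (partial a f)}).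
Proof.
move=> oV; split=> [/isCkS[_ H2 H3]|[H2 H3]].
  by split=> // a; exact: Ck_continuous.
apply/isCkS; split=> // [y Vy|a]; last by apply/isCk0; exact: H3.
apply: differentiable_continuous.
by have [] := @C1_differentiable R m f y V oV Vy (fun a z Vz => H2 z Vz a) (fun a => H3 a y Vy).
Qed.

Lemma Ck_derive N V f y v : open V -> isCk N.+1 V f -> V y ->
  is_derive y v f (\sum_a partial a f y * v ord0 a).
Proof.
move=> oV Hf Vy; have [df E] := Ck_differentiable oV Hf Vy.
split; first exact: diff_derivable.
by rewrite deriveE // E /linform; apply: eq_bigr => a _; rewrite mxE.
Qed.

Lemma partial_cst (c : R) a y : partial a (cst c : 'rV[R]_m -> R) y = 0.
Proof. exact: derive_cst. Qed.

Lemma Ck_cst N V (c : R) : isCk N V (cst c).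
Proof.
elim: N c => [|N IH] c; first by apply/isCk0 => y _; exact: cst_continuous.
apply/isCkS; split=> [y _|y _ a|a]; first exact: cst_continuous.
- exact: derivable_cst.
- by have -> : partial a (cst c) = cst 0 by apply/funext => y; exact: partial_cst.
Qed.

Lemma is_derive_coord (b : 'I_m) y v : is_derive y v (fun z : 'rV[R]_m => z ord0 b) (v ord0 b).
Proof.
have E : (fun h : R => h^-1 *: (((fun z : 'rV[R]_m => z ord0 b) \o shift y) (h *: v) - y ord0 b))
    = (fun h => h^-1 * h * v ord0 b).
  by apply/funext => h /=; rewrite !mxE addrK -mulrA.
have H : (fun h => h^-1 * h * v ord0 b) @ 0^' --> v ord0 b.
  rewrite -[X in _ --> X]mul1r; apply: cvgMl.
  apply: (@cvg_trans _ ((fun=> 1 : R) @ (0 : R)^')); last exact: cvg_cst.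
  apply: near_eq_cvg; near=> h; rewrite mulVf //; near: h.
  exact: nbhs_dnbhs_neq.
split; first by rewrite /derivable E; apply/cvg_ex; exists (v ord0 b).
by rewrite /derive E; exact/cvg_lim.
Unshelve. all: by end_near. Qed.

Lemma partial_coord (b a : 'I_m) y : partial a (fun z => z ord0 b) y = (a == b)%:R.
Proof.
by rewrite /partial (derive_val (is_derive := is_derive_coord b y _)) mxE eqxx /= eq_sym.
Qed.

Lemma Ck_coord N V (b : 'I_m) : isCk N V (fun z => z ord0 b).
Proof.
case: N => [|N].
  by apply/isCk0 => y _; exact: coord_continuous.
apply/isCkS; split=> [y _|y _ a|a]; first exact: coord_continuous.
- by have [] := is_derive_coord b y (delta_mx ord0 a).
- have -> : partial a (fun z => z ord0 b) = cst ((a == b)%:R : R).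
    by apply/funext => y; exact: partial_coord.
  exact: Ck_cst.
Qed.

Lemma CkD N V f g : open V -> isCk N V f -> isCk N V g -> isCk N V (fun y => f y + g y).
Proof.
move=> oV; elim: N f g => [|N IH] f g.
  move=> /isCk0 Hf /isCk0 Hg; apply/isCk0 => y Vy.
  by apply: continuousD; [exact: Hf|exact: Hg].
move=> Hf Hg; apply/isCkS; split=> [y Vy|y Vy a|a].
- by apply: continuousD; [exact: Ck_continuous Hf _ Vy|exact: Ck_continuous Hg _ Vy].
- by apply: derivableD; [exact: Ck_derivable Hf _ Vy _|exact: Ck_derivable Hg _ Vy _].
- apply: (@Ck_ext _ _ (fun y => partial a f y + partial a g y)) => //; last first.
    by apply: IH; exact: Ck_partial.
  move=> y; rewrite inE => Vy; rewrite /partial deriveD //.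
    exact: Ck_derivable Hf _ Vy _.
  exact: Ck_derivable Hg _ Vy _.
Qed.

Lemma CkM N V f g : open V -> isCk N V f -> isCk N V g -> isCk N V (fun y => f y * g y).
Proof.
move=> oV; elim: N f g => [|N IH] f g.
  move=> /isCk0 Hf /isCk0 Hg; apply/isCk0 => y Vy.
  by apply: continuousM; [exact: Hf|exact: Hg].
move=> Hf Hg; apply/isCkS; split=> [y Vy|y Vy a|a].
- by apply: continuousM; [exact: Ck_continuous Hf _ Vy|exact: Ck_continuous Hg _ Vy].
- by apply: derivableM; [exact: Ck_derivable Hf _ Vy _|exact: Ck_derivable Hg _ Vy _].
- apply: (@Ck_ext _ _ (fun y => f y * partial a g y + g y * partial a f y)) => //; last first.
    by apply: CkD => //; apply: IH; [exact: Ck_le Hf|exact: Ck_partial|exact: Ck_le Hg|exact: Ck_partial].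
  move=> y; rewrite inE => Vy; rewrite /partial deriveM //.
    exact: Ck_derivable Hf _ Vy _.
  exact: Ck_derivable Hg _ Vy _.
Qed.

Lemma CkZ N V (c : R) f : open V -> isCk N V f -> isCk N V (fun y => c * f y).
Proof. by move=> oV; apply: CkM => //; exact: Ck_cst. Qed.

Lemma CkN N V f : open V -> isCk N V f -> isCk N V (fun y => - f y).
Proof.
move=> oV /(CkZ (-1) oV) H; have -> : (fun y => - f y) = (fun y => -1 * f y) by
  apply/funext => y; rewrite mulN1r.
by [].
Qed.

Lemma CkB N V f g : open V -> isCk N V f -> isCk N V g -> isCk N V (fun y => f y - g y).
Proof. by move=> oV Hf Hg; apply: CkD => //; exact: CkN. Qed.

Lemma Ck_sum N V (I : Type) (r : seq I) (P : pred I) (F : I -> 'rV[R]_m -> R) : open V ->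
  (forall i, P i -> isCk N V (F i)) -> isCk N V (fun y => \sum_(i <- r | P i) F i y).
Proof.
move=> oV H; elim: r => [|i r IH].
  have -> : (fun y => \sum_(i <- [::] | P i) F i y) = cst 0 by
    apply/funext => y; rewrite big_nil.
  exact: Ck_cst.
have -> : (fun y => \sum_(i <- i :: r | P i) F i y) =
   if P i then (fun y => F i y + \sum_(i <- r | P i) F i y) else (fun y => \sum_(i <- r | P i) F i y).
  by case: ifP => Pi; apply/funext => y; rewrite big_cons Pi.
by case: ifP => // Pi; apply: CkD => //; exact: H.
Qed.

Lemma Ck_prod N V (I : Type) (r : seq I) (P : pred I) (F : I -> 'rV[R]_m -> R) : open V ->
  (forall i, P i -> isCk N V (F i)) -> isCk N V (fun y => \prod_(i <- r | P i) F i y).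
Proof.
move=> oV H; elim: r => [|i r IH].
  have -> : (fun y => \prod_(i <- [::] | P i) F i y) = cst 1 by
    apply/funext => y; rewrite big_nil.
  exact: Ck_cst.
have -> : (fun y => \prod_(i <- i :: r | P i) F i y) =
   if P i then (fun y => F i y * \prod_(i <- r | P i) F i y) else (fun y => \prod_(i <- r | P i) F i y).
  by case: ifP => Pi; apply/funext => y; rewrite big_cons Pi.
by case: ifP => // Pi; apply: CkM => //; exact: H.
Qed.

Lemma is_derive_comp1 (phi : R -> R) f y v (l df : R) :
  is_derive y v f df -> is_derive (f y) 1 phi l ->
  is_derive y v (fun z => phi (f z)) (l * df).
Proof.
move=> Hf Hp; have H0 : is_derive (0 : R) 1 (fun s : R => f (y + s *: v)) df.
  by apply: is_derive_line; rewrite scale0r addr0.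
have H1 : is_derive (0 : R) 1 (phi \o (fun s : R => f (y + s *: v))) (l * df).
  by apply: is_derive1_comp; rewrite ?scale0r ?addr0.
have D : derivable (fun z => phi (f z)) y v by apply/derivable_lineP; case: H1.
split=> //; have /derivableP := D => H2.
have := @is_derive_line R _ _ (fun z => phi (f z)) y v 0 ('D_v (fun z => phi (f z)) y).
rewrite scale0r addr0 => /(_ H2) H3.
by rewrite -(derive_val (is_derive := H3)) -(derive_val (is_derive := H1)).
Qed.

(* The family phi lists functions whose derivatives are again in the family up to C^N factors. *)
Lemma Ck_comp1 V (I : Type) (phi dphi : I -> R -> R) (D : set R) f : open V ->
  (forall i t, D t -> is_derive t 1 (phi i) (dphi i t)) ->
  (forall N i, isCk N V f -> (forall i, isCk N V (fun y => phi i (f y))) ->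
     isCk N V (fun y => dphi i (f y))) ->
  (forall y, V y -> D (f y)) ->
  forall N i, isCk N V f -> isCk N V (fun y => phi i (f y)).
Proof.
move=> oV dphiP HN fD; elim=> [|N IH] i.
  move=> /isCk0 Hf; apply/isCk0 => y Vy; apply: (continuous_comp (Hf y Vy)).
  apply: differentiable_continuous; apply/derivable1_diffP.
  by have [] := dphiP i _ (fD y Vy).
move=> Hf; have HfN : isCk N V f by exact: Ck_le Hf.
have is_d y a : V y -> is_derive y (delta_mx ord0 a) (fun z => phi i (f z)) (dphi i (f y) * partial a f y).
  move=> Vy; apply: is_derive_comp1; last exact: dphiP (fD y Vy).
  by apply/derivableP; exact: Ck_derivable Hf _ Vy _.
apply/isCkS; split=> [y Vy|y Vy a|a].
- apply: (continuous_comp (Ck_continuous Hf Vy)).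
  apply: differentiable_continuous; apply/derivable1_diffP.
  by have [] := dphiP i _ (fD y Vy).
- by have [] := is_d y a Vy.
- apply: (@Ck_ext _ _ (fun y => dphi i (f y) * partial a f y)) => //.
    by move=> y; rewrite inE => Vy; rewrite /partial (derive_val (is_derive := is_d y a Vy)).
  apply: CkM => //; last exact: Ck_partial.
  by apply: HN => // j; exact: IH.
Qed.

Lemma Ck_inv N V f : open V -> (forall y, V y -> f y != 0) -> isCk N V f ->
  isCk N V (fun y => (f y)^-1).
Proof.
move=> oV f0; apply: (@Ck_comp1 V unit (fun _ t => t^-1) (fun _ t => - (t^-1 * t^-1))
  [set t | t != 0] f oV _ _ f0 N tt) => [[] t t0|K _ Hf HK].
  apply: is_derive_eq; first exact: is_deriveV.
  by rewrite -[_ *: 1]/(_ * 1) mulr1 expr2 invfM.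
by apply: CkN => //; apply: CkM => //; exact: (HK tt).
Qed.

Lemma Ck_div N V f g : open V -> (forall y, V y -> g y != 0) -> isCk N V f -> isCk N V g ->
  isCk N V (fun y => f y / g y).
Proof. by move=> oV g0 Hf Hg; apply: CkM => //; exact: Ck_inv. Qed.

End Ck.

(** * Chain rule, powers, determinants and inverse matrices *)

Section ChainRule.
Context {R : realType}.

Lemma continuous_rV (T : topologicalType) (k : nat) (F : T -> 'rV[R]_k) (x : T) :
  (forall b, {for x, continuous (fun z => F z ord0 b)}) -> {for x, continuous F}.
Proof.
move=> H; apply/(@cvgrPdist_le _ _ _ (nbhs x) _ F (F x)) => e e0.
have : \forall z \near x, forall b, `|F x ord0 b - F z ord0 b| <= e.
  apply: (@filter_forall _ _ (fun b z => `|F x ord0 b - F z ord0 b| <= e) (nbhs x)) => b.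
  by have /(@cvgrPdist_le _ R _ (nbhs x) _ _ (F x ord0 b)) /(_ _ e0) := H b.
apply: filterS => z Hz; apply: norm_le_coord; first exact: ltW.
by move=> b; rewrite !mxE.
Qed.

(** Restriction to the line through y in direction v turns F into a curve, which is derivable as
    soon as its coordinates are; the chain rule is then applied to f along that curve. *)
Lemma is_derive_comp_rV (U : normedModType R) (k : nat) (F : U -> 'rV[R]_k)
    (f : 'rV[R]_k -> R) y v (l : 'rV[R]_k) :
  differentiable f (F y) ->
  (forall b, is_derive y v (fun z => F z ord0 b) (l ord0 b)) ->
  is_derive y v (fun z => f (F z)) ('d f (F y) l).
Proof.
move=> df dF; pose c (s : R) := F (y + s *: v).
have dc b : is_derive (0 : R) 1 (fun s => c s ord0 b) (l ord0 b).
  by apply: (@is_derive_line R U R (fun z => F z ord0 b) y v 0); rewrite scale0r addr0.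
have Dc : derivable c 0 1.
  by apply/derivable_mxP => i b; rewrite ord1; case: (dc b).
have Ec : 'D_1 c 0 = l.
  rewrite derive_mx //; apply/rowP => b; rewrite mxE.
  exact: (derive_val (is_derive := dc b)).
have /derivable1_diffP Dc' := Dc.
have Ec' : 'd c 0 1 = l by rewrite -Ec deriveE.
have c0 : c 0 = F y by rewrite /c scale0r addr0.
have dfc : differentiable f (c 0) by rewrite c0.
have D0 : differentiable (f \o c) 0 by exact: differentiable_comp.
have H1 : is_derive (0 : R) 1 (f \o c) ('d f (F y) l).
  split; first by apply/derivable1_diffP.
  by rewrite deriveE // diff_comp //= c0 Ec'.
have D : derivable (fun z => f (F z)) y v by apply/derivable_lineP; case: H1.
split=> //; have /derivableP := D => H2.
have := @is_derive_line R _ _ (fun z => f (F z)) y v 0 ('D_v (fun z => f (F z)) y).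
rewrite scale0r addr0 => /(_ H2) H3.
by rewrite -(derive_val (is_derive := H3)) -(derive_val (is_derive := H1)).
Qed.

Lemma partial_comp (m k : nat) (F : 'rV[R]_m -> 'rV[R]_k) (f : 'rV[R]_k -> R) y
    (a : 'I_m) (W : set 'rV[R]_k) :
  open W -> W (F y) -> isCk 1 W f ->
  (forall b, derivable (fun z => F z ord0 b) y (delta_mx ord0 a)) ->
  is_derive y (delta_mx ord0 a) (fun z => f (F z))
    (\sum_b partial b f (F y) * partial a (fun z => F z ord0 b) y).
Proof.
move=> oW WF Hf dF; have [df E] := Ck_differentiable oW Hf WF.
apply: is_derive_eq.
  apply: (@is_derive_comp_rV _ _ _ _ _ _ (\row_b partial a (fun z => F z ord0 b) y)) => // b.
  by rewrite mxE; apply/derivableP; exact: dF.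
by rewrite E /linform; apply: eq_bigr => b _; rewrite !mxE.
Qed.

Lemma Ck_comp (m k : nat) N (V : set 'rV[R]_m) (W : set 'rV[R]_k)
    (F : 'rV[R]_m -> 'rV[R]_k) (f : 'rV[R]_k -> R) :
  open V -> open W -> (forall y, V y -> W (F y)) ->
  (forall b, isCk N V (fun y => F y ord0 b)) -> isCk N W f -> isCk N V (fun y => f (F y)).
Proof.
move=> oV oW VW; elim: N f => [|N IH] f HF Hf.
  apply/isCk0 => y Vy; apply: continuous_comp.
    by apply: continuous_rV => b; exact: Ck_continuous (HF b) _ Vy.
  by apply: Ck_continuous Hf _ _; exact: VW.
have HD y a : V y -> is_derive y (delta_mx ord0 a) (fun z => f (F z))
    (\sum_b partial b f (F y) * partial a (fun z => F z ord0 b) y).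
  move=> Vy; apply: (partial_comp oW) => //; first exact: VW.
    exact: Ck_le Hf.
  by move=> b; exact: Ck_derivable (HF b) _ Vy _.
apply/isCkS; split=> [y Vy|y Vy a|a].
- apply: continuous_comp.
    by apply: continuous_rV => b; exact: Ck_continuous (HF b) _ Vy.
  by apply: Ck_continuous Hf _ _; exact: VW.
- by case: (HD y a Vy).
- apply: (@Ck_ext _ _ _ _ (fun y => \sum_b partial b f (F y) * partial a (fun z => F z ord0 b) y)) => //.
    by move=> y; rewrite inE => Vy; rewrite /partial (derive_val (is_derive := HD y a Vy)).
  apply: Ck_sum => // b _; apply: CkM => //.
    by apply: IH; [move=> c; exact: Ck_le (HF c)|exact: Ck_partial].
  exact: Ck_partial.
Qed.

Lemma Ck_powR m N (V : set 'rV[R]_m) f (r : R) : open V -> (forall y, V y -> 0 < f y) ->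
  isCk N V f -> isCk N V (fun y => f y `^ r).
Proof.
move=> oV f0.
have D (s t : R) : [set t | 0 < t] t -> is_derive t 1 (fun t => t `^ s) (s * t `^ (s - 1)).
  by move=> t0; exact: is_derive1_powR.
apply: (@Ck_comp1 R m V R (fun r t => t `^ r) _ _ f oV D _ f0 N r) => K s Hf HK.
by apply: CkZ => //; exact: HK.
Qed.

Lemma Ck_sqrt m N (V : set 'rV[R]_m) f : open V -> (forall y, V y -> 0 < f y) ->
  isCk N V f -> isCk N V (fun y => Num.sqrt (f y)).
Proof.
move=> oV f0 Hf; apply: (@Ck_ext _ _ _ _ (fun y => f y `^ 2^-1)) => //; last exact: Ck_powR.
by move=> y; rewrite inE => /f0 /ltW; exact: powR12_sqrt.
Qed.

(** Serves the outer functions that enter only as C^1 functions: the smoothed positive part [theta]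
    and [atan]. *)
Lemma C1_comp1 m (V : set 'rV[R]_m) f (phi dphi : R -> R) : open V ->
  (forall t : R, is_derive t 1 phi (dphi t)) -> continuous dphi ->
  isCk 1 V f -> isCk 1 V (fun y => phi (f y)).
Proof.
move=> oV D Cd /isCkS[H1 H2 H3].
have HD y a : V y -> is_derive y (delta_mx ord0 a) (fun z => phi (f z)) (dphi (f y) * partial a f y).
  by move=> Vy; apply: is_derive_comp1 => //; apply/derivableP; exact: H2.
apply/Ck1P => //; split=> [y Vy a|a y Vy]; first by case: (HD y a Vy).
apply: (@continuous_near _ _ (fun y => dphi (f y) * partial a f y)).
  apply: (near_eq_open oV) => // z; rewrite inE => Vz.
  by rewrite /partial (derive_val (is_derive := HD z a Vz)).
apply: continuousM; last exact: Ck_continuous (H3 a) _ Vy.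
by apply: continuous_comp; [exact: H1|exact: Cd].
Qed.

Lemma Ck_det m k N (V : set 'rV[R]_m) (A : 'rV[R]_m -> 'M[R]_k) : open V ->
  (forall i j, isCk N V (fun y => A y i j)) -> isCk N V (fun y => \det (A y)).
Proof.
move=> oV HA; rewrite /determinant; apply: Ck_sum => // s _.
by apply: CkZ => //; apply: Ck_prod.
Qed.

(** Cramer's rule: the entries of the inverse are rational in those of the matrix. *)
Lemma Ck_invmx m k N (V : set 'rV[R]_m) (A : 'rV[R]_m -> 'M[R]_k) : open V ->
  (forall y, V y -> \det (A y) != 0) ->
  (forall i j, isCk N V (fun y => A y i j)) -> forall i j, isCk N V (fun y => invmx (A y) i j).
Proof.
move=> oV dA HA i j.
apply: (@Ck_ext _ _ _ _ (fun y => (\det (A y))^-1 * cofactor (A y) j i)) => //.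
  move=> y; rewrite inE => Vy; rewrite /invmx unitmxE unitfE dA //.
  by rewrite mxE [\adj _ _ _]mxE.
apply: CkM => //; first by apply: Ck_inv => //; exact: Ck_det.
rewrite /cofactor; apply: CkZ => //; apply: Ck_det => // a b.
have -> : (fun y => (row' j (col' i (A y))) a b) = (fun y => A y (lift j a) (lift i b)).
  by apply/funext => y; rewrite !mxE.
exact: HA.
Qed.

End ChainRule.

(** * A smooth step function *)

Section SmoothStep.
Context {R : realType}.

(** The classical exp(-1/t), extended by zero, is [flat 0]. The negative powers of t are included so
    that the family is stable under differentiation up to constants, as [Ck_comp1] requires. *)
Definition flat (k : nat) (t : R) : R := if 0 < t then t ^- k * expR (- t^-1) else 0.

Lemma flat_ge0 k t : 0 <= flat k t.
Proof.
by rewrite /flat; case: ifP => // t0; rewrite mulr_ge0 ?expR_ge0 // invr_ge0 exprn_ge0 // ltW.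
Qed.

Lemma flat_gt0 k t : 0 < t -> 0 < flat k t.
Proof. by move=> t0; rewrite /flat t0 mulr_gt0 ?expR_gt0 // invr_gt0 exprn_gt0. Qed.

Lemma flat_le0 k t : t <= 0 -> flat k t = 0.
Proof. by move=> t0; rewrite /flat ltNge t0. Qed.

(** Comes from exp s >= (s / (k+1))^(k+1) at s = 1/t. It yields the derivative at the origin,
    because the difference quotient of [flat k] there is [flat k.+1]. *)
Lemma flat_bound k t : `|flat k t| <= (k.+1%:R ^+ k.+1) * `|t|.
Proof.
rewrite ger0_norm ?flat_ge0 //; have [t0|t0] := ltP 0 t; last first.
  by rewrite flat_le0 // mulr_ge0 // exprn_ge0.
rewrite /flat t0 (gtr0_norm t0) expRN.
have H : (t^-1 / k.+1%:R) ^+ k.+1 <= expR t^-1.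
  have -> : expR t^-1 = expR (t^-1 / k.+1%:R) ^+ k.+1.
    by rewrite -expRM_natl mulrC divfK.
  apply: lerXn2r; rewrite ?nnegrE ?expR_ge0 ?divr_ge0 ?invr_ge0 ?(ltW t0) //.
  by apply: le_trans (expR_ge1Dx _); rewrite lerDr.
rewrite ler_pdivrMr ?expR_gt0 //.
apply: le_trans (ler_wpM2l _ H); last by rewrite mulr_ge0 ?exprn_ge0 // ltW.
rewrite -mulrA mulrCA exprMn exprVn [X in _ <= t * X]mulrC exprVn.
rewrite mulfVK ?expf_neq0 //.
by rewrite exprS invfM mulrA mulfV ?mul1r // gt_eqF.
Qed.

Lemma flat_derive k (t : R) : is_derive t 1 (flat k) (flat k.+2 t - k%:R * flat k.+1 t).
Proof.
have [t0|t0|->] := ltgtP t 0.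
- rewrite !flat_le0 ?(ltW t0) // mulr0 subr0.
  have D0 : is_derive t 1 (cst (0 : R)) (0 : R) by exact: is_derive_cst.
  apply: near_eq_is_derive D0.
  by near=> s; rewrite flat_le0 // ltW //; near: s; exact: lt_nbhsl.
- have E : \forall s \near t, s ^- k * expR (- s^-1) = flat k s.
    near=> s; rewrite /flat ifT //; near: s; exact: lt_nbhsr.
  apply: (near_eq_is_derive E).
  have tn0 : t != 0 by rewrite gt_eqF.
  have D1 : is_derive t 1 (fun s : R => s^-1) (- t ^- 2).
    apply: is_derive_eq; first exact: is_deriveV.
    by rewrite -[_ *: 1]/(_ * 1) mulr1.
  have D2 : is_derive t 1 (fun s : R => expR (- s^-1)) (expR (- t^-1) * t ^- 2).
    apply: (@is_derive1_comp R expR (fun s => - s^-1)).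
    by rewrite -[X in is_derive _ _ _ X]opprK; apply: is_deriveN.
  have D3 : is_derive t 1 (fun s : R => s ^- k) (- (k%:R * t ^- k.+1)).
    have -> : (fun s : R => s ^- k) = (GRing.inv : R -> R) ^+ k.
      by apply/funext => s; rewrite exprfctE exprVn.
    have D4 := @is_deriveX R R GRing.inv k t 1 _ D1.
    suff <- : (k%:R * t^-1 ^+ k.-1) *: (- t ^- 2) = - (k%:R * t ^- k.+1) by exact: D4.
    clear D4.
    rewrite -[_ *: _]/(_ * _) mulrN; congr (- _); rewrite -mulrA.
    case: k E => [|k] E; first by rewrite !mul0r.
    congr (_ * _).
    by rewrite exprVn -invfM -exprD addn2.
  have D4 := @is_deriveM R R _ _ t 1 _ _ D3 D2.
  suff <- : t ^- k *: (expR (- t^-1) * t ^- 2) + expR (- t^-1) *: - (k%:R * t ^- k.+1)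
     = flat k.+2 t - k%:R * flat k.+1 t by exact: D4.
  rewrite /flat t0 -![_ *: _]/(_ * _).
  have -> : t ^- k.+2 = t ^- k * t ^- 2 by rewrite -addn2 exprD invfM.
  by ring.
- rewrite !flat_le0 // mulr0 subr0.
  have H : (fun h : R => h^-1 *: ((flat k \o shift 0) (h *: 1) - flat k 0)) @ 0^' --> (0 : R).
    apply/cvgrPdist_le => e e0; near=> h.
    have hn0 : h != 0 by near: h; exact: nbhs_dnbhs_neq.
    rewrite sub0r normrN /= addr0 [h *: 1]mulr1 (flat_le0 _ (lexx 0)) subr0.
    have -> : h^-1 *: flat k h = flat k.+1 h.
      rewrite /flat; case: ifP => _; last by rewrite scaler0.
      by rewrite -[_ *: _]/(_ * _) mulrA exprS invfM.
    apply: (le_trans (flat_bound _ _)).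
    have c0 : 0 < (k.+2%:R ^+ k.+2 : R) by rewrite exprn_gt0.
    rewrite mulrC -ler_pdivlMr //; near: h; apply: dnbhs0_le; exact: divr_gt0.
  by split; [apply/cvg_ex; exists 0|exact: cvg_lim].
Unshelve. all: by end_near. Qed.

Lemma Ck_flat m N (V : set 'rV[R]_m) f k : open V -> isCk N V f ->
  isCk N V (fun y => flat k (f y)).
Proof.
move=> oV; apply: (@Ck_comp1 R m V nat flat
  (fun k t => flat k.+2 t - k%:R * flat k.+1 t) setT f oV _ _ _ N k) => // [j t _|K j Hf HK].
  exact: flat_derive.
by apply: CkB => //; apply: CkZ.
Qed.

Definition step (t : R) : R := flat 0 t / (flat 0 t + flat 0 (1 - t)).

Lemma step_den_gt0 t : 0 < flat 0 t + flat 0 (1 - t).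
Proof.
have [t0|t0] := ltP 0 t; first by rewrite ltr_wpDr ?flat_ge0 ?flat_gt0.
by rewrite ltr_wpDl ?flat_ge0 // flat_gt0 // subr_gt0 (le_lt_trans t0).
Qed.

Lemma step_ge0 t : 0 <= step t.
Proof. by rewrite divr_ge0 ?flat_ge0 // ltW // step_den_gt0. Qed.

Lemma step_le1 t : step t <= 1.
Proof. by rewrite ler_pdivrMr ?step_den_gt0 // mul1r lerDl flat_ge0. Qed.

Lemma step0 t : t <= 0 -> step t = 0.
Proof. by move=> t0; rewrite /step flat_le0 // mul0r. Qed.

Lemma step1 t : 1 <= t -> step t = 1.
Proof.
move=> t1; rewrite /step (@flat_le0 _ (1 - t)) ?subr_le0 // addr0 divff //.
by rewrite gt_eqF // flat_gt0 // (lt_le_trans ltr01).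
Qed.

Lemma Ck_step m N (V : set 'rV[R]_m) f : open V -> isCk N V f ->
  isCk N V (fun y => step (f y)).
Proof.
move=> oV Hf; have Hg : isCk N V (fun y => 1 - f y) by apply: CkB => //; exact: Ck_cst.
apply: Ck_div => //; first by move=> y _; rewrite gt_eqF ?step_den_gt0.
  exact: Ck_flat.
apply: CkD => //; first exact: Ck_flat.
exact: (@Ck_flat _ N V (fun y => 1 - f y)).
Qed.

End SmoothStep.

Lemma is_derive_lineP {R : realType} {U W : normedModType R} (f : U -> W) y v l :
  is_derive y v f l <-> is_derive (0 : R) 1 (fun s => f (y + s *: v)) l.
Proof.
split=> [H|H]; first by apply: is_derive_line; rewrite scale0r addr0.
have D : derivable f y v by apply/derivable_lineP; case: H.
split=> //; have /derivableP := D => H2.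
have := @is_derive_line R U W f y v 0 ('D_v f y).
rewrite scale0r addr0 => /(_ H2) H3.
by rewrite -(derive_val (is_derive := H3)) -(derive_val (is_derive := H)).
Qed.

Lemma is_derive_affine {R : realType} (t c d : R) : is_derive t 1 (fun s : R => c + s * d) d.
Proof.
have -> : (fun s : R => c + s * d) = cst c + d *: (id : R -> R).
  by apply/funext => s; rewrite -[RHS]/(c + d * s) [d * s]mulrC.
have H := is_deriveD (is_derive_cst c t (1 : R)) (is_deriveZ d (is_derive_id t (1 : R))).
by move: H; rewrite add0r -[d *: 1]/(d * 1) mulr1.
Qed.

Lemma is_derive_bigsum {R : realType} {U : normedModType R} (I : Type) (r : seq I) (P : pred I)
    (F : I -> U -> R) (l : I -> R) y v : (forall i, P i -> is_derive y v (F i) (l i)) ->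
  is_derive y v (fun z => \sum_(i <- r | P i) F i z) (\sum_(i <- r | P i) l i).
Proof.
move=> H; elim: r => [|i r IH].
  under eq_fun do rewrite big_nil; rewrite big_nil; exact: is_derive_cst.
under eq_fun do rewrite big_cons; rewrite big_cons; case: ifP => // Pi.
by apply: is_deriveD => //; exact: H.
Qed.

(** * Smooth splines and quasi-interpolation on a grid *)

Section Bspline.
Context {R : realType}.

(** A smooth positive part that equals 0 or t exactly outside [-1/2, 1/2]. This exactness lets the
    translates of its second difference [bspline] reproduce affine functions by telescoping, like
    the piecewise linear hat function. *)
Definition ramp (t : R) : R := t * step (t + 2^-1).
Definition ramp1 (t : R) : R := ramp (t + 1) - ramp t.
(* A smooth substitute for the hat function; it need not be nonnegative. *)
Definition bspline (t : R) : R := ramp1 t - ramp1 (t - 1).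

Lemma ramp_le t : t <= - 2^-1 -> ramp t = 0.
Proof. by move=> t2; rewrite /ramp step0 ?mulr0 //; lra. Qed.

Lemma ramp_ge t : 2^-1 <= t -> ramp t = t.
Proof. by move=> t2; rewrite /ramp step1 ?mulr1 //; lra. Qed.

Lemma ramp1_ge t : 2^-1 <= t -> ramp1 t = 1.
Proof. by move=> t2; rewrite /ramp1 !ramp_ge //; lra. Qed.

Lemma ramp1_le t : t <= - 3 / 2 -> ramp1 t = 0.
Proof. by move=> t2; rewrite /ramp1 !ramp_le ?subrr //; lra. Qed.

Lemma bspline_supp t : 3 / 2 <= `|t| -> bspline t = 0.
Proof.
rewrite /bspline; have [t0|t0] := leP 0 t.
  by rewrite ger0_norm // => t2; rewrite !ramp1_ge ?subrr //; lra.
by rewrite ltr0_norm // => t2; rewrite !ramp1_le ?subrr //; lra.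
Qed.

Lemma sum_bspline K t : \sum_(k < K) bspline (t - k%:R) = ramp1 t - ramp1 (t - K%:R).
Proof.
elim: K => [|K IH]; first by rewrite big_ord0 subr0 subrr.
have -> : t - K.+1%:R = t - K%:R - 1 by rewrite -[K.+1]addn1 natrD opprD addrA.
by rewrite big_ord_recr /= IH /bspline; ring.
Qed.

(** Summation by parts. Where the boundary terms take their exact values, this and [sum_bspline]
    give the reproduction of the identity and of constants. *)
Lemma sum_id_bspline K t : \sum_(k < K) k%:R * bspline (t - k%:R) =
  ramp t - ramp (t - K%:R) - K%:R * ramp1 (t - K%:R).
Proof.
elim: K => [|K IH]; first by rewrite big_ord0 subr0; ring.
have -> : t - K.+1%:R = t - K%:R - 1 by rewrite -[K.+1]addn1 natrD opprD addrA.
rewrite big_ord_recr /= IH /bspline -[K.+1]addn1 natrD.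
have -> : ramp (t - K%:R) = ramp (t - K%:R - 1) + ramp1 (t - K%:R - 1).
  by rewrite /ramp1 subrK; ring.
by ring.
Qed.

Lemma Ck_bspline m N (V : set 'rV[R]_m) f : open V -> isCk N V f ->
  isCk N V (fun y => bspline (f y)).
Proof.
move=> oV Hf; have S (c : R) : isCk N V (fun y => f y + c) by apply: CkD => //; exact: Ck_cst.
have Ra (g : 'rV[R]_m -> R) : isCk N V g -> isCk N V (fun y => ramp (g y)).
  move=> Hg; apply: CkM => //; apply: (@Ck_step _ _ _ _ (fun y => g y + 2^-1)) => //.
  by apply: CkD => //; exact: Ck_cst.
have Ra1 (g : 'rV[R]_m -> R) : isCk N V g -> isCk N V (fun y => ramp1 (g y)).
  move=> Hg; apply: CkB => //; last exact: Ra.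
  by apply: (@Ra (fun y => g y + 1)); apply: CkD => //; exact: Ck_cst.
by apply: CkB => //; [exact: Ra1|exact: (@Ra1 (fun y => f y + -1))].
Qed.

(** Defined through row vectors of length 1 so that its continuity can be read off from
    [Ck_bspline]. *)
Definition dbspline (t : R) : R :=
  partial ord0 (fun y : 'rV[R]_1 => bspline (y ord0 ord0)) (const_mx t).

Lemma is_derive_bspline (t : R) : is_derive t 1 bspline (dbspline t).
Proof.
have C1 : isCk 1 setT (fun y : 'rV[R]_1 => bspline (y ord0 ord0)).
  by apply: Ck_bspline; [exact: openT|exact: Ck_coord].
have /derivableP H : derivable (fun y : 'rV[R]_1 => bspline (y ord0 ord0)) (const_mx t) (delta_mx ord0 ord0) by exact: Ck_derivable C1 _ I _.
have E : (fun s : R => bspline s) = (fun s => (fun y : 'rV[R]_1 => bspline (y ord0 ord0)) (0 + s *: delta_mx ord0 ord0)).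
  by apply/funext => s; rewrite !mxE eqxx add0r mulr1.
have E1 : const_mx t = 0 + t *: delta_mx ord0 ord0 :> 'rV[R]_1.
  by apply/rowP => i; rewrite !ord1 !mxE eqxx add0r mulr1.
rewrite /dbspline /partial; move: H; rewrite E1 => /is_derive_line.
by rewrite -E.
Qed.

Lemma bspline_bounds : exists2 C : R, 1 <= C & forall t : R,
  `|bspline t| <= C * (`|t| <= 2)%R%:R /\ `|dbspline t| <= C * (`|t| <= 2)%R%:R.
Proof.
have cb : continuous bspline.
  move=> t; apply: differentiable_continuous; apply/derivable1_diffP.
  by case: (is_derive_bspline t).
have cd : continuous dbspline.
  have C1 : isCk 1 setT (fun y : 'rV[R]_1 => bspline (y ord0 ord0)).
    by apply: Ck_bspline; [exact: openT|exact: Ck_coord].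
  move=> t; apply: (@continuous_comp _ _ _ (fun t : R => const_mx t : 'rV[R]_1)).
    apply: continuous_rV => b; apply: (@continuous_near _ _ (id : R -> R)); last exact: cvg_id.
    by near=> s; rewrite mxE.
  exact: Ck_continuous (Ck_partial C1 ord0) _ _.
have bd (f : R -> R) : continuous f -> exists C : R, forall t, t \in `[-2, 2] -> `|f t| <= C.
  move=> cf; have [||c _ Hc] := @EVT_max R (fun t => `|f t|) (-2) 2.
  - by rewrite -subr_ge0; lra.
  - apply: continuous_subspaceT => t; apply: (@continuous_comp _ _ _ f); first exact: cf.
    exact: norm_continuous.
  - by exists `|f c| => t /Hc.
have [C1 H1] := bd _ cb; have [C2 H2] := bd _ cd.
exists (1 + `|C1| + `|C2|); first by rewrite -addrA lerDl addr_ge0.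
move=> t; have [t2|t2] := leP `|t| 2.
  have tI : t \in `[-2, 2] by rewrite in_itv /= -ler_norml.
  rewrite mulr1; split.
    by rewrite (le_trans (H1 t tI)) // (le_trans (ler_norm _)) // addrAC lerDr addr_ge0.
  by rewrite (le_trans (H2 t tI)) // (le_trans (ler_norm _)) // lerDr addr_ge0.
rewrite mulr0 bspline_supp ?normr0; last lra.
split=> //; rewrite normr_le0.
(* Beyond 2 the point is interior to the zero set, since [bspline] vanishes outside [-3/2, 3/2]. *)
have Z : is_derive t 1 bspline 0.
  have E : \forall s \near t, cst 0 s = bspline s.
    apply/nbhs_ballP; exists (`|t| - 2) => [|s] /=; first by rewrite subr_gt0.
    rewrite /ball /= => st; rewrite bspline_supp //=.
    by have := ler_normD (t - s) s; rewrite subrK; lra.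
  by apply: (near_eq_is_derive E); exact: is_derive_cst.
by rewrite -(derive_val (is_derive := is_derive_bspline t)) (derive_val (is_derive := Z)).
Unshelve. all: by end_near. Qed.

Lemma sum_indicator_le K (t : R) : \sum_(k < K) (`|t - k%:R| <= 2)%R%:R <= (5 : R).
Proof.
(* [T] clamps to [-2, 3], an interval of length 5. It is nondecreasing and grows by exactly 1 from s
   to s + 1 when |s| <= 2, so the indicators are dominated by increments of [T] that telescope. *)
pose T (s : R) : R := Num.min (Num.max s (-2)) 3.
have T1 s : (`|s| <= 2)%R%:R <= T (s + 1) - T s.
  rewrite /T; have [s2|s2] := boolP (`|s| <= 2) => /=; move: s2.
    rewrite ler_norml => /andP[s1 s2].
    rewrite !max_l ?min_l; lra.
  rewrite ler_norml negb_and -!ltNge => /orP[s2|s2].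
    rewrite (max_r (ltW s2)) (@min_l _ _ (-2)) //; last lra.
    rewrite subr_ge0 le_min; apply/andP; split; last lra.
    by rewrite le_max lexx orbT.
  rewrite (@max_l _ _ (s + 1)); last lra.
  rewrite (@min_r _ _ (s + 1)); last lra.
  by rewrite subr_ge0 ge_min lexx orbT.
apply: (@le_trans _ _ (T (t + 1) - T (t + 1 - K%:R))).
  elim: K => [|K IH]; first by rewrite big_ord0 subr0 subrr.
  rewrite big_ord_recr /= -[K.+1]addn1 natrD.
  have := T1 (t - K%:R); have -> : t + 1 - (K%:R + 1%:R) = t - K%:R by ring.
  have -> : t - K%:R + 1 = t + 1 - K%:R by ring.
  by lra.
have TL s : -2 <= T s by rewrite /T le_min le_max lexx orbT /=; lra.
have TU s : T s <= 3 by rewrite /T ge_min lexx orbT.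
by have := TL (t + 1 - K%:R); have := TU (t + 1); lra.
Qed.

End Bspline.

Section QuasiInterpolation.
Context {R : realType} {m : nat}.
Variables (h : R) (N : nat).
Hypothesis h_gt0 : 0 < h.
Implicit Types (f : 'rV[R]_m -> R) (y : 'rV[R]_m).

Let K := N.*2.+1.

Let KE : K%:R = 2 * N%:R + 1 :> R.
Proof. by rewrite /K -addn1 natrD -muln2 natrM mulrC. Qed.

Definition gridpt (z : {ffun 'I_m -> 'I_K}) : 'rV[R]_m :=
  \row_a (h * ((z a)%:R - N%:R)).

Definition gridwt (z : {ffun 'I_m -> 'I_K}) y : R :=
  \prod_a bspline (y ord0 a / h + N%:R - (z a)%:R).

(** Smoothing without convolution integrals: a finite combination of smooth tensor products, with
    the values of f at the grid points as coefficients. *)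
Definition qi f y : R := \sum_z f (gridpt z) * gridwt z y.

Lemma Ck_qi f k : isCk k setT (qi f).
Proof.
have oT : open (@setT 'rV[R]_m) by exact: openT.
apply: Ck_sum => // z _; apply: CkZ => //; apply: Ck_prod => // a _.
apply: (@Ck_bspline _ _ _ _ (fun y => y ord0 a / h + N%:R - (z a)%:R)) => //.
apply: CkB => //; last exact: Ck_cst.
apply: CkD => //; last exact: Ck_cst.
by apply: CkM => //; [exact: Ck_coord|exact: Ck_cst].
Qed.

Let inner y := `|y| <= h * (N%:R - 2).

Lemma sum_gridwt y : inner y -> \sum_z gridwt z y = 1.
Proof.
move=> yN; rewrite -(bigA_distr_bigA (fun a k => bspline (y ord0 a / h + N%:R - (k : 'I_K)%:R))) /=.
rewrite big1 // => a _; rewrite sum_bspline.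
have : `|y ord0 a / h| <= N%:R - 2.
  rewrite normrM normfV (gtr0_norm h_gt0) ler_pdivrMr // mulrC.
  by rewrite (le_trans (coord_le_norm y a)).
rewrite ler_norml => /andP[y1 y2].
rewrite ramp1_ge ?ramp1_le ?subr0 //; last lra.
by rewrite KE; lra.
Qed.

Lemma sum_gridpt_gridwt y b : inner y -> \sum_z gridpt z ord0 b * gridwt z y = y ord0 b.
Proof.
move=> yN; pose G a (k : 'I_K) := (if a == b then h * (k%:R - N%:R) else 1) *
  bspline (y ord0 a / h + N%:R - k%:R).
have yl a : `|y ord0 a / h| <= N%:R - 2.
  rewrite normrM normfV (gtr0_norm h_gt0) ler_pdivrMr // mulrC.
  by rewrite (le_trans (coord_le_norm y a)).
have E1 a : \sum_(k < K) bspline (y ord0 a / h + N%:R - k%:R) = 1.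
  have := yl a; rewrite ler_norml => /andP[y1 y2].
  rewrite sum_bspline ramp1_ge ?ramp1_le ?subr0 //; last lra.
  by rewrite KE; lra.
transitivity (\sum_(z : {ffun 'I_m -> 'I_K}) \prod_a G a (z a)).
  apply: eq_bigr => z _; rewrite /gridwt /G big_split /= mxE.
  by rewrite -big_mkcond /= big_pred1_eq.
rewrite -(bigA_distr_bigA G) /= (bigD1 b) //= [X in _ * X]big1 ?mulr1; last first.
  by move=> a /negPf ab; rewrite -[RHS](E1 a); apply: eq_bigr => k _; rewrite /G ab mul1r.
rewrite (eq_bigr (fun k : 'I_K => h * (k%:R * bspline (y ord0 b / h + N%:R - k%:R))
   - h * N%:R * bspline (y ord0 b / h + N%:R - k%:R))); last first.
  by move=> k _; rewrite /G eqxx; ring.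
rewrite sumrB -!mulr_sumr E1 sum_id_bspline.
have := yl b; rewrite ler_norml => /andP[y1 y2].
rewrite ramp_ge ?ramp_le ?ramp1_le; first (by field; rewrite gt_eqF); try lra.
- by rewrite KE; lra.
- by rewrite KE; lra.
Qed.

(** The sums over the grid factor into one-dimensional ones. The margin of two cells in [inner]
    keeps y away from the boundary of the finite grid, where reproduction fails. *)
Lemma qi_affine (c : R) (l x y : 'rV[R]_m) : inner y ->
  qi (fun z => c + linform l (z - x)) y = c + linform l (y - x).
Proof.
move=> yN; rewrite /qi; transitivity (\sum_z ((c - linform l x) * gridwt z y
    + \sum_b l ord0 b * (gridpt z ord0 b * gridwt z y))).
  apply: eq_bigr => z _; rewrite linearB /= mulrDl [in LHS]mulrBl mulrBl.
  rewrite {1}/linform mulr_suml -addrA; congr (_ + _); rewrite addrC; congr (_ + _).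
  by apply: eq_bigr => b _; rewrite mulrA.
rewrite big_split /= -mulr_sumr sum_gridwt // mulr1 exchange_big /=.
rewrite (eq_bigr (fun b => l ord0 b * y ord0 b)); last first.
  by move=> b _; rewrite -mulr_sumr sum_gridpt_gridwt.
by rewrite linearB /= -/(linform l y); ring.
Qed.

Lemma is_derive_gridwt z y a : is_derive y (delta_mx ord0 a) (gridwt z)
  (\prod_(b | b != a) bspline (y ord0 b / h + N%:R - (z b)%:R)
    * (dbspline (y ord0 a / h + N%:R - (z a)%:R) / h)).
Proof.
apply/is_derive_lineP.
have -> : (fun s : R => gridwt z (y + s *: delta_mx ord0 a)) =
  (\prod_(b | b != a) bspline (y ord0 b / h + N%:R - (z b)%:R)) *:
   (fun s : R => bspline (y ord0 a / h + N%:R - (z a)%:R + s / h)).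
  apply/funext => s; rewrite /gridwt (bigD1 a) //= mulrC.
  rewrite -[RHS]/(_ * bspline _); congr (_ * _).
    by apply: eq_bigr => b ba; rewrite !mxE eqxx /= (negPf ba) mulr0 addr0.
  by congr bspline; rewrite !mxE !eqxx mulr1 mulrDl; ring.
apply: is_deriveZ.
apply: (@is_derive1_comp R bspline (fun s => y ord0 a / h + N%:R - (z a)%:R + s / h)).
  by rewrite mul0r addr0; exact: is_derive_bspline.
exact: is_derive_affine.
Qed.

Variable C : R.
Hypothesis C1 : 1 <= C.
Hypothesis HC : forall t : R,
  `|bspline t| <= C * (`|t| <= 2)%R%:R /\ `|dbspline t| <= C * (`|t| <= 2)%R%:R.

Let wt y (z : {ffun 'I_m -> 'I_K}) := \prod_a (C * (`|y ord0 a / h + N%:R - (z a)%:R| <= 2)%R%:R).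

Let wt_supp y z : 2 * h < `|gridpt z - y| -> wt y z = 0.
Proof.
move=> H; have : exists a, ~~ (`|y ord0 a / h + N%:R - (z a)%:R| <= 2).
  apply/existsP; rewrite -negb_forall; apply/negP => /forallP Ha.
  move: H; rewrite ltNge => /negP; apply; apply: norm_le_coord => [|a].
    by rewrite mulr_ge0 // ltW.
  rewrite !mxE; have -> : h * ((z a)%:R - N%:R) - y ord0 a = - (h * (y ord0 a / h + N%:R - (z a)%:R)).
    by field; rewrite gt_eqF.
  by rewrite normrN normrM (gtr0_norm h_gt0) mulrC ler_wpM2r // ltW.
by move=> [a /negPf Ha]; rewrite /wt (bigD1 a) //= Ha mulr0 mul0r.
Qed.

Let sum_wt y : \sum_z wt y z <= (5 * C) ^+ m.
Proof.
rewrite -(bigA_distr_bigA (fun a (k : 'I_K) => C * (`|y ord0 a / h + N%:R - k%:R| <= 2)%R%:R)) /=.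
apply: (@le_trans _ _ (\prod_(a < m) (5 * C))); last by rewrite prodr_const card_ord.
apply: ler_prod => a _; rewrite -mulr_sumr; apply/andP; split.
  by rewrite mulr_ge0 ?sumr_ge0 // (le_trans ler01).
by rewrite mulrC ler_wpM2r ?sum_indicator_le // (le_trans ler01).
Qed.

Let gridwt_le z y : `|gridwt z y| <= wt y z.
Proof.
rewrite normr_prod; apply: ler_prod => a _; rewrite normr_ge0 /=.
by have [] := HC (y ord0 a / h + N%:R - (z a)%:R).
Qed.

Let dgridwt_le z y a : `|partial a (gridwt z) y| <= wt y z / h.
Proof.
rewrite /partial (derive_val (is_derive := is_derive_gridwt z y a)) mulrA normrM.
rewrite normfV (gtr0_norm h_gt0) ler_wpM2r ?invr_ge0 ?(ltW h_gt0) //.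
rewrite /wt [X in _ <= X](bigD1 a) //= [X in _ <= X]mulrC normrM; apply: ler_pM => //; last first.
  by have [] := HC (y ord0 a / h + N%:R - (z a)%:R).
rewrite normr_prod; apply: ler_prod => b _; rewrite normr_ge0 /=.
by have [] := HC (y ord0 b / h + N%:R - (z b)%:R).
Qed.

(** Since [qi] reproduces the affine function with value f y and slope l, only the remainder r
    contributes, and it is of size e * h on the cells that matter. A derivative of a weight costs
    1/h, which leaves e. In each coordinate at most 5 grid values contribute, each weighted by at
    most C, whence the constant (5 * C) ^+ m. *)
Lemma qi_approx f y l e : `|y| < h * (N%:R - 2) -> 0 <= e ->
  (forall z, `|z - y| <= 2 * h -> `|f z - (f y + linform l (z - y))| <= e * h) ->
  `|qi f y - f y| <= (5 * C) ^+ m * e * h /\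
  forall a, `|partial a (qi f) y - l ord0 a| <= (5 * C) ^+ m * e.
Proof.
move=> yN e0 Hf; pose r z := f z - (f y + linform l (z - y)).
have E x : inner x -> qi f x = f y + linform l (x - y) + qi r x.
  move=> xN; rewrite -(qi_affine (f y) l y xN) /qi -big_split /=.
  by apply: eq_bigr => z _; rewrite -mulrDl /r addrC subrK.
have rw z (c c' : R) : 0 <= c' -> `|c| <= wt y z * c' ->
    `|r (gridpt z) * c| <= e * h * wt y z * c'.
  move=> c'0 cw; have [zy|zy] := leP `|gridpt z - y| (2 * h).
    by rewrite normrM -mulrA ler_pM //; exact: Hf.
  move: cw; rewrite wt_supp // mul0r normr_le0 => /eqP ->.
  by rewrite mulr0 normr0 mulr0 mul0r.
split.
  rewrite (E y (ltW yN)) subrr linear0 addr0 [f y + _]addrC addrK /qi.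
  rewrite (le_trans (ler_norm_sum _ _ _)) //.
  apply: (@le_trans _ _ (\sum_z e * h * wt y z * 1)).
    by apply: ler_sum => z _; apply: rw => //; rewrite mulr1.
  rewrite -mulr_suml -mulr_sumr mulr1 -[X in _ <= X]mulrA [X in _ <= X]mulrC.
  by rewrite ler_wpM2l ?sum_wt // mulr_ge0 // ltW.
move=> a.
have D z : is_derive y (delta_mx ord0 a) (gridwt z) (partial a (gridwt z) y).
  by apply/derivableP; case: (is_derive_gridwt z y a).
have DR : is_derive y (delta_mx ord0 a) (qi r) (\sum_z r (gridpt z) * partial a (gridwt z) y).
  by apply: is_derive_bigsum => z _; exact: is_deriveZ.
have DL : is_derive y (delta_mx ord0 a) (fun x => f y + linform l (x - y) + qi r x)
   (l ord0 a + \sum_z r (gridpt z) * partial a (gridwt z) y).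
  apply: (is_deriveD _ DR).
  rewrite -[l ord0 a]add0r; apply: (@is_deriveD _ _ _ (cst (f y)) (fun x => linform l (x - y))).
  have -> : (fun x => linform l (x - y)) = (fun x => \sum_b l ord0 b * (x ord0 b - y ord0 b)).
    by apply/funext => x; apply: eq_bigr => b _; rewrite !mxE.
  have -> : l ord0 a = \sum_b l ord0 b * (b == a)%:R.
    rewrite (bigD1 a) //= eqxx mulr1 big1 ?addr0 // => b /negPf ->.
    by rewrite mulr0.
  apply: is_derive_bigsum => b _; apply: is_deriveZ.
  have H2 := is_deriveB (is_derive_coord b y (delta_mx ord0 a))
    (is_derive_cst (y ord0 b) y (delta_mx ord0 a)).
  by move: H2; rewrite mxE eqxx subr0.
have nE : \forall x \near y, f y + linform l (x - y) + qi r x = qi f x.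
  have : \forall x \near y, `|x| < h * (N%:R - 2).
    apply/nbhs_rV; exists (h * (N%:R - 2) - `|y|); first by rewrite subr_gt0.
    move=> x; rewrite ltrBrDr; apply: le_lt_trans.
    by rewrite -{1}(subrK y x) ler_normD.
  by apply: filterS => x /ltW xN; rewrite [RHS]E.
rewrite /partial (derive_val (is_derive := near_eq_is_derive nE DL)) addrC addKr.
rewrite (le_trans (ler_norm_sum _ _ _)) //.
apply: (@le_trans _ _ (\sum_z e * h * wt y z * h^-1)).
  apply: ler_sum => z _; apply: rw; first by rewrite invr_ge0 ltW.
  exact: dgridwt_le.
rewrite -mulr_suml -mulr_sumr mulrAC -[e * h / h]mulrA mulfV ?gt_eqF // mulr1 mulrC.
by rewrite ler_wpM2r // sum_wt.
Qed.

End QuasiInterpolation.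

Notation borel M := (g_sigma_algebraType (@open M)).

(** * Borel measurability *)

Section Borel.
Context {R : realType}.

Lemma borel_open (M : ptopologicalType) (A : set M) : open A -> measurable (A : set (borel M)).
Proof. by move=> oA; exact: sub_sigma_algebra. Qed.

Lemma borel_closed (M : ptopologicalType) (A : set M) : closed A -> measurable (A : set (borel M)).
Proof. by move=> cA; rewrite -[A]setCK; apply: measurableC; apply: borel_open; exact: closed_openC. Qed.

Lemma continuous_borelR (M : ptopologicalType) (f : M -> R) :
  continuous f -> measurable_fun setT (f : borel M -> measurableTypeR R).
Proof.
move=> /continuousP cf; apply: (measurability _ (RGenOpens.measurableE R)).
move=> _ [_ [a [b ->]] <-]; rewrite setTI; apply: borel_open; apply: cf.
exact: interval_open.
Qed.

(* On R the usual measurable structure is generated by half-open intervals. *)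
Lemma open_borelR (A : set R) : open A -> measurable (A : set (measurableTypeR R)).
Proof. exact: open_measurable. Qed.

Lemma within_continuous_borel (M : ptopologicalType) (D : set M) (f : M -> R) :
  open D -> (forall x, D x -> {for x, continuous f}) ->
  measurable_fun setT ((fun x => if `[< D x >] then f x else 0) : borel M -> measurableTypeR R).
Proof.
move=> oD cf; apply: (measurability _ (RGenOInfty.measurableE R)).
move=> _ [_ [a ->]] <-; rewrite setTI.
have -> : (fun x => if `[< D x >] then f x else 0) @^-1` `]a, +oo[%classic =
    [set x | D x /\ a < f x] `|` (if a < 0 then ~` D else set0).
  apply/seteqP; split=> x /=; rewrite in_itv /= andbT.
    case: asboolP => Dx; first by left.
    by move=> ->; right.
  case=> [[Dx ax]|]; first by rewrite asboolT.
  by case: ifP => // a0 Dx; rewrite asboolF.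
apply: measurableU; last first.
  by case: ifP => // _; apply: measurableC; exact: borel_open.
apply: borel_open; rewrite openE => x [Dx ax].
apply: (@filterS2 _ (nbhs x) _ D (fun x => a < f x)) => [y Dy ay||].
- by [].
- exact: open_nbhs_nbhs.
- by apply: (cf x Dx [set z | a < z]); exact: lt_nbhsr.
Qed.

Lemma rat_near (x e : R) : 0 < e -> exists q : rat, `|x - ratr q| < e.
Proof.
move=> e0; have [|q] := @rat_in_itvoo R (x - e) (x + e); first lra.
by rewrite in_itv /= => /andP[q1 q2]; exists q; rewrite ltr_norml; lra.
Qed.

(** Every open set is a countable union of cubes [B q] with rational centre and radius 1/(n+1), and
    the preimage of such a cube is a finite intersection of coordinate conditions. *)
Lemma measurable_rV d (T : measurableType d) m (F : T -> 'rV[R]_m) :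
  (forall a, measurable_fun setT (fun x => F x ord0 a : measurableTypeR R)) ->
  measurable_fun setT (F : T -> borel 'rV[R]_m).
Proof.
move=> mF; apply: (@measurability _ _ T (borel 'rV[R]_m) setT F open) => //.
move=> _ [U oU <-]; rewrite setTI.
pose B (q : 'rV[rat]_m * nat) := [set x : 'rV[R]_m | forall a, `|x ord0 a - ratr (q.1 ord0 a)| < q.2.+1%:R^-1 :> R].
have -> : F @^-1` U = \bigcup_(q in [set q | B q `<=` U]) F @^-1` (B q).
  apply/seteqP; split=> x /=; last by move=> [q /= BU] /BU.
  move=> Ux; have /nbhs_rV[r r0 Hr] : nbhs (F x) U by exact: open_nbhs_nbhs.
  have [n nr] : exists n : nat, n.+1%:R^-1 < r / 2.
    have /cvgrPdist_lt/(_ _ (divr_gt0 r0 (ltr0Sn R 1))) [n _ Hn] := @cvg_harmonic R.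
    by exists n; have := Hn n (leqnn n); rewrite /harmonic sub0r normrN ger0_norm // invr_ge0.
  have /choice[q Hq] : forall a, exists q : rat, `|F x ord0 a - ratr q| < n.+1%:R^-1.
    by move=> a; apply: rat_near; rewrite invr_gt0.
  exists (\row_a q a, n); last by move=> a /=; rewrite mxE.
  move=> z Bz; apply: Hr; apply: (@le_lt_trans _ _ (2 * n.+1%:R^-1)); last first.
    by rewrite mulrC -ltr_pdivlMr.
  apply: norm_le_coord => [|a]; first by rewrite mulr_ge0.
  have := Bz a; have := Hq a; rewrite /= !mxE => h1 h2.
  rewrite -(subrKA (ratr (q a))) (le_trans (ler_normD _ _)) // mulrDl mul1r lerD ?ltW //.
  by rewrite distrC.
rewrite bigcup_mkcond; apply: countable_bigcupT_measurable => [|q]; first exact: countableP.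
case: ifP => // _.
have -> : F @^-1` B q = \bigcap_(a in [set: 'I_m]) [set x | `|F x ord0 a - ratr (q.1 ord0 a)| < q.2.+1%:R^-1].
  by apply/seteqP; split=> x /= H a; [move=> _; exact: H|exact: H].
apply: fin_bigcap_measurable => [|a _]; first exact: finite_finset.
have := mF a measurableT [set t | `|t - ratr (q.1 ord0 a)| < q.2.+1%:R^-1].
rewrite setTI; apply; apply: open_borelR.
have -> : [set t : R | `|t - ratr (q.1 ord0 a)| < q.2.+1%:R^-1] = ball (ratr (q.1 ord0 a) : R) (q.2.+1%:R^-1).
  by apply/seteqP; split=> t; rewrite /ball /= distrC.
exact: ball_open.
Qed.

Lemma measurable_coord m (a : 'I_m) :
  measurable_fun setT ((fun y : 'rV[R]_m => y ord0 a) : borel 'rV[R]_m -> measurableTypeR R).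
Proof. by apply: continuous_borelR; exact: coord_continuous. Qed.

Lemma measurable_addrV d (T : measurableType d) m (F G : T -> 'rV[R]_m) :
  measurable_fun setT (F : T -> borel 'rV[R]_m) -> measurable_fun setT (G : T -> borel 'rV[R]_m) ->
  measurable_fun setT ((fun x => F x + G x) : T -> borel 'rV[R]_m).
Proof.
move=> mF mG; apply: measurable_rV => a; under eq_fun do rewrite mxE.
by apply: measurable_funD; [exact: (measurableT_comp (measurable_coord a) mF)
  |exact: (measurableT_comp (measurable_coord a) mG)].
Qed.

Lemma measurable_mulmx d (T : measurableType d) m k (A : 'M[R]_(m, k)) (F : T -> 'rV[R]_m) :
  measurable_fun setT (F : T -> borel 'rV[R]_m) ->
  measurable_fun setT ((fun x => F x *m A) : T -> borel 'rV[R]_k).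
Proof.
move=> mF; apply: measurable_rV => a; under eq_fun do rewrite mxE.
apply: measurable_sum => b; apply: measurable_funM; last exact: measurable_cst.
exact: (measurableT_comp (measurable_coord b) mF).
Qed.

End Borel.

Definition pushm d d' (T1 : measurableType d) (T2 : measurableType d') (R : realType)
    (mu : {measure set T1 -> \bar R}) (f : T1 -> T2) (mf : measurable_fun setT f) :
    {measure set T2 -> \bar R} :=
  measure_function_pushforward__canonical__measure_function_Measure mu mf.

Lemma integral_pushm d d' (T1 : measurableType d) (T2 : measurableType d') (R : realType)
    (mu : {measure set T1 -> \bar R}) (phi : T1 -> T2) (mphi : measurable_fun setT phi)
    (f : T2 -> \bar R) : measurable_fun setT f -> (forall y, 0 <= f y)%E ->
  (\int[pushm mu mphi]_y f y = \int[mu]_x f (phi x))%E.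
Proof.
by move=> mf f0; rewrite (ge0_integral_pushforward mphi) // preimage_setT.
Qed.

(** * Lebesgue measure on R^m *)

Section Lebesgue.
Context {R : realType}.
Notation sfm m := {sigma_finite_measure set (borel 'rV[R]_m) -> \bar R}.

Definition row_cons m (p : R * 'rV[R]_m) : 'rV[R]_(1 + m) := row_mx (p.1%:M : 'rV[R]_1) p.2.

Lemma ord_1_ind m (P : 'I_(1 + m) -> Prop) :
  P (lshift m ord0) -> (forall a, P (rshift 1 a)) -> forall a, P a.
Proof.
move=> P0 P1 a; rewrite -[a]splitK; case: (fintype.split a) => b //=.
by rewrite (ord1 b).
Qed.

Lemma row_consE0 m (t : R) (v : 'rV[R]_m) : row_cons (t, v) ord0 (lshift m ord0) = t.
Proof. by rewrite /row_cons row_mxEl mxE eqxx. Qed.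

Lemma row_consES m (t : R) (v : 'rV[R]_m) a : row_cons (t, v) ord0 (rshift 1 a) = v ord0 a.
Proof. by rewrite /row_cons row_mxEr. Qed.

Lemma measurable_row_cons m :
  measurable_fun setT (@row_cons m : measurableTypeR R * borel 'rV[R]_m -> borel 'rV[R]_(1 + m)).
Proof.
apply: measurable_rV; apply: ord_1_ind => [|b].
  have -> : (fun p => @row_cons m p ord0 (lshift m ord0)) = fst.
    by apply/funext => -[t v]; rewrite row_consE0.
  exact: measurable_fst.
have -> : (fun p => @row_cons m p ord0 (rshift 1 b)) = (fun p => p.2 ord0 b).
  by apply/funext => -[t v]; rewrite row_consES.
exact: (measurableT_comp (measurable_coord b) measurable_snd).
Qed.

Definition row_uncons m (y : 'rV[R]_(1 + m)) : R * 'rV[R]_m :=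
  (y ord0 (lshift m ord0), \row_a y ord0 (rshift 1 a)).

Lemma row_consK m : cancel (@row_cons m) (@row_uncons m).
Proof.
move=> [t v]; rewrite /row_uncons row_consE0; congr pair.
by apply/rowP => a; rewrite mxE row_consES.
Qed.

Lemma row_unconsK m : cancel (@row_uncons m) (@row_cons m).
Proof.
move=> y; apply/rowP; apply: ord_1_ind => [|b]; first by rewrite row_consE0.
by rewrite row_consES mxE.
Qed.

Lemma measurable_row_uncons m :
  measurable_fun setT (@row_uncons m : borel 'rV[R]_(1 + m) -> measurableTypeR R * borel 'rV[R]_m).
Proof.
apply/measurable_fun_pairP; split => /=; first exact: measurable_coord.
by apply: measurable_rV => a; under eq_fun do rewrite mxE; exact: measurable_coord.
Qed.

Definition lebS_measure m (mu : sfm m) : {measure set (borel 'rV[R]_(1 + m)) -> \bar R} :=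
  pushm (@lebesgue_measure R \x mu)%E (@measurable_row_cons m).

Lemma lebS_sigma_finite m (mu : sfm m) : sigma_finite setT (lebS_measure mu).
Proof.
have /sigma_finiteP[F [FT ndF mF]] : sigma_finite setT (@lebesgue_measure R) by exact: sigma_finiteT.
have /sigma_finiteP[G [GT ndG mG]] : sigma_finite setT mu by exact: sigma_finiteT.
exists (fun i => @row_uncons m @^-1` (F i `*` G i)).
  apply/esym; rewrite -subTset => y _.
  have [i _ Fi] : (\bigcup_i F i) (row_uncons y).1 by rewrite -FT.
  have [j _ Gj] : (\bigcup_i G i) (row_uncons y).2 by rewrite -GT.
  exists (maxn i j) => //; split.
    by move: Fi; apply/subsetPset/ndF/leq_maxl.
  by move: Gj; apply/subsetPset/ndG/leq_maxr.
move=> i; have [mFi Fi] := mF i; have [mGi Gi] := mG i; split.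
  by rewrite -[X in measurable X]setTI; apply: measurable_row_uncons => //; exact: measurableX.
rewrite /lebS_measure /= /pushforward.
have -> : (@row_cons m @^-1` (@row_uncons m @^-1` (F i `*` G i))) = F i `*` G i.
  rewrite -comp_preimage (_ : _ \o _ = id) ?preimage_id //.
  by apply/funext => p /=; rewrite row_consK.
by rewrite product_measure1E // lte_mul_pinfty // ge0_fin_numE.
Qed.

Definition lebS m (mu : sfm m) : sfm (1 + m) :=
  HB.pack_for (sfm (1 + m)) (Measure.sort (lebS_measure mu))
   (Measure_isSigmaFinite.Build _ _ _ (lebS_measure mu) (lebS_sigma_finite mu)).

Lemma leb0_sigma_finite : sigma_finite setT (@dirac _ (borel 'rV[R]_0) (0 : 'rV[R]_0) R).
Proof.
exists (fun=> setT) => [|i]; first by rewrite bigcup_const //; exists 0%N.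
by split=> //; rewrite /= diracE mem_set // ltry.
Qed.

Definition leb0 : sfm 0 :=
  HB.pack_for (sfm 0) (Measure.sort (@dirac _ (borel 'rV[R]_0) (0 : 'rV[R]_0) R))
   (Measure_isSigmaFinite.Build _ _ _ (@dirac _ (borel 'rV[R]_0) (0 : 'rV[R]_0) R) leb0_sigma_finite).

(** Realizes the iterated integral [integral_rV] as the integral against a measure, so that
    Tonelli's theorem applies. Sigma-finiteness travels along the recursion because products of
    measures require it. *)
Fixpoint leb m : sfm m :=
  match m with 0 => leb0 | m'.+1 => lebS (leb m') end.

Local Open Scope ereal_scope.

Lemma integral_lebS m (f : 'rV[R]_(1 + m) -> \bar R) :
  measurable_fun setT (f : borel 'rV[R]_(1 + m) -> \bar R) -> (forall y, 0 <= f y) ->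
  \int[leb (1 + m)]_y f y = \int[@lebesgue_measure R]_t \int[leb m]_v f (row_cons (t, v)).
Proof.
move=> mf f0; transitivity (\int[(@lebesgue_measure R \x leb m)]_p f (row_cons p)).
  rewrite -[LHS]/(\int[lebS_measure (leb m)]_y f y).
  by rewrite integral_pushm.
pose h : measurableTypeR R * borel 'rV[R]_m -> \bar R := fun p => f (@row_cons m p).
rewrite -[LHS]/(\int[(@lebesgue_measure R \x leb m)]_p h p) (fubini_tonelli1 h) //.
  exact: (measurableT_comp mf (@measurable_row_cons m)).
by move=> p; exact: f0.
Qed.

Lemma integral_leb0 (f : 'rV[R]_0 -> \bar R) :
  measurable_fun setT (f : borel 'rV[R]_0 -> \bar R) ->
  \int[leb 0]_y f y = f 0%R.
Proof.
move=> mf; rewrite -[LHS]/(\int[@dirac _ (borel 'rV[R]_0) (0 : 'rV[R]_0)%R R]_y f y).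
by rewrite integral_dirac // diracE mem_set // mul1e.
Qed.

Lemma measurable_integral_leb d (T : measurableType d) m (f : T * 'rV[R]_m -> \bar R) :
  measurable_fun setT (f : T * borel 'rV[R]_m -> \bar R) -> (forall p, 0 <= f p) ->
  measurable_fun setT (fun t => \int[leb m]_v f (t, v)).
Proof. by move=> mf f0; apply: (measurable_fun_fubini_tonelli_F (T2 := borel 'rV[R]_m) (m2 := leb m) f) => // p; exact: f0. Qed.

Lemma integral_rVE m (f : 'rV[R]_m -> \bar R) :
  measurable_fun setT (f : borel 'rV[R]_m -> \bar R) -> (forall y, 0 <= f y) ->
  integral_rV f = \int[leb m]_y f y.
Proof.
elim: m f => [|m IH] f mf f0; first by rewrite integral_leb0.
rewrite [RHS](integral_lebS (m := m)) //=; apply: eq_integral => t _.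
rewrite -(IH (fun v => f (row_cons (t, v)))) //.
apply: (measurableT_comp mf); apply: (measurableT_comp (@measurable_row_cons m)).
exact: measurable_pair1.
Qed.

Lemma lebesgue_measure_affine (a b : R) (A : set R) : a != 0%R -> measurable (A : set (measurableTypeR R)) ->
  (`|a|%:E * @lebesgue_measure R ((fun t : R => (t * a + b)%R) @^-1` A) = @lebesgue_measure R A).
Proof.
move=> a0 mA.
have mf : measurable_fun setT ((fun t => t * a + b)%R : measurableTypeR R -> measurableTypeR R).
  by apply: measurable_funD => //; apply: measurable_funM.
pose mu := mscale (NngNum (normr_ge0 a)) (pushm (@lebesgue_measure R) mf).
rewrite -[LHS]/(mu A); apply/esym; apply: lebesgue_measure_unique => // _ [[x y] xy <-].
rewrite lebesgue_measure_itv /=.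
rewrite -[RHS]/(`|a|%:E * @lebesgue_measure R ((fun t => t * a + b)%R @^-1` `]x, y]%classic)).
have na : (0 < `|a|)%R by rewrite normr_gt0.
have [a1|a1] : (0 < a \/ a < 0)%R by move: a0; rewrite neq_lt => /orP[]; [right|left].
  have -> : (fun t => t * a + b)%R @^-1` `]x, y]%classic = `]((x - b) / a)%R, ((y - b) / a)%R]%classic.
    apply/seteqP; split=> t /=; rewrite !in_itv /= ltr_pdivrMr // ler_pdivlMr //;
    by rewrite ltrBlDr lerBrDr.
  rewrite lebesgue_measure_itv /= !lte_fin ltr_pM2r ?invr_gt0 // ltrD2r.
  case: ifP => _; last by rewrite mule0.
  by rewrite -!EFinB -EFinM; congr EFin; rewrite gtr0_norm //; field; rewrite gt_eqF.
(* For negative a the preimage is open on the other side, which leaves its length unchanged. *)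
have -> : (fun t => t * a + b)%R @^-1` `]x, y]%classic = `[((y - b) / a)%R, ((x - b) / a)%R[%classic.
  apply/seteqP; split=> t /=; rewrite !in_itv /= ltr_ndivlMr // ler_ndivrMr //;
  by rewrite ltrBlDr lerBrDr andbC.
rewrite lebesgue_measure_itv /= !lte_fin ltr_nM2r ?invr_lt0 // ltrD2r.
case: ifP => _; last by rewrite mule0.
by rewrite -!EFinB -EFinM; congr EFin; rewrite ltr0_norm //; field; rewrite lt_eqF.
Qed.

Lemma integral_affine (a b : R) (f : R -> \bar R) : a != 0%R ->
  measurable_fun setT (f : measurableTypeR R -> \bar R) -> (forall t, 0 <= f t) ->
  \int[@lebesgue_measure R]_t f (t * a + b)%R =
  (`|a|^-1)%:E * \int[@lebesgue_measure R]_t f t.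
Proof.
move=> a0 mf f0.
have mh : measurable_fun setT ((fun t => t * a + b)%R : measurableTypeR R -> measurableTypeR R).
  by apply: measurable_funD => //; apply: measurable_funM.
have -> : \int[@lebesgue_measure R]_t f t =
    \int[mscale (NngNum (normr_ge0 a)) (pushm (@lebesgue_measure R) mh)]_t f t.
  apply: eq_measure_integral => A mA _.
  by apply/esym; exact: (lebesgue_measure_affine b a0 mA).
rewrite ge0_integral_mscale //= muleA -EFinM mulVf ?normr_eq0 // mul1e.
by rewrite -[X in _ = X]/(\int[pushm (@lebesgue_measure R) mh]_x f x) integral_pushm.
Qed.

End Lebesgue.

Section Boxes.
Context {R : realType}.
Local Open Scope ereal_scope.

Definition box m (lo hi : 'rV[R]_m) : set 'rV[R]_m :=
  [set y | forall a, (lo ord0 a <= y ord0 a < hi ord0 a)%R].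

Lemma measurable_box m (lo hi : 'rV[R]_m) : measurable (box lo hi : set (borel 'rV[R]_m)).
Proof.
have -> : box lo hi = \bigcap_(a in [set: 'I_m])
    ((fun y : 'rV[R]_m => y ord0 a) @^-1` `[lo ord0 a, hi ord0 a[%classic).
  by apply/seteqP; split=> y /= H a; [move=> _|have := H a I]; rewrite /= in_itv //=; exact: H.
apply: fin_bigcap_measurable => [|a _]; first exact: finite_finset.
by rewrite -[X in measurable X]setTI; exact: (@measurable_coord R m a).
Qed.

Lemma measurable_fun_indicE d (T : measurableType d) (A : set T) : measurable A ->
  measurable_fun setT (fun x => (\1_A x : R)%:E).
Proof. by move=> mA; apply/measurable_EFinP; exact: measurable_indic. Qed.

Lemma leb_indic m (A : set 'rV[R]_m) : measurable (A : set (borel 'rV[R]_m)) ->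
  leb m A = \int[leb m]_y (\1_A y : R)%:E.
Proof. by move=> mA; rewrite integral_indic // setIT. Qed.

Lemma leb_box m (lo hi : 'rV[R]_m) : (forall a, (lo ord0 a <= hi ord0 a)%R) ->
  leb m (box lo hi) = (\prod_a (hi ord0 a - lo ord0 a))%:E.
Proof.
elim: m lo hi => [|m IH] lo hi lohi.
  rewrite big_ord0 /= diracE mem_set //; by case.
rewrite -[m.+1]/(1 + m)%N in lo hi lohi *.
rewrite leb_indic; last exact: measurable_box.
rewrite integral_lebS; last 2 first.
- by apply: measurable_fun_indicE; exact: measurable_box.
- by move=> y; rewrite lee_fin.
pose lo' := (row_uncons lo).2; pose hi' := (row_uncons hi).2.
pose l0 := lo ord0 (lshift m ord0); pose h0 := hi ord0 (lshift m ord0).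
have E t v : (\1_(box lo hi) (row_cons (t, v)) : R) = (\1_(`[l0, h0[%classic) t * \1_(box lo' hi') v)%R.
  rewrite !indicE -natrM mulnb; congr GRing.natmul; congr nat_of_bool; apply/idP/idP.
    move/set_mem => H; apply/andP; split; apply/mem_set.
      by rewrite /= in_itv /=; have := H (lshift m ord0); rewrite row_consE0.
    by move=> a; have := H (rshift 1 a); rewrite row_consES /lo' /hi' /= !mxE.
  move=> /andP[/set_mem H1 /set_mem H2]; apply/mem_set; apply: ord_1_ind => [|a].
    by rewrite row_consE0; move: H1; rewrite /= in_itv.
  by rewrite row_consES; have := H2 a; rewrite /lo' /hi' /= !mxE.
have P a : (lo' ord0 a <= hi' ord0 a)%R by rewrite !mxE.
under eq_integral => t _ do under eq_integral => v _ do rewrite E EFinM.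
transitivity (\int[@lebesgue_measure R]_t
    ((\prod_a (hi' ord0 a - lo' ord0 a))%:E * (\1_(`[l0, h0[%classic) t : R)%:E)).
  apply: eq_integral => t _; rewrite ge0_integralZl_EFin //; last first.
    by apply: measurable_fun_indicE; exact: measurable_box.
  by rewrite -leb_indic ?IH 1?muleC //; exact: measurable_box.
rewrite ge0_integralZl_EFin //; last 2 first.
- by apply: measurable_fun_indicE.
- by apply: prodr_ge0 => a _; rewrite subr_ge0.
have -> : \int[@lebesgue_measure R]_x (\1_(`[l0, h0[%classic) x : R)%:E = @lebesgue_measure R `[l0, h0[%classic.
  by rewrite integral_indic ?setIT.
rewrite lebesgue_measure_itv /=.
have -> : (if l0%:E < h0%:E then h0%:E - l0%:E else 0) = (h0 - l0)%:E.
  rewrite lte_fin; case: ltP => // h.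
  by have := lohi (lshift m ord0); rewrite -/l0 -/h0 => h'; congr EFin; lra.
rewrite -EFinM; congr EFin; rewrite mulrC big_split_ord /= big_ord1; congr (_ * _)%R.
by apply: eq_bigr => a _; rewrite !mxE.
Qed.

End Boxes.

(** * Triangular factorization and linear changes of variables *)

Section Cholesky.
Context {R : realType}.

(** The induction matches the recursion defining [leb]: multiplying the row (t, v) by the block
    matrix scales t by a and sends v to v L + t r, so the inner integral only sees L and a
    translation. *)
Inductive utri : forall m, 'M[R]_m -> Prop :=
| utri0 (L : 'M[R]_0) : utri L
| utriS m (a : R) (r : 'rV[R]_m) (L : 'M[R]_m) : a != 0 -> utri L ->
    @utri (1 + m) (block_mx a%:M r 0 L).

Lemma utri_det m (L : 'M[R]_m) : utri L -> \det L != 0.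
Proof.
elim=> [L'|k a r L' a0 _ IH]; first by rewrite det_mx00 oner_neq0.
by rewrite det_ublock mulf_neq0 // det_scalar1.
Qed.

Definition posdef m (A : 'M[R]_m) := forall v, v != 0 -> 0 < bilin A v v.

Lemma cholesky m (A : 'M[R]_m) : A^T = A -> posdef A ->
  exists2 L, utri L & A = L *m L^T.
Proof.
elim: m A => [|m IH] A sA pA.
  by exists A; [exact: utri0|apply/matrixP => -[]].
rewrite -[m.+1]/(1 + m)%N in A sA pA *.
pose b := ursubmx A; pose D := drsubmx A.
have EA : A = block_mx (ulsubmx A) b b^T D.
  by rewrite -[LHS]submxK; congr block_mx; rewrite /b trmx_ursub sA.
have sD : D^T = D by rewrite /D trmx_drsub sA.
have pD : posdef D.
  move=> v v0; have := pA (row_mx 0 v); rewrite {1}EA /bilin mul_row_block tr_row_mx mul_row_col.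
  rewrite !mul0mx !add0r trmx0 mulmx0 add0r; apply.
  by apply: contra v0 => /eqP /(congr1 rsubmx); rewrite row_mxKr linear0 => ->.
have [L' uL' ED] := IH D sD pD.
have dL' : L' \in unitmx by rewrite unitmxE unitfE utri_det.
pose r := b *m invmx L'^T.
have Er : b = r *m L'^T by rewrite /r mulmxKV // unitmx_tr.
(* The Schur complement of the lower right block. It is positive because it is the value of the
   quadratic form at the vector (1, - r L'^-1). *)
pose s := ulsubmx A ord0 ord0 - (r *m r^T) ord0 ord0.
have s0 : 0 < s.
  have := pA (row_mx 1%:M (- (r *m invmx L'))).
  have -> : row_mx 1%:M (- (r *m invmx L')) != 0 :> 'rV[R]_(1 + m).
    apply/negP => /eqP /(congr1 lsubmx); rewrite row_mxKl linear0 => /matrixP /(_ ord0 ord0).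
    by rewrite !mxE eqxx => /eqP; rewrite oner_eq0.
  move=> /(_ isT); rewrite {1}EA /bilin mul_row_block tr_row_mx mul_row_col !mul1mx trmx1 mulmx1.
  suff -> : ulsubmx A + - (r *m invmx L') *m b^T + (b + - (r *m invmx L') *m D) *m (- (r *m invmx L'))^T
     = ulsubmx A - r *m r^T by rewrite /s !mxE.
  have E1 : b + - (r *m invmx L') *m D = 0.
    by rewrite ED mulNmx mulmxA mulmxKV // -Er subrr.
  by rewrite E1 mul0mx addr0 mulNmx [in b^T]Er trmx_mul trmxK mulmxA mulmxKV.
exists (block_mx (Num.sqrt s)%:M r 0 L').
  by apply: utriS => //; rewrite gt_eqF // sqrtr_gt0.
rewrite tr_block_mx mulmx_block trmx0 !mul0mx !mulmx0 !add0r tr_scalar_mx -ED -Er.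
rewrite {1}EA; congr block_mx; last by rewrite Er trmx_mul trmxK.
apply/matrixP => i j; rewrite !ord1 -scalar_mxM -expr2 sqr_sqrtr ?ltW //.
by rewrite [RHS]mxE [_%:M _ _]mxE eqxx mulr1n /s subrK.
Qed.

Definition enorm2 k (v : 'rV[R]_k) : R := \sum_a v ord0 a ^+ 2.

Lemma enorm2E k (v : 'rV[R]_k) : enorm2 v = (v *m v^T) ord0 ord0.
Proof. by rewrite mxE; apply: eq_bigr => a _; rewrite mxE expr2. Qed.

Lemma enorm2_ge0 k (v : 'rV[R]_k) : 0 <= enorm2 v.
Proof. by apply: sumr_ge0 => a _; rewrite sqr_ge0. Qed.

Lemma enorm2_gt0 k (v : 'rV[R]_k) : v != 0 -> 0 < enorm2 v.
Proof.
rewrite lt0r enorm2_ge0 andbT; apply: contra; rewrite psumr_eq0 => [/allP H|a _]; last exact: sqr_ge0.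
apply/eqP/rowP => a; rewrite [RHS]mxE; apply/eqP; rewrite -sqrf_eq0.
by apply: H; exact: mem_index_enum.
Qed.

Lemma posdef_mulmxT k (A : 'M[R]_k) : A \in unitmx -> posdef (A *m A^T).
Proof.
move=> Au v v0; rewrite /bilin mulmxA -mulmxA -trmx_mul -enorm2E; apply: enorm2_gt0.
by apply: contra v0 => /eqP vA; rewrite -[v](mulmxK Au) vA mul0mx.
Qed.

End Cholesky.

Section LinearChange.
Context {R : realType} {m : nat}.
Local Open Scope ereal_scope.

Lemma measurable_affine k (A : 'M[R]_k) (c : 'rV[R]_k) :
  measurable_fun setT ((fun y => y *m A + c)%R : borel 'rV[R]_k -> borel 'rV[R]_k).
Proof. by apply: measurable_addrV; [exact: measurable_mulmx|exact: measurable_cst]. Qed.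

Lemma integral_utri k (L : 'M[R]_k) : utri L -> forall (c : 'rV[R]_k) (f : 'rV[R]_k -> \bar R),
  measurable_fun setT (f : borel 'rV[R]_k -> \bar R) -> (forall y, 0 <= f y) ->
  \int[leb k]_y f (y *m L + c)%R = (`|\det L|^-1)%:E * \int[leb k]_y f y.
Proof.
elim=> {k L} [L' c f mf f0|k a r L' a0 uL IH c f mf f0].
  rewrite det_mx00 normr1 invr1 mul1e !integral_leb0 //.
    by congr f; apply/rowP => -[].
  by apply: (measurableT_comp mf); exact: measurable_affine.
have mf' t : measurable_fun setT ((fun v => f (row_cons (t, v))) : borel 'rV[R]_k -> \bar R).
  apply: (measurableT_comp mf); apply: (measurableT_comp (@measurable_row_cons R k)).
  exact: measurable_pair1.
have mI : measurable_fun setT ((fun t => \int[leb k]_v f (row_cons (t, v))) : measurableTypeR R -> \bar R).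
  apply: (@measurable_integral_leb R _ (measurableTypeR R) k (fun p => f (row_cons p))) => //.
  exact: (measurableT_comp mf (@measurable_row_cons R k)).
rewrite integral_lebS //; last first.
  by apply: (measurableT_comp mf); exact: measurable_affine.
rewrite [in RHS]integral_lebS //.
pose c0 := (row_uncons c).1; pose c1 := (row_uncons c).2.
have E t v : (row_cons (t, v) *m block_mx a%:M r 0 L' + c)%R =
    row_cons ((t * a + c0)%R, (v *m L' + (t *: r + c1))%R).
  rewrite -[c](@row_unconsK R k) /row_cons mul_row_block -/c0 -/c1 /= mulmx0 addr0 add_row_mx.
  by rewrite -scalar_mxM -raddfD /= mul_scalar_mx addrCA addrA.
under eq_integral => t _ do under eq_integral => v _ do rewrite E.
have [K [EK mK K0]] : exists K : R -> \bar R,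
    [/\ forall t, \int[leb k]_v f (row_cons (t, v)) = K t,
        measurable_fun setT (K : measurableTypeR R -> \bar R) & forall t, 0 <= K t].
  by exists (fun t => \int[leb k]_v f (row_cons (t, v))); split=> // t; exact: integral_ge0.
transitivity (\int[@lebesgue_measure R]_t ((`|\det L'|^-1)%:E * K (t * a + c0)%R)).
  by apply: eq_integral => t _; rewrite (IH _ (fun v => f (row_cons ((t * a + c0)%R, v)))) // EK.
have mK' : measurable_fun setT ((fun t => K (t * a + c0)%R) : measurableTypeR R -> \bar R).
  by apply: (measurableT_comp mK); apply: measurable_funD => //; exact: measurable_funM.
rewrite ge0_integralZl_EFin; [|exact: measurableT|by move=> t _; exact: K0|exact: mK'|by rewrite invr_ge0].
rewrite integral_affine // muleA -EFinM -invfM -normrM mulrC det_ublock det_scalar1.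
by rewrite mulrC; congr (_ * _); apply: eq_integral => t _; rewrite EK.
Qed.

Lemma integral_translate (c : 'rV[R]_m) (f : 'rV[R]_m -> \bar R) :
  measurable_fun setT (f : borel 'rV[R]_m -> \bar R) -> (forall y, 0 <= f y) ->
  \int[leb m]_y f (y + c)%R = \int[leb m]_y f y.
Proof.
move=> mf f0; have u1 : @utri R m 1%:M.
  elim: (m) => [|k IH]; first exact: utri0.
  by rewrite -[k.+1]/(1 + k)%N scalar_mx_block; apply: utriS => //; exact: oner_neq0.
have := @integral_utri m _ u1 c f mf f0; rewrite det1 normr1 invr1 mul1e => <-.
by apply: eq_integral => y _; rewrite mulmx1.
Qed.

(* For an invariant measure, I = \int\int f(xO) g(y) dx dy factors in two ways when g is radial. *)
Lemma integral_orthogonal (O : 'M[R]_m) (f : 'rV[R]_m -> \bar R) : O *m O^T = 1%:M ->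
  measurable_fun setT (f : borel 'rV[R]_m -> \bar R) -> (forall y, 0 <= f y) ->
  \int[leb m]_y f (y *m O)%R = \int[leb m]_y f y.
Proof.
move=> OO mf f0; have OO' : O^T *m O = 1%:M by apply/mulmx1C.
pose B : set 'rV[R]_m := [set y | (enorm2 y <= 1)%R].
have cB : closed B.
  have -> : B = @enorm2 R m @^-1` [set t | (t <= 1)%R] by [].
  apply: closed_comp; last exact: closed_le.
  have CB : isCk 0 setT (@enorm2 R m).
    apply: Ck_sum => [|a _]; first exact: openT.
    by under eq_fun do rewrite expr2; apply: CkM; [exact: openT|exact: Ck_coord|exact: Ck_coord].
  by move=> y _; exact: Ck_continuous CB _ _.
have mB : measurable (B : set (borel 'rV[R]_m)) by exact: borel_closed.
pose g y : \bar R := (\1_B y : R)%:E.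
have mg : measurable_fun setT (g : borel 'rV[R]_m -> \bar R) by exact: measurable_fun_indicE.
have g0 y : 0 <= g y by rewrite lee_fin.
have gE y z : enorm2 y = enorm2 z -> g y = g z.
  have BE x : (x \in B) = (enorm2 x <= 1)%R by apply/idP/idP => [/set_mem|/mem_set].
  by move=> yz; rewrite /g !indicE !BE yz.
have gO y : g (y *m O)%R = g y.
  by apply: gE; rewrite !enorm2E trmx_mul mulmxA -[y *m O *m _]mulmxA OO mulmx1.
have gN y : g (- y)%R = g y.
  by apply: gE; apply: eq_bigr => a _; rewrite mxE sqrrN.
(* The factor to be cancelled must be positive and finite: the unit ball contains a cube of half
   side 1/(m+1) and lies in one of half side 2. *)
have Ig : 0 < \int[leb m]_y g y /\ \int[leb m]_y g y < +oo.
  rewrite -leb_indic //; split.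
    pose e : R := (m.+1%:R^-1)%R; have e0 : (0 < e)%R by rewrite invr_gt0.
    apply: (@lt_le_trans _ _ (leb m (box (const_mx (- e)%R) (const_mx e)))).
      rewrite leb_box => [|a]; last by rewrite !mxE; lra.
      by rewrite lte_fin; apply: prodr_gt0 => a _; rewrite !mxE; lra.
    apply: le_measure; rewrite ?inE //; first exact: measurable_box.
    move=> y Hy; rewrite /B /= /enorm2; apply: (@le_trans _ _ (\sum_(a < m) e ^+ 2)%R).
      apply: ler_sum => a _; have := Hy a; rewrite !mxE => /andP[y1 /ltW y2].
      by rewrite -real_normK ?num_real // lerXn2r ?nnegrE ?(ltW e0) // ler_norml y1.
    rewrite sumr_const card_ord -mulr_natl expr2 mulrA.
    have me : (m%:R * e <= 1)%R by rewrite ler_pdivrMr // mul1r ler_nat.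
    have e1 : (e <= 1)%R by rewrite invf_le1 // ler1n.
    by rewrite (le_trans _ e1) // ler_piMl // ltW.
  apply: (@le_lt_trans _ _ (leb m (box (const_mx (- 2)%R) (const_mx 2%R)))).
    apply: le_measure; rewrite ?inE //; first exact: measurable_box.
    move=> y By a; rewrite !mxE; have : (y ord0 a ^+ 2 <= 1)%R.
      by apply: le_trans By; rewrite /enorm2 (bigD1 a) //= lerDl sumr_ge0 // => b _; rewrite sqr_ge0.
    by move=> H; nra.
  by rewrite leb_box ?ltry // => a; rewrite !mxE; lra.
have mS : measurable_fun setT ((fun p => p.1 *m O + p.2)%R :
    (borel 'rV[R]_m * borel 'rV[R]_m)%type -> borel 'rV[R]_m).
  apply: measurable_addrV; last exact: measurable_snd.
  by apply: measurable_mulmx; exact: measurable_fst.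
have m1 (h : 'rV[R]_m -> \bar R) (c : 'rV[R]_m) : measurable_fun setT (h : borel 'rV[R]_m -> \bar R) ->
    measurable_fun setT ((fun y => h (y *m O + c)%R) : borel 'rV[R]_m -> \bar R).
  by move=> mh; apply: (measurableT_comp mh); exact: measurable_affine.
pose If := \int[leb m]_y f y; pose IO := \int[leb m]_y f (y *m O)%R; pose I := \int[leb m]_y g y.
have mfO : measurable_fun setT ((fun y => f (y *m O)%R) : borel 'rV[R]_m -> \bar R).
  by apply: (measurableT_comp mf); apply: measurable_mulmx; exact: measurable_id.
suff E : IO * I = If * I.
  have I0 : I != 0 by rewrite gt_eqF //; case: Ig.
  have If' : I \is a fin_num by rewrite ge0_fin_numE ?integral_ge0 //; case: Ig.
  have cancel x : x * I * ((fine I)^-1)%:E = x.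
    by rewrite -{1}(fineK If') -muleA -EFinM mulfV ?mule1 // fine_eq0.
  by rewrite -[LHS]cancel -[RHS]cancel -/IO -/If E.
have mF1 : measurable_fun setT ((fun p => f (p.1 *m O + p.2)%R * g p.2) :
    (borel 'rV[R]_m * borel 'rV[R]_m)%type -> \bar R).
  apply: emeasurable_funM; first exact: (measurableT_comp mf mS).
  exact: (measurableT_comp mg measurable_snd).
have mS' : measurable_fun setT ((fun p => p.2 - p.1 *m O)%R :
    (borel 'rV[R]_m * borel 'rV[R]_m)%type -> borel 'rV[R]_m).
  have -> : (fun p : 'rV[R]_m * 'rV[R]_m => p.2 - p.1 *m O)%R = (fun p => p.2 + p.1 *m (- O))%R.
    by apply/funext => p; rewrite mulmxN.
  apply: measurable_addrV; first exact: measurable_snd.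
  by apply: measurable_mulmx; exact: measurable_fst.
have mF2 : measurable_fun setT ((fun p => f p.2 * g (p.2 - p.1 *m O)%R) :
    (borel 'rV[R]_m * borel 'rV[R]_m)%type -> \bar R).
  apply: emeasurable_funM; first exact: (measurableT_comp mf measurable_snd).
  exact: (measurableT_comp mg mS').
transitivity (\int[leb m]_y \int[leb m]_x (f (x *m O + y)%R * g y)).
  rewrite -ge0_integralZl //; last by apply: integral_ge0 => x _; exact: f0.
  apply: eq_integral => y _.
  rewrite ge0_integralZr //; last exact: m1.
  congr (_ * _); transitivity (\int[leb m]_x f ((x + y *m O^T) *m O)%R).
    by apply/esym; exact: (integral_translate (y *m O^T) mfO (fun x => f0 _)).
  by apply: eq_integral => x _; rewrite mulmxDl -mulmxA OO' mulmx1.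
rewrite -(fubini_tonelli (fun p : borel 'rV[R]_m * borel 'rV[R]_m => f (p.1 *m O + p.2)%R * g p.2)) //; last first.
  by move=> p; exact: mule_ge0.
(* Shifting y by x O moves the orthogonal matrix from f to the radial function g, which is
   insensitive to it. *)
transitivity (\int[leb m]_x \int[leb m]_y (f y * g (y - x *m O)%R)).
  apply: eq_integral => x _ /=.
  rewrite -[RHS](integral_translate (x *m O)) //.
  - by apply: eq_integral => y _; rewrite addrK [(y + _)%R]addrC.
  - apply: emeasurable_funM => //; apply: (measurableT_comp mg).
    by apply: measurable_addrV; [exact: measurable_id|exact: measurable_cst].
  - by move=> y; exact: mule_ge0.
rewrite (fubini_tonelli (fun p : borel 'rV[R]_m * borel 'rV[R]_m => f p.2 * g (p.2 - p.1 *m O)%R)) //; last first.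
  by move=> p; exact: mule_ge0.
rewrite -ge0_integralZr //; last by apply: integral_ge0.
apply: eq_integral => y _ /=.
rewrite ge0_integralZl //; last first.
  apply: (measurableT_comp mg).
  have -> : (fun x : 'rV[R]_m => y - x *m O)%R = (fun x => x *m (- O) + y)%R.
    by apply/funext => x; rewrite mulmxN addrC.
  exact: measurable_affine.
congr (_ * _); transitivity (\int[leb m]_x g (x + - (y *m O^T))%R); last first.
  exact: (integral_translate _ mg g0).
apply: eq_integral => x _; rewrite -[RHS]gO -[RHS]gN; congr g.
by rewrite mulmxBl -mulmxA OO' mulmx1 opprB.
Qed.

(** The factorization A = L O, with L the Cholesky factor of A A^T: then L^-1 A is orthogonal, and
    the triangular and orthogonal cases combine. The translation c is removed last. *)
Lemma integral_linear (A : 'M[R]_m) (c : 'rV[R]_m) (f : 'rV[R]_m -> \bar R) : \det A != 0%R ->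
  measurable_fun setT (f : borel 'rV[R]_m -> \bar R) -> (forall y, 0 <= f y) ->
  \int[leb m]_y f (y *m A + c)%R = (`|\det A|^-1)%:E * \int[leb m]_y f y.
Proof.
move=> dA mf f0.
have Au : A \in unitmx by rewrite unitmxE unitfE.
have sAA : (A *m A^T)^T = A *m A^T by rewrite trmx_mul trmxK.
have pAA := posdef_mulmxT Au.
have [L uL EL] := cholesky sAA pAA.
have Lu : L \in unitmx by rewrite unitmxE unitfE utri_det.
pose O := invmx L *m A.
have EA : A = L *m O by rewrite /O mulKVmx.
have OO : (O *m O^T = 1%:M)%R.
  by rewrite /O trmx_mul mulmxA -[_ *m A *m _]mulmxA EL mulmxA mulVmx // mul1mx trmx_inv mulmxV // unitmx_tr.
have dO : (`|\det O| = 1)%R.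
  apply/eqP; rewrite -sqrp_eq1 // -normrX expr2 -{2}det_tr -det_mulmx OO det1 normr1 //.
clearbody O; transitivity (\int[leb m]_y f (y *m L *m O + c)%R).
  by apply: eq_integral => y _; rewrite EA mulmxA.
have mfc : measurable_fun setT ((fun y => f (y + c)%R) : borel 'rV[R]_m -> \bar R).
  by apply: (measurableT_comp mf); apply: measurable_addrV; [exact: measurable_id|exact: measurable_cst].
have := @integral_utri m L uL 0%R (fun y => f (y *m O + c)%R).
under eq_integral => y _ do rewrite addr0.
move=> ->//; last by apply: (measurableT_comp mf); exact: measurable_affine.
rewrite EA det_mulmx normrM dO mulr1; congr (_ * _).
by rewrite (@integral_orthogonal O (fun y => f (y + c)%R)) // integral_translate.
Qed.

End LinearChange.

(** * Measures given by a density *)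

Section Density.
Context d (T : measurableType d) (R : realType) (mu : {measure set T -> \bar R}) (w : T -> R).
Hypotheses (mw : measurable_fun setT w) (w0 : forall x, 0 <= w x).
Local Open Scope ereal_scope.

(** The two proofs are arguments so that the measure structure can be attached to the term
    [dens mw w0]. *)
Definition dens (_ : measurable_fun setT w) (_ : forall x, (0 <= w x)%R) (A : set T) : \bar R :=
  \int[mu]_x ((w x)%:E * (\1_A x : R)%:E).

Let m1 (A : set T) : measurable A -> measurable_fun setT (fun x => (w x)%:E * (\1_A x : R)%:E).
Proof.
move=> mA; apply: emeasurable_funM; first exact/measurable_EFinP.
exact: measurable_fun_indicE.
Qed.

Let p1 (A : set T) x : 0 <= (w x)%:E * (\1_A x : R)%:E.
Proof. by rewrite mule_ge0 // lee_fin. Qed.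

Let dens0 : dens mw w0 set0 = 0.
Proof. by rewrite /dens integral0_eq // => x _; rewrite indic0 mule0. Qed.

Let dens_ge0 A : 0 <= dens mw w0 A.
Proof. exact: integral_ge0. Qed.

Let dens_sigma : semi_sigma_additive (dens mw w0).
Proof.
move=> F mF tF mUF.
have -> : dens mw w0 (\bigcup_n F n) = \sum_(n <oo) dens mw w0 (F n).
  rewrite /dens -integral_nneseries //; last by move=> n; exact: m1.
  apply: eq_integral => x _; rewrite nneseriesZl; last by move=> n _; rewrite lee_fin.
  by congr (_ * _); rewrite indic_bigcup.
by apply: is_cvg_nneseries => n _ _; exact: dens_ge0.
Qed.

HB.instance Definition _ := isMeasure.Build _ _ _ (dens mw w0) dens0 dens_ge0 dens_sigma.

Import HBNNSimple.

Lemma integral_dens (f : T -> \bar R) : measurable_fun setT f -> (forall x, 0 <= f x) ->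
  \int[dens mw w0]_x f x = \int[mu]_x (f x * (w x)%:E).
Proof.
move=> mf f0; pose f_ := nnsfun_approx measurableT mf.
have mwE : measurable_fun setT (fun x => (w x)%:E) by exact/measurable_EFinP.
have lim_f x : (f_ n x)%:E @[n --> \oo] --> f x.
  by apply: cvg_nnsfun_approx => // y _; exact: f0.
have nd_f x : {homo (fun n => (f_ n x)%:E) : a b / (a <= b)%N >-> a <= b}.
  by move=> a b ab; rewrite lee_fin; exact/lefP/nd_nnsfun_approx.
have mf_ n : measurable_fun setT (fun x => (f_ n x)%:E).
  by apply/measurable_EFinP.
transitivity (limn (fun n => \int[dens mw w0]_x (f_ n x)%:E)).
  rewrite -monotone_convergence //; first by apply: eq_integral => x _; apply/esym/cvg_lim.
  by move=> n x _; rewrite lee_fin.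
transitivity (limn (fun n => \int[mu]_x ((f_ n x)%:E * (w x)%:E))); last first.
  rewrite -monotone_convergence //.
  - apply: eq_integral => x _; apply/cvg_lim => //.
    by apply: cvgeZr => //; exact: lim_f.
  - by move=> n; apply: emeasurable_funM.
  - by move=> n x _; rewrite mule_ge0 // lee_fin.
  - by move=> x _ a b ab; rewrite lee_wpmul2r ?lee_fin //; exact: nd_f.
congr (limn _); apply/funext => n.
transitivity (\int[dens mw w0]_x (\sum_(y \in range (f_ n)) (y * \1_(f_ n @^-1` [set y]) x)%:E)).
  by apply: eq_integral => t tE; rewrite /= fimfunE -fsumEFin.
have indich r : measurable_fun setT (fun x => (r * \1_(f_ n @^-1` [set r]) x)%:E).
  by apply/measurable_EFinP; apply: measurable_funM.
rewrite ge0_integral_fsum //; last by move=> y x _; exact: nnfun_muleindic_ge0.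
transitivity (\int[mu]_x (\sum_(y \in range (f_ n)) (y * \1_(f_ n @^-1` [set y]) x)%:E * (w x)%:E)); last first.
  apply: eq_integral => x _.
  rewrite -ge0_mule_fsuml => [|y]; last exact: nnfun_muleindic_ge0.
  by rewrite fsumEFin // -(fimfunE _ x).
rewrite ge0_integral_fsum //; last 2 first.
- by move=> y; apply: emeasurable_funM.
- by move=> y x _; rewrite mule_ge0 ?lee_fin //; exact: nnfun_muleindic_ge0.
apply: eq_fsbigr => r rn.
have r0 : (0 <= r)%R by move: rn; rewrite inE => -[x _ <-].
have mr : measurable (f_ n @^-1` [set r]) by [].
transitivity (r%:E * \int[dens mw w0]_x (\1_(f_ n @^-1` [set r]) x : R)%:E).
  rewrite -ge0_integralZl_EFin //; last exact: measurable_fun_indicE.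
rewrite integral_indic // setIT /dens -ge0_integralZl_EFin //; last exact: m1.
by apply: eq_integral => x _; rewrite EFinM -muleA [_%:E * (w x)%:E]muleC.
Qed.

End Density.

(** * Boxes, bisection and the change of variables formula *)

Section Cells.
Context {R : realType} {m : nat}.
Implicit Types (lo hi y : 'rV[R]_m).
Local Open Scope ereal_scope.

Definition cbox lo hi : set 'rV[R]_m :=
  [set y | forall a, (lo ord0 a <= y ord0 a <= hi ord0 a)%R].

Lemma box_cbox lo hi : box lo hi `<=` cbox lo hi.
Proof. by move=> y H a; have /andP[-> /ltW] := H a. Qed.

Lemma compact_cbox lo hi : compact (cbox lo hi).
Proof.
have -> : cbox lo hi = [set v | forall i, `[lo ord0 i, hi ord0 i]%classic (v ord0 i)].
  by apply/seteqP; split=> v H i; have := H i; rewrite /= in_itv.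
by apply: (@rV_compact _ _ (fun i => `[lo ord0 i, hi ord0 i]%classic)) => i; exact: segment_compact.
Qed.

Lemma box_setI lo hi lo' hi' : box lo hi `&` box lo' hi' =
  box (\row_a Num.max (lo ord0 a) (lo' ord0 a)) (\row_a Num.min (hi ord0 a) (hi' ord0 a)).
Proof.
apply/seteqP; split=> y.
  by move=> [H H'] a; rewrite !mxE ge_max lt_min; have /andP[-> ->] := H a; have /andP[-> ->] := H' a.
move=> H; split=> a; have := H a; rewrite !mxE ge_max lt_min.
  by move=> /andP[/andP[-> _] /andP[-> _]].
by move=> /andP[/andP[_ ->] /andP[_ ->]].
Qed.

(** Half-open boxes with rational corners. Their closures are required to lie in U because
    [bisection] needs local information at every point of the closed box. *)
Lemma open_box_cover (U : set 'rV[R]_m) : open U ->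
  exists (D : set nat) (lo hi : nat -> 'rV[R]_m),
    (forall k, D k -> cbox (lo k) (hi k) `<=` U) /\ U = \bigcup_(k in D) box (lo k) (hi k).
Proof.
move=> oU.
pose L (q : 'rV[rat]_m) : 'rV[R]_m := \row_a ratr (q ord0 a).
pose q_ (k : nat) : 'rV[rat]_m * 'rV[rat]_m := odflt (0, 0)%R (choice.unpickle k).
exists [set k | cbox (L (q_ k).1) (L (q_ k).2) `<=` U], (fun k => L (q_ k).1), (fun k => L (q_ k).2).
split=> //; apply/seteqP; split=> y; last by move=> [k /= kU /box_cbox /kU].
move=> Uy; have /nbhs_rV[r r0 Hr] : nbhs y U by exact: open_nbhs_nbhs.
have /choice[p Hp] (a : 'I_m) : exists p : rat, (y ord0 a - r / 2 < ratr p < y ord0 a)%R.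
  have [|p] := @rat_in_itvoo R (y ord0 a - r / 2)%R (y ord0 a); first by lra.
  by rewrite in_itv /= => ?; exists p.
have /choice[q Hq] (a : 'I_m) : exists q : rat, (y ord0 a < ratr q < y ord0 a + r / 2)%R.
  have [|q] := @rat_in_itvoo R (y ord0 a) (y ord0 a + r / 2)%R; first by lra.
  by rewrite in_itv /= => ?; exists q.
pose k := choice.pickle (\row_a p a, \row_a q a : 'rV[rat]_m).
have qk : q_ k = (\row_a p a, \row_a q a) by rewrite /q_ /k choice.pickleK.
exists k => [/=|a]; rewrite ?qk /L /= ?mxE.
  move=> z Hz; apply: Hr; apply: (@le_lt_trans _ _ (r / 2)%R); last by lra.
  apply: norm_le_coord => [|a]; first by lra.
  have := Hz a; have := Hp a; have := Hq a; rewrite !mxE => /andP[a1 a2] /andP[a3 a4] /andP[a5 a6].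
  by rewrite ler_norml; apply/andP; split; lra.
by have := Hp a; have := Hq a => /andP[-> _] /andP[_ /ltW ->].
Qed.

(** Boxes are stable under intersection and, by [open_box_cover], generate the Borel sets, so
    uniqueness of measures on a generating family applies. *)
Lemma measure_box_unique (mu nu : {measure set (borel 'rV[R]_m) -> \bar R}) :
  (forall lo hi, mu (box lo hi) = nu (box lo hi)) -> (forall lo hi, mu (box lo hi) < +oo) ->
  forall A, measurable (A : set (borel 'rV[R]_m)) -> mu A = nu A.
Proof.
move=> E fin A mA.
pose G : set (set (borel 'rV[R]_m)) := [set B | exists lo hi, B = box lo hi].
apply: (@measure_unique _ R (borel 'rV[R]_m) G (fun n => box (const_mx (- n%:R)%R) (const_mx n%:R))) => //.
- apply/seteqP; split; last first.
    apply: smallest_sub; first exact: sigma_algebra_measurable.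
    by move=> _ [lo [hi ->]]; exact: measurable_box.
  apply: smallest_sub; first exact: smallest_sigma_algebra.
  move=> U /open_box_cover[D [lo [hi [_ ->]]]]; rewrite bigcup_mkcond.
  have [_ _ GU] := smallest_sigma_algebra setT G; apply: GU => k.
  case: ifP => _; last by have [] := smallest_sigma_algebra setT G.
  by apply: sub_sigma_algebra; exists (lo k), (hi k).
- by move=> _ _ [lo [hi ->]] [lo' [hi' ->]]; rewrite box_setI; eexists; eexists.
- by move=> n; eexists; eexists.
- apply/seteqP; split=> // y _; have [n Hn] : exists n : nat, (`|y| < n%:R)%R.
    by exists (Num.bound `|y|); rewrite archi_boundP.
  exists n => // a; rewrite !mxE; have := coord_le_norm y a.
  by rewrite ler_norml => /andP[]; lra.
- by move=> _ [lo [hi ->]].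
Qed.

Definition mid lo hi : 'rV[R]_m := (2^-1 *: (lo + hi))%R.
Definition clo lo hi (s : {ffun 'I_m -> bool}) : 'rV[R]_m :=
  \row_a (if s a then mid lo hi ord0 a else lo ord0 a).
Definition chi lo hi (s : {ffun 'I_m -> bool}) : 'rV[R]_m :=
  \row_a (if s a then hi ord0 a else mid lo hi ord0 a).

Lemma child_size lo hi s : (chi lo hi s - clo lo hi s = 2^-1 *: (hi - lo))%R.
Proof. by apply/rowP => a; rewrite !mxE; case: (s a); lra. Qed.

Definition ordered lo hi := forall a, (lo ord0 a <= hi ord0 a)%R.

Lemma child_ordered lo hi s : ordered lo hi -> ordered (clo lo hi s) (chi lo hi s).
Proof. by move=> H a; have := H a; rewrite !mxE; case: (s a); lra. Qed.

Lemma child_cbox lo hi s : ordered lo hi -> cbox (clo lo hi s) (chi lo hi s) `<=` cbox lo hi.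
Proof.
by move=> H y Hy a; have := H a; have := Hy a; rewrite !mxE; case: (s a) => /andP[h1 h2] h3; apply/andP; split; lra.
Qed.

Lemma indic_children lo hi y : ordered lo hi ->
  (\1_(box lo hi) y = \sum_s \1_(box (clo lo hi s) (chi lo hi s)) y :> R)%R.
Proof.
move=> H; rewrite indicE.
have sub s : y \in box (clo lo hi s) (chi lo hi s) -> y \in box lo hi.
  move=> /set_mem Hy; apply/mem_set => a; have := H a; have := Hy a; rewrite !mxE.
  by case: (s a) => /andP[h1 h2] h3; apply/andP; split; lra.
have [/set_mem yB|yB] := boolP (y \in box lo hi); last first.
  rewrite big1 // => s _; rewrite indicE; case: (boolP (y \in _)) => // /sub.
  by rewrite (negPf yB).
pose sy := [ffun a => (mid lo hi ord0 a <= y ord0 a)%R].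
rewrite (bigD1 sy) //= indicE mem_set => [|a]; last first.
  have := yB a; have := H a; rewrite /clo /chi !mxE !ffunE.
  move=> h2 /andP[h3 h4]; case: (leP (mid lo hi ord0 a)) => h1;
  by apply/andP; split=> //; move: h1; rewrite !mxE; lra.
rewrite big1 ?addr0 // => s ssy; rewrite indicE; case: (boolP (y \in _)) => // /set_mem ys.
case/eqP: ssy; apply/ffunP => a; rewrite ffunE; have := ys a; rewrite /clo /chi !mxE.
by case: (s a) => /andP[h1 h2]; apply/esym; [apply/idP|apply/negbTE; rewrite -ltNge].
Qed.

Lemma measure_children (mu : {measure set (borel 'rV[R]_m) -> \bar R}) lo hi : ordered lo hi ->
  mu (box lo hi) = \sum_s mu (box (clo lo hi s) (chi lo hi s)).
Proof.
move=> H; have I A : measurable (A : set (borel 'rV[R]_m)) -> mu A = \int[mu]_y (\1_A y : R)%:E.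
  by move=> mA; rewrite integral_indic // setIT.
rewrite I; last exact: measurable_box.
under [RHS]eq_bigr => s _ do (rewrite I; last exact: measurable_box).
rewrite -ge0_integral_sum //.
- by apply: eq_integral => y _; rewrite indic_children // sumEFin.
- by move=> s; apply: measurable_fun_indicE; exact: measurable_box.
Qed.

(** Goursat's argument: if P failed, it would fail on a nested sequence of halved boxes shrinking to
    a point y of the closed box, near which it holds. The local hypothesis may assume that the small
    box is a scaled copy of the first one, which bounds its aspect ratio uniformly. *)
Lemma bisection (P : 'rV[R]_m -> 'rV[R]_m -> Prop) lo hi : ordered lo hi ->
  (forall l h, ordered l h -> (forall s, P (clo l h s) (chi l h s)) -> P l h) ->
  (forall y, cbox lo hi y -> exists2 d : R, (0 < d)%R &
     forall k l h, (h - l = 2^-1 ^+ k *: (hi - lo))%R -> ordered l h -> cbox l h y ->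
       cbox l h `<=` cbox lo hi -> (`|h - l| < d)%R -> P l h) ->
  P lo hi.
Proof.
move=> Hlh H1 H2; apply: contrapT => nP.
pose bad (p : 'rV[R]_m * 'rV[R]_m) := ordered p.1 p.2 /\ ~ P p.1 p.2.
have /choice[nx Hnx] p : exists s, bad p -> bad (clo p.1 p.2 s, chi p.1 p.2 s).
  have [bp|nb] := pselect (bad p); last by exists [ffun=> true].
  have [s ns] : exists s, ~ P (clo p.1 p.2 s) (chi p.1 p.2 s).
    by apply/existsNP => nn; case: bp => o np; apply: np; exact: H1.
  by exists s => _; split=> //=; apply: child_ordered; case: bp.
pose q := fix q k := if k is k'.+1 then (clo (q k').1 (q k').2 (nx (q k')), chi (q k').1 (q k').2 (nx (q k')))
   else (lo, hi).
have badq k : bad (q k).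
  by elim: k => [|k IH] //; exact: Hnx.
have oq k : ordered (q k).1 (q k).2 by case: (badq k).
have size k : ((q k).2 - (q k).1 = 2^-1 ^+ k *: (hi - lo))%R.
  elim: k => [|k IH]; first by rewrite expr0 scale1r.
  by rewrite /= child_size IH scalerA exprS.
have subq k j : cbox (q (k + j)%N).1 (q (k + j)%N).2 `<=` cbox (q k).1 (q k).2.
  elim: j => [|j IH]; first by rewrite addn0.
  rewrite addnS; apply: subset_trans IH; by apply: child_cbox; exact: oq.
have loq k : cbox (q k).1 (q k).2 (q k).1.
  by move=> a; rewrite lexx; exact: oq.
have le_q j k a : ((q j).1 ord0 a <= (q k).2 ord0 a)%R.
  have [jk|/ltnW kj] := leqP j k.
    have := subq j (k - j)%N; rewrite subnKC // => /(_ _ (loq k)) /(_ a) /andP[h _].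
    by apply: (le_trans h); exact: oq.
  by have := subq k (j - k)%N; rewrite subnKC // => /(_ _ (loq j)) /(_ a) /andP[].
pose y : 'rV[R]_m := \row_a sup (range (fun k => (q k).1 ord0 a)).
have hs a : has_sup (range (fun k => (q k).1 ord0 a)).
  by split; [exists ((q 0%N).1 ord0 a); exists 0%N|exists (hi ord0 a) => _ [k _ <-]; exact: (le_q k 0%N)].
have yq k : cbox (q k).1 (q k).2 y.
  move=> a; rewrite mxE; apply/andP; split.
    by apply: sup_ubound; [case: (hs a)|exists k].
  by apply: sup_le_ub; [case: (hs a)|move=> _ [j _ <-]; exact: le_q].
have [d d0 Hd] := H2 y (yq 0%N).
have [k Hk] : exists k, (`|2^-1 ^+ k *: (hi - lo)| < d)%R.
  have c : ((2^-1 : R) ^+ k * `|hi - lo| @[k --> \oo] --> (0 : R))%R.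
    rewrite -[X in _ --> X](mul0r (`|hi - lo|)%R); apply: cvgMl; apply: cvg_expr.
    by rewrite ger0_norm; lra.
  have /cvgrPdist_lt/(_ _ d0) [k _ Hk] := c.
  exists k; have := Hk k (leqnn k).
  by rewrite normrZ sub0r normrN normrM normr_id.
have [_ nPq] := badq k; apply: nPq; apply: (Hd k) => //; last by rewrite size.
by have := subq 0%N k.
Qed.

End Cells.

Section Jacobian.
Context {R : realType} {m : nat}.
Local Open Scope ereal_scope.

Lemma differentiable_approx_rV k (H : 'rV[R]_m -> 'rV[R]_k) y : differentiable H y ->
  forall e : R, (0 < e)%R -> exists2 r : R, (0 < r)%R &
    forall q, (`|q - y| < r)%R -> (`|H q - H y - 'd H y (q - y)| <= e * `|q - y|)%R.
Proof.
move=> /diff_locallyP[_ /eqaddoP E] e /E /nbhs_rV[r r0 Hr].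
exists r => // z zr; have /= := Hr (z - y)%R; rewrite subr0 => /(_ zr).
rewrite -[(H \o _ - _)%R (z - y)%R]/(H (z - y + y) - (H y + 'd H y (z - y)))%R.
by rewrite subrK opprD addrA.
Qed.

Lemma diff_jacobian k (H : 'rV[R]_m -> 'rV[R]_k) y v : 'd H y v = (v *m 'J H y)%R.
Proof. by rewrite /jacobian mul_rV_lin1. Qed.

Lemma jacobian_inverse (V : set 'rV[R]_m) (F G : 'rV[R]_m -> 'rV[R]_m) y : open V -> V y ->
  (forall q, V q -> G (F q) = q) -> differentiable F y -> differentiable G (F y) ->
  ('J F y *m 'J G (F y) = 1%:M)%R.
Proof.
move=> oV Vy FK dF dG; have dGF : differentiable (G \o F) y by exact: differentiable_comp.
have E (v : 'rV[R]_m) : (v *m ('J F y *m 'J G (F y)) = v)%R.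
  have -> : (v *m ('J F y *m 'J G (F y)) = 'd G (F y) ('d F y v))%R by rewrite !diff_jacobian mulmxA.
  have /(congr1 (@^~ v)) /= <- := diff_comp dF dG.
  rewrite -deriveE //.
  have := derive_id y v.
  move=> {2}<-.
  apply: near_eq_derive.
  by apply: (near_eq_open oV Vy) => q; rewrite inE => /FK.
by apply/row_matrixP => a; rewrite rowE E rowE mulmx1.
Qed.

Lemma mulmx_bound k l (B : 'M[R]_(k, l)) : exists2 C : R, (0 < C)%R &
  forall v : 'rV[R]_k, (`|v *m B| <= C * `|v|)%R.
Proof.
exists (1 + \sum_a \sum_b `|B b a|)%R; first by rewrite ltr_wpDr // sumr_ge0 // => a _; rewrite sumr_ge0.
move=> v; apply: norm_le_coord => [|a]; first by rewrite mulr_ge0 // addr_ge0 // sumr_ge0 // => b _; rewrite sumr_ge0.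
have -> : ((v *m B) ord0 a = linform (\row_b B b a) v)%R.
  by rewrite mxE; apply: eq_bigr => b _; rewrite mxE mulrC.
apply: (le_trans (linform_bound _ _)); rewrite ler_wpM2r //.
rewrite (bigD1 a) //=; under eq_bigr do rewrite mxE.
by rewrite addrCA lerDl addr_ge0 // sumr_ge0 // => b _; rewrite sumr_ge0.
Qed.

End Jacobian.

Section CellEstimates.
Context {R : realType} {m : nat}.
Local Open Scope ereal_scope.

(** Negative t shrinks the box; both signs occur, for the outer and the inner estimate of an
    image. *)
Definition grow (lo hi : 'rV[R]_m) (t : R) := box (lo - t *: (hi - lo))%R (hi + t *: (hi - lo))%R.

Lemma growP (lo hi q : 'rV[R]_m) (t : R) : grow lo hi t q -> forall a,
  (lo ord0 a - t * (hi ord0 a - lo ord0 a) <= q ord0 a < hi ord0 a + t * (hi ord0 a - lo ord0 a))%R.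
Proof. by move=> H a; have := H a; rewrite !mxE. Qed.

Lemma leb_grow (lo hi : 'rV[R]_m) (t : R) : ordered lo hi -> (0 <= 1 + 2 * t)%R ->
  leb m (grow lo hi t) = ((1 + 2 * t) ^+ m * \prod_a (hi ord0 a - lo ord0 a))%:E.
Proof.
move=> o t0; rewrite leb_box => [|a]; last by have := o a; rewrite !mxE; nra.
congr EFin; rewrite -[m in (_ ^+ m)%R]card_ord -prodr_const -big_split /=.
by apply: eq_bigr => a _; rewrite !mxE; ring.
Qed.

Definition aspect (rho : R) (lo hi : 'rV[R]_m) := forall a, (rho * `|hi - lo| <= hi ord0 a - lo ord0 a)%R.

Lemma dist_cbox (lo hi p q : 'rV[R]_m) : cbox lo hi p -> cbox lo hi q -> (`|p - q| <= `|hi - lo|)%R.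
Proof.
move=> Hp Hq; apply: norm_le_coord => // a; apply: le_trans (coord_le_norm _ a).
have /andP[p1 p2] := Hp a; have /andP[q1 q2] := Hq a; rewrite !mxE.
by rewrite [leRHS]ger0_norm; [rewrite ler_norml; apply/andP; split|]; lra.
Qed.

Definition pr (lo hi : 'rV[R]_m) : R := (\prod_a (hi ord0 a - lo ord0 a))%R.

(** At t = 0 both polynomial expressions equal c * D, so continuity leaves room for e on either
    side. *)
Lemma small_parameter (c D e : R) : (0 <= c)%R -> (0 < e)%R -> (0 <= D)%R -> exists2 t : R, (0 < t < 2^-1)%R &
  [/\ ((c + t) * D * (1 + 2 * t) ^+ m <= c * D + e)%R & (c * D - e <= (c - t) * D * (1 - 2 * t) ^+ m)%R].
Proof.
move=> c0 e0 D0.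
have cf (s : R) : ((c + s * t) * D * (1 + 2 * (s * t)) ^+ m @[t --> (0 : R)] --> c * D)%R.
  have -> : (c * D = (c + s * 0) * D * (1 + 2 * (s * 0)) ^+ m)%R.
    by rewrite mulr0 mulr0 !addr0 expr1n mulr1.
  apply: (@continuous_comp _ _ _ (fun t => (c + s * t) * D * (1 + 2 * (s * t)) ^+ m)%R id) => //.
  pose p : {poly R} := ((c%:P + s *: 'X) * D%:P * (1 + (2 * s) *: 'X) ^+ m)%R.
  have -> : (fun t => (c + s * t) * D * (1 + 2 * (s * t)) ^+ m)%R = horner p.
    by apply/funext => t; rewrite /p !(hornerM, horner_exp, hornerD, hornerZ, hornerC, hornerX) -[(2 * s * t)%R]mulrA.
  exact: continuous_horner.
have /cvgrPdist_lt/(_ _ e0) N1 := cf 1%R.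
have /cvgrPdist_lt/(_ _ e0) N2 := cf (-1)%R.
pose P (s t : R) := (`|c * D - (c + s * t) * D * (1 + 2 * (s * t)) ^+ m| < e)%R.
have /nbhs_ballP[d /= d0 Hd] : nbhs (0 : R)%R (P 1%R `&` P (-1)%R).
  by apply: filterI; [exact: N1|exact: N2].
exists (Num.min (d / 2) 4^-1)%R.
  rewrite lt_min divr_gt0 //= invr_gt0 ltr0n /=.
  by apply: (@le_lt_trans _ _ 4^-1%R); [rewrite ge_min lexx orbT|lra].
set t := Num.min _ _; have [h1 h2] : (0 < t /\ t < d)%R.
  split; first by rewrite lt_min divr_gt0 //= invr_gt0 ltr0n.
  by apply: (@le_lt_trans _ _ (d / 2)%R); [rewrite ge_min lexx|lra].
have [] := Hd t; first by rewrite /ball /= sub0r normrN gtr0_norm.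
rewrite /P mul1r mulN1r mulrN !ltr_norml => /andP[a1 a2] /andP[a3 a4].
by split; lra.
Qed.

End CellEstimates.

Section ChangeOfVariables.
Context {R : realType} {m : nat}.
Variables (V W : set 'rV[R]_m) (F G : 'rV[R]_m -> 'rV[R]_m) (w1 w2 : 'rV[R]_m -> R).
Hypotheses (oV : open V) (oW : open W).
Hypotheses (FV : forall y, V y -> W (F y)) (GW : forall z, W z -> V (G z)).
Hypotheses (GK : forall z, W z -> F (G z) = z).
Variables (A B : 'rV[R]_m -> 'M[R]_m).
Hypothesis AB : forall y, V y -> A y *m B y = 1%:M.
Hypothesis dF : forall y, V y -> forall e : R, 0 < e -> exists2 r : R, 0 < r &
  forall q, `|q - y| < r -> `|F q - F y - (q - y) *m A y| <= e * `|q - y|.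
Hypothesis dG : forall y, V y -> forall e : R, 0 < e -> exists2 r : R, 0 < r &
  forall z, `|z - F y| < r -> `|G z - y - (z - F y) *m B y| <= e * `|z - F y|.
Hypothesis cG : forall z, W z -> {for z, continuous G}.
Hypotheses (cw1 : forall z, W z -> {for z, continuous w1}) (cw2 : forall y, V y -> {for y, continuous w2}).
Hypotheses (w1_ge0 : forall z, W z -> 0 <= w1 z) (w2_ge0 : forall y, V y -> 0 <= w2 y).
Hypothesis w12 : forall y, V y -> w2 y = w1 (F y) * `|\det (A y)|.

Let u1 z : R := if `[< W z >] then w1 z else 0.
Let u2 y : R := if `[< V y >] then w2 y else 0.
(** Extended by zero off W to be measurable on the whole space; the density [u1] vanishes there. *)
Let G' z : 'rV[R]_m := \row_a (if `[< W z >] then G z ord0 a else 0).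

Let mu1 : measurable_fun setT (u1 : borel 'rV[R]_m -> measurableTypeR R).
Proof. exact: within_continuous_borel. Qed.
Let mu2 : measurable_fun setT (u2 : borel 'rV[R]_m -> measurableTypeR R).
Proof. exact: within_continuous_borel. Qed.
Let u1_ge0 z : 0 <= u1 z.
Proof. by rewrite /u1; case: asboolP => // /w1_ge0. Qed.
Let u2_ge0 z : 0 <= u2 z.
Proof. by rewrite /u2; case: asboolP => // /w2_ge0. Qed.

Let G'E z : W z -> G' z = G z.
Proof. by move=> Wz; apply/rowP => a; rewrite mxE asboolT. Qed.

Let mG' : measurable_fun setT (G' : borel 'rV[R]_m -> borel 'rV[R]_m).
Proof.
apply: measurable_rV => a; under eq_fun do rewrite mxE.
apply: (@within_continuous_borel R _ W (fun z => G z ord0 a)) => // z Wz.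
apply: (@continuous_comp _ _ _ G (fun v => v ord0 a)); last exact: coord_continuous.
exact: cG.
Qed.

(** The formula to be proved says that two measures agree: the density w1 on W transported to V by
    G, and the density w2 on V. They are compared on small boxes, where G is nearly affine, and the
    errors, proportional to volume, are added up by bisection. *)
Let nu1 := pushm (dens (leb m) mu1 u1_ge0) mG'.
Let nu2 := dens (leb m) mu2 u2_ge0.

Local Open Scope ereal_scope.

Let nu1E (E : set 'rV[R]_m) :
  nu1 E = \int[leb m]_z ((u1 z)%:E * (\1_(G' @^-1` E) z : R)%:E).
Proof. by []. Qed.

Let affine_vol (y : 'rV[R]_m) (E : set 'rV[R]_m) : V y -> measurable (E : set (borel 'rV[R]_m)) ->
  \int[leb m]_z (\1_E (y + (z - F y) *m B y)%R : R)%:E = `|\det (A y)|%:E * leb m E.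
Proof.
move=> Vy mE; have := congr1 determinant (AB Vy); rewrite det_mulmx det1 => dd.
have dG0 : (\det (B y) != 0)%R by apply/eqP => d0; move: dd; rewrite d0 mulr0 => /eqP; rewrite eq_sym oner_eq0.
have := @integral_linear R m (B y) (y - F y *m B y)%R (fun z => (\1_E z : R)%:E) dG0.
move=> H; rewrite leb_indic // -[X in _ = X * _]/((`|\det (A y)|)%:E).
have -> : (`|\det (A y)| = `|\det (B y)|^-1)%R.
  by apply: (@mulIf _ `|\det (B y)|%R); rewrite ?normr_eq0 // mulVf ?normr_eq0 // -normrM dd normr1.
rewrite -H //; last exact: measurable_fun_indicE.
by apply: eq_integral => z _; rewrite mulmxBl addrCA.
Qed.

Let local2 y (e : R) : V y -> (0 < e)%R -> exists2 d : R, (0 < d)%R & forall lo hi,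
  ordered lo hi -> cbox lo hi y -> (`|hi - lo| < d)%R ->
  nu2 (box lo hi) <= (w2 y + e)%:E * (pr lo hi)%:E /\
  (w2 y)%:E * (pr lo hi)%:E <= nu2 (box lo hi) + e%:E * (pr lo hi)%:E.
Proof.
move=> Vy e0; have /continuous_rVP/(_ _ e0) [r1 r10 H1] := cw2 Vy.
have [r2 r20 H2] : exists2 r : R, (0 < r)%R & forall z, (`|z - y| < r)%R -> V z.
  by apply/nbhs_rV; exact: open_nbhs_nbhs.
exists (Num.min r1 r2) => [|lo hi o cy]; first by rewrite lt_min r10.
rewrite lt_min => /andP[d1 d2].
have u2E q : box lo hi q -> V q /\ (`|u2 q - w2 y| < e)%R.
  move=> /box_cbox cq; have qy := dist_cbox cq cy.
  have Vq : V q by apply: H2; exact: le_lt_trans d2.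
  by split=> //; rewrite /u2 asboolT //; apply: H1; exact: le_lt_trans d1.
have mi : measurable_fun setT ((fun q => (\1_(box lo hi) q : R)%:E) : borel 'rV[R]_m -> \bar R).
  by apply: measurable_fun_indicE; exact: measurable_box.
have mu : measurable_fun setT ((fun q => (u2 q)%:E * (\1_(box lo hi) q : R)%:E) : borel 'rV[R]_m -> \bar R).
  by apply: emeasurable_funM => //; exact/measurable_EFinP.
have I (c : R) : (0 <= c)%R -> c%:E * (pr lo hi)%:E = \int[leb m]_q (c%:E * (\1_(box lo hi) q : R)%:E).
  move=> c0; rewrite ge0_integralZl_EFin // -leb_indic; last exact: measurable_box.
  by rewrite leb_box.
have c0 := w2_ge0 Vy; have e0' := ltW e0.
rewrite !I ?addr_ge0 //; split.
  rewrite /nu2 /dens; apply: ge0_le_integral => //.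
  - by move=> q _; rewrite mule_ge0 // lee_fin.
  - by apply: emeasurable_funM.
  - move=> q _; rewrite indicE; have [/set_mem Qq|_] := boolP (q \in box lo hi); last by rewrite !mule0.
    by rewrite !mule1 lee_fin; have [_] := u2E q Qq; rewrite ltr_norml => /andP[]; lra.
rewrite /nu2 /dens -ge0_integralD //; last 3 first.
- by move=> q _; rewrite mule_ge0 // lee_fin.
- by move=> q _; rewrite mule_ge0 // lee_fin.
- by apply: emeasurable_funM.
apply: ge0_le_integral => //.
- by move=> q _; rewrite mule_ge0 // lee_fin.
- by apply: emeasurable_funM.
- by apply: emeasurable_funD => //; apply: emeasurable_funM.
- move=> q _; rewrite indicE; have [/set_mem Qq|_] := boolP (q \in box lo hi); last by rewrite !mule0 adde0.
  by rewrite !mule1 -EFinD lee_fin; have [_] := u2E q Qq; rewrite ltr_norml => /andP[]; lra.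
Qed.

(** Near y the map G is compared with its affine approximation [psi]. If G z lies in the box, then
    psi z lies in the box grown by t; if psi z lies in the box shrunk by t, then G z lies in the
    box. The error |G z - psi z| is controlled by the longest side but must stay below t times every
    side, hence the aspect bound [rho]. *)
Let local1 y (e rho : R) : V y -> (0 < e)%R -> (0 < rho)%R -> exists2 d : R, (0 < d)%R & forall lo hi,
  ordered lo hi -> cbox lo hi y -> (`|hi - lo| < d)%R -> aspect rho lo hi ->
  nu1 (box lo hi) <= (w2 y + e)%:E * (pr lo hi)%:E /\
  (w2 y)%:E * (pr lo hi)%:E <= nu1 (box lo hi) + e%:E * (pr lo hi)%:E.
Proof.
move=> Vy e0 rho0; have WF := FV Vy.
pose D : R := (`|\det (A y)|)%R; pose c := w1 (F y).
have D0 : (0 <= D)%R by exact: normr_ge0.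
have [t /andP[t0 t2] [ht1 ht2]] := @small_parameter R m c D e (w1_ge0 WF) e0 D0.
have [CA CA0 HA] := mulmx_bound (A y); have [CB CB0 HB] := mulmx_bound (B y).
have tr0 : (0 < t * rho)%R by rewrite mulr_gt0.
have [rF rF0 HF] := dF Vy (divr_gt0 tr0 CB0).
have [rG rG0 HG] := dG Vy (divr_gt0 tr0 CA0).
have [rw rw0 Hw] : exists2 r : R, (0 < r)%R & forall z, (`|z - F y| < r)%R -> W z /\ (`|w1 z - c| < t)%R.
  apply/nbhs_rV; apply: filterI; first exact: open_nbhs_nbhs.
  by have /continuous_rVP/(_ _ t0) Hc := cw1 WF; apply/nbhs_rV.
pose K : R := (CA + t * rho / CB)%R.
have K0 : (0 < K)%R by rewrite addr_gt0 // divr_gt0.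
have AB1 := AB Vy; have BA := mulmx1C AB1.
exists (Num.min rF (Num.min rG rw / K))%R => [|lo hi o cy]; first by rewrite lt_min rF0 divr_gt0 // lt_min rG0.
rewrite lt_min ltr_pdivlMr // lt_min => /andP[d1 /andP[d2 d3]] asp.
pose psi z := (y + (z - F y) *m B y)%R.
have tasp a : (t * rho * `|hi - lo| <= t * (hi ord0 a - lo ord0 a))%R.
  by rewrite -mulrA ler_wpM2l ?asp // ltW.
have up z : W z -> box lo hi (G z) -> grow lo hi t (psi z) /\ (w1 z <= c + t)%R.
  move=> Wz Qz; have qy := dist_cbox (box_cbox Qz) cy.
  have E := HF _ (le_lt_trans qy d1); rewrite GK // in E.
  have zF : (`|z - F y| <= K * `|hi - lo|)%R.
    have -> : (z - F y = (z - F y - (G z - y) *m A y) + (G z - y) *m A y)%R by rewrite subrK.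
    apply: (le_trans (ler_normD _ _)); rewrite /K mulrDl addrC.
    apply: lerD; first by apply: (le_trans (HA _)); rewrite ler_wpM2l // ltW.
    apply: (le_trans E); rewrite ler_wpM2l // divr_ge0 // ltW //.
  have [_ wz] := Hw z (le_lt_trans zF (eq_ind _ (fun x => (x < rw)%R) d3 _ (mulrC _ _))).
  split; last by move: wz; rewrite ltr_norml => /andP[_ h]; lra.
  have Ep : (psi z - G z = (z - F y - (G z - y) *m A y) *m B y)%R.
    rewrite mulmxBl -mulmxA AB1 mulmx1 /psi opprB.
    by rewrite [(y + _)%R]addrC -addrA.
  have np : (`|psi z - G z| <= t * rho * `|hi - lo|)%R.
    rewrite Ep; apply: (le_trans (HB _)); rewrite mulrC -ler_pdivlMr //.
    apply: (le_trans E); rewrite mulrAC ler_wpM2r ?ler_wpM2l ?invr_ge0 //; exact: ltW.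
  move=> a; have := le_trans (le_trans (coord_le_norm _ a) np) (tasp a).
  have := Qz a; rewrite [(psi z - G z)%R ord0 a]mxE [(- G z)%R ord0 a]mxE ler_norml !mxE.
  by move=> /andP[h1 h2] /andP[h3 h4]; apply/andP; split; lra.
have low z : grow lo hi (- t) (psi z) -> [/\ W z, box lo hi (G z) & (c - t <= w1 z)%R].
  move=> gz; have cp : cbox lo hi (psi z).
    by move=> a; have := o a; have := growP gz a => /[swap] h0 /andP[h1 h2]; apply/andP; split; nra.
  have py := dist_cbox cp cy.
  have Ez : (z - F y = (psi z - y) *m A y)%R.
    have -> : (psi z - y = (z - F y) *m B y)%R by rewrite /psi addrAC subrr add0r.
    by rewrite -mulmxA BA mulmx1.
  have zF : (`|z - F y| <= CA * `|hi - lo|)%R.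
    by rewrite Ez; apply: (le_trans (HA _)); rewrite ler_wpM2l // ltW.
  have CK : (CA * `|hi - lo| <= `|hi - lo| * K)%R.
    by rewrite mulrC ler_wpM2l // /K lerDl divr_ge0 // ltW.
  have [Wz wz] := Hw z (le_lt_trans (le_trans zF CK) d3).
  have E := HG z (le_lt_trans (le_trans zF CK) d2).
  split=> //; last by move: wz; rewrite ltr_norml => /andP[h _]; lra.
  have Ep : (G z - y - (z - F y) *m B y = G z - psi z)%R.
    by rewrite /psi opprD addrA.
  have np : (`|G z - psi z| <= t * rho * `|hi - lo|)%R.
    rewrite -Ep; apply: (le_trans E); apply: (@le_trans _ _ (t * rho / CA * (CA * `|hi - lo|))%R).
      by rewrite ler_wpM2l // divr_ge0 // ltW.
    by rewrite mulrA divfK // gt_eqF.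
  move=> a; have := le_trans (le_trans (coord_le_norm _ a) np) (tasp a).
  have := growP gz a; rewrite [(G z - psi z)%R ord0 a]mxE [(- psi z)%R ord0 a]mxE ler_norml.
  by move=> /andP[h1 h2] /andP[h3 h4]; apply/andP; split; lra.
have mpsi (E : set 'rV[R]_m) : measurable (E : set (borel 'rV[R]_m)) ->
    measurable_fun setT ((fun z => (\1_E (psi z) : R)%:E) : borel 'rV[R]_m -> \bar R).
  move=> mE; apply: (measurableT_comp (measurable_fun_indicE mE)).
  have -> : psi = (fun z => z *m B y + (y - F y *m B y))%R.
    by apply/funext => z; rewrite /psi mulmxBl addrCA.
  exact: measurable_affine.
have mgrow s : measurable (grow lo hi s : set (borel 'rV[R]_m)) by exact: measurable_box.
have mI : measurable_fun setT ((fun z => (u1 z)%:E * (\1_(G' @^-1` (box lo hi)) z : R)%:E) : borel 'rV[R]_m -> \bar R).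
  apply: emeasurable_funM; first exact/measurable_EFinP.
  apply: measurable_fun_indicE; rewrite -[X in measurable X]setTI; apply: mG' => //; exact: measurable_box.
have c0 : (0 <= c)%R by exact: w1_ge0.
have pr0 : (0 <= pr lo hi)%R by apply: prodr_ge0 => a _; rewrite subr_ge0.
have IG (k s : R) : (0 <= k)%R -> (0 <= 1 + 2 * s)%R ->
    \int[leb m]_z (k%:E * (\1_(grow lo hi s) (psi z) : R)%:E) = (k * D * (1 + 2 * s) ^+ m * pr lo hi)%:E.
  move=> k0 s0; rewrite ge0_integralZl_EFin //; last exact: mpsi.
  by rewrite affine_vol // leb_grow // -!EFinM -!mulrA.
rewrite nu1E (w12 Vy) -/c -/D; split.
  apply: (@le_trans _ _ ((c + t) * D * (1 + 2 * t) ^+ m * pr lo hi)%:E); last first.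
    by rewrite -EFinM lee_fin ler_wpM2r.
  rewrite -IG ?addr_ge0 ?mulr_ge0 ?(ltW t0) //; apply: ge0_le_integral => //.
  - by move=> z _; rewrite mule_ge0 // lee_fin.
  - by apply: emeasurable_funM => //; exact: mpsi.
  - move=> z _; rewrite [\1_(G' @^-1` _) z]indicE; have [/set_mem Qz|_] := boolP (z \in _); last first.
      by rewrite mule0 mule_ge0 // lee_fin // addr_ge0 // ltW.
    rewrite mule1 /u1; case: asboolP => Wz; last by rewrite mule_ge0 // lee_fin // addr_ge0 // ltW.
    have Qz' : box lo hi (G z) by rewrite -(G'E Wz).
    have [gz wz] := up z Wz Qz'.
    by rewrite indicE mem_set // mule1 lee_fin.
(* If c <= t, then c - t cannot serve as a nonnegative density; but in that case [ht2] gives c * D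
   <= e and the lower bound is immediate. *)
have [ct|ct] := leP c t.
  apply: (@le_trans _ _ (e%:E * (pr lo hi)%:E)); last by rewrite leeDr // integral_ge0 // => z _; rewrite mule_ge0 // lee_fin.
  rewrite -!EFinM lee_fin ler_wpM2r //.
  have : ((c - t) * D * (1 - 2 * t) ^+ m <= 0)%R.
    rewrite -mulrA; apply: mulr_le0_ge0; first by rewrite subr_le0.
    by rewrite mulr_ge0 // exprn_ge0 //; lra.
  by lra.
apply: (@le_trans _ _ (((c - t) * D * (1 + 2 * (- t)) ^+ m * pr lo hi)%:E + e%:E * (pr lo hi)%:E)).
  rewrite -!EFinM -EFinD lee_fin -mulrDl ler_wpM2r // mulrN; lra.
apply: leeD => //; rewrite -IG; [|lra|lra]; apply: ge0_le_integral => //.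
- by move=> z _; rewrite mule_ge0 // lee_fin //; lra.
- by apply: emeasurable_funM => //; exact: mpsi.
- move=> z _; rewrite [\1_(grow _ _ _) _]indicE; have [/set_mem /low[Wz Qz wz]|_] := boolP (psi z \in _); last first.
    by rewrite mule0 mule_ge0 // lee_fin.
  rewrite indicE mem_set ?mule1; last by rewrite /preimage /= G'E.
  by rewrite lee_fin /u1 asboolT.
Qed.

Let nu10 : nu1 set0 = 0.
Proof. exact: measure0. Qed.
Let nu20 : nu2 set0 = 0.
Proof. exact: measure0. Qed.

Let box_close (e : R) (lo hi : 'rV[R]_m) : (0 < e)%R -> (forall a, lo ord0 a < hi ord0 a)%R -> cbox lo hi `<=` V ->
  [/\ nu1 (box lo hi) <= nu2 (box lo hi) + (2 * e)%:E * leb m (box lo hi),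
      nu2 (box lo hi) <= nu1 (box lo hi) + (2 * e)%:E * leb m (box lo hi) & nu2 (box lo hi) < +oo].
Proof.
move=> e0 lh sV; pose N : R := (`|hi - lo|)%R.
(* 1/S bounds from below the ratio of any side to the longest one. Halving preserves it, so [local1]
   can be used with one constant at all scales. *)
pose S : R := (1 + \sum_a N / (hi ord0 a - lo ord0 a))%R.
have t0 a : (0 <= N / (hi ord0 a - lo ord0 a))%R by rewrite divr_ge0 ?normr_ge0 // subr_ge0 ltW.
have S0 : (0 < S)%R by rewrite ltr_wpDr // sumr_ge0.
have asp a : (S^-1 * N <= hi ord0 a - lo ord0 a)%R.
  rewrite mulrC ler_pdivrMr // mulrC -ler_pdivrMr ?subr_gt0 //.
  by rewrite /S (bigD1 a) //= addrCA lerDl addr_ge0 // sumr_ge0.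
have o : ordered lo hi by move=> a; exact: ltW.
pose P l h := [/\ nu1 (box l h) <= nu2 (box l h) + (2 * e)%:E * leb m (box l h),
      nu2 (box l h) <= nu1 (box l h) + (2 * e)%:E * leb m (box l h) & nu2 (box l h) < +oo].
apply: (@bisection R m P lo hi o).
  move=> l h olh HP; rewrite /P (measure_children (leb m) olh).
  have -> : nu1 (box l h) = \sum_s nu1 (box (clo l h s) (chi l h s)) := measure_children nu1 olh.
  have -> : nu2 (box l h) = \sum_s nu2 (box (clo l h s) (chi l h s)) := measure_children nu2 olh.
  have c0 : 0 <= (2 * e)%:E :> \bar R by rewrite lee_fin mulr_ge0 // ltW.
  rewrite ge0_sume_distrr; last by move=> s _; exact: measure_ge0.
  split.
  - by rewrite -big_split; apply: lee_sum => s _; case: (HP s).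
  - by rewrite -big_split; apply: lee_sum => s _; case: (HP s).
  - by apply: lte_sum_pinfty => s _; case: (HP s).
move=> y /sV Vy; have Si0 : (0 < S^-1)%R by rewrite invr_gt0.
have [d1 d10 H1] := local1 Vy e0 Si0; have [d2 d20 H2] := local2 Vy e0.
exists (Num.min d1 d2) => [|k l h E olh cy _]; first by rewrite lt_min d10.
rewrite lt_min => /andP[l1 l2].
have alh : aspect S^-1 l h.
  move=> a; have := asp a; have -> : (h ord0 a - l ord0 a = 2^-1 ^+ k * (hi ord0 a - lo ord0 a))%R.
    by have := congr1 (fun v : 'rV[R]_m => v ord0 a) E; rewrite !mxE.
  rewrite E normrZ ger0_norm ?exprn_ge0 ?invr_ge0 // => ha.
  by rewrite mulrCA ler_wpM2l // exprn_ge0 // invr_ge0.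
have [a1 a2] := H1 l h olh cy l1 alh; have [b1 b2] := H2 l h olh cy l2.
have pr0 : (0 <= pr l h)%R by apply: prodr_ge0 => a _; rewrite subr_ge0.
rewrite /P leb_box // -/(pr l h) mulr_natl mulr2n EFinD muleDl //.
have D : (w2 y + e)%:E * (pr l h)%:E = (w2 y)%:E * (pr l h)%:E + e%:E * (pr l h)%:E.
  by rewrite EFinD muleDl.
rewrite !addeA; split.
- by apply: (le_trans a1); rewrite D; apply: leeD.
- by apply: (le_trans b1); rewrite D; apply: leeD.
- by apply: (le_lt_trans b1); rewrite -EFinM ltry.
Qed.

Let box_eq (lo hi : 'rV[R]_m) : cbox lo hi `<=` V -> nu1 (box lo hi) = nu2 (box lo hi) /\ nu2 (box lo hi) < +oo.
Proof.
move=> sV; have [lh|] := pselect (forall a, lo ord0 a < hi ord0 a)%R; last first.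
  move=> /existsNP[a /negP]; rewrite -leNgt => ha.
  have -> : box lo hi = set0.
    by apply/seteqP; split=> // y /(_ a) /andP[h1 h2]; have := le_lt_trans h1 (lt_le_trans h2 ha); rewrite ltxx.
  by rewrite nu10 nu20.
have o : ordered lo hi by move=> a; exact: ltW.
have pr0 : (0 <= pr lo hi)%R by apply: prodr_ge0 => a _; rewrite subr_ge0.
have [_ _ fin] := box_close ltr01 lh sV; split => //.
have H (x z : \bar R) : (forall e : R, (0 < e)%R -> x <= z + (2 * e)%:E * leb m (box lo hi)) -> x <= z.
  move=> h; apply/lee_addgt0Pr => e e0; have q0 : (0 < pr lo hi + 1)%R by rewrite ltr_wpDl.
  have e2 : (0 < e / (2 * (pr lo hi + 1)))%R by rewrite divr_gt0 // mulr_gt0.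
  apply: (le_trans (h _ e2)); apply: leeD => //; rewrite leb_box // -/(pr lo hi) -EFinM lee_fin.
  have -> : (2 * (e / (2 * (pr lo hi + 1))) * pr lo hi = e * (pr lo hi / (pr lo hi + 1)))%R.
    by field; rewrite gt_eqF.
  rewrite ler_piMr ?(ltW e0) // ler_pdivrMr // mul1r lerDl; exact: ler01.
by apply/eqP; rewrite eq_le; apply/andP; split; apply: H => e e0; have [] := box_close e0 lh sV.
Qed.

Let restr_eq (lo hi : 'rV[R]_m) (E : set 'rV[R]_m) : cbox lo hi `<=` V -> measurable (E : set (borel 'rV[R]_m)) ->
  nu1 (E `&` box lo hi) = nu2 (E `&` box lo hi).
Proof.
move=> sV mE; have mQ : measurable (box lo hi : set (borel 'rV[R]_m)) by exact: measurable_box.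
have K l h : nu1 (box l h `&` box lo hi) = nu2 (box l h `&` box lo hi) /\ nu2 (box l h `&` box lo hi) < +oo.
  rewrite box_setI; apply: box_eq => y H; apply: sV => a; have := H a.
  by rewrite !mxE ge_max le_min => /andP[/andP[_ ->] /andP[_ ->]].
apply: (@measure_box_unique R m (mrestr nu1 mQ) (mrestr nu2 mQ)) => //.
  by move=> l h; have [] := K l h.
move=> l h; have [E1 E2] := K l h; have E3 : nu1 (box l h `&` box lo hi) < +oo by rewrite E1.
exact: E3.
Qed.

(** V is cut into countably many disjoint pieces of boxes. Off V both measures vanish, the first one
    because G maps W into V. *)
Let nu_eq (E : set 'rV[R]_m) : measurable (E : set (borel 'rV[R]_m)) -> nu1 E = nu2 E.
Proof.
move=> mE; have [D [lo [hi [sV VE]]]] := open_box_cover oV.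
have mV : measurable (V : set (borel 'rV[R]_m)) by exact: borel_open.
pose Q k : set (borel 'rV[R]_m) := if `[< D k >] then box (lo k) (hi k) else set0.
have mQ k : measurable (Q k) by rewrite /Q; case: asboolP => // _; exact: measurable_box.
have VQ : V = \bigcup_k Q k.
  rewrite VE; apply/seteqP; split=> y [k].
    by move=> Dk Hy; exists k => //; rewrite /Q asboolT.
  by move=> _; rewrite /Q; case: asboolP => // Dk Hy; exists k.
have z1 : nu1 (E `\` V) = 0.
  rewrite nu1E; apply: integral0_eq => z _; rewrite /u1 indicE; case: asboolP => Wz; last by rewrite mul0e.
  by rewrite memNset ?mule0 //= => -[_]; rewrite G'E //; apply; exact: GW.
have z2 : nu2 (E `\` V) = 0.
  apply: integral0_eq => z _; rewrite /u2 indicE; case: asboolP => Wz; last by rewrite mul0e.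
  by rewrite memNset ?mule0 //= => -[].
have EV : E `&` V = \bigcup_k (E `&` seqDU Q k).
  by rewrite VQ seqDU_bigcup_eq setI_bigcupr.
have mS k : measurable (seqDU Q k) by apply: measurableD => //; exact: bigsetU_measurable.
have tS : trivIset setT (fun k => E `&` seqDU Q k).
  by apply: trivIset_setIl; exact: trivIset_seqDU.
have mES k : measurable (E `&` seqDU Q k : set (borel 'rV[R]_m)) by exact: measurableI.
have S (nu : {measure set (borel 'rV[R]_m) -> \bar R}) : nu (E `\` V) = 0 ->
    nu E = \sum_(0 <= k <oo) nu (E `&` seqDU Q k).
  move=> z; have -> : nu E = nu (E `\` V) + nu (E `&` V) := measureDI nu mE mV.
  rewrite z add0e EV measure_bigcup //.
  by apply: eq_eseriesl => k; rewrite in_setT.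
have E1 : nu1 E = \sum_(0 <= k <oo) nu1 (E `&` seqDU Q k) := S nu1 z1.
have E2 : nu2 E = \sum_(0 <= k <oo) nu2 (E `&` seqDU Q k) := S nu2 z2.
rewrite E1 E2; apply: eq_eseriesr => k _.
have -> : E `&` seqDU Q k = (E `&` seqDU Q k) `&` Q k.
  by rewrite -setIA; congr setI; apply/seteqP; split=> [y h|y []] //; split=> //; case: h.
rewrite /Q; case: asboolP => [Dk|_]; last by rewrite setI0 nu10 nu20.
by apply: restr_eq => //; exact: sV.
Qed.

Lemma change_variables_approx (E : set 'rV[R]_m) : measurable (E : set (borel 'rV[R]_m)) ->
  \int[leb m]_z (if `[< W z /\ E (G z) >] then w1 z else 0%R)%:E =
  \int[leb m]_y (if `[< V y /\ E y >] then w2 y else 0%R)%:E.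
Proof.
move=> mE; transitivity (nu1 E).
  rewrite nu1E; apply: eq_integral => z _; rewrite /u1 indicE.
  case: (asboolP (W z)) => Wz; last by rewrite mul0e asboolF // => -[].
  case: asboolP => [[_ Ez]|nE]; first by rewrite mem_set ?mule1 //= G'E.
  by rewrite memNset ?mule0 //= G'E // => Ez; apply: nE.
rewrite nu_eq //; apply: eq_integral => z _; rewrite /u2 indicE.
case: (asboolP (V z)) => Vz; last by rewrite mul0e asboolF // => -[].
case: asboolP => [[_ Ez]|nE]; first by rewrite mem_set ?mule1.
by rewrite memNset ?mule0 // => Ez; apply: nE.
Qed.

End ChangeOfVariables.

Lemma change_variables (R : realType) m (V W : set 'rV[R]_m) (F G : 'rV[R]_m -> 'rV[R]_m) (w1 w2 : 'rV[R]_m -> R) :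
  open V -> open W -> (forall y, V y -> W (F y)) -> (forall z, W z -> V (G z)) ->
  (forall y, V y -> G (F y) = y) -> (forall z, W z -> F (G z) = z) ->
  (forall y, V y -> differentiable F y) -> (forall z, W z -> differentiable G z) ->
  (forall z, W z -> {for z, continuous w1}) -> (forall y, V y -> {for y, continuous w2}) ->
  (forall z, W z -> 0 <= w1 z) -> (forall y, V y -> 0 <= w2 y) ->
  (forall y, V y -> w2 y = w1 (F y) * `|\det ('J F y)|) ->
  forall E : set 'rV[R]_m, measurable (E : set (borel 'rV[R]_m)) ->
  (\int[leb m]_z (if `[< W z /\ E (G z) >] then w1 z else 0%R)%:E =
   \int[leb m]_y (if `[< V y /\ E y >] then w2 y else 0%R)%:E)%E.
Proof.
move=> oV oW FV GW FK GK dF dG cw1 cw2 w10 w20 w12 E mE.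
have AB y : V y -> 'J F y *m 'J G (F y) = 1%:M.
  by move=> Vy; exact: (jacobian_inverse oV Vy FK (dF y Vy) (dG _ (FV y Vy))).
have aF y : V y -> forall e : R, 0 < e -> exists2 r : R, 0 < r &
    forall q, `|q - y| < r -> `|F q - F y - (q - y) *m 'J F y| <= e * `|q - y|.
  move=> Vy e e0; have [r r0 H] := differentiable_approx_rV (dF y Vy) e0.
  by exists r => // q qr; rewrite -diff_jacobian; exact: H.
have aG y : V y -> forall e : R, 0 < e -> exists2 r : R, 0 < r &
    forall z, `|z - F y| < r -> `|G z - y - (z - F y) *m 'J G (F y)| <= e * `|z - F y|.
  move=> Vy e e0; have [r r0 H] := differentiable_approx_rV (dG _ (FV y Vy)) e0.
  by exists r => // q qr; have := H q qr; rewrite diff_jacobian FK.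
have cG z : W z -> {for z, continuous G} by move=> Wz; apply: differentiable_continuous; exact: dG.
exact: (change_variables_approx oV oW FV GW GK AB aF aG cG cw1 cw2 w10 w20 w12 mE).
Qed.

(** * Integrals of continuous functions with compact support *)

Section CompactSupport.
Context {R : realType} {M : ptopologicalType}.
Implicit Types (f h : M -> R) (K : set M).

(** The support is encoded by some compact set off which f vanishes, a form that passes directly to
    sums and products. *)
Definition cc f := continuous f /\ exists2 K, compact K & forall x, f x != 0 -> K x.

Lemma cc0 : cc (fun=> 0).
Proof.
split; first by move=> x; exact: cst_continuous.
by exists set0; [exact: compact0|move=> x; rewrite eqxx].
Qed.

Lemma ccD f h : cc f -> cc h -> cc (fun x => f x + h x).
Proof.
move=> [cf [K cK fK]] [ch [L cL hL]]; split; first by move=> x; exact: (@continuousD R R^o M f h x (cf x) (ch x)).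
exists (K `|` L); first exact: compactU.
move=> x; have [->|/fK] := eqVneq (f x) 0; last by left.
by rewrite add0r => /hL; right.
Qed.

Lemma ccM f h : continuous f -> cc h -> cc (fun x => f x * h x).
Proof.
move=> cf [ch [L cL hL]]; split; first by move=> x; exact: (@continuousM R M f h x (cf x) (ch x)).
by exists L => // x; rewrite mulf_eq0 negb_or => /andP[_ /hL].
Qed.

Lemma ccMr f h : continuous f -> cc h -> cc (fun x => h x * f x).
Proof. by move=> cf /(ccM cf); under eq_fun do rewrite mulrC. Qed.

Lemma ccZ (c : R) f : cc f -> cc (fun x => c * f x).
Proof. by apply: ccM => x; exact: cst_continuous. Qed.

Lemma ccN f : cc f -> cc (fun x => - f x).
Proof. by move=> /(ccZ (-1)); under eq_fun do rewrite mulN1r. Qed.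

Lemma ccB f h : cc f -> cc h -> cc (fun x => f x - h x).
Proof. by move=> cf /ccN; exact: ccD. Qed.

Lemma cc_norm f : cc f -> cc (fun x => `|f x|).
Proof.
move=> [cf [K cK fK]]; split.
  by move=> x; apply: (@continuous_comp _ _ _ f (@Num.norm R R)); [exact: cf|exact: norm_continuous].
by exists K => // x; rewrite normr_eq0; exact: fK.
Qed.

Lemma cc_sum (I : Type) (r : seq I) (P : pred I) (F : I -> M -> R) :
  (forall i, P i -> cc (F i)) -> cc (fun x => \sum_(i <- r | P i) F i x).
Proof.
move=> H; elim: r => [|i r IH]; first by under eq_fun do rewrite big_nil; exact: cc0.
under eq_fun do rewrite big_cons.
by case E : (P i) => //; apply: ccD => //; exact: H.
Qed.

Lemma cc_bounded f : cc f -> exists2 B, 0 <= B & forall x, `|f x| <= B.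
Proof.
move=> [cf [K cK fK]]; have cfK : compact (f @` K).
  by apply: continuous_compact => //; apply: continuous_subspaceT.
have [B [_ HB]] := @compact_bounded R R^o _ cfK; exists (`|B| + 1) => // x.
have [->|/fK Kx] := eqVneq (f x) 0; first by rewrite normr0.
by apply: HB; [rewrite (le_lt_trans (ler_norm B)) // ltrDl|exists x].
Qed.

Hypothesis haus : hausdorff_space M.
Variable mu : {measure set (borel M) -> \bar R}.
Hypothesis mu_compact : forall K : set M, compact K -> (mu K < +oo)%E.

Lemma measurable_compact K : compact K -> measurable (K : set (borel M)).
Proof. by move=> cK; apply: borel_closed; exact: compact_closed. Qed.

Lemma cc_measurable f : cc f -> measurable_fun setT (f : borel M -> measurableTypeR R).
Proof. by move=> [cf _]; exact: continuous_borelR. Qed.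

Definition Int f : R := (\int[mu]_x f x)%R.

Lemma Int_bound_integrable f K (e : R) : cc f -> compact K -> (forall x, f x != 0 -> K x) ->
  (forall x, `|f x| <= e) -> mu.-integrable setT (EFin \o f) /\ `|Int f| <= e * fine (mu K).
Proof.
move=> cf cK fK fe; have mf := cc_measurable cf; have mK := measurable_compact cK.
have mN : measurable_fun setT (fun x : borel M => `|(f x)%:E|%E).
  by apply: measurableT_comp => //; exact/measurable_EFinP.
have e0 : 0 <= e by exact: le_trans (fe point).
have B : (\int[mu]_x `|(f x)%:E| <= e%:E * mu K)%E.
  have -> : mu K = (\int[mu]_x (\1_K x : R)%:E)%E by rewrite (integral_indic _ measurableT mK) setIT.
  rewrite -ge0_integralZl_EFin //; last exact: measurable_fun_indicE.
  apply: ge0_le_integral => //.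
    by apply: emeasurable_funM => //; exact: measurable_fun_indicE.
  move=> x _; rewrite indicE; have [->|/fK Kx] := eqVneq (f x) 0.
    by rewrite abse0 mule_ge0 // lee_fin.
  by rewrite mem_set // mule1 abse_EFin lee_fin.
have fin : mu K \is a fin_num by rewrite ge0_fin_numE ?measure_ge0 // mu_compact.
have I : mu.-integrable setT (EFin \o f).
  apply/integrableP; split; first exact/measurable_EFinP.
  by apply: (le_lt_trans B); rewrite -(fineK fin) -EFinM ltry.
split=> //; apply: (le_trans (le_normr_Rintegral measurableT I)).
have fB : (e%:E * mu K)%E \is a fin_num by rewrite fin_numM.
have -> : e * fine (mu K) = fine (e%:E * mu K) by rewrite fineM.
apply: fine_le => //; rewrite ge0_fin_numE ?integral_ge0 //; apply: (le_lt_trans B).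
by rewrite -(fineK fin) -EFinM ltry.
Qed.

Lemma cc_integrable f : cc f -> mu.-integrable setT (EFin \o f).
Proof.
move=> cf; have [B _ HB] := cc_bounded cf; have [_ [K cK fK]] := cf.
by have [] := Int_bound_integrable cf cK fK HB.
Qed.

Lemma Int_bound f K (e : R) : cc f -> compact K -> (forall x, f x != 0 -> K x) ->
  (forall x, `|f x| <= e) -> `|Int f| <= e * fine (mu K).
Proof. by move=> cf cK fK fe; have [] := Int_bound_integrable cf cK fK fe. Qed.

Lemma IntD f h : cc f -> cc h -> Int (fun x => f x + h x) = Int f + Int h.
Proof. by move=> cf ch; rewrite /Int RintegralD //; exact: cc_integrable. Qed.

Lemma IntZ (c : R) f : cc f -> Int (fun x => c * f x) = c * Int f.
Proof. by move=> cf; rewrite /Int RintegralZl //; exact: cc_integrable. Qed.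

Lemma IntN f : cc f -> Int (fun x => - f x) = - Int f.
Proof. by move=> cf; rewrite -mulN1r -IntZ //; congr Int; apply/funext => x; rewrite mulN1r. Qed.

Lemma IntB f h : cc f -> cc h -> Int (fun x => f x - h x) = Int f - Int h.
Proof. by move=> cf ch; rewrite IntD ?IntN //; exact: ccN. Qed.

Lemma Int0 : Int (fun=> 0) = 0.
Proof. by rewrite /Int /Rintegral integral0. Qed.

Lemma Int_sum (I : Type) (r : seq I) (P : pred I) (F : I -> M -> R) :
  (forall i, P i -> cc (F i)) ->
  Int (fun x => \sum_(i <- r | P i) F i x) = \sum_(i <- r | P i) Int (F i).
Proof.
move=> H; elim: r => [|i r IH].
  by rewrite big_nil -[RHS]Int0; congr Int; apply/funext => x; rewrite big_nil.
rewrite big_cons -IH.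
have -> : (fun x => \sum_(j <- i :: r | P j) F j x) =
    (fun x => if P i then F i x + \sum_(j <- r | P j) F j x else \sum_(j <- r | P j) F j x).
  by apply/funext => x; rewrite big_cons.
by case E : (P i) => //; rewrite IntD //; [exact: H|exact: cc_sum].
Qed.

Lemma Int_ge0 f : (forall x, 0 <= f x) -> 0 <= Int f.
Proof. by move=> f0; apply: Rintegral_ge0. Qed.

Lemma Int_le f h : cc f -> cc h -> (forall x, f x <= h x) -> Int f <= Int h.
Proof. by move=> cf ch fh; apply: le_Rintegral => //; exact: cc_integrable. Qed.

Lemma Int_EFin f : cc f -> (Int f)%:E = (\int[mu]_x (f x)%:E)%E.
Proof. by move=> cf; rewrite /Int /Rintegral fineK //; apply: integrable_fin_num => //; exact: cc_integrable. Qed.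

(** A positive value at x persists, up to a factor 1/2, on an open set, and nonempty open sets have
    positive measure. *)
Lemma Int_eq0 f : (forall U : set M, open U -> U !=set0 -> (0 < mu U)%E) ->
  cc f -> (forall x, 0 <= f x) -> Int f <= 0 -> forall x, f x = 0.
Proof.
move=> mu_open cf f0 If x; apply/eqP/negPn/negP => fx.
have fx0 : 0 < f x by rewrite lt0r fx f0.
pose U := [set z | f x / 2 < f z]; have oU : open U.
  have [/continuousP c _] := cf; rewrite (_ : U = f @^-1` [set t | f x / 2 < t]) //.
  by apply: c; exact: open_gt.
have mU : (0 < mu U)%E by apply: mu_open => //; exists x; rewrite /U /=; lra.
have : ((f x / 2)%:E * mu U <= \int[mu]_z (f z)%:E)%E.
  have mUs : measurable (U : set (borel M)) by exact: borel_open.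
  have -> : mu U = (\int[mu]_x (\1_U x : R)%:E)%E by rewrite (integral_indic _ measurableT mUs) setIT.
  rewrite -ge0_integralZl_EFin //; last 2 first.
  - exact: measurable_fun_indicE.
  - by lra.
  apply: ge0_le_integral => //.
  - by move=> z _; rewrite mule_ge0 // lee_fin //; lra.
  - by apply: emeasurable_funM => //; exact: measurable_fun_indicE.
  - by apply/measurable_EFinP; exact: cc_measurable.
  move=> z _; rewrite indicE; have [/set_mem Uz|_] := boolP (z \in U); last by rewrite mule0 lee_fin.
  by rewrite mule1 lee_fin; exact: ltW.
rewrite -Int_EFin //; apply/negP; rewrite -ltNge.
apply: (@le_lt_trans _ _ 0%E); first by rewrite lee_fin.
by rewrite mule_gt0 // lte_fin; lra.
Qed.

End CompactSupport.

(** * Partial derivatives and integration by parts for C^1 functions *)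

Section PartialRules.
Context {R : realType} {m : nat}.
Implicit Types (f h : 'rV[R]_m -> R) (y : 'rV[R]_m).
Let e_ (a : 'I_m) : 'rV[R]_m := delta_mx ord0 a.

Lemma partialD a f h y : derivable f y (e_ a) -> derivable h y (e_ a) ->
  partial a (fun z => f z + h z) y = partial a f y + partial a h y.
Proof. by move=> df dh; exact: (deriveD df dh). Qed.

Lemma partialM a f h y : derivable f y (e_ a) -> derivable h y (e_ a) ->
  partial a (fun z => f z * h z) y = partial a f y * h y + f y * partial a h y.
Proof. by move=> df dh; rewrite addrC [X in _ + X]mulrC; exact: (deriveM df dh). Qed.

Lemma partialZ a (c : R) f y : derivable f y (e_ a) -> partial a (fun z => c * f z) y = c * partial a f y.
Proof. by move=> df; exact: (deriveZ c df). Qed.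

Lemma partial_sum (I : Type) (r : seq I) (P : pred I) (F : I -> 'rV[R]_m -> R) a y :
  (forall i, derivable (F i) y (e_ a)) ->
  derivable (fun z => \sum_(i <- r | P i) F i z) y (e_ a) /\
  partial a (fun z => \sum_(i <- r | P i) F i z) y = \sum_(i <- r | P i) partial a (F i) y.
Proof.
move=> H; elim: r => [|i r [IH1 IH2]].
  rewrite big_nil; under eq_fun do rewrite big_nil.
  by split; [exact: derivable_cst|exact: partial_cst].
rewrite big_cons; under eq_fun do rewrite big_cons.
case: (P i) => //; split; first exact: (derivableD (H i) IH1).
by rewrite partialD // IH2.
Qed.

Lemma translate_shift a f (c : 'rV[R]_m) y :
  (fun t : R => t^-1 *: (f (t *: e_ a + y + c) - f (y + c))) = (fun t => t^-1 *: (f (t *: e_ a + (y + c)) - f (y + c))).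
Proof. by apply/funext => t; rewrite addrA. Qed.

Lemma derivable_translate a f (c : 'rV[R]_m) y : derivable f (y + c) (e_ a) -> derivable (fun z => f (z + c)) y (e_ a).
Proof. by rewrite /derivable (translate_shift a f c y). Qed.

Lemma partial_translate a f (c : 'rV[R]_m) y : partial a (fun z => f (z + c)) y = partial a f (y + c).
Proof. by rewrite /partial /derive (translate_shift a f c y). Qed.

Lemma partial_supp (K : set 'rV[R]_m) a f : closed K -> (forall y, f y != 0 -> K y) ->
  forall y, partial a f y != 0 -> K y.
Proof.
move=> cK fK y; apply: contra_neqP => nKy; rewrite -(partial_cst (0 : R) a y).
apply: (@partial_ext R m (~` K)) => //; first exact: closed_openC.
by move=> z; rewrite inE => nKz; apply/eqP/negPn/negP => /fK.
Qed.

End PartialRules.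

Section IntegrationByParts.
Context {R : realType} {m : nat}.
Implicit Types (f h : 'rV[R]_m -> R) (y : 'rV[R]_m).
Let L f := Int (leb m) f.
Let e_ (a : 'I_m) : 'rV[R]_m := delta_mx ord0 a.

Definition rbox (r : R) : set 'rV[R]_m := cbox (const_mx (- r)) (const_mx r).

Lemma rboxP (r : R) y : 0 <= r -> rbox r y <-> `|y| <= r.
Proof.
move=> r0; split=> [H|H a].
  by apply: norm_le_coord => // a; have := H a; rewrite !mxE ler_norml.
by rewrite !mxE -ler_norml; exact: le_trans (coord_le_norm _ a) H.
Qed.

Lemma haus_rV : hausdorff_space 'rV[R]_m.
Proof. exact: norm_hausdorff. Qed.

Lemma compact_rbox (K : set 'rV[R]_m) : compact K -> exists2 r : R, 0 <= r & K `<=` rbox r.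
Proof.
move=> /compact_bounded[r [_ H]]; exists (`|r| + 1) => [|y Ky]; first by rewrite addr_ge0.
by apply/rboxP; [rewrite addr_ge0|apply: H => //; rewrite (le_lt_trans (ler_norm r)) // ltrDl].
Qed.

Lemma leb_compact (K : set 'rV[R]_m) : compact K -> (leb m K < +oo)%E.
Proof.
move=> cK; have [r r0 Kr] := compact_rbox cK.
pose Q : set (borel 'rV[R]_m) := box (const_mx (- r)) (const_mx (r + 1)).
have mQ : measurable Q by exact: measurable_box.
have KQ : K `<=` Q.
  by move=> y /Kr H a; have := H a; rewrite !mxE => /andP[-> h]; rewrite (le_lt_trans h) // ltrDl.
apply: (@le_lt_trans _ _ (leb m Q)).
  by apply: le_measure; rewrite ?inE //; exact: (measurable_compact haus_rV cK).
by rewrite leb_box ?ltry // => a; rewrite !mxE; lra.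
Qed.

Let H := haus_rV.
Let LC := leb_compact.

Lemma cc_rV f : cc f <-> continuous f /\ exists2 r : R, 0 <= r & forall y, r < `|y| -> f y = 0.
Proof.
split=> [[cf [K cK fK]]|[cf [r r0 fr]]]; split=> //.
  have [r r0 Kr] := compact_rbox cK; exists r => // y ry.
  apply/eqP/negPn/negP => /fK /Kr /(rboxP _ r0); by rewrite leNgt ry.
exists (rbox r); first exact: compact_cbox.
by move=> y fy; apply/(rboxP _ r0); rewrite leNgt; apply: contra fy => /fr ->.
Qed.

Lemma cc_translate f c : cc f -> cc (fun y => f (y + c)).
Proof.
move=> /cc_rV[cf [r r0 fr]]; apply/cc_rV; split.
  move=> y; apply: (@continuous_comp _ _ _ (fun y => y + c) f); last exact: cf.
  by apply: (@continuousD R _ _ id (cst c)); [exact: cvg_id|exact: cst_continuous].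
exists (r + `|c|) => [|y ry]; first by rewrite addr_ge0.
apply: fr; have := ler_normB (y + c) c; rewrite addrK; lra.
Qed.

Lemma Int_translate f c : cc f -> L (fun y => f (y + c)) = L f.
Proof.
move=> cf; have mf : measurable_fun setT (EFin \o f : borel 'rV[R]_m -> \bar R).
  by apply/measurable_EFinP; exact: cc_measurable.
have T1 := @integral_translate R m c ((EFin \o f)^\+)%E (measurable_funepos mf) (fun y => funepos_ge0 _ y).
have T2 := @integral_translate R m c ((EFin \o f)^\-)%E (measurable_funeneg mf) (fun y => funeneg_ge0 _ y).
rewrite /L /Int /Rintegral integralE [X in _ = fine X]integralE; congr fine; congr (_ - _)%E.
  by rewrite -[RHS]T1; apply: eq_integral => y _; rewrite !funeposE.
by rewrite -[RHS]T2; apply: eq_integral => y _; rewrite !funenegE.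
Qed.

Lemma cc_uniform f : cc f -> forall e : R, 0 < e -> exists2 d : R, 0 < d &
  forall x y, `|x - y| < d -> `|f x - f y| < e.
Proof.
move=> /cc_rV[cf [r r0 fr]] e e0.
have /compact_near_coveringP nK : compact (rbox (r + 1)) by exact: compact_cbox.
have N : \forall d \near (0 : R)^'+, forall x, rbox (r + 1) x -> forall y, `|x - y| < d -> `|f x - f y| < e.
  apply: (nK _ _ (fun d x => forall y, `|x - y| < d -> `|f x - f y| < e)) => x _.
  have e2 : 0 < e / 2 by rewrite divr_gt0.
  have [d d0 Hd] := (continuous_rVP f x).1 (cf x) _ e2.
  exists ([set z | `|z - x| < d / 2], [set t | t < d / 2]) => /=.
    split; first by apply/nbhs_rV; exists (d / 2) => //; rewrite divr_gt0.
    by apply: nbhs_right_lt; rewrite divr_gt0.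
  move=> [z t] /= [zx td] y zy.
  have h1 : `|f z - f x| < e / 2 by apply: Hd; lra.
  have h2 : `|f y - f x| < e / 2.
    apply: Hd; have -> : y - x = (z - x) - (z - y) by rewrite opprB [RHS]addrC subrKA.
    by have := ler_normB (z - x) (z - y); lra.
  have -> : f z - f y = (f z - f x) - (f y - f x) by ring.
  by have := ler_normB (f z - f x) (f y - f x); lra.
have [d [Hd d0]] := @filter_ex _ (0 : R)^'+ _ _ (filterI N (nbhs_right_gt 0)).
exists (Num.min d 1); first by rewrite lt_min d0 ltr01.
move=> x y; rewrite lt_min => /andP[xd x1].
have [xr|xr] := leP `|x| (r + 1); first by apply: Hd => //; apply/rboxP => //; lra.
have yr : r < `|y| by have := ler_normD (x - y) y; rewrite subrK; lra.
by rewrite (fr x) ?(fr y) ?subrr ?normr0 //; lra.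
Qed.

Definition c1c f := isCk 1 setT f /\ cc f.

Lemma c1c_derivable f y a : c1c f -> derivable f y (e_ a).
Proof. by case=> /Ck_derivable /(_ y I a). Qed.

Lemma c1c_partial f a : c1c f -> cc (partial a f).
Proof.
move=> [Cf [_ [K cK fK]]]; split; first by move=> y; exact: (Ck_continuous (Ck_partial Cf a)).
by exists K => //; apply: partial_supp => //; exact: compact_closed.
Qed.

Lemma c1cM f h : isCk 1 setT f -> c1c h -> c1c (fun y => f y * h y).
Proof.
move=> Cf [Ch ch]; split; first by apply: CkM => //; exact: openT.
by apply: ccM => // y; exact: (Ck_continuous Cf).
Qed.

Lemma c1c_translate f c : c1c f -> c1c (fun y => f (y + c)).
Proof.
move=> [Cf cf]; split; last exact: cc_translate.
apply/Ck1P; first exact: openT.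
split=> [y _ a|a y _]; first by apply: derivable_translate; exact: (Ck_derivable Cf).
have -> : partial a (fun z => f (z + c)) = (fun z => partial a f (z + c)) by apply/funext => z; exact: partial_translate.
by have [h _] := cc_translate c (c1c_partial a (conj Cf cf)); exact: h.
Qed.

Definition dq (a : 'I_m) (s : R) f y := s^-1 * (f (y + s *: e_ a) - f y).

Lemma dq_c1c a s f : c1c f -> c1c (dq a s f).
Proof.
move=> cf; have [C1 C2] := c1c_translate (s *: e_ a) cf; have [D1 D2] := cf; split.
  by apply: CkZ; [exact: openT|apply: CkB; [exact: openT| |]].
by apply: ccZ; apply: ccB.
Qed.

Lemma dq_cc a s f : cc f -> cc (dq a s f).
Proof. by move=> cf; apply: ccZ; apply: ccB => //; exact: cc_translate. Qed.

Lemma partial_dq a b s f y : c1c f -> partial b (dq a s f) y = dq a s (partial b f) y.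
Proof.
move=> cf; have c1 := c1c_translate (s *: e_ a) cf.
have d1 := @c1c_derivable _ y b c1; have d2 := @c1c_derivable _ y b cf.
have := @partialZ R m b s^-1 (fun z => f (z + s *: e_ a) - f z) y (derivableB d1 d2).
rewrite /dq => ->; congr (_ * _); rewrite -(partial_translate b f); exact: (deriveB d1 d2).
Qed.

Lemma dq_uniform a f : c1c f -> forall e : R, 0 < e -> exists2 d : R, 0 < d &
  forall s, s != 0 -> `|s| < d -> forall y, `|partial a f y - dq a s f y| <= e.
Proof.
move=> cf e e0; have [d d0 Hd] := cc_uniform (c1c_partial a cf) e0.
exists d => // s s0 sd y.
have [t /andP[t0 t1] E] := @MVT_delta R m f y a s (fun t _ => @c1c_derivable _ _ a cf).
rewrite /dq -/(e_ a) E mulKf //; apply: ltW; apply: Hd.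
rewrite opprD addrA subrr add0r normrN; apply: le_lt_trans sd.
rewrite normrZ normrM (ger0_norm t0) -[leRHS]mulr1; apply: ler_pM => //; first by rewrite mulr_ge0.
  by rewrite ler_piMl.
exact: norm_delta_le.
Qed.

Lemma small_eq0 (x C : R) : (forall e, 0 < e -> `|x| <= e * C) -> x = 0.
Proof.
move=> h; apply/eqP; rewrite -normr_eq0; apply/eqP/le_anti; rewrite normr_ge0 andbT.
have C0 : 0 <= C by have := h 1 ltr01; rewrite mul1r => /(le_trans (normr_ge0 _)).
apply/ler_addgt0Pl => e e0; rewrite addr0.
have q : 0 < C + 1 by lra.
apply: le_trans (h (e / (C + 1)) (divr_gt0 e0 q)) _.
by rewrite mulrAC ler_pdivrMr // ler_wpM2l ?(ltW e0) // lerDl ler01.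
Qed.

Lemma Int_translate_sub f c : cc f -> L (fun y => f (y + c) - f y) = 0.
Proof.
move=> cf; rewrite /L (IntB H LC) //; last exact: cc_translate.
by have := Int_translate c cf; rewrite /L => ->; rewrite subrr.
Qed.

Lemma dq_supp a s f (r : R) : (forall y, r < `|y| -> f y = 0) -> `|s| <= 1 ->
  forall y, r + 1 < `|y| -> dq a s f y = 0.
Proof.
move=> fr s1 y yr; rewrite /dq (fr y) ?fr ?subrr ?mulr0 //; last lra.
have := ler_normB (y + s *: e_ a) (s *: e_ a); rewrite addrK.
have : `|s *: e_ a| <= 1; last lra.
rewrite normrZ -[leRHS]mulr1; apply: ler_pM => //; exact: norm_delta_le.
Qed.

Lemma dq_limit a f h : c1c f -> cc h -> exists C : R, forall e : R, 0 < e -> exists2 d : R, 0 < d &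
  forall s, s != 0 -> `|s| < d -> `|L (fun y => partial a f y * h y) - L (fun y => dq a s f y * h y)| <= e * C.
Proof.
move=> cf ch; have [B B0 HB] := cc_bounded ch.
have [_ [K cK hK]] := ch.
exists (B * fine (leb m K)) => e e0; have [d d0 Hd] := dq_uniform a cf e0.
exists d => // s s0 sd.
have cp := c1c_partial a cf; have [_ cd] := dq_c1c a s cf.
have c1 : cc (fun y => partial a f y * h y) by apply: ccM => //; case: cp.
have c2 : cc (fun y => dq a s f y * h y) by apply: ccM => //; case: cd.
rewrite /L -(IntB H LC) // mulrA; apply: (Int_bound H LC) => //; first exact: ccB.
  by move=> y ny; apply: hK; apply: contra ny => /eqP ->; rewrite !mulr0 subrr.
by move=> y; rewrite -mulrBl normrM; apply: ler_pM => //; exact: Hd.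
Qed.

(** Translation invariance kills the integral of every difference quotient, and these converge
    uniformly to the derivative with supports in a fixed cube. *)
Lemma Int_partial a f : c1c f -> L (partial a f) = 0.
Proof.
move=> cf; have /cc_rV[_ [r r0 fr]] := cf.2.
have K2 : compact (rbox (r + 1)) by exact: compact_cbox.
apply: (@small_eq0 _ (fine (leb m (rbox (r + 1))))) => e e0.
have [d d0 Hd] := dq_uniform a cf e0.
pose s := Num.min (d / 2) 1; have s0 : 0 < s by rewrite lt_min divr_gt0 ?ltr01.
have s1 : `|s| <= 1 by rewrite gtr0_norm // ge_min lexx orbT.
have sd : `|s| < d by rewrite gtr0_norm //; apply: (@le_lt_trans _ _ (d / 2)); [rewrite ge_min lexx|lra].
have cp := c1c_partial a cf; have cd := dq_cc a s cf.2.
have Z : L (dq a s f) = 0.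
  have ct : cc (fun y => f (y + s *: e_ a) - f y) by apply: ccB; [exact: cc_translate cf.2|exact: cf.2].
  by rewrite /L (IntZ H LC) //; have := Int_translate_sub (s *: e_ a) cf.2; rewrite /L => ->; rewrite mulr0.
have -> : L (partial a f) = L (fun y => partial a f y - dq a s f y).
  by rewrite /L (IntB H LC) //; move: Z; rewrite /L => ->; rewrite subr0.
apply: (Int_bound H LC) => //; first exact: ccB.
  move=> y; apply: contra_neqP => ny; have yr : r + 1 < `|y|.
    by rewrite ltNge; apply/negP => h; apply: ny; apply/rboxP => //; lra.
  rewrite (dq_supp a fr s1 yr) subr0; apply/eqP/negPn/negP.
  have K1 : closed (rbox r) by apply: compact_closed => //; exact: compact_cbox.
  have fK z : f z != 0 -> rbox r z.
    by move=> fz; apply/rboxP => //; rewrite leNgt; apply: contra fz => /fr ->.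
  by move=> /(partial_supp K1 fK) /(rboxP _ r0); lra.
by move=> y; apply: Hd => //; rewrite gt_eqF.
Qed.

Lemma Int_parts a f h : c1c f -> isCk 1 setT h ->
  L (fun y => partial a f y * h y) = - L (fun y => f y * partial a h y).
Proof.
move=> cf Ch; have cfh : c1c (fun y => f y * h y) by under eq_fun do rewrite mulrC; exact: c1cM.
apply/eqP; rewrite -addr_eq0 -(Int_partial a cfh) /L -(IntD H LC); last 2 first.
- by apply: ccMr; [move=> y; exact: (Ck_continuous Ch)|exact: c1c_partial].
- by apply: ccMr; [move=> y; exact: (Ck_continuous (Ck_partial Ch a))|case: cf].
apply/eqP; congr Int; apply/funext => y; rewrite partialM //; first exact: c1c_derivable.
exact: (Ck_derivable Ch).
Qed.

(** Integrating by parts twice would need second derivatives. Instead the derivative in direction a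
    is replaced by a difference quotient, which commutes with the derivative in direction b and, by
    a translation, passes to the other factor with step -s. Both quotients then converge uniformly,
    so C^1 functions suffice. *)
Lemma Int_commute a b f h : c1c f -> c1c h ->
  L (fun y => partial a f y * partial b h y) = L (fun y => partial b f y * partial a h y).
Proof.
move=> cf ch; have cpf := c1c_partial b cf; have cph := c1c_partial b ch.
have [C1 H1] := dq_limit a cf cph; have [C2 H2] := dq_limit a ch cpf.
apply/eqP; rewrite -subr_eq0; apply/eqP; apply: (@small_eq0 _ (C1 + C2)) => e e0.
have [d1 d10 {}H1] := H1 e e0; have [d2 d20 {}H2] := H2 e e0.
pose s := Num.min d1 d2 / 2.
have s0 : 0 < s by rewrite divr_gt0 // lt_min d10.
have s1 : s < d1 /\ s < d2.
  have h1 : Num.min d1 d2 <= d1 by rewrite ge_min lexx.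
  have h2 : Num.min d1 d2 <= d2 by rewrite ge_min lexx orbT.
  by have := s0; rewrite /s; split; lra.
have sn : - s != 0 by rewrite oppr_eq0 gt_eqF.
have {}H1 := H1 s (lt0r_neq0 s0); have {}H2 := H2 (- s) sn.
rewrite normrN gtr0_norm // in H1 H2; have {}H1 := H1 s1.1; have {}H2 := H2 s1.2.
have E : L (fun y => dq a s f y * partial b h y) = L (fun y => dq a (- s) h y * partial b f y).
  have cd := dq_c1c a s cf; have [Ch _] := ch.
  have := Int_parts b cd Ch => /(congr1 -%R); rewrite opprK => <-.
  have cp1 := cpf; have ct := cc_translate (s *: e_ a) cpf.
  have E1 : L (fun y => partial b (dq a s f) y * h y) =
     s^-1 * (L (fun y => partial b f (y + s *: e_ a) * h y) - L (fun y => partial b f y * h y)).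
    rewrite /L -(IntB H LC); last 2 first.
    - by apply: ccMr => //; case: ch.2.
    - by apply: ccMr => //; case: ch.2.
    rewrite -(IntZ H LC); last by apply: ccB; apply: ccMr => //; case: ch.2.
    by congr Int; apply/funext => y; rewrite partial_dq // /dq -mulrA mulrBl.
  have ct2 := cc_translate (- (s *: e_ a)) ch.2.
  have k1 : cc (fun y => partial b f y * h (y - s *: e_ a)) by apply: ccM => //; case: cpf.
  have k2 : cc (fun y => partial b f y * h y) by apply: ccM; [case: cpf|case: ch].
  have E2 : L (fun y => dq a (- s) h y * partial b f y) =
     (- s)^-1 * (L (fun y => partial b f y * h (y - s *: e_ a)) - L (fun y => partial b f y * h y)).
    rewrite /L -(IntB H LC k1 k2) -(IntZ H LC _ (ccB k1 k2)).
    by congr Int; apply/funext => y; rewrite /dq scaleNr; ring.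
  rewrite E1 E2 invrN mulNr; congr (- (_ * (_ - _))).
  have := @Int_translate (fun y => partial b f y * h (y - s *: e_ a)) (s *: e_ a).
  rewrite /L => <-; last by apply: ccM => //; case: cpf.
  by congr Int; apply/funext => y; rewrite addrK.
have -> : L (fun y => partial b f y * partial a h y) = L (fun y => partial a h y * partial b f y).
  by congr Int; apply/funext => y; rewrite mulrC.
move: H1 H2; rewrite E; set x := L _; set y := L _; set z := L _ => H1 H2.
have -> : x - z = (x - y) - (z - y) by ring.
by rewrite mulrDr; apply: le_trans (ler_normB _ _) _; apply: lerD.
Qed.

End IntegrationByParts.

(** * Gram matrices and the linear algebra of the refined Kato inequality *)

Section Bilin.
Context {R : realType} {m : nat}.
Implicit Types (A B : 'M[R]_m) (v w x : 'rV[R]_m).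

Definition gram A := A^T = A /\ posdef A.

Lemma bilinDl A v w x : bilin A (v + w) x = bilin A v x + bilin A w x.
Proof. by rewrite /bilin !mulmxDl mxE. Qed.
Lemma bilinDr A v w x : bilin A x (v + w) = bilin A x v + bilin A x w.
Proof. by rewrite /bilin linearD mulmxDr mxE. Qed.
Lemma bilinZl A (c : R) v w : bilin A (c *: v) w = c * bilin A v w.
Proof. by rewrite /bilin -!scalemxAl mxE. Qed.
Lemma bilinZr A (c : R) v w : bilin A v (c *: w) = c * bilin A v w.
Proof. by rewrite /bilin linearZ -scalemxAr mxE. Qed.
Lemma bilinNl A v w : bilin A (- v) w = - bilin A v w.
Proof. by rewrite -scaleN1r bilinZl mulN1r. Qed.
Lemma bilinNr A v w : bilin A v (- w) = - bilin A v w.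
Proof. by rewrite -scaleN1r bilinZr mulN1r. Qed.
Lemma bilin0l A w : bilin A 0 w = 0.
Proof. by rewrite /bilin !mul0mx mxE. Qed.
Lemma bilin0r A w : bilin A w 0 = 0.
Proof. by rewrite /bilin trmx0 mulmx0 mxE. Qed.
Lemma bilinD A B v w : bilin (A + B) v w = bilin A v w + bilin B v w.
Proof. by rewrite /bilin mulmxDr mulmxDl mxE. Qed.
Lemma bilinZ A (c : R) v w : bilin (c *: A) v w = c * bilin A v w.
Proof. by rewrite /bilin -scalemxAr -scalemxAl mxE. Qed.
Lemma bilinN A v w : bilin (- A) v w = - bilin A v w.
Proof. by rewrite -scaleN1r bilinZ mulN1r. Qed.

Lemma bilinE A v w : bilin A v w = \sum_a \sum_b v ord0 a * A a b * w ord0 b.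
Proof.
rewrite /bilin mxE exchange_big; apply: eq_bigr => b _ /=; rewrite !mxE big_distrl /=.
by [].
Qed.

Lemma mx11_tr (B : 'M[R]_1) : B ord0 ord0 = B^T ord0 ord0.
Proof. by rewrite mxE. Qed.

Lemma bilin_tr A v w : bilin A^T v w = bilin A w v.
Proof.
by rewrite /bilin [RHS]mx11_tr !trmx_mul trmxK mulmxA.
Qed.

Lemma bilinMl A B v w : bilin (B *m A) v w = bilin A (v *m B) w.
Proof. by rewrite /bilin !mulmxA. Qed.
Lemma bilinMr A B v w : bilin (A *m B^T) v w = bilin A v (w *m B).
Proof. by rewrite /bilin trmx_mul !mulmxA. Qed.

Lemma bilin_delta A (a b : 'I_m) : bilin A (delta_mx ord0 a) (delta_mx ord0 b) = A a b.
Proof. by rewrite /bilin -rowE trmx_delta -colE !mxE. Qed.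

Lemma gram_ge0 A v : gram A -> 0 <= bilin A v v.
Proof. by move=> [_ p]; have [->|/p/ltW] := eqVneq v 0; rewrite ?bilin0l. Qed.

Lemma bilin_sym A v w : A^T = A -> bilin A v w = bilin A w v.
Proof. by move=> sA; rewrite -{1}sA bilin_tr. Qed.

Lemma cauchy_schwarz A v w : gram A -> bilin A v w ^+ 2 <= bilin A v v * bilin A w w.
Proof.
move=> pA; have [sA p] := pA; have [->|w0] := eqVneq w 0; first by rewrite !bilin0r expr0n mulr0.
have := gram_ge0 (bilin A w w *: v - bilin A v w *: w) pA.
rewrite bilinDl !bilinDr !bilinNl !bilinNr !bilinZl !bilinZr (bilin_sym w v sA).
set a := bilin A w w; set b := bilin A v w; set c := bilin A v v.
have a0 : 0 < a by exact: p.
have -> : a * (a * c) - a * (b * b) + (- (b * (a * b)) - - (b * (b * a))) = a * (c * a - b ^+ 2) by ring.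
by rewrite pmulr_rge0 // subr_ge0.
Qed.

Lemma gram_unitmx A : gram A -> A \in unitmx.
Proof.
move=> [_ p]; rewrite -row_free_unit; apply/negPn/negP; rewrite -kermx_eq0 => /rowV0Pn[v /sub_kermxP vA v0].
by have := p v v0; rewrite /bilin vA mul0mx mxE ltxx.
Qed.

Lemma gram_invmx A : gram A -> gram (invmx A).
Proof.
move=> pA; have [sA p] := pA; have uA := gram_unitmx pA; split; first by rewrite trmx_inv sA.
move=> v v0; have -> : bilin (invmx A) v v = bilin A (v *m invmx A) (v *m invmx A).
  by rewrite /bilin trmx_mul trmx_inv sA !mulmxA mulmxK // -!mulmxA.
by apply: p; apply: contra v0 => /eqP E; rewrite -(mulmxKV uA v) E mul0mx.
Qed.

(* For v, f orthogonal of equal length, [bilin g v v *: invmx g - v^T v - f^T f] is positive semidefinite by Bessel's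
   inequality; its pairing with the positive semidefinite matrix S g^-1 S is the claim. *)
Lemma bessel g v f x : gram g -> bilin g f f = bilin g v v -> bilin g v f = 0 ->
  bilin g x v ^+ 2 + bilin g x f ^+ 2 <= bilin g v v * bilin g x x.
Proof.
move=> pg ff vf; have [sg p] := pg; set G := bilin g v v.
have [v0|v0] := eqVneq v 0.
  have f0 : f = 0.
    by apply/eqP/negPn/negP => /p; rewrite ff v0 bilin0l ltxx.
  by rewrite /G v0 f0 !bilin0r expr0n /= mul0r addr0.
have G0 : 0 < G by exact: p.
have := gram_ge0 (G *: x - bilin g x v *: v - bilin g x f *: f) pg.
rewrite !(bilinDl, bilinDr, bilinNl, bilinNr, bilinZl, bilinZr) (bilin_sym v x sg) (bilin_sym f x sg) (bilin_sym f v sg) vf ff -/G.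
set a := bilin g x x; set b := bilin g x v; set c := bilin g x f.
have E : forall t : R, t = G * (G * a - (b ^+ 2 + c ^+ 2)) -> 0 <= t -> b ^+ 2 + c ^+ 2 <= G * a.
  by move=> t ->; rewrite pmulr_rge0 // subr_ge0.
by apply: E; ring.
Qed.

Lemma mxtraceE_bilin (B C : 'M[R]_m) : \tr (B *m C *m B^T) = \sum_i bilin C (row i B) (row i B).
Proof.
apply: eq_bigr => i _; rewrite /bilin -row_mul.
by rewrite [RHS]mxE [LHS]mxE; apply: eq_bigr => j _; rewrite [row i _ _ _]mxE [(row i B)^T _ _]mxE [row i B _ _]mxE [B^T _ _]mxE.
Qed.

Variables (g S J : 'M[R]_m).
Hypotheses (pg : gram g) (sS : S^T = S) (JJ : J *m J = - 1%:M) (Jg : J *m g *m J^T = g) (JS : J *m S *m J^T = - S).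
Let A := invmx g.
Let ug := gram_unitmx pg.
Let pA : gram A := gram_invmx pg.

Let JtJt : J^T *m J^T = - 1%:M.
Proof. by rewrite -trmx_mul JJ linearN /= trmx1. Qed.

Let JAJ : J^T *m A *m J = A.
Proof.
have gJ : g *m J^T = - (J *m g).
  by rewrite -[in RHS]Jg !mulmxA JJ !mulNmx mul1mx opprK.
have : (J^T *m A *m J) *m g = 1%:M.
  have -> : J^T *m A *m J *m g = - (J^T *m (A *m (g *m J^T))) by rewrite gJ !mulmxN opprK !mulmxA.
  by rewrite [A *m _]mulmxA mulVmx // mul1mx JtJt opprK.
by move=> /(congr1 (mulmx^~ A)); rewrite mulmxK // mul1mx.
Qed.

Let JSt : J *m S = S *m J^T.
Proof.
have : J *m S *m J^T *m J^T = - S *m J^T by rewrite JS.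
by rewrite -mulmxA JtJt mulmxN mulmx1 mulNmx => /oppr_inj.
Qed.

(** Conjugation by J fixes the inverse metric and changes the sign of S, so the trace equals its
    opposite. For S the covariant Hessian this says that a pluriharmonic function is harmonic. *)
Lemma kahler_trace0 : \tr (S *m A) = 0.
Proof.
have : \tr (S *m A) = - \tr (S *m A).
  rewrite -{1}JAJ mulmxA mxtrace_mulC !mulmxA JS mulNmx linearN /= //.
by move=> /eqP; rewrite -addr_eq0 -mulr2n mulrn_eq0 /= => /eqP.
Qed.

(** The image f of v under J is orthogonal to v, has the same length, and S stretches both equally.
    Each direction thus contributes |S v|^2 / |v|^2 to the squared norm of S, which is the origin of
    the factor 2. *)
Lemma kahler_kato v : 2 * bilin A (v *m S) (v *m S) <= bilin g v v * \tr (S *m A *m (S *m A)).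
Proof.
have [sg p] := pg; have [sA _] := pA.
pose f := v *m J.
have ff : bilin g f f = bilin g v v by rewrite /f -bilinMr -bilinMl mulmxA Jg.
have vf : bilin g v f = 0.
  have : bilin g v f = - bilin g v f.
    rewrite {1}bilin_sym // /f -bilinMl -bilinMr -bilinN; congr (bilin _ v v).
    by rewrite -[in RHS]Jg -!mulmxA JtJt !mulmxN opprK mulmx1.
  by move=> /eqP; rewrite -addr_eq0 -mulr2n mulrn_eq0 /= => /eqP.
pose C := bilin g v v *: A - v^T *m v - f^T *m f.
have outer (a c : 'rV[R]_m) : bilin (a^T *m a) c c = bilin 1%:M c a ^+ 2.
  have -> : bilin 1%:M c a = (c *m a^T) ord0 ord0 by rewrite /bilin mulmx1.
  rewrite /bilin !mulmxA -mulmxA mxE big_ord1; congr (_ * _).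
  by rewrite mx11_tr trmx_mul trmxK.
have C0 c : 0 <= bilin C c c.
  rewrite /C bilinD bilinN bilinD bilinN bilinZ !outer.
  have E (a : 'rV[R]_m) : bilin 1%:M c a = bilin g (c *m A) a.
    by rewrite -bilinMl mulVmx.
  have Ex : bilin A c c = bilin g (c *m A) (c *m A).
    by rewrite -bilinMl mulVmx // -bilinMr mul1mx sA.
  have := bessel (c *m A) pg ff vf; rewrite Ex !E; lra.
(* A factor of the inverse metric rewrites the trace against [C] as a sum of values of the positive
   semidefinite form [C]. *)
have [L _ AL] := cholesky sA pA.2.
have T : \tr (S *m A *m (S *m C)) = \sum_i bilin C (row i (L^T *m S)) (row i (L^T *m S)).
  rewrite -mxtraceE_bilin trmx_mul trmxK sS.
  rewrite -[in RHS]mulmxA mxtrace_mulC AL !mulmxA mxtrace_mulC !mulmxA.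
  by rewrite -!mulmxA mxtrace_mulC !mulmxA.
have T0 : 0 <= \tr (S *m A *m (S *m C)) by rewrite T sumr_ge0.
have O (a : 'rV[R]_m) : \tr (S *m A *m (S *m (a^T *m a))) = bilin A (a *m S) (a *m S).
  rewrite !mulmxA mxtrace_mulC -!mulmxA; rewrite /mxtrace big_ord1 /bilin trmx_mul sS.
  by rewrite !mulmxA.
have Ef : bilin A (f *m S) (f *m S) = bilin A (v *m S) (v *m S).
  have -> : f *m S = v *m S *m J^T by rewrite /f -mulmxA JSt mulmxA.
  by rewrite -bilinMr -bilinMl trmxK mulmxA JAJ.
move: T0; rewrite /C !mulmxBr !linearB /= -!scalemxAr linearZ /= !O Ef.
set p1 := \tr _; set p2 := bilin _ _ _ * _; set p3 := bilin A _ _; lra.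
Qed.

End Bilin.

(** * Derivatives of determinants and symmetry of second derivatives *)

Section JacobiFormula.
Context {R : realType} {m : nat}.
Implicit Types (y : 'rV[R]_m).
Let e_ (a : 'I_m) : 'rV[R]_m := delta_mx ord0 a.

Lemma derivable_scale (c : R) (f : 'rV[R]_m -> R) a y :
  derivable f y (e_ a) -> derivable (fun z => c * f z) y (e_ a).
Proof. by move=> df; exact: (derivableM (derivable_cst c y (e_ a)) df). Qed.

Lemma derivable_prod (I : Type) (r : seq I) (P : pred I) (F : I -> 'rV[R]_m -> R) a y :
  (forall i, derivable (F i) y (e_ a)) -> derivable (fun z => \prod_(i <- r | P i) F i z) y (e_ a).
Proof.
move=> H; elim: r => [|i r IH]; first by under eq_fun do rewrite big_nil; exact: derivable_cst.
under eq_fun do rewrite big_cons.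
by case: (P i); [exact: (derivableM (H i) IH)|exact: IH].
Qed.

Lemma partial_prod1 (I : Type) (r : seq I) (F : I -> 'rV[R]_m -> R) a y :
  (forall i, derivable (F i) y (e_ a)) -> (forall i, F i y = 1) ->
  partial a (fun z => \prod_(i <- r) F i z) y = \sum_(i <- r) partial a (F i) y.
Proof.
move=> H F1; elim: r => [|i r IH].
  by under eq_fun do rewrite big_nil; rewrite big_nil; exact: partial_cst.
under eq_fun do rewrite big_cons.
rewrite big_cons partialM //; last exact: derivable_prod.
by rewrite IH F1 mul1r big1 ?mulr1 // => j _; exact: F1.
Qed.

(** At the identity matrix only the identity permutation matters: any other permutation moves at
    least two indices, so its product has two factors vanishing at y and its derivative vanishes
    too. *)
Lemma partial_det1 k (B : 'rV[R]_m -> 'M[R]_k) a y :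
  (forall i j, derivable (fun z => B z i j) y (e_ a)) -> B y = 1%:M ->
  partial a (fun z => \det (B z)) y = \sum_i partial a (fun z => B z i i) y.
Proof.
move=> dB B1.
have dP (s : {perm 'I_k}) : derivable (fun z => \prod_i B z i (s i)) y (e_ a) by exact: derivable_prod.
have [_ ->] := @partial_sum R m _ (index_enum _) xpredT (fun (s : {perm 'I_k}) z => (-1) ^+ s * \prod_i B z i (s i)) a y
  (fun s => @derivable_scale ((-1) ^+ s) _ a y (dP s)).
rewrite (bigD1 1%g) //= [X in _ + X]big1 ?addr0 => [|s s1].
  rewrite partialZ // odd_perm1 expr0 mul1r.
  have -> : (fun z => \prod_i B z i ((1%g : {perm 'I_k}) i)) = (fun z => \prod_i B z i i).
    by apply/funext => z; apply: eq_bigr => i _; rewrite perm1.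
  by apply: partial_prod1 => // i; rewrite B1 mxE eqxx.
rewrite partialZ //; have [i si] : exists i, s i != i.
  by apply/existsP; apply: contraR s1 => /existsPn H; apply/eqP/permP => i; rewrite perm1; apply/eqP; have := H i; rewrite negbK.
pose j := s i; have sj : s j != j by apply: contra si => /eqP /perm_inj /eqP.
have E : (fun z => \prod_i B z i (s i)) =
    (fun z => B z i (s i) * (B z j (s j) * \prod_(l | (l != i) && (l != j)) B z l (s l))).
  apply/funext => z; rewrite (bigD1 i) //= (bigD1 j) //=.
have dr : derivable (fun z => \prod_(l | (l != i) && (l != j)) B z l (s l)) y (e_ a) by exact: derivable_prod.
have d2 : derivable (fun z => B z j (s j) * \prod_(l | (l != i) && (l != j)) B z l (s l)) y (e_ a).
  exact: (derivableM (dB _ _) dr).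
rewrite E (partialM (dB _ _) d2) (partialM (dB _ _) dr).
have z1 : B y i (s i) = 0 by rewrite B1 mxE eq_sym (negbTE si).
have z2 : B y j (s j) = 0 by rewrite B1 mxE eq_sym (negbTE sj).
by rewrite z1 z2 !(mul0r, mulr0, addr0).
Qed.

(** Jacobi's formula, reduced to [partial_det1] by multiplying B with the constant inverse of B
    y. *)
Lemma partial_det k (B : 'rV[R]_m -> 'M[R]_k) a y :
  (forall i j, derivable (fun z => B z i j) y (e_ a)) -> B y \in unitmx ->
  partial a (fun z => \det (B z)) y =
  \det (B y) * \sum_i \sum_j invmx (B y) i j * partial a (fun z => B z j i) y.
Proof.
move=> dB uB; pose C z := invmx (B y) *m B z.
have dC i j : derivable (fun z => C z i j) y (e_ a) /\
    partial a (fun z => C z i j) y = \sum_l invmx (B y) i l * partial a (fun z => B z l j) y.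
  have -> : (fun z => C z i j) = (fun z => \sum_l invmx (B y) i l * B z l j) by apply/funext => z; rewrite mxE.
  have [D1 D2] := @partial_sum R m _ (index_enum _) xpredT (fun l z => invmx (B y) i l * B z l j) a y
    (fun l => @derivable_scale (invmx (B y) i l) _ a y (dB l j)).
  by split=> //; rewrite D2; apply: eq_bigr => l _; rewrite partialZ.
have -> : (fun z => \det (B z)) = (fun z => \det (B y) * \det (C z)).
  by apply/funext => z; rewrite -det_mulmx mulKVmx.
have C1 : C y = 1%:M by rewrite /C mulVmx.
have dd : derivable (fun z => \det (C z)) y (e_ a).
  refine (@partial_sum R m _ (index_enum _) xpredT (fun (s : {perm 'I_k}) z => (-1) ^+ s * \prod_i C z i (s i)) a y _).1 => s.
  apply: derivable_scale.
  by apply: derivable_prod => i; case: (dC i (s i)).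
rewrite partialZ // (partial_det1 (fun i j => (dC i j).1) C1); congr (_ * _).
by apply: eq_bigr => i _; case: (dC i i).
Qed.

Lemma difference_swap (x1 x2 x3 x4 : R) : x1 - x2 - (x3 - x4) = x1 - x3 - (x2 - x4).
Proof. ring. Qed.

Lemma dist_half (x1 x2 x3 e : R) : `|x1 - x2| < e / 2 -> `|x1 - x3| < e / 2 -> `|x2 - x3| <= e.
Proof. by rewrite !ltr_norml ler_norml => /andP[? ?] /andP[? ?]; apply/andP; split; lra. Qed.

(* Second differences, computed by the mean value theorem in both orders. *)
Lemma schwarz (V : set 'rV[R]_m) (f : 'rV[R]_m -> R) a b y : open V -> isCk 2 V f -> V y ->
  partial a (partial b f) y = partial b (partial a f) y.
Proof.
move=> oV Cf Vy.
have MV (h : 'rV[R]_m -> R) z c s : (forall t : R, 0 <= t <= 1 -> V (z + (t * s) *: e_ c)) -> isCk 1 V h ->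
    exists2 t : R, 0 <= t <= 1 & h (z + s *: e_ c) - h z = s * partial c h (z + (t * s) *: e_ c).
  by move=> Hz Ch; apply: MVT_delta => t /Hz Vt; exact: (Ck_derivable Ch Vt).
have [r0 r00 Hr0] : exists2 r : R, 0 < r & forall z, `|z - y| < r -> V z.
  by apply/nbhs_rV; exact: open_nbhs_nbhs.
have nd (z : 'rV[R]_m) c (t s : R) : 0 <= t <= 1 -> 0 <= s -> `|z + (t * s) *: e_ c - y| <= `|z - y| + s.
  move=> /andP[t0 t1] s0; rewrite addrAC; apply: (le_trans (ler_normD _ _)); rewrite lerD2l.
  rewrite normrZ normrM !ger0_norm // -[leRHS]mulr1; apply: ler_pM => //; first by rewrite mulr_ge0.
    by rewrite ler_piMl.
  exact: norm_delta_le.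
have half (c d : 'I_m) (s : R) : 0 < s -> 3 * s < r0 -> exists2 p, `|p - y| <= 2 * s &
    f (y + s *: e_ c + s *: e_ d) - f (y + s *: e_ c) - (f (y + s *: e_ d) - f y)
      = s * (s * partial d (partial c f) p).
  move=> s0 sr.
  pose h z := f (z + s *: e_ d) - f z.
  have [W [oW Wh Wn]] : exists W, [/\ open W, (forall z, `|z - y| < r0 - s -> W z) & forall z, W z -> V z /\ V (z + s *: e_ d)].
    exists (ball y (r0 - s)); split; first exact: ball_open.
      by move=> z zy; rewrite -ball_normE /= distrC.
    move=> z; rewrite -ball_normE /= distrC => zy; split; apply: Hr0; first lra.
    have := nd z d 1 s; rewrite mul1r lexx ler01 => /(_ isT (ltW s0)); lra.
  have dh z e : W z -> derivable h z (e_ e) /\ partial e h z = partial e f (z + s *: e_ d) - partial e f z.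
    move=> /Wn[V1 V2]; have d1 := @derivable_translate R m e f (s *: e_ d) z (@Ck_derivable R m 1 V f Cf _ V2 e); have d2 := @Ck_derivable R m 1 V f Cf _ V1 e.
    split; first exact: (derivableB d1 d2).
    by rewrite -(partial_translate e f); exact: (deriveB d1 d2).
  have yz : `|y - y| = 0 by rewrite subrr normr0.
  have [t t1 E1] : exists2 t : R, 0 <= t <= 1 & h (y + s *: e_ c) - h y = s * partial c h (y + (t * s) *: e_ c).
    apply: MVT_delta => t t1; apply: (dh _ c _).1; apply: Wh.
    by have := nd y c t s t1 (ltW s0); rewrite yz; lra.
  have q1 := nd y c t s t1 (ltW s0); rewrite yz add0r in q1.
  have Hq (t' : R) : 0 <= t' <= 1 -> V (y + (t * s) *: e_ c + (t' * s) *: e_ d).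
    by move=> t'1; apply: Hr0; have := nd (y + (t * s) *: e_ c) d t' s t'1 (ltW s0); lra.
  have [t' t'1 E2] := MV _ _ d s Hq (Ck_partial Cf c).
  exists (y + (t * s) *: e_ c + (t' * s) *: e_ d).
    by have := nd (y + (t * s) *: e_ c) d t' s t'1 (ltW s0); lra.
  have -> : f (y + s *: e_ c + s *: e_ d) - f (y + s *: e_ c) - (f (y + s *: e_ d) - f y) = h (y + s *: e_ c) - h y by [].
  have Wq : W (y + (t * s) *: e_ c) by apply: Wh; lra.
  by rewrite E1 (dh _ c Wq).2 E2.
apply/eqP; rewrite -subr_eq0; apply/eqP; apply: (@small_eq0 _ _ 1) => e e0; rewrite mulr1.
have e2 : 0 < e / 2 by rewrite divr_gt0.
have ca := Ck_continuous (Ck_partial (Ck_partial Cf b) a) Vy.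
have cb := Ck_continuous (Ck_partial (Ck_partial Cf a) b) Vy.
have [d1 d10 H1] := (continuous_rVP _ y).1 ca _ e2; have [d2 d20 H2] := (continuous_rVP _ y).1 cb _ e2.
pose s := Num.min r0 (Num.min d1 d2) / 4.
have m0 : 0 < Num.min r0 (Num.min d1 d2) by rewrite !lt_min r00 d10.
have l0 : Num.min r0 (Num.min d1 d2) <= r0 by rewrite ge_min lexx.
have l1 : Num.min r0 (Num.min d1 d2) <= d1 by rewrite !ge_min lexx orbT.
have l2 : Num.min r0 (Num.min d1 d2) <= d2 by rewrite !ge_min lexx !orbT.
have s0 : 0 < s by rewrite divr_gt0.
have [sr s1 s2] : [/\ 3 * s < r0, 2 * s < d1 & 2 * s < d2] by rewrite /s; split; lra.
have [p py Ep] := half b a s s0 sr; have [q qy Eq] := half a b s s0 sr.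
have E : partial a (partial b f) p = partial b (partial a f) q.
  apply: (mulfI (lt0r_neq0 s0)); apply: (mulfI (lt0r_neq0 s0)).
  have {}Ep := esym Ep; apply: (etrans Ep); apply: (etrans _ Eq).
  have -> : y + s *: e_ b + s *: e_ a = y + s *: e_ a + s *: e_ b by exact: addrAC.
  exact: difference_swap.
have h1 := H1 p (le_lt_trans py s1); have h2 := H2 q (le_lt_trans qy s2); rewrite E in h1.
exact: (dist_half h1 h2).
Qed.

End JacobiFormula.

(** * The weak Bochner formula in coordinates *)

Section WeakBochner.
Context {R : realType} {m : nat}.
Implicit Types (y : 'rV[R]_m).
Let L (f : 'rV[R]_m -> R) := Int (leb m) f.
Let e_ (a : 'I_m) : 'rV[R]_m := delta_mx ord0 a.

Variables (w eta : 'rV[R]_m -> R) (v : 'I_m -> 'rV[R]_m -> R) (Gam : 'I_m -> 'I_m -> 'I_m -> 'rV[R]_m -> R).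
Variables (U K : set 'rV[R]_m).
Hypotheses (Cw : isCk 1 setT w) (Cv : forall a, c1c (v a)) (CGam : forall c a b, isCk 1 setT (Gam c a b)).
Hypotheses (oU : open U) (Ceta : c1c eta) (cK : compact K) (KU : K `<=` U) (etaK : forall y, eta y != 0 -> K y).
Let gam b y := \sum_c Gam c c b y.
Hypothesis dw : forall y, U y -> forall b, partial b w y = w y * gam b y.
Hypothesis Gam_sym : forall y, U y -> forall c a b, Gam c a b y = Gam c b a y.
Hypothesis div0 : forall y, U y -> \sum_b partial b (v b) y + \sum_b gam b y * v b y = 0.

(** In the application v is a gradient field, Gam the Levi-Civita connection and w the volume
    density, all multiplied by a cutoff that equals 1 near the support of eta. This is why the
    identities relating them are assumed on U only. *)
Definition covd a b y := partial a (v b) y + \sum_c Gam b a c y * v c y.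

Definition ricci_of a b y :=
  \sum_c (partial c (Gam c a b) y - partial b (Gam c a c) y)
   + \sum_c \sum_d (Gam c c d y * Gam d a b y - Gam c b d y * Gam d a c y).

(** For a divergence-free field v, the field D_v v has divergence tr((Dv)^2) + Ric(v, v), where D is
    the covariant derivative. This is the integrand of the weak form of that identity, tested with
    eta and weighted by the volume density. *)
Definition bochner_term y :=
  w y * (\sum_a \sum_b v a y * covd a b y * partial b eta y) +
  eta y * w y * (\sum_a \sum_b covd a b y * covd b a y + \sum_a \sum_b ricci_of a b y * v a y * v b y).

Let m_ a y := w y * v a y.
(** On U this equals the coordinate divergence of v by [div0], but it contains no derivative of v
    and is therefore C^1, whereas the divergence is a priori only continuous. *)
Let theta y := - \sum_b gam b y * v b y.
Let kap b y := \sum_a \sum_c Gam b a c y * v a y * v c y.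

Let oT : open [set: 'rV[R]_m] := openT.
Let C1v a := (Cv a).1.
Let Cgam b : isCk 1 setT (gam b).
Proof. by apply: Ck_sum. Qed.
Let Cm a : isCk 1 setT (m_ a).
Proof. exact: CkM. Qed.
Let Ctheta : isCk 1 setT theta.
Proof. by apply: CkN => //; apply: Ck_sum => // b _; apply: CkM. Qed.
Let Ckap b : isCk 1 setT (kap b).
Proof. by apply: Ck_sum => // a _; apply: Ck_sum => // c _; apply: CkM => //; exact: CkM. Qed.

Let D (f : 'rV[R]_m -> R) a y : isCk 1 setT f -> derivable f y (e_ a).
Proof. by move=> /Ck_derivable /(_ y I a). Qed.

Let Ceta_ (f : 'rV[R]_m -> R) : isCk 1 setT f -> c1c (fun y => f y * eta y).
Proof. by move=> Cf; exact: c1cM. Qed.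

(** [T1] and [T2] have equal integrals by [Int_commute], which replaces the formal exchange of the
    derivatives of v. [T3] and [T4] are derivatives of compactly supported C^1 functions and
    integrate to zero. *)
Let T1 a b y := partial a (v b) y * partial b (fun z => m_ a z * eta z) y.
Let T2 a b y := partial b (v b) y * partial a (fun z => m_ a z * eta z) y.
Let T3 a y := partial a (fun z => theta z * m_ a z * eta z) y.
Let T4 b y := partial b (fun z => w z * kap b z * eta z) y.

Let cT1 a b : cc (T1 a b).
Proof. by apply: ccM; [case: (c1c_partial a (Cv b))|apply: c1c_partial; exact: Ceta_]. Qed.
Let cT2 a b : cc (T2 a b).
Proof. by apply: ccM; [case: (c1c_partial b (Cv b))|apply: c1c_partial; exact: Ceta_]. Qed.
Let cT3 a : cc (T3 a).
Proof. by apply: c1c_partial; apply: Ceta_; exact: CkM. Qed.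
Let cT4 b : cc (T4 b).
Proof. by apply: c1c_partial; apply: Ceta_; exact: CkM. Qed.

Let total y := (\sum_a \sum_b T1 a b y - \sum_a \sum_b T2 a b y) + (\sum_a T3 a y + \sum_b T4 b y).

Let Int_total : L total = 0.
Proof.
have c1 : cc (fun y => \sum_a \sum_b T1 a b y) by apply: cc_sum => a _; apply: cc_sum.
have c2 : cc (fun y => \sum_a \sum_b T2 a b y) by apply: cc_sum => a _; apply: cc_sum.
have c3 : cc (fun y => \sum_a T3 a y) by apply: cc_sum.
have c4 : cc (fun y => \sum_b T4 b y) by apply: cc_sum.
have H := @haus_rV R m; have LC := @leb_compact R m.
rewrite /L /total (IntD H LC (ccB c1 c2) (ccD c3 c4)) (IntB H LC c1 c2) (IntD H LC c3 c4).
have IS (F : 'I_m -> 'rV[R]_m -> R) : (forall i, cc (F i)) ->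
    Int (leb m) (fun y => \sum_i F i y) = \sum_i Int (leb m) (F i).
  by move=> cF; apply: (Int_sum H LC) => i _; exact: cF.
rewrite (IS (fun a y => \sum_b T1 a b y)) => [|a]; last exact: cc_sum.
rewrite (IS (fun a y => \sum_b T2 a b y)) => [|a]; last exact: cc_sum.
rewrite (IS T3 cT3) (IS T4 cT4).
rewrite [X in _ + (X + _)]big1 => [|a _]; last by apply: Int_partial; apply: Ceta_; exact: CkM.
rewrite [X in _ + (_ + X)]big1 => [|b _]; last by apply: Int_partial; apply: Ceta_; exact: CkM.
rewrite !addr0; apply/eqP; rewrite subr_eq0; apply/eqP; apply: eq_bigr => a _.
rewrite (IS (T1 a) (cT1 a)) (IS (T2 a) (cT2 a)).
by apply: eq_bigr => b _; exact: (Int_commute a b (Cv b) (Ceta_ (Cm a))).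
Qed.

Let eta0 y : ~ K y -> eta y = 0 /\ forall b, partial b eta y = 0.
Proof.
move=> nK; split; first by apply/eqP/negPn/negP => /etaK.
move=> b; apply/eqP/negPn/negP => /(partial_supp (compact_closed (@haus_rV R m) cK) etaK) //.
Qed.

Let pM (f h : 'rV[R]_m -> R) a y : isCk 1 setT f -> isCk 1 setT h ->
  partial a (fun z => f z * h z) y = partial a f y * h y + f y * partial a h y.
Proof. by move=> Cf Ch; apply: partialM; exact: D. Qed.

(* At a point the integrand becomes a polynomial identity between the matrices D = (d_a v^b) and
   Q = (Gam^b_ac v^c), whose sum is the covariant derivative of v. *)
Let pointwise y : total y = bochner_term y.
Proof.
have [Ky|nK] := pselect (K y); last first.
  have [e0 de0] := eta0 nK.
  rewrite /bochner_term /total e0 !mul0r addr0 [X in w y * X]big1 ?mulr0 => [|a _]; last first.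
    by rewrite big1 // => b _; rewrite de0 mulr0.
  have Z f a : isCk 1 setT f -> partial a (fun z => f z * eta z) y = 0.
    by move=> Cf; rewrite pM //; [rewrite e0 de0 !mulr0 addr0|exact: Ceta.1].
  rewrite big1 => [|a _]; last by rewrite big1 // => b _; rewrite /T1 Z ?mulr0.
  rewrite [X in _ - X]big1 => [|a _]; last by rewrite big1 // => b _; rewrite /T2 Z ?mulr0.
  rewrite big1 => [|a _]; last by rewrite /T3 Z //; exact: CkM.
  rewrite big1 => [|a _]; last by rewrite /T4 Z //; exact: CkM.
  by rewrite subr0 !addr0.
have Uy := KU Ky.
pose W := w y; pose e := eta y; pose de b := partial b eta y.
pose V a := v a y; pose DD a b := partial a (v b) y.
pose g_ b := gam b y; pose dg a b := partial a (gam b) y.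
pose Q a b := \sum_c Gam b a c y * v c y.
have th : theta y = \sum_b DD b b.
  by apply/eqP; rewrite /theta eq_sym -addr_eq0 (div0 Uy).
have dm a b : partial b (m_ a) y = W * g_ b * V a + W * DD b a.
  by rewrite pM // dw.
have dme a b : partial b (fun z => m_ a z * eta z) y =
    (W * g_ b * V a + W * DD b a) * e + W * V a * de b.
  by rewrite pM //; [rewrite dm|exact: Ceta.1].
have dth a : partial a theta y = - \sum_b (dg a b * V b + g_ b * DD a b).
  rewrite /theta.
  have -> : (fun z => - \sum_b gam b z * v b z) = (fun z => (-1) * \sum_b gam b z * v b z).
    by apply/funext => z; rewrite mulN1r.
  have [d1 d2] := @partial_sum R m _ (index_enum _) xpredT (fun b z => gam b z * v b z) a y
    (fun b => D (CkM oT (Cgam b) (C1v b))).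
  by rewrite partialZ // mulN1r d2; congr (- _); apply: eq_bigr => b _; rewrite pM.
pose k_ b := kap b y.
have kE b : k_ b = \sum_a V a * Q a b.
  by apply: eq_bigr => a _; rewrite /Q mulr_sumr; apply: eq_bigr => c _; rewrite /V; ring.
pose dG c a b d := partial d (Gam c a b) y.
have dk b : partial b (kap b) y = \sum_a \sum_c dG b a c b * V a * V c + 2 * \sum_a Q a b * DD b a.
  rewrite /kap.
  have CC a c : isCk 1 setT (fun z => Gam b a c z * v a z * v c z) by apply: CkM => //; exact: CkM.
  have CS a : isCk 1 setT (fun z => \sum_c Gam b a c z * v a z * v c z) by apply: Ck_sum.
  have [_ ->] := @partial_sum R m _ (index_enum _) xpredT (fun a z => \sum_c Gam b a c z * v a z * v c z) b y
    (fun a => D (CS a)).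
  have E a : partial b (fun z => \sum_c Gam b a c z * v a z * v c z) y =
     \sum_c dG b a c b * V a * V c + \sum_c Gam b a c y * DD b a * V c + \sum_c Gam b a c y * V a * DD b c.
    have [_ ->] := @partial_sum R m _ (index_enum _) xpredT (fun c z => Gam b a c z * v a z * v c z) b y
      (fun c => D (CC a c)).
    rewrite -!big_split /=; apply: eq_bigr => c _; rewrite pM //; last exact: CkM.
    by rewrite pM // mulrDl.
  under eq_bigr do rewrite E; rewrite !big_split /= -addrA; congr (_ + _).
  rewrite [X in _ + X]exchange_big /= mulr_natl mulr2n; congr (_ + _); apply: eq_bigr => a _.
    by rewrite /Q mulr_suml; apply: eq_bigr => c _; rewrite /V; ring.
  by rewrite /Q mulr_suml; apply: eq_bigr => c _; rewrite (Gam_sym Uy b c a) /V.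
(* Both sides are expanded in these nine contractions. S2 cancels between [E1] and [E23], and S9
   between [EN] and [ER]. *)
pose S1 := \sum_a \sum_b DD a b * (V a * de b).
pose S2 := \sum_a \sum_b DD a b * (g_ b * V a).
pose S3 := \sum_a \sum_b DD a b * DD b a.
pose S4 := \sum_a \sum_b V a * V b * dg a b.
pose S5 := \sum_b de b * k_ b.
pose S6 := \sum_b g_ b * k_ b.
pose S7 := \sum_b \sum_a \sum_c dG b a c b * V a * V c.
pose S8 := \sum_a \sum_b Q a b * DD b a.
pose S9 := \sum_a \sum_b Q a b * Q b a.
have E1 : \sum_a \sum_b T1 a b y = W * S1 + e * W * S2 + e * W * S3.
  rewrite /S1 /S2 /S3 !mulr_sumr -!big_split /=; apply: eq_bigr => a _.
  rewrite !mulr_sumr -!big_split /=; apply: eq_bigr => b _; rewrite /T1 dme -/(DD a b); ring.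
have E23 : \sum_a T3 a y = \sum_a \sum_b T2 a b y - e * W * S4 - e * W * S2.
  have -> : \sum_a \sum_b T2 a b y = \sum_a theta y * partial a (fun z => m_ a z * eta z) y.
    by apply: eq_bigr => a _; rewrite th mulr_suml.
  rewrite /S4 /S2 !mulr_sumr -!sumrB; apply: eq_bigr => a _; rewrite /T3.
  have -> : (fun z => theta z * m_ a z * eta z) = (fun z => theta z * (m_ a z * eta z)).
    by apply/funext => z; rewrite -[LHS]mulrA.
  rewrite (@pM _ _ a y Ctheta (Ceta_ (Cm a)).1).
  rewrite dth addrC -addrA; congr (_ + _).
  rewrite !mulr_sumr -opprD -big_split /= mulNr; congr (- _); rewrite mulr_suml; apply: eq_bigr => b _.
  rewrite /m_ -/W -/e -/(V a); ring.
have E4 : \sum_b T4 b y = W * S5 + e * W * S6 + e * W * S7 + 2 * (e * W * S8).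
  have -> : S8 = \sum_b \sum_a Q a b * DD b a by rewrite /S8 exchange_big.
  rewrite /S5 /S6 /S7 !mulr_sumr -!big_split /=; apply: eq_bigr => b _.
  rewrite /T4 pM //; [|exact: CkM|exact: Ceta.1].
  rewrite (@pM _ _ b y Cw (Ckap b)) dw // dk -/W -/e -/(de b) -/(g_ b) -/(k_ b).
  set s1 := \sum_a \sum_c _; set s2 := \sum_a Q a b * _; ring.
have EN : \sum_a \sum_b covd a b y * covd b a y = S3 + 2 * S8 + S9.
  have -> : 2 * S8 = S8 + \sum_a \sum_b DD a b * Q b a.
    rewrite mulr_natl mulr2n; congr (_ + _); rewrite /S8 exchange_big /=.
    by apply: eq_bigr => a _; apply: eq_bigr => b _; rewrite mulrC.
  rewrite /S3 /S8 /S9 -!big_split /=; apply: eq_bigr => a _; rewrite -!big_split /=.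
  by apply: eq_bigr => b _; rewrite /covd -/(DD a b) -/(DD b a) -/(Q a b) -/(Q b a); ring.
have EV : w y * (\sum_a \sum_b v a y * covd a b y * partial b eta y) = W * S1 + W * S5.
  rewrite -mulrDr; congr (_ * _); rewrite /S5.
  have -> : \sum_b de b * k_ b = \sum_a \sum_b de b * (V a * Q a b).
    by rewrite exchange_big /=; apply: eq_bigr => b _; rewrite kE mulr_sumr.
  rewrite /S1 -big_split /=; apply: eq_bigr => a _; rewrite -big_split /=; apply: eq_bigr => b _.
  by rewrite /covd -/(DD a b) -/(Q a b) -/(V a) -/(de b); ring.
have swap3 (F : 'I_m -> 'I_m -> 'I_m -> R) :
    \sum_a \sum_b (\sum_d F d a b) * V a * V b = \sum_d \sum_a \sum_b F d a b * V a * V b.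
  rewrite [RHS]exchange_big /=; apply: eq_bigr => a _; rewrite [RHS]exchange_big /=; apply: eq_bigr => b _.
  by rewrite !mulr_suml.
have R1 : \sum_a \sum_b (\sum_c dG c a b c) * V a * V b = S7 by rewrite swap3.
have R2 : \sum_a \sum_b (\sum_c dG c a c b) * V a * V b = S4.
  rewrite /S4 [RHS]exchange_big /=; apply: eq_bigr => a _; apply: eq_bigr => b _.
  have [_ E] := @partial_sum R m _ (index_enum _) xpredT (fun c z => Gam c c a z) b y (fun c => D (CGam c c a)).
  rewrite /dg /gam E -mulrA [V b * V a]mulrC [RHS]mulrC; congr (_ * _); apply: eq_bigr => c _.
  by apply: (partial_ext oU) => // z; rewrite inE => Uz; exact: Gam_sym.
have R3 : \sum_a \sum_b (\sum_c \sum_d Gam c c d y * Gam d a b y) * V a * V b = S6.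
  under eq_bigr do under eq_bigr do rewrite exchange_big.
  rewrite swap3 /S6; apply: eq_bigr => d _; rewrite /k_ /kap mulr_sumr; apply: eq_bigr => a _.
  rewrite mulr_sumr; apply: eq_bigr => b _; rewrite -mulr_suml -!mulrA; congr (_ * (_ * _)).
have R4 : \sum_a \sum_b (\sum_c \sum_d Gam c b d y * Gam d a c y) * V a * V b = S9.
  rewrite swap3 /S9; apply: eq_bigr => c _.
  have -> : \sum_a \sum_b (\sum_d Gam c b d y * Gam d a c y) * V a * V b =
      \sum_d \sum_a \sum_b (Gam c b d y * Gam d a c y) * V a * V b by rewrite swap3.
  apply: eq_bigr => d _; rewrite {1}/Q mulr_suml; apply: eq_bigr => a _.
  rewrite /Q mulr_sumr; apply: eq_bigr => b _; rewrite (Gam_sym Uy c b d) (Gam_sym Uy d a c) /V; ring.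
have ER : \sum_a \sum_b ricci_of a b y * v a y * v b y = S7 - S4 + S6 - S9.
  rewrite -R1 -R2 -R3 -R4 -!sumrB -!big_split -!sumrB /=; apply: eq_bigr => a _.
  rewrite -!sumrB -!big_split -!sumrB /=; apply: eq_bigr => b _; rewrite /ricci_of sumrB.
  under [X in _ + X]eq_bigr do rewrite sumrB.
  rewrite sumrB /dG /V; ring.
rewrite /total /bochner_term EV EN ER E1 E23 E4 -/W -/e; ring.
Qed.

Lemma weak_bochner : Int (leb m) bochner_term = 0.
Proof. by rewrite -Int_total /L; congr Int; apply/funext => y; rewrite pointwise. Qed.

End WeakBochner.

(** * Bump functions in R^m *)

Section Bump.
Context {R : realType} {m : nat}.
Implicit Types (V K : set 'rV[R]_m) (y : 'rV[R]_m).

Definition cube_bump (x : 'rV[R]_m) (r : R) y : R :=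
  \prod_a (step (2 - r^-1 * (y ord0 a - x ord0 a)) * step (2 + r^-1 * (y ord0 a - x ord0 a))).

Lemma Ck_cube_bump N x r V : open V -> isCk N V (cube_bump x r).
Proof.
move=> oV; apply: Ck_prod => // a _; have C1 : isCk N V (fun y => r^-1 * (y ord0 a - x ord0 a)).
  by apply: CkZ => //; apply: CkB => //; [exact: Ck_coord|exact: Ck_cst].
by apply: CkM => //; apply: Ck_step => //; [apply: CkB|apply: CkD] => //; exact: Ck_cst.
Qed.

Lemma cube_bump_ge0 x r y : 0 <= cube_bump x r y.
Proof. by apply: prodr_ge0 => a _; rewrite mulr_ge0 ?step_ge0. Qed.

Lemma cube_bump1 x r y : 0 < r -> `|y - x| < r -> cube_bump x r y = 1.
Proof.
move=> r0 yx; apply: big1 => a _; have := le_lt_trans (coord_le_norm _ a) yx.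
rewrite !mxE => h; have : `|r^-1 * (y ord0 a - x ord0 a)| < 1.
  by rewrite normrM gtr0_norm ?invr_gt0 // mulrC ltr_pdivrMr // mul1r.
rewrite ltr_norml => /andP[h1 h2].
by rewrite !step1 ?mulr1 //; lra.
Qed.

Lemma cube_bump0 x r y : 0 < r -> 2 * r < `|y - x| -> cube_bump x r y = 0.
Proof.
move=> r0 yx; have [a ha] : exists a, 2 * r < `|(y - x) ord0 a|.
  apply/not_existsP => H; move: yx; apply/negP; rewrite -leNgt; apply: norm_le_coord; first lra.
  by move=> a; rewrite leNgt; apply/negP; exact: H.
rewrite /cube_bump (bigD1 a) //=; move: ha; rewrite !mxE => ha.
have {}ha : 2 < `|r^-1 * (y ord0 a - x ord0 a)|.
  by rewrite normrM gtr0_norm ?invr_gt0 // mulrC ltr_pdivlMr.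
have [h|h] : r^-1 * (y ord0 a - x ord0 a) < -2 \/ 2 < r^-1 * (y ord0 a - x ord0 a).
  by move: ha; rewrite ltr_normr => /orP[h|h]; [right|left]; lra.
- by rewrite [X in _ * X * _]step0 ?mulr0 ?mul0r //; lra.
- by rewrite [X in X * _ * _]step0 ?mul0r //; lra.
Qed.

(** Finitely many cube bumps, each equal to 1 on a cube of radius r and vanishing off the cube of
    radius 2 r, sum to at least 1 near K; composing with [step] caps the sum at 1. Cubes of radius 3
    r inside V leave room for the closed ones of radius 2 r. *)
Lemma bump_rV K V : compact K -> open V -> K `<=` V ->
  exists chi : 'rV[R]_m -> R, exists U K' : set 'rV[R]_m,
    [/\ forall N, isCk N setT chi, (forall y, 0 <= chi y <= 1) &
        [/\ open U, K `<=` U, (forall y, U y -> chi y = 1), compact K' &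
            K' `<=` V /\ forall y, chi y != 0 -> K' y]].
Proof.
move=> cK oV KV.
have /choice[r Hr] : forall x : 'rV[R]_m, exists r : R, 0 < r /\ (V x -> forall z, `|z - x| < 3 * r -> V z).
  move=> x; have [Vx|] := pselect (V x); last by exists 1; split.
  have [r r0 H] : exists2 r : R, 0 < r & forall z, `|z - x| < r -> V z.
    by apply/nbhs_rV; exact: open_nbhs_nbhs.
  exists (r / 3); split; first by rewrite divr_gt0.
  by move=> _ z zx; apply: H; lra.
have r0 x : 0 < r x by case: (Hr x).
have cK' : cover_compact K by rewrite -compact_cover.
have [||D DV KD] := cK' 'rV[R]_m V (fun x => ball x (r x)).
- by move=> x _; exact: ball_open.
- by move=> x Kx; exists x; [exact: KV|exact: ballxx].
pose S y := \sum_(x <- enum_fset D) cube_bump x (r x) y.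
pose U := \bigcup_(x in [set` D]) ball x (r x).
pose K' := \bigcup_(x in [set` D]) closed_ball x (2 * r x).
have oT : open [set: 'rV[R]_m] := openT.
exists (fun y => step (S y)), U, K'; split.
- by move=> N; apply: Ck_step => //; apply: Ck_sum => // x _; exact: Ck_cube_bump.
- by move=> y; rewrite step_ge0 step_le1.
split.
- by apply: bigcup_open => x _; exact: ball_open.
- exact: KD.
- move=> y [x /= xD]; rewrite -ball_normE /= distrC => yx; apply: step1.
  rewrite /S (big_rem x) //= cube_bump1 // lerDl sumr_ge0 // => z _; exact: cube_bump_ge0.
- rewrite /K' bigcup_fset; apply: bigsetU_compact => x _.
  have -> : closed_ball x (2 * r x) = cbox (x - const_mx (2 * r x)) (x + const_mx (2 * r x)).
    rewrite closed_ballE ?mulr_gt0 //; apply/seteqP; split=> z; rewrite /closed_ball_ /=.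
      move=> h a; have := le_trans (coord_le_norm _ a) h; rewrite !mxE ler_norml; lra.
    move=> h; apply: norm_le_coord; first by rewrite mulr_ge0 // ltW.
    by move=> a; have := h a; rewrite !mxE ler_norml; lra.
  exact: compact_cbox.
split.
  move=> y [x /= xD]; rewrite closed_ballE ?mulr_gt0 // /closed_ball_ /= distrC => yx.
  have [_ H] := Hr x; apply: H; first by apply/set_mem; exact: DV.
  by have := r0 x; lra.
move=> y Sy; apply: contrapT => nK; move: Sy; rewrite step0 ?eqxx // /S big_seq big1 // => x xD.
apply: cube_bump0 => //; rewrite ltNge; apply/negP => yx; apply: nK; exists x => //.
by rewrite closed_ballE ?mulr_gt0 // /closed_ball_ /= distrC.
Qed.

Lemma Ck_glob N K V (chi f : 'rV[R]_m -> R) : open V -> compact K -> K `<=` V ->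
  (forall y, chi y != 0 -> K y) -> isCk N setT chi -> isCk N V f -> isCk N setT (fun y => chi y * f y).
Proof.
move=> oV cK KV chiK Cchi Cf; have clK : closed K by apply: compact_closed => //; exact: haus_rV.
have oK : open (~` K) by exact: closed_openC.
apply: Ck_bigcup => y _; have [Vy|nV] := pselect (V y).
  by exists V => //; apply: CkM => //; exact: Ck_sub Cchi.
exists (~` K); first by move=> /KV.
apply: (@Ck_ext _ _ _ _ (cst 0)) => //; last exact: Ck_cst.
by move=> z; rewrite inE => nK; apply/eqP; rewrite /= eq_sym mulf_eq0 (contra_notT (chiK z) nK).
Qed.

End Bump.

(** * Kähler geometry in a chart *)

Section MetricCalculus.
Context {R : realType} {n : nat}.
Let m := (n + n)%N.
Variables (V : set 'rV[R]_(n + n)) (gm : 'rV[R]_(n + n) -> 'M[R]_(n + n)) (f : 'rV[R]_(n + n) -> R).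
Hypotheses (oV : open V) (Cg : forall N a b, isCk N V (fun y => gm y a b)).
Hypotheses (gramg : forall y, V y -> gram (gm y)) (Cf : isCk 2 V f).
Hypothesis herm : forall y, V y -> Jmx *m gm y *m Jmx^T = gm y.
Hypothesis kahl : forall y, V y -> forall a b c,
    let omega := fun z => Jmx *m gm z in
    dmetric omega a b c y + dmetric omega b c a y + dmetric omega c a b y = 0.
Definition hess (h : 'rV[R]_(n + n) -> R) y : 'M[R]_(n + n) := \matrix_(a, b) partial a (partial b h) y.
Hypothesis plurih : forall y, V y -> Jmx *m hess f y *m Jmx^T = - hess f y.

Implicit Types (y : 'rV[R]_(n + n)) (a b c d : 'I_(n + n)).
Let e_ a : 'rV[R]_(n + n) := delta_mx ord0 a.
Let A y := invmx (gm y).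
Definition drow (h : 'rV[R]_(n + n) -> R) y : 'rV[R]_(n + n) := \row_a partial a h y.
Let v a y := \sum_b partial b f y * A y b a.
Let G y := bilin (A y) (drow f y) (drow f y).
Let w y := Num.sqrt (\det (gm y)).
Let dg a y : 'M[R]_(n + n) := \matrix_(b, c) dmetric gm a b c y.
Let Gam c a b y := christoffel gm c a b y.

Let ug y : V y -> gm y \in unitmx.
Proof. by move=> Vy; exact: gram_unitmx (gramg Vy). Qed.
Let sg y a b : V y -> gm y a b = gm y b a.
Proof. by move=> Vy; have [s _] := gramg Vy; rewrite -{1}s mxE. Qed.
Let sA y : V y -> (A y)^T = A y.
Proof. by move=> Vy; have [s _] := gram_invmx (gramg Vy). Qed.
Let sAE y a b : V y -> A y a b = A y b a.
Proof. by move=> Vy; rewrite -{1}(sA Vy) mxE. Qed.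

Let det_gt0 y : V y -> 0 < \det (gm y).
Proof.
move=> Vy; have [s p] := gramg Vy; have [L _ gL] := cholesky s p.
have := ug Vy; rewrite unitmxE unitfE gL det_mulmx det_tr -expr2 => d0.
by rewrite lt0r d0 sqr_ge0.
Qed.

Let CA N a b : isCk N V (fun y => A y a b).
Proof. by apply: Ck_invmx => // y /ug; rewrite unitmxE unitfE. Qed.
Let Cw N : isCk N V w.
Proof. by apply: Ck_sqrt => //; exact: Ck_det. Qed.
Let Cdf b : isCk 1 V (partial b f).
Proof. exact: Ck_partial. Qed.
Let Cv a : isCk 1 V (v a).
Proof. by apply: Ck_sum => // b _; apply: CkM. Qed.
Let Cdg N a b c : isCk N V (dmetric gm a b c).
Proof. exact: Ck_partial (Cg N.+1 b c) a. Qed.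
Let CGam N c a b : isCk N V (Gam c a b).
Proof.
apply: CkZ => //; apply: Ck_sum => // d _; apply: CkM => //.
by apply: CkB => //; apply: CkD.
Qed.

Let Dv y h a : V y -> isCk 1 V h -> derivable h y (e_ a).
Proof. by move=> Vy /Ck_derivable /(_ y Vy a). Qed.

Let dg_sym y a b c : V y -> dmetric gm a b c y = dmetric gm a c b y.
Proof. by move=> Vy; apply: (partial_ext oV) => // z; rewrite inE => Vz; exact: sg. Qed.

Let GamS y c a b : V y -> Gam c a b y = Gam c b a y.
Proof.
move=> Vy; rewrite /Gam /christoffel; congr (_ * _); apply: eq_bigr => d _.
by rewrite (dg_sym d a b Vy) [X in _ * (X - _)]addrC.
Qed.

Let Glow y a c d : V y -> \sum_b Gam b a c y * gm y b d =
  2^-1 * (dmetric gm a c d y + dmetric gm c a d y - dmetric gm d a c y).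
Proof.
move=> Vy; rewrite /Gam /christoffel.
transitivity (2^-1 * \sum_e (\sum_b gm y d b * A y b e) * (dmetric gm a c e y + dmetric gm c a e y - dmetric gm e a c y)).
  rewrite mulr_sumr; under [RHS]eq_bigr => e _ do rewrite mulr_suml mulr_sumr.
  rewrite [RHS]exchange_big /=; apply: eq_bigr => b _; rewrite mulr_sumr mulr_suml; apply: eq_bigr => e _.
  by rewrite (sg b d Vy) -/(A y); ring.
have gA e : \sum_b gm y d b * A y b e = (d == e)%:R.
  by transitivity ((gm y *m A y) d e); [rewrite mxE|rewrite mulmxV ?ug // mxE].
congr (_ * _); under eq_bigr do rewrite gA; rewrite (bigD1 d) //= eqxx mul1r big1 ?addr0 // => e ed.
by rewrite eq_sym (negbTE ed) mul0r.
Qed.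

Let gamE y b : V y -> \sum_c Gam c c b y = 2^-1 * \sum_c \sum_d A y c d * dmetric gm b d c y.
Proof.
move=> Vy; rewrite /Gam /christoffel -mulr_sumr; congr (_ * _).
have Z : \sum_c \sum_d A y c d * (dmetric gm c b d y - dmetric gm d c b y) = 0.
  apply/eqP; under eq_bigr do under eq_bigr do rewrite mulrBr; under eq_bigr do rewrite sumrB.
  rewrite sumrB subr_eq0; apply/eqP; rewrite [RHS]exchange_big /=; apply: eq_bigr => c _; apply: eq_bigr => d _.
  by rewrite (sAE c d Vy) (dg_sym c b d Vy).
rewrite -[RHS]addr0 -[X in _ = _ + X]Z -big_split /=; apply: eq_bigr => c _; rewrite -big_split /=; apply: eq_bigr => d _.
by rewrite -/(A y) (dg_sym b c d Vy); ring.
Qed.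

(** Jacobi's formula, applied to w * w = det g so that the square root need not be
    differentiated. *)
Let dw y b : V y -> partial b w y = w y * \sum_c Gam c c b y.
Proof.
move=> Vy; have w0 : 0 < w y by rewrite sqrtr_gt0 det_gt0.
have := @partial_det R _ _ gm b y (fun i j => @Dv y _ b Vy (Cg 1 i j)) (ug Vy).
have -> : partial b (fun z => \det (gm z)) y = partial b (fun z => w z * w z) y.
  apply: (partial_ext oV) => // z; rewrite inE => Vz.
  by rewrite -expr2 sqr_sqrtr // ltW // det_gt0.
rewrite partialM; [|exact: (Dv Vy (Cw 1))..]; rewrite gamE // -/(A y).
have <- : w y * w y = \det (gm y) by rewrite -expr2 sqr_sqrtr // ltW // det_gt0.
set s := \sum_i _.
move=> E; apply: (mulfI (lt0r_neq0 w0)).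
have -> : w y * partial b w y = 2^-1 * (partial b w y * w y + w y * partial b w y) by field.
by rewrite E; field.
Qed.

Let lower y b : V y -> \sum_a v a y * gm y a b = partial b f y.
Proof.
move=> Vy; transitivity ((drow f y *m A y *m gm y) ord0 b).
  by rewrite mxE; apply: eq_bigr => a _; rewrite mxE; congr (_ * _); apply: eq_bigr => c _; rewrite mxE.
by rewrite -mulmxA mulVmx ?ug // mulmx1 mxE.
Qed.

Let vrow y : 'rV[R]_(n + n) := \row_a v a y.
Let vrowE y : vrow y = drow f y *m A y.
Proof. by apply/rowP => a; rewrite !mxE; apply: eq_bigr => b _; rewrite mxE. Qed.

Let GE y : V y -> G y = \sum_b v b y * partial b f y.
Proof.
move=> Vy; rewrite /G /bilin -vrowE mxE; apply: eq_bigr => b _; by rewrite !mxE.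
Qed.
Let Gg y : V y -> bilin (gm y) (vrow y) (vrow y) = G y.
Proof.
move=> Vy; rewrite vrowE -bilinMl /A mulVmx ?ug // /bilin mulmx1 trmx_mul -/(A y) (sA Vy).
by rewrite /G /bilin mulmxA.
Qed.

Let Nm y : 'M[R]_(n + n) := \matrix_(a, b) covd v Gam a b y.
(** The covariant Hessian of f: the covariant derivative of the gradient with its index lowered. *)
Let S y := Nm y *m gm y.
(** Minus the Christoffel symbols of the first kind contracted with the gradient, that is, the
    difference between the covariant and the coordinate Hessian. *)
Let Fm y : 'M[R]_(n + n) := \matrix_(a, b) (2^-1 * \sum_c v c y *
  (dmetric gm c a b y - dmetric gm a c b y - dmetric gm b a c y)).

Let Dlow y a b : V y -> \sum_d partial a (v d) y * gm y d b =
  hess f y a b - \sum_d v d y * dmetric gm a d b y.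
Proof.
move=> Vy; apply/eqP; rewrite eq_sym subr_eq -big_split /= mxE; apply/eqP.
have -> : partial a (partial b f) y = partial a (fun z => \sum_d v d z * gm z d b) y.
  by apply: (partial_ext oV) => // z; rewrite inE => Vz; rewrite lower.
have [_ ->] := @partial_sum R _ _ (index_enum _) xpredT (fun d z => v d z * gm z d b) a y
  (fun d => @Dv y _ a Vy (CkM oV (Cv d) (Cg 1 d b))).
by apply: eq_bigr => d _; rewrite partialM //; [exact: (Dv Vy (Cv d))|exact: (Dv Vy (Cg 1 d b))].
Qed.

Let SE y : V y -> S y = hess f y + Fm y.
Proof.
move=> Vy; apply/matrixP => a b; rewrite mxE [RHS]mxE.
have -> : \sum_d Nm y a d * gm y d b =
    \sum_d partial a (v d) y * gm y d b + \sum_c v c y * (\sum_d Gam d a c y * gm y d b).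
  under [X in _ + X]eq_bigr do rewrite mulr_sumr; rewrite [X in _ + X]exchange_big -big_split /=.
  apply: eq_bigr => d _; rewrite mxE /covd mulrDl mulr_suml; congr (_ + _); apply: eq_bigr => c _; ring.
rewrite Dlow // -addrA; congr (_ + _); rewrite [RHS]mxE mulr_sumr addrC -sumrB; apply: eq_bigr => c _.
by rewrite Glow //; field.
Qed.

(** The derivative of the metric in direction X evaluated on Y and Z. As a trilinear form on vectors
    it lets the matrix J act on its arguments, so that the Hermitian and Kähler conditions become
    the identities [Therm] and [Tclosed]. *)
Let T y (X Y Z : 'rV[R]_(n + n)) := \sum_a X ord0 a * bilin (dg a y) Y Z.

Let TE y X Y Z : T y X Y Z = \sum_a \sum_b \sum_c X ord0 a * Y ord0 b * Z ord0 c * dmetric gm a b c y.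
Proof.
apply: eq_bigr => a _; rewrite bilinE mulr_sumr; apply: eq_bigr => b _; rewrite mulr_sumr; apply: eq_bigr => c _.
by rewrite mxE; ring.
Qed.

Let Tsym y X Y Z : V y -> T y X Y Z = T y X Z Y.
Proof.
move=> Vy; rewrite !TE; apply: eq_bigr => a _; rewrite exchange_big /=.
by apply: eq_bigr => b _; apply: eq_bigr => c _; rewrite (dg_sym a c b Vy); ring.
Qed.

Let JdgE y a : V y -> forall b c, partial a (fun z => (Jmx *m gm z) b c) y = (Jmx *m dg a y) b c.
Proof.
move=> Vy b c; under eq_fun do rewrite mxE.
have [_ ->] := @partial_sum R _ _ (index_enum _) xpredT (fun d z => Jmx b d * gm z d c) a y
  (fun d => @derivable_scale R _ (Jmx b d) _ a y (@Dv y _ a Vy (Cg 1 d c))).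
by rewrite mxE; apply: eq_bigr => d _; rewrite partialZ ?mxE //; exact: (Dv Vy (Cg 1 d c)).
Qed.

Let Therm y X Y Z : V y -> T y X (Y *m Jmx) (Z *m Jmx) = T y X Y Z.
Proof.
move=> Vy; apply: eq_bigr => a _; rewrite -bilinMr -bilinMl; congr (_ * bilin _ _ _).
apply/matrixP => b c; rewrite mulmxA [LHS]mxE [RHS]mxE.
have -> : dmetric gm a b c y = partial a (fun z => \sum_d Jmx c d * (Jmx *m gm z) b d) y.
  apply: (partial_ext oV) => // z; rewrite inE => Vz; rewrite -[LHS](congr1 (fun B : 'M[R]_(n + n) => B b c) (herm Vz)).
  by rewrite mxE; apply: eq_bigr => d _; rewrite [Jmx^T _ _]mxE mulrC.
have CJ d : isCk 1 V (fun z => (Jmx *m gm z) b d).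
  by under eq_fun do rewrite mxE; apply: Ck_sum => // e _; apply: CkZ.
have [_ ->] := @partial_sum R _ _ (index_enum _) xpredT (fun d z => Jmx c d * (Jmx *m gm z) b d) a y
  (fun d => @derivable_scale R _ (Jmx c d) _ a y (@Dv y _ a Vy (CJ d))).
apply: eq_bigr => d _; rewrite partialZ; last exact: (Dv Vy (CJ d)).
by rewrite JdgE // [Jmx^T _ _]mxE mulrC.
Qed.

Let Tclosed y X Y Z : V y -> T y X (Y *m Jmx) Z + T y Y (Z *m Jmx) X + T y Z (X *m Jmx) Y = 0.
Proof.
move=> Vy; pose O a b c := (Jmx *m dg a y) b c.
have E P Q W : T y P (Q *m Jmx) W = \sum_a \sum_b \sum_c P ord0 a * Q ord0 b * W ord0 c * O a b c.
  apply: eq_bigr => a _; rewrite -bilinMl bilinE mulr_sumr; apply: eq_bigr => b _; rewrite mulr_sumr.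
  by apply: eq_bigr => c _; rewrite /O; ring.
have kO a b c : O a b c + O b c a + O c a b = 0.
  by have := kahl Vy a b c; rewrite /dmetric /= (JdgE a Vy) (JdgE b Vy) (JdgE c Vy).
rewrite !E.
have -> : \sum_a \sum_b \sum_c Y ord0 a * Z ord0 b * X ord0 c * O a b c =
    \sum_c \sum_a \sum_b Y ord0 a * Z ord0 b * X ord0 c * O a b c.
  by rewrite [RHS]exchange_big /=; apply: eq_bigr => a _; rewrite [RHS]exchange_big.
have -> : \sum_a \sum_b \sum_c Z ord0 a * X ord0 b * Y ord0 c * O a b c =
    \sum_b \sum_c \sum_a Z ord0 a * X ord0 b * Y ord0 c * O a b c.
  by rewrite exchange_big /=; apply: eq_bigr => b _; rewrite exchange_big.
rewrite -!big_split big1 // => a _; rewrite -!big_split big1 // => b _; rewrite -!big_split big1 //= => c _.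
have -> : X ord0 a * Y ord0 b * Z ord0 c * O a b c + Y ord0 b * Z ord0 c * X ord0 a * O b c a +
  Z ord0 c * X ord0 a * Y ord0 b * O c a b = X ord0 a * Y ord0 b * Z ord0 c * (O a b c + O b c a + O c a b) by ring.
by rewrite kO mulr0.
Qed.

Let TN y X Y Z : T y X (- Y) Z = - T y X Y Z.
Proof. by rewrite /T -sumrN; apply: eq_bigr => a _; rewrite bilinNl mulrN. Qed.

Let FE y X Y : bilin (Fm y) X Y = 2^-1 * (T y (vrow y) X Y - T y X (vrow y) Y - T y Y X (vrow y)).
Proof.
rewrite !TE bilinE.
have -> : \sum_a \sum_b \sum_c vrow y ord0 a * X ord0 b * Y ord0 c * dmetric gm a b c y =
   \sum_a \sum_b \sum_c v c y * X ord0 a * Y ord0 b * dmetric gm c a b y.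
  rewrite exchange_big /=; apply: eq_bigr => a _; rewrite exchange_big /=.
  by apply: eq_bigr => b _; apply: eq_bigr => c _; rewrite mxE.
have -> : \sum_a \sum_b \sum_c X ord0 a * vrow y ord0 b * Y ord0 c * dmetric gm a b c y =
   \sum_a \sum_b \sum_c X ord0 a * v c y * Y ord0 b * dmetric gm a c b y.
  apply: eq_bigr => a _; rewrite exchange_big /=.
  by apply: eq_bigr => b _; apply: eq_bigr => c _; rewrite mxE.
have -> : \sum_a \sum_b \sum_c Y ord0 a * X ord0 b * vrow y ord0 c * dmetric gm a b c y =
   \sum_a \sum_b \sum_c Y ord0 b * X ord0 a * v c y * dmetric gm b a c y.
  rewrite exchange_big /=; apply: eq_bigr => a _.
  by apply: eq_bigr => b _; apply: eq_bigr => c _; rewrite mxE.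
rewrite -!sumrB mulr_sumr; apply: eq_bigr => a _; rewrite -!sumrB mulr_sumr; apply: eq_bigr => b _.
rewrite -!sumrB mxE !mulr_sumr mulr_suml; apply: eq_bigr => c _; ring.
Qed.

Let JJ : @Jmx R n *m Jmx = - 1%:M.
Proof.
rewrite /Jmx mulmx_block !mulmx0 !mul0mx !mulmx1 !mul1mx !(add0r, addr0).
by rewrite (@scalar_mx_block R n n 1) opp_block_mx oppr0.
Qed.

(** Closedness of the fundamental form, used for (X J, Y, W) and (Y J, X, W), together with
    J-invariance of the metric. It expresses that the Christoffel symbols of a Kähler metric have no
    mixed components, so the covariant Hessian inherits J-anti-invariance from the coordinate
    one. *)
Let JF y : V y -> Jmx *m Fm y *m Jmx^T = - Fm y.
Proof.
move=> Vy; apply/matrixP => a b; rewrite -bilin_delta bilinMr bilinMl !FE [RHS]mxE -bilin_delta FE -mulrN; congr (_ * _).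
set X := delta_mx ord0 a; set Y := delta_mx ord0 b; set W := vrow y.
have J2 (P : 'rV[R]_(n + n)) : P *m Jmx *m Jmx = - P by rewrite -mulmxA JJ mulmxN mulmx1.
rewrite (Therm W X Y Vy).
have := Tclosed (X *m Jmx) Y W Vy; rewrite J2 TN (Therm Y W X Vy) => E1.
have := Tclosed (Y *m Jmx) X W Vy; rewrite J2 TN (Therm X W Y Vy) => E2.
rewrite (Tsym (X *m Jmx) W _ Vy) (Tsym Y X W Vy).
move: E1 E2; rewrite (Tsym W Y X Vy); set t1 := T y _ _ _; set t2 := T y _ _ _; set t3 := T y _ _ _.
set t4 := T y _ _ _; set t5 := T y _ _ _; move=> E1 E2; lra.
Qed.

Let JS y : V y -> Jmx *m S y *m Jmx^T = - S y.
Proof. by move=> Vy; rewrite SE // mulmxDr mulmxDl plurih // JF // opprD. Qed.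

Let symS y : V y -> (S y)^T = S y.
Proof.
move=> Vy; rewrite SE // linearD /=; congr (_ + _); apply/matrixP => a b; rewrite !mxE.
  exact: (schwarz _ _ oV Cf Vy).
congr (_ * _); apply: eq_bigr => c _; congr (_ * _).
by rewrite (dg_sym c a b Vy) (dg_sym a c b Vy) (dg_sym b a c Vy); ring.
Qed.

Let NE y : V y -> Nm y = S y *m A y.
Proof. by move=> Vy; rewrite /S -mulmxA mulmxV ?ug // mulmx1. Qed.

Let trN y : V y -> \tr (Nm y) = 0.
Proof.
by move=> Vy; rewrite NE //; apply: (kahler_trace0 (gramg Vy) JJ (herm Vy) (JS Vy)).
Qed.

Let div0 y : V y -> \sum_b partial b (v b) y + \sum_b (\sum_c Gam c c b y) * v b y = 0.
Proof.
move=> Vy; transitivity (\tr (Nm y)); last exact: trN.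
rewrite /mxtrace; under [RHS]eq_bigr do rewrite mxE /covd.
rewrite big_split /=; congr (_ + _); rewrite exchange_big /=; apply: eq_bigr => b _; by rewrite mulr_suml.
Qed.

(** Compatibility of the connection with the metric. The energy is differentiated in the form of the
    sum of v^b times the derivatives of f, whose factors are C^1. *)
Let dG y a : V y -> partial a G y = 2 * (vrow y *m S y) ord0 a.
Proof.
move=> Vy.
have -> : partial a G y = partial a (fun z => \sum_b v b z * partial b f z) y.
  by apply: (partial_ext oV) => // z; rewrite inE => Vz; rewrite GE.
have [_ ->] := @partial_sum R _ _ (index_enum _) xpredT (fun b z => v b z * partial b f z) a y
  (fun b => @Dv y _ a Vy (CkM oV (Cv b) (Cdf b))).
have -> : \sum_b partial a (fun z => v b z * partial b f z) y =
   \sum_b partial a (v b) y * partial b f y + \sum_b v b y * hess f y a b.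
  by rewrite -big_split; apply: eq_bigr => b _; rewrite partialM ?mxE //; [exact: (Dv Vy (Cv b))|exact: (Dv Vy (Cdf b))].
have -> : \sum_b partial a (v b) y * partial b f y = \sum_c v c y * (hess f y a c - \sum_d v d y * dmetric gm a d c y).
  under eq_bigr => b _ do (rewrite -lower // mulr_sumr); rewrite exchange_big /=.
  apply: eq_bigr => c _; rewrite -Dlow // mulr_sumr; apply: eq_bigr => b _; rewrite (sg c b Vy); ring.
have -> : (vrow y *m S y) ord0 a = \sum_b v b y * (hess f y a b + Fm y a b).
  rewrite -{1}(symS Vy) mxE; apply: eq_bigr => b _; by rewrite SE // !mxE.
have Z : \sum_b v b y * (2 * Fm y a b) = - \sum_b v b y * (\sum_d v d y * dmetric gm a d b y).
  rewrite -sumrN.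
  transitivity (\sum_b \sum_c v b y * v c y * (dmetric gm c a b y - dmetric gm a c b y - dmetric gm b a c y)).
    apply: eq_bigr => b _; rewrite mxE [2 * (2^-1 * _)]mulrA divff // mul1r mulr_sumr; apply: eq_bigr => c _; ring.
  have E : \sum_b \sum_c v b y * v c y * dmetric gm c a b y = \sum_b \sum_c v b y * v c y * dmetric gm b a c y.
    by rewrite exchange_big /=; apply: eq_bigr => b _; apply: eq_bigr => c _; rewrite [v c y * _]mulrC.
  have -> : \sum_b \sum_c v b y * v c y * (dmetric gm c a b y - dmetric gm a c b y - dmetric gm b a c y) =
     \sum_b \sum_c v b y * v c y * dmetric gm c a b y - \sum_b \sum_c v b y * v c y * dmetric gm b a c y
     - \sum_b \sum_c v b y * v c y * dmetric gm a c b y.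
    by rewrite -!sumrB; apply: eq_bigr => b _; rewrite -!sumrB; apply: eq_bigr => c _; ring.
  rewrite E subrr sub0r -sumrN; apply: eq_bigr => b _; congr (- _); rewrite mulr_sumr; apply: eq_bigr => c _; ring.
have -> : \sum_c v c y * (hess f y a c - \sum_d v d y * dmetric gm a d c y) =
   \sum_c v c y * hess f y a c + \sum_b v b y * (2 * Fm y a b).
  by rewrite Z -sumrB; apply: eq_bigr => c _; ring.
rewrite mulr_sumr addrAC -!big_split /=; apply: eq_bigr => b _; ring.
Qed.

Let dGrow y : V y -> drow G y = 2 *: (vrow y *m S y).
Proof. by move=> Vy; apply/rowP => a; rewrite [LHS]mxE dG // [RHS]mxE. Qed.

(** By Bochner's formula this is formally half the Laplacian of the energy. The expression is
    continuous although the energy is only known to be C^1. *)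
Definition bochnerZ y : R := \sum_a \sum_b covd v Gam a b y * covd v Gam b a y + bilin (ricci gm y) (vrow y) (vrow y).

Let trNE y : V y -> \sum_a \sum_b covd v Gam a b y * covd v Gam b a y = \tr (S y *m A y *m (S y *m A y)).
Proof. by move=> Vy; rewrite -NE //; apply: eq_bigr => a _; rewrite mxE; apply: eq_bigr => b _; rewrite !mxE. Qed.

(** Since dG is twice the Hessian applied to the gradient, [kahler_kato] bounds the squared norm of
    the Hessian below by |dG|^2 / (2 G). Adding e to the denominator weakens the bound and keeps it
    meaningful at zeros of the gradient. *)
Lemma bochnerZ_ge y (e h : R) : V y -> 0 < e ->
  h * bilin (gm y) (vrow y) (vrow y) <= bilin (ricci gm y) (vrow y) (vrow y) ->
  bilin (A y) (drow G y) (drow G y) / (2 * (G y + e)) + h * G y <= bochnerZ y.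
Proof.
move=> Vy e0 hr; rewrite /bochnerZ; apply: lerD; last by rewrite -Gg.
have gA := gram_invmx (gramg Vy); have [sA' pA] := gA.
have kato := kahler_kato (gramg Vy) (symS Vy) JJ (herm Vy) (JS Vy) (vrow y).
rewrite trNE //; set t := \tr _ in kato *; rewrite (Gg Vy) -/(A y) in kato.
have t0 : 0 <= t.
  have [L _ AL] := cholesky sA' pA.
  rewrite /t -/(A y) (_ : \tr _ = \tr (L^T *m S y *m A y *m (L^T *m S y)^T)).
    by rewrite mxtraceE_bilin sumr_ge0 // => i _; exact: gram_ge0.
  by rewrite trmx_mul trmxK (symS Vy) {2}/A AL !mulmxA mxtrace_mulC !mulmxA.
have G0 : 0 <= G y by exact: gram_ge0.
rewrite ler_pdivrMr; last by rewrite mulr_gt0 // ltr_wpDl.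
rewrite dGrow // bilinZl bilinZr; set q := bilin _ _ _ in kato *.
have et : 0 <= e * t by rewrite mulr_ge0 // ltW.
move: kato et; set x := G y * t; have -> : t * (2 * (G y + e)) = 2 * x + 2 * (e * t) by rewrite /x; ring.
by set z := e * t; lra.
Qed.

Lemma Ck_bochnerZ : isCk 0 V bochnerZ.
Proof.
have C10 h : isCk 1 V h -> isCk 0 V h by exact: Ck_le.
have Cc a b : isCk 0 V (covd v Gam a b).
  apply: CkD => //; first exact: Ck_partial.
  by apply: Ck_sum => // c _; apply: CkM => //; exact: C10.
apply: CkD => //; first by apply: Ck_sum => // a _; apply: Ck_sum => // b _; exact: CkM.
have -> : (fun y => bilin (ricci gm y) (vrow y) (vrow y)) = (fun y => \sum_a \sum_b v a y * ricci_of Gam a b y * v b y).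
  by apply/funext => y; rewrite bilinE; apply: eq_bigr => a _; apply: eq_bigr => b _; rewrite !mxE.
apply: Ck_sum => // a _; apply: Ck_sum => // b _; apply: CkM => //; last exact: C10.
apply: CkM => //; first exact: C10.
apply: CkD => //; apply: Ck_sum => // c _; first by apply: CkB => //; exact: Ck_partial.
by apply: Ck_sum => // d _; apply: CkB => //; apply: CkM.
Qed.

Lemma C1_G : isCk 1 V G.
Proof.
apply: (@Ck_ext _ _ _ _ (fun y => \sum_b v b y * partial b f y)) => //.
  by move=> y; rewrite inE => Vy; rewrite GE.
by apply: Ck_sum => // b _; exact: CkM.
Qed.

Section Test.
Variables (eta : 'rV[R]_(n + n) -> R) (K : set 'rV[R]_(n + n)).
Hypotheses (Ceta : c1c eta) (cK : compact K) (KV : K `<=` V) (etaK : forall y, eta y != 0 -> K y).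

Let eta0 y : ~ K y -> eta y = 0 /\ drow eta y = 0.
Proof.
move=> nK; split; first by apply/eqP/negPn/negP => /etaK.
apply/rowP => b; rewrite !mxE; apply/eqP/negPn/negP.
by move=> /(partial_supp (compact_closed (@haus_rV R (n + n)) cK) etaK).
Qed.

Lemma local_bochner : Int (leb (n + n)) (fun y =>
  w y * (2^-1 * bilin (A y) (drow eta y) (drow G y)) + eta y * w y * bochnerZ y) = 0.
Proof.
have [chi [U [K' [Cchi chi01 [oU KU chi1 cK' [KV' chiK]]]]]] := bump_rV cK oV KV.
(* The data live on V only. Multiplied by a cutoff equal to 1 near K they become global functions
   and keep their identities on the open set [W]. *)
pose w' y := chi y * w y; pose v' a y := chi y * v a y; pose Gam' c a b y := chi y * Gam c a b y.
have gl N h : isCk N V h -> isCk N setT (fun y => chi y * h y) by move=> Ch; exact: (Ck_glob oV cK' KV' chiK).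
pose W := U `&` V; have oW : open W by exact: openI.
have eqW (h : 'rV[R]_(n + n) -> R) y : W y -> chi y * h y = h y by move=> [/chi1 -> _]; rewrite mul1r.
have pW (h : 'rV[R]_(n + n) -> R) a y : W y -> partial a (fun z => chi z * h z) y = partial a h y.
  by move=> Wy; apply: (partial_ext oW) => // z; rewrite inE => /eqW.
have cv' a : c1c (v' a).
  split; first exact: gl.
  split; first by move=> y; exact: (Ck_continuous (gl _ _ (Cv a))).
  by exists K' => // y; rewrite mulf_eq0 negb_or => /andP[/chiK].
have KW : K `<=` W by move=> y Ky; split; [exact: KU|exact: KV].
have dw' y : W y -> forall b, partial b w' y = w' y * \sum_c Gam' c c b y.
  move=> Wy b; rewrite pW // dw; last by case: Wy.
  by rewrite /w' eqW //; congr (_ * _); apply: eq_bigr => c _; rewrite /Gam' eqW.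
have sym' y : W y -> forall c a b, Gam' c a b y = Gam' c b a y.
  by move=> [_ Vy] c a b; rewrite /Gam' GamS.
have div' y : W y -> \sum_b partial b (v' b) y + \sum_b (\sum_c Gam' c c b y) * v' b y = 0.
  move=> Wy; rewrite -[RHS](div0 (Wy.2)); congr (_ + _); apply: eq_bigr => b _; first exact: pW.
  by rewrite /v' eqW //; congr (_ * _); apply: eq_bigr => c _; rewrite /Gam' eqW.
have := weak_bochner (gl _ _ (Cw 1)) cv' (fun c a b => gl _ _ (CGam 1 c a b)) oW Ceta cK KW etaK dw' sym' div'.
move=> <-; congr Int; apply/funext => y; have [Ky|nK] := pselect (K y); last first.
  have [e1 e2] := eta0 nK; rewrite /bochner_term e1 e2 bilin0l !(mulr0, mul0r, addr0) big1 ?mulr0 // => a _.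
  by rewrite big1 // => b _; have := congr1 (fun r : 'rV[R]_(n + n) => r ord0 b) e2; rewrite !mxE => ->; rewrite mulr0.
have Wy := KW _ Ky; have Vy := KV Ky.
have cE a b : covd v' Gam' a b y = covd v Gam a b y.
  by rewrite /covd pW //; congr (_ + _); apply: eq_bigr => c _; rewrite /Gam' /v' !eqW.
rewrite /bochner_term /bochnerZ /w' eqW //; congr (_ * _ + _ * (_ + _)).
- rewrite dGrow // bilinZr mulrA mulVf // mul1r (bilin_sym _ _ (sA Vy)) /bilin -mulmxA.
  have -> : vrow y *m S y *m (A y *m (drow eta y)^T) = vrow y *m Nm y *m (drow eta y)^T by rewrite NE // !mulmxA.
  rewrite mxE exchange_big /=; apply: eq_bigr => b _; rewrite mxE mulr_suml; apply: eq_bigr => a _.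
  by rewrite cE /v' eqW // !mxE.
- by apply: eq_bigr => a _; apply: eq_bigr => b _; rewrite !cE.
rewrite bilinE; apply: eq_bigr => a _; apply: eq_bigr => b _; rewrite /v' !eqW // !mxE [v a y * _]mulrC.
congr (_ * _ * _); rewrite /ricci_of; congr (_ + _); apply: eq_bigr => c _.
  by rewrite !pW.
by apply: eq_bigr => d _; rewrite /Gam' !eqW.
Qed.

(** Weak harmonicity: the field w v is divergence-free by [div0], so only the derivative of eta
    survives the integration by parts. *)
Lemma local_divergence : Int (leb (n + n)) (fun y => w y * bilin (A y) (drow eta y) (drow f y)) = 0.
Proof.
have [chi [U [K' [Cchi chi01 [oU KU chi1 cK' [KV' chiK]]]]]] := bump_rV cK oV KV.
have gl N h : isCk N V h -> isCk N setT (fun y => chi y * h y) by move=> Ch; exact: (Ck_glob oV cK' KV' chiK).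
pose W := U `&` V; have oW : open W by exact: openI.
pose m_ a y := chi y * (w y * v a y); have Cm a : isCk 1 setT (m_ a) by apply: gl; exact: CkM.
have cm a : c1c (fun y => m_ a y * eta y) by exact: c1cM.
have H := @haus_rV R (n + n); have LC := @leb_compact R (n + n).
have E : Int (leb (n + n)) (fun y => \sum_a partial a (fun z => m_ a z * eta z) y) = 0.
  rewrite (Int_sum H LC) => [|a _]; last exact: c1c_partial.
  by apply: big1 => a _; exact: Int_partial.
rewrite -E; congr Int; apply/funext => y; have pm a : partial a (fun z => m_ a z * eta z) y =
    partial a (m_ a) y * eta y + m_ a y * partial a eta y.
  by apply: partialM; [exact: (Ck_derivable (Cm a))|exact: c1c_derivable].
under eq_bigr do rewrite pm; rewrite big_split /=.
have [Ky|nK] := pselect (K y); last first.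
  have [e1 e2] := eta0 nK; rewrite e2 bilin0l mulr0 e1 big1 ?add0r => [|a _]; last by rewrite mulr0.
  by rewrite big1 // => a _; have := congr1 (fun r : 'rV[R]_(n + n) => r ord0 a) e2; rewrite !mxE => ->; rewrite mulr0.
have Wy : W y by split; [exact: KU|exact: KV].
have Vy := KV Ky.
have mE a z : W z -> m_ a z = w z * v a z by move=> [/chi1 h _]; rewrite /m_ h mul1r.
have dm a : partial a (m_ a) y = w y * (\sum_c Gam c c a y) * v a y + w y * partial a (v a) y.
  rewrite (@partial_ext R _ W (m_ a) (fun z => w z * v a z)) //; last by move=> z; rewrite inE => /mE.
  by rewrite partialM; [rewrite dw|exact: (Dv Vy (Cw 1))|exact: (Dv Vy (Cv a))].
have -> : \sum_a partial a (m_ a) y * eta y = w y * eta y *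
    (\sum_b partial b (v b) y + \sum_b (\sum_c Gam c c b y) * v b y).
  by rewrite -big_split mulr_sumr; apply: eq_bigr => a _; rewrite dm /=; ring.
rewrite (div0 Vy) mulr0 add0r (bilin_sym _ _ (sA Vy)) /bilin -vrowE mxE mulr_sumr.
by apply: eq_bigr => a _; rewrite mE // !mxE mulrA.
Qed.

End Test.
End MetricCalculus.

(** * Charts and the pairing of differentials *)

Section Charts.
Context {R : realType} {n : nat} {M : ptopologicalType} {X : complexManifold R n M} (g : kahlerMetric X).
Implicit Types (x : M) (y z : 'rV[R]_(n + n)) (i j l : nat).

Definition dom i := chart_dom X i.
Definition cod i := chart_cod X i.
Definition ch i := chart X i.
Definition inv i := chart_inv X i.
Definition trans i j := ch j \o inv i.
Definition overlap i j : set 'rV[R]_(n + n) := cod i `&` inv i @^-1` dom j.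

Lemma dom_open i : open (dom i). Proof. exact: chart_dom_open. Qed.
Lemma cod_open i : open (cod i). Proof. exact: chart_cod_open. Qed.
Lemma ch_cod i x : dom i x -> cod i (ch i x). Proof. exact: chart_to. Qed.
Lemma inv_dom i y : cod i y -> dom i (inv i y). Proof. exact: chart_inv_to. Qed.
Lemma chK i x : dom i x -> inv i (ch i x) = x. Proof. exact: chartK. Qed.
Lemma invK i y : cod i y -> ch i (inv i y) = y. Proof. exact: chart_invK. Qed.
Lemma ch_cont i x : dom i x -> {for x, continuous (ch i)}. Proof. exact: chart_continuous. Qed.
Lemma inv_cont i y : cod i y -> {for y, continuous (inv i)}. Proof. exact: chart_inv_continuous. Qed.

Lemma haus : hausdorff_space M. Proof. exact: manifold_hausdorff X. Qed.

Lemma open_preim (T U : topologicalType) (D : set T) (h : T -> U) (B : set U) : open D ->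
  (forall t : T, D t -> {for t, continuous h}) -> open B -> open (D `&` h @^-1` B).
Proof.
move=> oD cth oB; rewrite openE => t [Dt Bt]; apply: filterI; first exact: open_nbhs_nbhs.
by apply: (cth t Dt); exact: open_nbhs_nbhs.
Qed.

Lemma overlap_open i j : open (overlap i j).
Proof. by apply: open_preim; [exact: cod_open|exact: inv_cont|exact: dom_open]. Qed.

Lemma trans_overlap i j y : overlap i j y -> overlap j i (trans i j y).
Proof. by move=> [cy dy]; split; [exact: ch_cod|rewrite /trans /= chK //; exact: inv_dom]. Qed.

Lemma transK i j y : overlap i j y -> trans j i (trans i j y) = y.
Proof. by move=> [cy dy]; rewrite /trans /= chK // invK. Qed.

Lemma inv_trans i j y : overlap i j y -> inv j (trans i j y) = inv i y.
Proof. by move=> [cy dy]; rewrite /trans /= chK. Qed.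

Lemma ch_overlap i j x : dom i x -> dom j x -> overlap i j (ch i x) /\ trans i j (ch i x) = ch j x.
Proof.
move=> di dj; split; last by rewrite /trans /= chK.
by split; [exact: ch_cod|rewrite -[X in dom j X](chK di) in dj].
Qed.

Lemma trans_Ck N i j b : isCk N (overlap i j) (fun y => trans i j y ord0 b).
Proof. by apply/isCkP; have [H _] := transition_holomorphic X i j; exact: H. Qed.

Lemma trans_diff i j y : overlap i j y -> differentiable (trans i j) y.
Proof.
move=> Oy; have -> : trans i j = \sum_b (fun z => trans i j z ord0 b *: (delta_mx ord0 b : 'rV[R]_(n + n))).
  by apply/funext => z; rewrite fct_sumE [LHS]row_sum_delta.
apply: differentiable_sum => b; apply: differentiableZl.
by have [] := Ck_differentiable (@overlap_open i j) (trans_Ck 1 i j b) Oy.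
Qed.

Lemma Ck_trans N i j f : isCk N (cod j) f -> isCk N (overlap i j) (f \o trans i j).
Proof.
move=> Cf; apply: (Ck_comp (W := cod j)) => //; [exact: overlap_open|exact: cod_open| |].
  by move=> y [_ dy]; exact: ch_cod.
by move=> b; exact: trans_Ck.
Qed.

Lemma gram_metric i y : cod i y -> gram (metric g i y).
Proof. by move=> cy; split; [exact: (@Defs.metric_sym R n M X g i y cy)|move=> v v0; exact: (@Defs.metric_pos R n M X g i y cy v v0)]. Qed.

Lemma jac_key : unit. Proof. exact: tt. Qed.
(* Locked because unification tends to unfold differentials. *)
Definition jac i j y : 'M[R]_(n + n) := locked_with jac_key ('J (trans i j) y).
Lemma jacE i j y : jac i j y = 'J (trans i j) y.
Proof. by rewrite /jac unlock. Qed.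

Lemma jac_compat i j y : overlap i j y ->
  metric g i y = jac i j y *m metric g j (trans i j y) *m (jac i j y)^T.
Proof. by move=> [cy dy]; rewrite jacE; exact: (@metric_compat R n M X g i j y cy dy). Qed.

Lemma jac_inv i j y : overlap i j y -> jac i j y *m jac j i (trans i j y) = 1%:M.
Proof.
move=> Oy; rewrite !jacE; apply: (jacobian_inverse (@overlap_open i j) Oy); first by move=> q; exact: transK.
  exact: trans_diff.
by apply: trans_diff; exact: trans_overlap.
Qed.

Lemma jac_unit i j y : overlap i j y -> jac i j y \in unitmx.
Proof.
move=> Oy; have := jac_inv Oy; move: (jac j i _) (jac i j y) => Q P PQ.
by apply: (proj1 (mulmx1_unit PQ)).
Qed.

Lemma drow_trans i j (h : 'rV[R]_(n + n) -> R) y : overlap i j y -> differentiable h (trans i j y) ->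
  drow (h \o trans i j) y = drow h (trans i j y) *m (jac i j y)^T.
Proof.
move=> Oy dh; have dF := trans_diff Oy; apply/rowP => a; rewrite !mxE /partial deriveE; last exact: differentiable_comp.
have /(congr1 (fun k : 'rV[R]_(n + n) -> R => k (delta_mx ord0 a))) -> := diff_comp dF dh.
rewrite /comp diff_jacobian -jacE -rowE [X in 'd h _ X]row_sum_delta linear_sum.
apply: eq_bigr => b _; rewrite linearZ /= -deriveE // [row _ _ _ _]mxE [drow _ _ _ _]mxE [_^T _ _]mxE.
exact: mulrC.
Qed.

Lemma invmx_compat i j y : overlap i j y ->
  (jac i j y)^T *m invmx (metric g i y) *m jac i j y = invmx (metric g j (trans i j y)).
Proof.
move=> Oy; have uJ := jac_unit Oy; have ug := gram_unitmx (gram_metric (ch_cod (x := inv i y) Oy.2)).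
rewrite (jac_compat Oy) -/(trans i j y); set P := jac i j y in uJ *; set g' := metric _ _ _.
have uP : P^T \in unitmx by rewrite unitmx_tr.
have ug' : g' \in unitmx by exact: ug.
have u1 : P *m g' \in unitmx by rewrite unitmx_mul uJ.
apply: (can_inj (mulmxK ug')); rewrite mulVmx //; apply: (can_inj (mulmxK uP)); rewrite mul1mx -!mulmxA.
by rewrite [P *m (g' *m _)]mulmxA mulVmx ?mulmx1 // unitmx_mul u1.
Qed.

Lemma bilin_trans i j y p q : overlap i j y ->
  bilin (invmx (metric g i y)) (p *m (jac i j y)^T) (q *m (jac i j y)^T) =
  bilin (invmx (metric g j (trans i j y))) p q.
Proof. by move=> Oy; rewrite -bilinMr -bilinMl trmxK mulmxA invmx_compat. Qed.

Definition lc i (f : M -> R) : 'rV[R]_(n + n) -> R := f \o inv i.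

Definition CM N (f : M -> R) := forall i, isCk N (cod i) (lc i f).

Definition gp i (f h : M -> R) y := bilin (invmx (metric g i y)) (drow (lc i f) y) (drow (lc i h) y).

Lemma CM_diff f i y : CM 1 f -> cod i y -> differentiable (lc i f) y.
Proof. by move=> Cf cy; have [] := Ck_differentiable (@cod_open i) (Cf i) cy. Qed.

Lemma lc_trans f i j y : overlap i j y -> lc i f y = lc j f (trans i j y).
Proof. by move=> Oy; rewrite /lc /= inv_trans. Qed.

Lemma gp_trans f h i j y : CM 1 f -> CM 1 h -> overlap i j y -> gp i f h y = gp j f h (trans i j y).
Proof.
move=> Cf Ch Oy; have E (k : M -> R) : CM 1 k -> drow (lc i k) y = drow (lc j k) (trans i j y) *m (jac i j y)^T.
  move=> Ck; rewrite -(drow_trans Oy); last by apply: CM_diff => //; exact: (ch_cod Oy.2).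
  apply/rowP => a; rewrite !mxE; apply: (partial_ext (@overlap_open i j)) => // z.
  by rewrite inE => /lc_trans.
by rewrite /gp (E f) // (E h) // bilin_trans.
Qed.

Lemma chart_atP x : dom (chart_at (X := X) x) x /\ forall j, dom j x -> (chart_at (X := X) x <= j)%N.
Proof.
rewrite /chart_at; case: xgetP => [i _ [di mi]|H]; first by [].
have [i0 di0] := chart_cover X x; have ex : exists i, `[< dom i x >] by exists i0; exact/asboolP.
exfalso; apply: (H (ex_minn ex)); case: ex_minnP => i /asboolP di mi; split=> // j dj.
by apply: mi; exact/asboolP.
Qed.

Notation cat x := (chart_at (X := X) x).

(** Read in the least chart around x so as to match [norm_grad]; [gpairE] shows that any chart
    around x gives the same value. *)
Definition gpair (f h : M -> R) x := gp (cat x) f h (ch (cat x) x).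

Lemma gpairE f h i x : CM 1 f -> CM 1 h -> dom i x -> gpair f h x = gp i f h (ch i x).
Proof.
move=> Cf Ch di; have [dc _] := chart_atP x; have [ov E] := ch_overlap dc di.
by rewrite /gpair (gp_trans Cf Ch ov) E.
Qed.

Lemma lc_gpair f h i y : CM 1 f -> CM 1 h -> cod i y -> lc i (gpair f h) y = gp i f h y.
Proof. by move=> Cf Ch cy; rewrite /lc /= (gpairE Cf Ch (inv_dom cy)) invK. Qed.

Lemma norm_gradE f x : norm_grad g f x = Num.sqrt (gpair f f x).
Proof.
rewrite /norm_grad /gpair /gp; set i := cat x.
by rewrite (_ : (\row_a partial a (f \o chart_inv X i) (chart X i x)) = drow (lc i f) (ch i x)).
Qed.

Lemma continuous_charts f : (forall i y, cod i y -> {for y, continuous (lc i f)}) -> continuous f.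
Proof.
move=> H x; have [i di] := chart_cover X x; have cy := ch_cod di.
have c : {for x, continuous (lc i f \o ch i)}.
  by apply: continuous_comp; [exact: ch_cont|exact: H].
apply: (@continuous_near _ _ (lc i f \o ch i) f x) c.
by apply: (near_eq_open (@dom_open i) di) => z; rewrite inE => dz; rewrite /lc /= chK.
Qed.

Lemma CM_continuous N f : CM N f -> continuous f.
Proof. by move=> Cf; apply: continuous_charts => i y cy; exact: (Ck_continuous (Cf i)). Qed.

Lemma CM0 f : continuous f -> CM 0 f.
Proof.
move=> cf i; apply/isCk0 => y cy; apply: continuous_comp; [exact: inv_cont|exact: cf].
Qed.

Lemma CMle N N' f : (N' <= N)%N -> CM N f -> CM N' f.
Proof. by move=> NN Cf i; exact: Ck_le (Cf i). Qed.
Lemma CMD N f h : CM N f -> CM N h -> CM N (fun x => f x + h x).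
Proof. by move=> Cf Ch i; apply: CkD => //; exact: cod_open. Qed.
Lemma CMM N f h : CM N f -> CM N h -> CM N (fun x => f x * h x).
Proof. by move=> Cf Ch i; apply: CkM => //; exact: cod_open. Qed.
Lemma CMZ N (c : R) f : CM N f -> CM N (fun x => c * f x).
Proof. by move=> Cf i; apply: CkZ => //; exact: cod_open. Qed.
Lemma CMB N f h : CM N f -> CM N h -> CM N (fun x => f x - h x).
Proof. by move=> Cf Ch i; apply: CkB => //; exact: cod_open. Qed.
Lemma CM_cst N (c : R) : CM N (fun=> c).
Proof. by move=> i; exact: Ck_cst. Qed.
Lemma CM_sum N (I : Type) (r : seq I) (F : I -> M -> R) : (forall k, CM N (F k)) ->
  CM N (fun x => \sum_(k <- r) F k x).
Proof. by move=> CF i; apply: Ck_sum => [|k _]; [exact: cod_open|exact: CF]. Qed.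
Lemma CM_powR N f (r : R) : (forall x, 0 < f x) -> CM N f -> CM N (fun x => f x `^ r).
Proof. by move=> f0 Cf i; apply: (Ck_powR r (@cod_open i) _ (Cf i)) => y _; exact: f0. Qed.

Lemma gpair_continuous f h : CM 1 f -> CM 1 h -> continuous (gpair f h).
Proof.
move=> Cf Ch; apply: continuous_charts => i y cy.
have C : isCk 0 (cod i) (gp i f h).
  rewrite /gp; under eq_fun do rewrite bilinE.
  apply: Ck_sum => [|a _]; first exact: cod_open; apply: Ck_sum => [|b _]; first exact: cod_open.
  have oi := @cod_open i; apply: CkM => //; first apply: CkM => //.
  - by under eq_fun do rewrite mxE; exact: Ck_partial (Cf i) a.
  - apply: Ck_invmx => // [z cz|c d]; last by apply/isCkP; exact: metric_smooth.
    by have := gram_unitmx (gram_metric cz); rewrite unitmxE unitfE.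
  - by under eq_fun do rewrite mxE; exact: Ck_partial (Ch i) b.
apply: (@continuous_near _ _ (gp i f h)); last exact: (Ck_continuous C).
by apply: (near_eq_open (@cod_open i) cy) => z; rewrite inE => cz; rewrite lc_gpair.
Qed.

Section GpairRules.
Variable i : nat.
Implicit Types (f h k : M -> R).

Lemma drowD f h y : CM 1 f -> CM 1 h -> cod i y ->
  drow (lc i (fun x => f x + h x)) y = drow (lc i f) y + drow (lc i h) y.
Proof.
move=> Cf Ch cy; apply/rowP => a; rewrite !mxE.
by apply: partialD; [exact: (Ck_derivable (Cf i))|exact: (Ck_derivable (Ch i))].
Qed.

Lemma drowM f h y : CM 1 f -> CM 1 h -> cod i y ->
  drow (lc i (fun x => f x * h x)) y = lc i h y *: drow (lc i f) y + lc i f y *: drow (lc i h) y.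
Proof.
move=> Cf Ch cy; apply/rowP => a; rewrite !mxE [_ * partial a (lc i f) y]mulrC.
by apply: partialM; [exact: (Ck_derivable (Cf i))|exact: (Ck_derivable (Ch i))].
Qed.

Lemma drow_cst (c : R) y : drow (lc i (fun=> c)) y = 0.
Proof. by apply/rowP => a; rewrite !mxE; exact: partial_cst. Qed.

Lemma drow_comp1 (f : M -> R) (phi : R -> R) (l : R) y : CM 1 f -> cod i y ->
  is_derive (lc i f y) 1 phi l -> drow (lc i (fun x => phi (f x))) y = l *: drow (lc i f) y.
Proof.
move=> Cf cy dphi; apply/rowP => a; rewrite !mxE.
have df : is_derive y (delta_mx ord0 a) (lc i f) (partial a (lc i f) y).
  by apply: DeriveDef => //; exact: (Ck_derivable (Cf i)).
by have [_ <-] := is_derive_comp1 df dphi; rewrite /partial.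
Qed.
End GpairRules.

Lemma gpairC f h x : gpair f h x = gpair h f x.
Proof.
have [dc _] := chart_atP x; rewrite /gpair /gp; apply: bilin_sym.
by have [] := gram_invmx (gram_metric (ch_cod dc)).
Qed.

Lemma gpair_ge0 f x : 0 <= gpair f f x.
Proof. by have [dc _] := chart_atP x; apply: gram_ge0; exact: gram_invmx (gram_metric (ch_cod dc)). Qed.

Lemma gpair_cs f h x : gpair f h x ^+ 2 <= gpair f f x * gpair h h x.
Proof. by have [dc _] := chart_atP x; apply: cauchy_schwarz; exact: gram_invmx (gram_metric (ch_cod dc)). Qed.

Lemma gpairDl f h k x : CM 1 f -> CM 1 h -> gpair (fun z : M => f z + h z) k x = gpair f k x + gpair h k x.
Proof. by move=> Cf Ch; have [dc _] := chart_atP x; rewrite /gpair /gp drowD // ?bilinDl //; exact: ch_cod. Qed.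

Lemma gpairMl f h k x : CM 1 f -> CM 1 h -> gpair (fun z : M => f z * h z) k x = h x * gpair f k x + f x * gpair h k x.
Proof.
move=> Cf Ch; have [dc _] := chart_atP x; rewrite /gpair /gp drowM //; last exact: ch_cod.
by rewrite bilinDl !bilinZl /lc /= chK.
Qed.

Lemma gpair_compl f (phi : R -> R) (l : R) k x : CM 1 f -> is_derive (f x) 1 phi l ->
  gpair (fun z : M => phi (f z)) k x = l * gpair f k x.
Proof.
move=> Cf d; have [dc _] := chart_atP x; rewrite /gpair /gp.
have d' : is_derive (lc (cat x) f (ch (cat x) x)) 1 phi l by rewrite /lc /= chK.
by rewrite (@drow_comp1 (cat x) f phi l _ Cf (ch_cod dc) d') bilinZl.
Qed.

Lemma gpair_cstl (c : R) k x : gpair (fun=> c) k x = 0.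
Proof. by rewrite /gpair /gp drow_cst bilin0l. Qed.

Lemma gpairZl (c : R) f k x : CM 1 f -> gpair (fun z : M => c * f z) k x = c * gpair f k x.
Proof. by move=> Cf; rewrite (gpairMl (f := fun=> c)) ?gpair_cstl ?mulr0 ?add0r //; exact: CM_cst. Qed.

Lemma gpair_suml (I : Type) (r : seq I) (F : I -> M -> R) k x : (forall j : I, CM 1 (F j)) ->
  gpair (fun z : M => \sum_(j <- r) F j z) k x = \sum_(j <- r) gpair (F j) k x.
Proof.
move=> CF; elim: r => [|j r IH]; first by under eq_fun do rewrite big_nil; rewrite big_nil gpair_cstl.
under eq_fun do rewrite big_cons.
by rewrite gpairDl ?big_cons ?IH //; exact: CM_sum.
Qed.

Lemma gpair_local (U : set M) f h k x : open U -> U x -> (forall z : M, U z -> f z = h z) ->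
  gpair f k x = gpair h k x.
Proof.
move=> oU Ux fh; have [dc _] := chart_atP x; rewrite /gpair /gp; set i := cat x in dc *.
suff -> : drow (lc i f) (ch i x) = drow (lc i h) (ch i x) by [].
apply/rowP => a; rewrite !mxE.
apply: (@partial_ext _ _ (cod i `&` inv i @^-1` U)).
- by apply: open_preim; [exact: cod_open|exact: inv_cont|].
- by move=> z; rewrite inE => -[_ Uz]; exact: fh.
- by split; [exact: ch_cod|rewrite /preimage /= chK].
Qed.

Lemma gpair_supp (K : set M) f k : closed K -> (forall x, f x != 0 -> K x) ->
  forall x, gpair f k x != 0 -> K x.
Proof.
move=> cK fK x; apply: contra_neqP => nK.
rewrite (@gpair_local (~` K) f (fun=> 0)) ?gpair_cstl //; first exact: closed_openC.
by move=> z nKz; apply/eqP/negPn/negP => /fK.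
Qed.

End Charts.
Arguments dom {R n M} X i _.
Arguments cod {R n M} X i _.
Arguments ch {R n M} X i _.
Arguments inv {R n M} X i _.
Arguments trans {R n M} X i j _.
Arguments overlap {R n M} X i j _.
Arguments jac {R n M} X i j y.
Arguments lc {R n M} X i f _.
Arguments CM {R n M} X N f.

(** * The Riemannian volume measure *)

Section Volume.
Context {R : realType} {n : nat} {M : ptopologicalType} {X : complexManifold R n M} (g : kahlerMetric X).
Implicit Types (x : M) (y z : 'rV[R]_(n + n)) (i j l : nat).
Let leb_ := leb (R := R) (n + n).
Local Open Scope ereal_scope.

Definition vd i z : R := Num.sqrt (\det (metric g i z)).

Lemma det_metric_gt0 i y : cod X i y -> (0 < \det (metric g i y))%R.
Proof.
move=> cy; have [s p] := gram_metric g cy; have [L _ gL] := cholesky s p.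
have := gram_unitmx (gram_metric g cy); rewrite unitmxE unitfE gL det_mulmx det_tr -expr2 => d0.
by rewrite lt0r d0 sqr_ge0.
Qed.

Lemma vd_gt0 i y : cod X i y -> (0 < vd i y)%R.
Proof. by move=> cy; rewrite sqrtr_gt0; exact: det_metric_gt0. Qed.

Lemma Ck_vd N i : isCk N (cod X i) (vd i).
Proof.
apply: Ck_sqrt => [|y|]; [exact: cod_open|exact: det_metric_gt0|].
by apply: Ck_det => [|a b]; [exact: cod_open|apply/isCkP; exact: metric_smooth].
Qed.

Lemma vd_cont i z : cod X i z -> {for z, continuous (vd i)}.
Proof. exact: (Ck_continuous (Ck_vd 0 i)). Qed.

Let d_ i z : R := if `[< cod X i z >] then vd i z else 0%R.
Let md i : measurable_fun setT (d_ i : borel 'rV[R]_(n + n) -> measurableTypeR R).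
Proof. by apply: within_continuous_borel; [exact: cod_open|exact: vd_cont]. Qed.
Let d_ge0 i z : (0 <= d_ i z)%R.
Proof. by rewrite /d_; case: asboolP => // _; exact: sqrtr_ge0. Qed.

(** The value off the chart is arbitrary: it makes the map total and measurable, and the density
    [d_] vanishes there. *)
Let I_ i z : M := if `[< cod X i z >] then inv X i z else point.
Let mI i : measurable_fun setT (I_ i : borel 'rV[R]_(n + n) -> borel M).
Proof.
apply: (@measurability _ _ (borel 'rV[R]_(n + n)) (borel M) setT (I_ i) open) => //.
move=> _ [B oB <-]; rewrite setTI.
have mc : measurable (cod X i : set (borel 'rV[R]_(n + n))) by apply: borel_open; exact: cod_open.
have m1 : measurable (cod X i `&` inv X i @^-1` B : set (borel 'rV[R]_(n + n))).
  by apply: borel_open; apply: open_preim => //; [exact: cod_open|exact: inv_cont].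
have m2 : measurable (~` cod X i `&` [set _ | B point] : set (borel 'rV[R]_(n + n))).
  apply: measurableI; first exact: measurableC.
  have [h|h] := pselect (B point).
    have -> : ([set _ | B point] : set (borel 'rV[R]_(n + n))) = setT by apply/seteqP; split.
    exact: measurableT.
  have -> : ([set _ | B point] : set (borel 'rV[R]_(n + n))) = set0 by apply/seteqP; split.
  exact: measurable0.
rewrite (_ : I_ i @^-1` B = (cod X i `&` inv X i @^-1` B) `|` (~` cod X i `&` [set _ | B point])).
  exact: measurableU.
apply/seteqP; split=> z; rewrite /preimage /= /I_; case: asboolP => c.
- by left.
- by right.
- by case=> -[].
- by case=> -[].
Qed.

Definition chart_measure i : {measure set (borel M) -> \bar R} := pushm (dens leb_ (md i) (d_ge0 i)) (mI i).

Lemma chart_measureE i (A : set M) : measurable (A : set (borel M)) ->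
  chart_measure i A = \int[leb_]_z (if `[< cod X i z /\ A (inv X i z) >] then vd i z else 0%R)%:E.
Proof.
move=> mA; apply: eq_integral => z _; rewrite /d_ indicE /I_.
case: (asboolP (cod X i z)) => c; last by rewrite mul0e asboolF // => -[].
case: asboolP => [[_ h]|h]; first by rewrite mem_set ?mule1 //= asboolT.
by rewrite memNset ?mule0 //= /I_ asboolT // => A'; apply: h.
Qed.

Lemma integral_chart_measure i (f : M -> \bar R) : measurable_fun setT (f : borel M -> \bar R) ->
  (forall x, 0 <= f x) ->
  \int[chart_measure i]_x f x = \int[leb_]_z (if `[< cod X i z >] then f (inv X i z) * (vd i z)%:E else 0).
Proof.
move=> mf f0; rewrite integral_pushm // integral_dens //; last exact: (measurableT_comp mf (mI i)).
apply: eq_integral => z _; rewrite /d_ /I_; case: asboolP => // _; by rewrite mule0.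
Qed.

(** Change of variables along the transition map: the determinants of the two Gram matrices differ
    by the square of the Jacobian determinant, so their square roots differ by its absolute
    value. *)
Lemma chart_measure_agree i l (A : set M) : measurable (A : set (borel M)) ->
  A `<=` dom X i -> A `<=` dom X l -> chart_measure i A = chart_measure l A.
Proof.
move=> mA Ai Al; rewrite !chart_measureE //.
pose E : set 'rV[R]_(n + n) := cod X i `&` I_ i @^-1` A.
have mE : measurable (E : set (borel 'rV[R]_(n + n))).
  apply: measurableI; first by apply: borel_open; exact: cod_open.
  by rewrite -[X in measurable X]setTI; apply: mI.
have := @change_variables R (n + n) (overlap X i l) (overlap X l i) (trans X i l) (trans X l i) (vd l) (vd i).
move=> /(_ (@overlap_open _ _ _ X i l) (@overlap_open _ _ _ X l i) (@trans_overlap _ _ _ X i l) (@trans_overlap _ _ _ X l i)).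
move=> /(_ (@transK _ _ _ X i l) (@transK _ _ _ X l i) (@trans_diff _ _ _ X i l) (@trans_diff _ _ _ X l i)).
have c1 z : overlap X l i z -> {for z, continuous (vd l)} by move=> [c _]; exact: vd_cont.
have c2 z : overlap X i l z -> {for z, continuous (vd i)} by move=> [c _]; exact: vd_cont.
move=> /(_ c1 c2 (fun z _ => sqrtr_ge0 _) (fun z _ => sqrtr_ge0 _)).
have w12 y : overlap X i l y -> vd i y = (vd l (trans X i l y) * `|\det ('J (trans X i l) y)|)%R.
  move=> Oy; rewrite -jacE /vd (jac_compat g Oy) !det_mulmx det_tr mulrAC -expr2.
  by rewrite sqrtrM ?sqr_ge0 // sqrtr_sqr mulrC.
move=> /(_ w12 E mE) H.
transitivity (\int[leb_]_z (if `[< overlap X i l z /\ E z >] then vd i z else 0%R)%:E).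
  apply: eq_integral => z _; congr (_%:E); congr (if _ then _ else _).
  apply: asbool_equiv_eq; split=> [[cz Az]|[[cz _] [_ Ez]]].
    by split; split=> //; [exact: Al|rewrite /preimage /= /I_ asboolT].
  by split=> //; move: Ez; rewrite /preimage /= /I_ asboolT.
rewrite -H; apply: eq_integral => z _; congr (_%:E); congr (if _ then _ else _).
apply: asbool_equiv_eq; split=> [[Oz [cE Ez]]|[cz Az]].
  split; first by case: Oz.
  by move: Ez; rewrite /preimage /= /I_ asboolT // inv_trans.
have Oz : overlap X l i z by split=> //; exact: Ai.
split=> //; have ct : cod X i (trans X l i z) by case: (trans_overlap Oz).
by split=> //; rewrite /preimage /= /I_ asboolT // inv_trans.
Qed.

Definition piece i : set M := [set x | chart_at (X := X) x = i].

Lemma piece_dom i : piece i `<=` dom X i.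
Proof. by move=> x <-; case: (chart_atP (X := X) x). Qed.

Lemma measurable_piece i : measurable (piece i : set (borel M)).
Proof.
have -> : piece i = dom X i `\` \bigcup_(j in [set j | (j < i)%N]) dom X j.
  apply/seteqP; split=> [x xi|x [di nd]].
    split; first exact: piece_dom.
    by move=> [j /= ji dj]; have [_ /(_ j dj)] := chart_atP (X := X) x; rewrite xi leqNgt ji.
  have [dc mc] := chart_atP (X := X) x; apply/eqP; rewrite eqn_leq mc //=.
  by rewrite leqNgt; apply/negP => lt; apply: nd; exists (chart_at (X := X) x).
apply: measurableD; first by apply: borel_open; exact: dom_open.
by apply: borel_open; apply: bigcup_open => j _; exact: dom_open.
Qed.

(** A measure in the full sense that agrees with [volume] on Borel sets, [volume] being a bare set
    function. *)
Definition volm : {measure set (borel M) -> \bar R} :=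
  mseries (fun i => mrestr (chart_measure i) (measurable_piece i)) 0.

Lemma volmE (A : set M) : volm A = \sum_(0 <= i <oo) chart_measure i (A `&` piece i).
Proof. by []. Qed.

Lemma volume_volm (A : set M) : measurable (A : set (borel M)) -> volume g A = volm A.
Proof.
move=> mA; rewrite volmE; apply: eq_eseriesr => i _.
rewrite chart_measureE; last by apply: measurableI => //; exact: measurable_piece.
rewrite integral_rVE; last 2 first.
- have mAi : measurable (A `&` piece i : set (borel M)) by apply: measurableI => //; exact: measurable_piece.
  apply/measurable_EFinP.
  have -> : (fun z => if `[< chart_cod X i z /\ chart_at (X := X) (chart_inv X i z) = i /\ A (chart_inv X i z) >]
      then Num.sqrt (\det (metric g i z)) else 0%R) = (fun z => d_ i z * \1_(I_ i @^-1` (A `&` piece i)) z)%R.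
    apply/funext => z; rewrite /d_ indicE; case: (asboolP (cod X i z)) => c; last by rewrite mul0r asboolF // => -[].
    case: asboolP => [[_ [h1 h2]]|h]; first by rewrite mem_set ?mulr1 //= /I_ asboolT.
    by rewrite memNset ?mulr0 //= /I_ asboolT // => -[h1 h2]; apply: h.
  apply: (measurable_funM (md i)); apply/measurable_EFinP.
  have mP : measurable (I_ i @^-1` (A `&` piece i) : set (borel 'rV[R]_(n + n))).
    by rewrite -[X in measurable X]setTI; exact: mI.
  exact: (measurable_fun_indicE mP).
- by move=> z; rewrite lee_fin; case: asboolP => // _; exact: sqrtr_ge0.
apply: eq_integral => z _; congr (_%:E); congr (if _ then _ else _); apply: asbool_equiv_eq.
by split=> [[c [h1 h2]]|[c [h1 h2]]].
Qed.

Import HBNNSimple.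

(** The integral evaluates the set function only on level sets of simple functions, and these are
    Borel sets, where [volume] and [volm] agree. The statement thus holds for arbitrary
    integrands. *)
Lemma integral_volume (f : M -> \bar R) : \int[volume g]_x f x = \int[volm]_x f x.
Proof.
have S (h : {nnsfun (borel M) >-> R}) : sintegral (volume g) h = sintegral volm h.
  by apply: eq_fsbigr => r _; rewrite volume_volm.
rewrite /integral; congr (ereal_sup _ - ereal_sup _); apply/seteqP; split=> _ [h /= hf <-]; exists h => //.
Qed.

Lemma measure_pieces (mu : {measure set (borel M) -> \bar R}) (A : set M) : measurable (A : set (borel M)) ->
  mu A = \sum_(0 <= i <oo) mu (A `&` piece i).
Proof.
move=> mA; have mAi i : measurable (A `&` piece i : set (borel M)) by apply: measurableI => //; exact: measurable_piece.
have -> : mu A = mu (\bigcup_i (A `&` piece i)).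
  by congr (mu _); apply/seteqP; split=> [x Ax|x [i _ []]] //; exists (chart_at (X := X) x).
rewrite measure_bigcup //; last first.
  by apply/trivIsetP => i j _ _ ij; apply/seteqP; split=> // x [[_ xi] [_ xj]]; move: ij; rewrite -xi -xj eqxx.
by apply: eq_eseriesl => i; rewrite in_setT.
Qed.

(** The cutting of M into pieces disappears inside one chart: on each piece the two chart measures
    agree, and the pieces of A add up again. *)
Lemma volm_dom l (A : set M) : measurable (A : set (borel M)) -> A `<=` dom X l -> volm A = chart_measure l A.
Proof.
move=> mA Al; rewrite volmE (measure_pieces (chart_measure l) mA).
apply: eq_eseriesr => i _; apply: chart_measure_agree.
- by apply: measurableI => //; exact: measurable_piece.
- by move=> x [_ /piece_dom].
- by move=> x [/Al].
Qed.

Lemma volm_open_gt0 (U : set M) : open U -> U !=set0 -> 0 < volm U.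
Proof.
move=> oU [x Ux]; have [l dl] := chart_cover X x.
pose A := U `&` dom X l; have oA : open A by apply: openI => //; exact: dom_open.
have mA : measurable (A : set (borel M)) by exact: borel_open.
apply: (@lt_le_trans _ _ (volm A)); last first.
  by apply: le_measure; [rewrite inE|rewrite inE; exact: borel_open|move=> z []].
rewrite (@volm_dom l A mA) ?chart_measureE //; last by move=> z [].
pose V := cod X l `&` inv X l @^-1` A; have cy := ch_cod dl.
have oV : open V by apply: open_preim => //; [exact: cod_open|exact: inv_cont].
have Vy : V (ch X l x) by split=> //; rewrite /preimage /= chK.
pose c := (vd l (ch X l x) / 2)%R; have c0 : (0 < c)%R by rewrite divr_gt0 // vd_gt0.
have [r r0 Hr] : exists2 r : R, (0 < r)%R & forall z, (`|z - ch X l x| < r)%R -> V z /\ (c <= vd l z)%R.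
  apply/nbhs_rV; apply: filterI; first exact: open_nbhs_nbhs.
  have /cvgrPdist_lt/(_ _ c0) := vd_cont cy; apply: filterS => z; rewrite ltr_norml => /andP[_]; rewrite /c; lra.
pose Q := box (ch X l x - const_mx (r / 2))%R (ch X l x + const_mx (r / 2))%R.
have mQ : measurable (Q : set (borel 'rV[R]_(n + n))) by exact: measurable_box.
apply: (@lt_le_trans _ _ (\int[leb_]_z (c%:E * (\1_Q z : R)%:E))).
  rewrite ge0_integralZl_EFin //; [|exact: measurable_fun_indicE|exact: ltW].
  rewrite -leb_indic // leb_box => [|a]; last by rewrite !mxE; lra.
  by rewrite -EFinM lte_fin mulr_gt0 // prodr_gt0 // => a _; rewrite !mxE; lra.
apply: ge0_le_integral => //.
- by move=> z _; rewrite mule_ge0 // lee_fin // ltW.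
- by apply: emeasurable_funM => //; exact: measurable_fun_indicE.
- apply/measurable_EFinP; rewrite (_ : (fun z => _) = (fun z => if `[< V z >] then vd l z else 0%R)).
    by apply: within_continuous_borel => // z [c' _]; exact: vd_cont.
  by [].
move=> z _; rewrite indicE; have [/set_mem Qz|_] := boolP (z \in Q); last first.
  by rewrite mule0 lee_fin; case: asboolP => // _; exact: sqrtr_ge0.
have [Vz cz] : V z /\ (c <= vd l z)%R.
  apply: Hr; apply: (@le_lt_trans _ _ (r / 2)%R); last lra.
  apply: norm_le_coord; first by rewrite divr_ge0 // ltW.
  by move=> a; have := Qz a; rewrite !mxE ler_norml => /andP[h1 h2]; apply/andP; split; lra.
by rewrite mule1 lee_fin asboolT.
Qed.

Lemma volm_compact (K : set M) : compact K -> volm K < +oo.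
Proof.
move=> cK; have /choice[U HU] : forall x, exists U : set M, [/\ open U, U x & volm U < +oo].
  move=> x; have [l dl] := chart_cover X x; have cy := ch_cod dl.
  have [r r0 Hr] : exists2 r : R, (0 < r)%R & forall z, (`|z - ch X l x| < r)%R -> cod X l z /\ (vd l z <= vd l (ch X l x) + 1)%R.
    apply/nbhs_rV; apply: filterI; first by apply: open_nbhs_nbhs; split=> //; exact: cod_open.
    have /cvgrPdist_lt/(_ _ ltr01) := vd_cont cy; apply: filterS => z; rewrite ltr_norml => /andP[+ _]; lra.
  pose U := dom X l `&` ch X l @^-1` (ball (ch X l x) r).
  have oU : open U by apply: open_preim; [exact: dom_open|exact: ch_cont|exact: ball_open].
  have mU : measurable (U : set (borel M)) by exact: borel_open.
  exists U; split=> //; first by split=> //; exact: ballxx.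
  rewrite (@volm_dom l U mU); last by move=> z [].
  rewrite chart_measureE //.
  pose Q := cbox (ch X l x - const_mx r)%R (ch X l x + const_mx r)%R.
  have cQ : compact Q by exact: compact_cbox.
  have mQ : measurable (Q : set (borel 'rV[R]_(n + n))) by apply: measurable_compact => //; exact: haus_rV.
  have c0 : (0 <= vd l (ch X l x) + 1)%R by rewrite addr_ge0 // sqrtr_ge0.
  apply: (@le_lt_trans _ _ ((vd l (ch X l x) + 1)%:E * leb_ Q)); last first.
    have fin : leb_ Q \is a fin_num by rewrite ge0_fin_numE ?measure_ge0 //; exact: leb_compact.
    by rewrite -(fineK fin) -EFinM ltry.
  rewrite leb_indic // -ge0_integralZl_EFin //; last exact: measurable_fun_indicE.
  apply: ge0_le_integral => //.
  - by move=> z _; rewrite lee_fin; case: asboolP => // _; exact: sqrtr_ge0.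
  - apply/measurable_EFinP; pose V := cod X l `&` inv X l @^-1` U.
    rewrite (_ : (fun z => _) = (fun z => if `[< V z >] then vd l z else 0%R)) //.
    apply: within_continuous_borel => [|z [c' _]]; last exact: vd_cont.
    by apply: open_preim => //; [exact: cod_open|exact: inv_cont].
  - by apply: emeasurable_funM => //; exact: measurable_fun_indicE.
  move=> z _; case: asboolP => [[cz [_ Uz]]|_]; last by rewrite mule_ge0 // lee_fin.
  move: Uz; rewrite /preimage /= invK // -ball_normE /= distrC => zr; have [_ vz] := Hr z zr.
  rewrite indicE mem_set ?mule1 ?lee_fin // => a; have := le_lt_trans (coord_le_norm _ a) zr.
  by rewrite !mxE ltr_norml => /andP[h1 h2]; apply/andP; split; lra.
have cK' : cover_compact K by rewrite -compact_cover.
have [||D _ KD] := cK' M setT U.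
- by move=> x _; case: (HU x).
- by move=> x Kx; exists x => //; case: (HU x).
have mU x : measurable (U x : set (borel M)) by apply: borel_open; case: (HU x).
apply: (@le_lt_trans _ _ (\sum_(x <- enum_fset D) volm (U x))); last first.
  by apply: lte_sum_pinfty => x _; case: (HU x).
apply: (@le_trans _ _ (volm (\big[setU/set0]_(x <- enum_fset D) (U x : set (borel M))))).
  apply: le_measure; rewrite ?inE.
  - by apply: measurable_compact => //; exact: (haus (X := X)).
  - by apply: bigsetU_measurable => x _; exact: mU.
  - by move=> x /KD [z /= zD Uz]; rewrite -bigcup_fset; exists z.
elim: (enum_fset D) => [|x s IH]; first by rewrite !big_nil measure0.
rewrite !big_cons; apply: le_trans (measureU2 _ _ _) _ => //.
  by apply: bigsetU_measurable => z _; exact: mU.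
exact: leeD.
Qed.

Lemma maxe_scale (a b : R) : (0 <= a)%R -> maxe b%:E 0 * a%:E = maxe (a * b)%:E 0.
Proof.
move=> a0; have [b0|b0] := leP b 0%R.
  by rewrite !max_r ?lee_fin ?mul0e // mulr_ge0_le0.
by rewrite !max_l ?lee_fin ?(ltW b0) ?mulr_ge0 ?(ltW b0) // -EFinM mulrC.
Qed.

Definition loc l (f : M -> R) z : R := if `[< cod X l z >] then f (inv X l z) else 0%R.

Lemma Int_chart l f K : cc f -> compact K -> K `<=` dom X l -> (forall x, f x != 0 -> K x)%R ->
  Int volm f = Int leb_ (fun z => vd l z * loc l f z)%R.
Proof.
move=> cf cK Kl fK.
have P (h : M -> \bar R) : measurable_fun setT (h : borel M -> \bar R) -> (forall x, 0 <= h x) ->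
    (forall x, ~ dom X l x -> h x = 0) ->
    \int[volm]_x h x = \int[leb_]_z (if `[< cod X l z >] then h (inv X l z) * (vd l z)%:E else 0).
  move=> mh h0 hl; rewrite -integral_chart_measure //.
  have md' : measurable (dom X l : set (borel M)) by apply: borel_open; exact: dom_open.
  have E (mu : {measure set (borel M) -> \bar R}) : \int[mu]_x h x = \int[mu]_(x in dom X l) h x.
    rewrite [RHS]integral_mkcond; apply: eq_integral => x _; rewrite patchE.
    by case: ifPn => // /negP nd; rewrite hl // => d; apply: nd; exact/mem_set.
  by rewrite !E; apply: eq_measure_integral => A mA Al; exact: volm_dom.
have mf : measurable_fun setT (EFin \o f : borel M -> \bar R) by apply/measurable_EFinP; exact: cc_measurable.
have f0 x : ~ dom X l x -> f x = 0%R by move=> nd; apply/eqP/negPn/negP => /fK/Kl.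
rewrite /Int /Rintegral integralE [X in _ = fine X]integralE; congr fine; congr (_ - _)%E.
  rewrite P; [|exact: measurable_funepos|by move=> x; exact: funepos_ge0|by move=> x nd; rewrite funeposE /= f0 // maxxx].
  apply: eq_integral => z _; rewrite !funeposE /= /loc; case: asboolP => cz; last by rewrite mulr0 maxxx.
  by rewrite maxe_scale // sqrtr_ge0.
rewrite P; [|exact: measurable_funeneg|by move=> x; exact: funeneg_ge0|by move=> x nd; rewrite funenegE /= f0 // oppr0 maxxx].
apply: eq_integral => z _; rewrite !funenegE /= /loc; case: asboolP => cz; last by rewrite mulr0 oppr0 maxxx.
by rewrite -mulrN maxe_scale // sqrtr_ge0.
Qed.

End Volume.

Lemma wirtinger_eq0 (R : realType) (a b c d : R) :
  2^-1 * (Complex (2^-1 * a) (2^-1 * b) - 'i%C * Complex (2^-1 * c) (2^-1 * d)) = 0 :> R[i] -> a + d = 0 /\ b = c.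
Proof.
move=> /eqP; rewrite mulf_eq0 invr_eq0 pnatr_eq0 /= eq_complex /= => /andP[/eqP h1 /eqP h2].
by split; lra.
Qed.

Lemma drow_ext (R : realType) n (V : set 'rV[R]_(n + n)) (f h : 'rV[R]_(n + n) -> R) y : open V -> V y ->
  (forall z, V z -> f z = h z) -> drow f y = drow h y.
Proof.
by move=> oV Vy fh; apply/rowP => a; rewrite !mxE; apply: (partial_ext oV) => // z; rewrite inE; exact: fh.
Qed.

(** * Partitions of unity and the global integral formulas *)

Section Gluing.
Context {R : realType} {n : nat} {M : ptopologicalType} (X : complexManifold R n M) (g : kahlerMetric X).
Implicit Types (x : M) (y z : 'rV[R]_(n + n)) (i j l : nat).
Let hM : hausdorff_space M := haus (X := X).
Let VC := @volm_compact R n M X g.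

(** Extension by zero from a chart to M. It preserves regularity when h vanishes off a compact part
    of the chart, because compact sets are closed in the Hausdorff space M. *)
Definition glob l (h : 'rV[R]_(n + n) -> R) x : R := if `[< dom X l x >] then h (ch X l x) else 0.

Lemma inv_compact l (K : set 'rV[R]_(n + n)) : compact K -> K `<=` cod X l -> compact (inv X l @` K).
Proof.
move=> cK Kl; apply: continuous_compact => //; apply: continuous_in_subspaceT => z /set_mem/Kl.
exact: inv_cont.
Qed.

Lemma ch_compact l (K : set M) : compact K -> K `<=` dom X l -> compact (ch X l @` K).
Proof.
move=> cK Kl; apply: continuous_compact => //; apply: continuous_in_subspaceT => z /set_mem/Kl.
exact: ch_cont.
Qed.

Lemma glob_supp l h (K : set 'rV[R]_(n + n)) : (forall z, h z != 0 -> K z) ->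
  forall x, glob l h x != 0 -> (inv X l @` K) x.
Proof.
by move=> hK x; rewrite /glob; case: asboolP => [dx /hK Kx|_]; [exists (ch X l x); rewrite ?chK|rewrite eqxx].
Qed.

Lemma inv_sub l (K : set 'rV[R]_(n + n)) : K `<=` cod X l -> inv X l @` K `<=` dom X l.
Proof. by move=> Kl _ [z /Kl cz <-]; exact: inv_dom. Qed.

Lemma glob_CM N l h (K : set 'rV[R]_(n + n)) : compact K -> K `<=` cod X l -> (forall z, h z != 0 -> K z) ->
  isCk N setT h -> CM X N (glob l h).
Proof.
move=> cK Kl hK Ch i; apply: Ck_bigcup => y cy.
have cL : closed (inv X l @` K) by apply: compact_closed => //; exact: inv_compact.
have [dl|ndl] := pselect (dom X l (inv X i y)).
  exists (overlap X i l); first by split.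
  apply: (@Ck_ext _ _ _ _ (h \o trans X i l)); first exact: overlap_open.
    by move=> z; rewrite inE => -[_ dz]; rewrite /lc /= /glob asboolT.
  by apply: Ck_trans; exact: Ck_sub Ch.
exists (cod X i `&` inv X i @^-1` (~` (inv X l @` K))).
  by split=> //; apply: contra_not ndl; exact: inv_sub.
apply: (@Ck_ext _ _ _ _ (cst 0)); last exact: Ck_cst.
  by apply: open_preim; [exact: cod_open|exact: inv_cont|exact: closed_openC].
move=> z; rewrite inE => -[_ nz]; rewrite /lc /=; apply/eqP; rewrite eq_sym; apply/negPn/negP.
by move=> /(glob_supp hK).
Qed.

Lemma loc_supp l f (K : set M) : (forall x, f x != 0 -> K x) ->
  forall z, loc (X := X) l f z != 0 -> (ch X l @` K) z.
Proof.
move=> fK z; rewrite /loc; case: asboolP => [cz /fK Kz|_]; last by rewrite eqxx.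
by exists (inv X l z) => //; rewrite invK.
Qed.

Lemma ch_sub l (K : set M) : K `<=` dom X l -> ch X l @` K `<=` cod X l.
Proof. by move=> Kl _ [x /Kl dx <-]; exact: ch_cod. Qed.

Lemma loc_Ck N l f (K : set M) : compact K -> K `<=` dom X l -> (forall x, f x != 0 -> K x) ->
  CM X N f -> isCk N setT (loc (X := X) l f).
Proof.
move=> cK Kl fK Cf; apply: Ck_bigcup => y _.
have cL : closed (ch X l @` K) by apply: compact_closed; [exact: haus_rV|exact: ch_compact].
have [cy|ncy] := pselect (cod X l y).
  exists (cod X l) => //; apply: (@Ck_ext _ _ _ _ (lc X l f)) => //; first exact: cod_open.
  by move=> z; rewrite inE => cz; rewrite /loc asboolT.
exists (~` (ch X l @` K)); first by apply: contra_not ncy; exact: ch_sub.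
apply: (@Ck_ext _ _ _ _ (cst 0)); [exact: closed_openC| |exact: Ck_cst].
by move=> z; rewrite inE => nz; apply/eqP; rewrite eq_sym; apply/negPn/negP => /(loc_supp fK).
Qed.

Lemma loc_c1c l f (K : set M) : compact K -> K `<=` dom X l -> (forall x, f x != 0 -> K x) ->
  CM X 1 f -> c1c (loc (X := X) l f).
Proof.
move=> cK Kl fK Cf; have C := loc_Ck cK Kl fK Cf; split=> //; split.
  by move=> z; exact: (Ck_continuous C).
by exists (ch X l @` K); [exact: ch_compact|exact: loc_supp].
Qed.

Lemma bump_M l (K : set M) : compact K -> K `<=` dom X l ->
  exists chi : M -> R, exists U K' : set M,
    [/\ forall N, CM X N chi, (forall x, 0 <= chi x <= 1) &
        [/\ open U, K `<=` U, (forall x, U x -> chi x = 1), compact K' &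
            K' `<=` dom X l /\ forall x, chi x != 0 -> K' x]].
Proof.
move=> cK Kl; have [h [U [L [Ch h01 [oU KU h1 cL [Ll hL]]]]]] := bump_rV (ch_compact cK Kl) (@cod_open _ _ _ X l) (ch_sub Kl).
exists (glob l h), (dom X l `&` ch X l @^-1` U), (inv X l @` L); split.
- by move=> N; exact: glob_CM cL Ll hL (Ch N).
- by move=> x; rewrite /glob; case: asboolP => // _; rewrite lexx ler01.
split.
- by apply: open_preim; [exact: dom_open|exact: ch_cont|].
- by move=> x Kx; split; [exact: Kl|apply: KU; exists x].
- by move=> x [dx Ux]; rewrite /glob asboolT // h1.
- exact: inv_compact.
- by split; [exact: inv_sub|exact: glob_supp].
Qed.

Definition chart_bump (c : (M -> R) * nat) := [/\ forall N, CM X N c.1, forall x, 0 <= c.1 x <= 1 &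
  exists K : set M, [/\ compact K, K `<=` dom X c.2 & forall x, c.1 x != 0 -> K x]].

(* The functions b_0, (1 - b_0) b_1, (1 - b_0)(1 - b_1) b_2, ... sum up to 1 - prod (1 - b_i). *)
Lemma telescope_bumps N (b : nat -> (M -> R) * nat) : (forall i, chart_bump (b i)) ->
  exists2 c : nat -> (M -> R) * nat, (forall i, chart_bump (c i)) &
    forall x, \sum_(i < N) (c i).1 x = 1 - \prod_(i < N) (1 - (b i).1 x).
Proof.
elim: N b => [|N IH] b Hb; first by exists b => // x; rewrite !big_ord0 subrr.
have [c Hc Ec] := IH (fun i => b i.+1) (fun i => Hb i.+1).
have [C0 b0 _] := Hb 0%N.
exists (fun i => if i is j.+1 then (fun x => (1 - (b 0%N).1 x) * (c j).1 x, (c j).2) else b 0%N).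
  case=> [|j]; first exact: Hb.
  have [Cc c01 [K [cK Kl cKs]]] := Hc j; split=> /=.
  - by move=> k; apply: CMM => //; apply: CMB => //; exact: CM_cst.
  - move=> x; have /andP[h1 h2] := b0 x; have /andP[h3 h4] := c01 x.
    rewrite mulr_ge0 ?subr_ge0 //=; apply: (@le_trans _ _ (1 * 1)); last by rewrite mulr1.
    by apply: ler_pM => //; rewrite ?subr_ge0 // lerBlDr lerDl.
  - by exists K; split=> // x; rewrite mulf_eq0 negb_or => /andP[_ /cKs].
by move=> x; rewrite !big_ord_recl /= -mulr_sumr Ec; ring.
Qed.

Lemma partition_of_unity (K : set M) : compact K ->
  exists N (c : nat -> (M -> R) * nat), (forall i, chart_bump (c i)) /\
    forall x, K x -> \sum_(i < N) (c i).1 x = 1.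
Proof.
move=> cK; have /choice[B HB] : forall x, exists B : (M -> R) * nat * set M,
    [/\ chart_bump B.1, open B.2, B.2 x & forall z : M, B.2 z -> B.1.1 z = 1].
  move=> x; have [l dl] := chart_cover X x.
  have sl : [set x] `<=` dom X l by move=> _ ->.
  have [chi [U [K' [Cc c01 [oU KU c1 cK' [Kl' cs]]]]]] := bump_M (@compact_set1 _ x) sl.
  exists ((chi, l), U); split=> //=; [|exact: KU].
  by split=> //; exists K'.
have cK' : cover_compact K by rewrite -compact_cover.
have [||D _ KD] := cK' M setT (fun x => (B x).2).
- by move=> x _; case: (HB x).
- by move=> x Kx; exists x => //; case: (HB x).
pose s := enum_fset D; pose b i := (B (nth point s i)).1.
have [c Hc Ec] := @telescope_bumps (size s) b (fun i => let: And4 h _ _ _ := HB (nth point s i) in h).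
exists (size s), c; split=> // x Kx; rewrite Ec; have [z /= zD Bz] := KD x Kx.
have zi : (index z s < size s)%N by rewrite index_mem.
rewrite (bigD1 (Ordinal zi)) //= /b nth_index //.
by have [_ _ _ ->] := HB z; rewrite // subrr mul0r subr0.
Qed.

Lemma continuous_supp (D K : set M) (f : M -> R) : (forall x, D x -> {for x, continuous f}) ->
  closed K -> K `<=` D -> (forall x, f x != 0 -> K x) -> continuous f.
Proof.
move=> cf cK KD fK x; have [Dx|nD] := pselect (D x); first exact: cf.
have nK : (~` K) x by move=> /KD.
apply: (@continuous_near _ _ (cst 0 : M -> R) f x); last exact: cst_continuous.
apply: (near_eq_open (closed_openC cK) nK) => z; rewrite inE => nKz.
by apply/eqP; rewrite eq_sym; apply/negPn/negP => /fK.
Qed.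

Lemma gpair_cc f h : CM X 1 f -> CM X 1 h -> cc f -> cc (gpair g f h).
Proof.
move=> Cf Ch [_ [K cK fK]]; split; first exact: gpair_continuous.
by exists K => //; apply: gpair_supp => //; exact: compact_closed.
Qed.

Variables (u : M -> R) (uP : pluriharmonic (X := X) u).

Let Cu : CM X 2 u.
Proof. by move=> i; apply/isCkP; case: uP => H _; exact: H. Qed.
Let Cu1 : CM X 1 u := CMle (leqnSn 1) Cu.

Lemma halfC : (2^-1 : R[i]) = (2^-1)%:C%C.
Proof. by rewrite fmorphV rmorph_nat. Qed.

Lemma Jmx_anti (A : 'I_(n + n) -> 'I_(n + n) -> R) :
  (forall j k : 'I_n, A (lshift n j) (lshift n k) + A (rshift n j) (rshift n k) = 0 /\
    A (lshift n j) (rshift n k) = A (rshift n j) (lshift n k)) ->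
  Jmx *m (\matrix_(a, b) A a b) *m Jmx^T = - \matrix_(a, b) A a b.
Proof.
move=> E; apply/matrixP => a b; rewrite -[a]splitK -[b]splitK.
rewrite /Jmx tr_block_mx !trmx0 linearN /= !trmx1 -[\matrix_(_, _) _]submxK !mulmx_block !mulmx0 !mul0mx.
rewrite !mulNmx !mulmxN !mul1mx !mulmx1 !add0r !addr0 opp_block_mx opprK.
case: (fintype.split a) => j; case: (fintype.split b) => k /=.
all: by rewrite ?(block_mxEul, block_mxEur, block_mxEdl, block_mxEdr) !mxE; have [e1 e2] := E j k; lra.
Qed.

(** The real and imaginary parts of the complex equation relate the blocks of the real Hessian: the
    x-x and y-y blocks are opposite, the x-y and y-x blocks are equal. This is the block form of
    J-anti-invariance. *)
Lemma pluri_hess l z : cod X l z -> Jmx *m hess (lc X l u) z *m Jmx^T = - hess (lc X l u) z.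
Proof.
move=> cz; have [_ /(_ l z cz) H] := uP.
pose f := lc X l u; pose H2 a b := partial a (partial b f) z.
have half_partial a b : partial a (fun w => 2^-1 * partial b f w) z = 2^-1 * H2 a b.
  apply: partialZ; exact: (Ck_derivable (Ck_partial (Cu l) b)).
have E (j k : 'I_n) : H2 (lshift n j) (lshift n k) + H2 (rshift n j) (rshift n k) = 0 /\
    H2 (lshift n j) (rshift n k) = H2 (rshift n j) (lshift n k).
  have D w : d_zbar k (fun w => Complex (f w) 0) w = Complex (2^-1 * partial (lshift n k) f w) (2^-1 * partial (rshift n k) f w).
    rewrite /d_zbar /partialC /= (partial_cst 0) (partial_cst 0) halfC; simpc.
    by rewrite ?(mul0r, mulr0, addr0, add0r, subr0, mul1r).
  have := H j k; rewrite -/f (_ : d_zbar k _ = (fun w => Complex (2^-1 * partial (lshift n k) f w) (2^-1 * partial (rshift n k) f w))); last exact/funext.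
  have PC a : partialC a (fun w => Complex (2^-1 * partial (lshift n k) f w) (2^-1 * partial (rshift n k) f w)) z =
      Complex (2^-1 * H2 a (lshift n k)) (2^-1 * H2 a (rshift n k)).
    by rewrite /partialC /= (half_partial a (lshift n k)) (half_partial a (rshift n k)).
  by rewrite /d_z !PC => /wirtinger_eq0.
exact: (Jmx_anti E).
Qed.

Definition energy := gpair g u u.

Let Gl l y := bilin (invmx (metric g l y)) (drow (lc X l u) y) (drow (lc X l u) y).

Let cg l N a b : isCk N (cod X l) (fun y => metric g l y a b).
Proof. by apply/isCkP; exact: metric_smooth. Qed.
Let grm l y : cod X l y -> gram (metric g l y).
Proof. exact: gram_metric. Qed.
Let hrm l y : cod X l y -> Jmx *m metric g l y *m Jmx^T = metric g l y.
Proof. exact: metric_hermitian. Qed.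
Let khl l y : cod X l y -> forall a b c, let omega := fun z => Jmx *m metric g l z in
  dmetric omega a b c y + dmetric omega b c a y + dmetric omega c a b y = 0.
Proof. exact: metric_kahler. Qed.

Lemma CM_energy : CM X 1 energy.
Proof.
move=> l; apply: (@Ck_ext _ _ _ _ (Gl l)); first exact: cod_open.
  by move=> z; rewrite inE => cz; rewrite /energy lc_gpair.
exact: (C1_G (@cod_open _ _ _ X l) (cg l) (grm (l := l)) (Cu l)).
Qed.

Let drow_energy l z : cod X l z -> drow (lc X l energy) z = drow (Gl l) z.
Proof.
move=> cz; apply: (drow_ext (@cod_open _ _ _ X l) cz) => w cw; exact: (lc_gpair g Cu1 Cu1 cw).
Qed.

Lemma energy_ge0 x : 0 <= energy x.
Proof. exact: gpair_ge0. Qed.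

(** The Bochner quantity computed in the coordinates of chart l, hence indexed by l. *)
Definition Zc l x := bochnerZ (metric g l) (lc X l u) (ch X l x).

Let drowE l f z : cod X l z -> drow (loc (X := X) l f) z = drow (lc X l f) z.
Proof.
by move=> cz; apply: (drow_ext (@cod_open _ _ _ X l) cz) => w cw; rewrite /loc asboolT.
Qed.

Section OneChart.
Variables (l : nat) (eta : M -> R) (K : set M).
Hypotheses (Ce : CM X 1 eta) (cK : compact K) (Kl : K `<=` dom X l) (eK : forall x, eta x != 0 -> K x).
Let K' := ch X l @` K.
Let cK' : compact K'. Proof. exact: ch_compact. Qed.
Let Kl' : K' `<=` cod X l. Proof. exact: ch_sub. Qed.
Let eK' : forall z, loc (X := X) l eta z != 0 -> K' z. Proof. exact: loc_supp. Qed.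
Let clK' : closed K'. Proof. by apply: compact_closed => //; exact: haus_rV. Qed.

Let off z : ~ cod X l z -> loc (X := X) l eta z = 0 /\ drow (loc (X := X) l eta) z = 0.
Proof.
move=> nz; split; first by rewrite /loc asboolF.
apply/rowP => a; rewrite !mxE; apply/eqP/negPn/negP => /(partial_supp clK' eK') /Kl'; exact: nz.
Qed.

Let ceta : cc eta.
Proof. by split; [exact: CM_continuous Ce|exists K]. Qed.

Lemma chart_bochner_cc : cc (fun x => eta x * Zc l x).
Proof.
split; last by exists K => // x; rewrite mulf_eq0 negb_or => /andP[/eK].
apply: (@continuous_supp (dom X l) K) => //; last 2 first.
- exact: compact_closed.
- by move=> x; rewrite mulf_eq0 negb_or => /andP[/eK].
move=> x dx; apply: (@continuousM R M eta (Zc l) x); first exact: (CM_continuous Ce).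
apply: (@continuous_comp _ _ _ (ch X l) (bochnerZ (metric g l) (lc X l u))); first exact: ch_cont.
have C := Ck_bochnerZ (@cod_open _ _ _ X l) (cg l) (grm (l := l)) (Cu l).
by apply: (Ck_continuous C); exact: ch_cod.
Qed.

Lemma chart_bochner : Int (volm g) (fun x => 2^-1 * gpair g eta energy x + eta x * Zc l x) = 0.
Proof.
have c1 : cc (fun x => 2^-1 * gpair g eta energy x + eta x * Zc l x).
  by apply: ccD; [apply: ccZ; apply: gpair_cc => //; exact: CM_energy|exact: chart_bochner_cc].
have supp x : 2^-1 * gpair g eta energy x + eta x * Zc l x != 0 -> K x.
  apply: contra_neqP => nK; have e0 : eta x = 0 by apply/eqP/negPn/negP => /eK.
  have -> : gpair g eta energy x = 0.
    by apply/eqP/negPn/negP => /(gpair_supp (compact_closed hM cK) eK).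
  by rewrite e0 mulr0 mul0r addr0.
rewrite (Int_chart g c1 cK Kl supp).
have := local_bochner (@cod_open _ _ _ X l) (cg l) (grm (l := l)) (Cu l) (hrm (l := l)) (khl (l := l))
  (pluri_hess (l := l)) (loc_c1c cK Kl eK Ce) cK' Kl' eK'.
move=> <-; congr Int; apply/funext => z; have [cz|ncz] := pselect (cod X l z); last first.
  by have [e1 e2] := off ncz; rewrite e1 e2 bilin0l /loc asboolF // !(mulr0, mul0r, addr0).
rewrite drowE // {1 2}/loc !asboolT //.
have -> : gpair g eta energy (inv X l z) = gp g l eta energy z by apply: lc_gpair => //; exact: CM_energy.
have -> : drow (fun y => bilin (invmx (metric g l y)) (drow (lc X l u) y) (drow (lc X l u) y)) z = drow (lc X l energy) z.
  exact: (esym (drow_energy cz)).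
rewrite /gp /Zc invK // /vd; ring.
Qed.

Lemma chart_divergence : Int (volm g) (gpair g eta u) = 0.
Proof.
have supp x : gpair g eta u x != 0 -> K x by apply: gpair_supp => //; exact: compact_closed.
rewrite (Int_chart g (gpair_cc Ce Cu1 ceta) cK Kl supp).
have := local_divergence (@cod_open _ _ _ X l) (cg l) (grm (l := l)) (Cu l) (hrm (l := l)) (khl (l := l))
  (pluri_hess (l := l)) (loc_c1c cK Kl eK Ce) cK' Kl' eK'.
move=> <-; congr Int; apply/funext => z; have [cz|ncz] := pselect (cod X l z); last first.
  by have [e1 e2] := off ncz; rewrite e2 bilin0l /loc asboolF // !mulr0.
rewrite drowE // /loc asboolT //.
by have -> : gpair g eta u (inv X l z) = gp g l eta u z by exact: lc_gpair.
Qed.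

End OneChart.

Lemma divergence_theorem eta : CM X 1 eta -> cc eta -> Int (volm g) (gpair g eta u) = 0.
Proof.
move=> Ce ce; have [_ [K cK eK]] := ce; have [N [c [Hc c1]]] := partition_of_unity cK.
pose ei (i : 'I_N) x := (c i).1 x * eta x.
have Cei (i : 'I_N) : CM X 1 (ei i) by apply: CMM => //; case: (Hc i).
have cei (i : 'I_N) : cc (ei i) by apply: ccM => //; have [h _ _] := Hc i; exact: CM_continuous (h 0%N).
have E : eta = (fun x => \sum_i ei i x).
  apply/funext => x; rewrite -mulr_suml; have [->|/eK Kx] := eqVneq (eta x) 0; first by rewrite mulr0.
  by rewrite c1 // mul1r.
have -> : gpair g eta u = (fun x => \sum_i gpair g (ei i) u x).
  by apply/funext => x; rewrite {1}E gpair_suml.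
rewrite (Int_sum hM VC) => [|i _]; last exact: gpair_cc.
apply: big1 => i _; have [_ _ [L [cL Ll cLs]]] := Hc i.
by apply: (chart_divergence (Cei i) cL Ll) => x; rewrite mulf_eq0 negb_or => /andP[/cLs].
Qed.

(** [S] is the average of the chart expressions [Zc], weighted by a partition of unity on K. Each
    satisfies the identity for test functions supported in its chart and the same lower bound, so
    curvatures computed in different charts never have to be compared. *)
Lemma bochner_formula (h : M -> R) eta (K : set M) : ricci_ge g h -> CM X 1 eta -> compact K ->
  (forall x, eta x != 0 -> K x) -> exists S : M -> R,
  [/\ cc (fun x => eta x * S x), Int (volm g) (fun x => 2^-1 * gpair g eta energy x + eta x * S x) = 0 &
      forall x (e : R), K x -> 0 < e -> gpair g energy energy x / (2 * (energy x + e)) + h x * energy x <= S x].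
Proof.
move=> ric Ce cK eK; have [N [c [Hc c1]]] := partition_of_unity cK.
have CE := CM_energy.
have ce : cc eta by split; [exact: CM_continuous Ce|exists K].
pose ei (i : 'I_N) x := (c i).1 x * eta x.
have Cei (i : 'I_N) : CM X 1 (ei i) by apply: CMM => //; case: (Hc i).
have cei (i : 'I_N) : cc (ei i) by apply: ccM => //; have [h' _ _] := Hc i; exact: CM_continuous (h' 0%N).
have E : eta = (fun x => \sum_i ei i x).
  apply/funext => x; rewrite -mulr_suml; have [->|/eK Kx] := eqVneq (eta x) 0; first by rewrite mulr0.
  by rewrite c1 // mul1r.
have czi (i : 'I_N) : cc (fun x => ei i x * Zc (c i).2 x).
  have [_ _ [L [cL Ll cLs]]] := Hc i.
  by apply: (chart_bochner_cc (Cei i) cL Ll) => x; rewrite mulf_eq0 negb_or => /andP[/cLs].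
exists (fun x => \sum_(i < N) (c i).1 x * Zc (c i).2 x).
have ES : (fun x => eta x * \sum_(i < N) (c i).1 x * Zc (c i).2 x) = (fun x => \sum_(i < N) ei i x * Zc (c i).2 x).
  by apply/funext => x; rewrite mulr_sumr; apply: eq_bigr => i _; rewrite /ei; ring.
split.
- by rewrite ES; apply: cc_sum.
- have -> : (fun x => 2^-1 * gpair g eta energy x + eta x * \sum_(i < N) (c i).1 x * Zc (c i).2 x) =
      (fun x => \sum_(i < N) (2^-1 * gpair g (ei i) energy x + ei i x * Zc (c i).2 x)).
    apply/funext => x; have /(congr1 (@^~ x)) /= -> := ES.
    by rewrite {1}E gpair_suml // mulr_sumr -big_split.
  rewrite (Int_sum hM VC) => [|i _]; last by apply: ccD => //; apply: ccZ; exact: gpair_cc.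
  apply: big1 => i _; have [_ _ [L [cL Ll cLs]]] := Hc i.
  by apply: (chart_bochner (Cei i) cL Ll) => x; rewrite mulf_eq0 negb_or => /andP[/cLs].
move=> x e Kx e0; set T := _ + _.
have -> : T = \sum_(i < N) (c i).1 x * T by rewrite -mulr_suml c1 // mul1r.
apply: ler_sum => i _; have [_ c01 [L [cL Ll cLs]]] := Hc i; have /andP[c0 _] := c01 x.
have [->|/cLs/Ll dx] := eqVneq ((c i).1 x) 0; first by rewrite !mul0r.
rewrite ler_wpM2l // /T; have cy := ch_cod dx.
have B := bochnerZ_ge (@cod_open _ _ _ X _) (cg (c i).2) (grm (l := (c i).2)) (Cu (c i).2) (hrm (l := (c i).2))
  (khl (l := (c i).2)) (pluri_hess (l := (c i).2)) cy e0.
have := B (h x); rewrite -/(Zc (c i).2 x); set l := (c i).2 in dx cy *.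
have -> : gpair g energy energy x = bilin (invmx (metric g l (ch X l x))) (drow (Gl l) (ch X l x)) (drow (Gl l) (ch X l x)).
  by rewrite (gpairE g CE CE dx) /gp (drow_energy cy).
have -> : energy x = Gl l (ch X l x) by rewrite /energy (gpairE g Cu1 Cu1 dx).
apply; have := ric l (ch X l x) cy; rewrite -/(inv X l (ch X l x)) chK //; exact.
Qed.

End Gluing.

(** * Smoothing, and the Poincaré inequality for C^1 functions *)

Section EuclideanSmoothing.
Context {R : realType} {m : nat}.
Implicit Types (f : 'rV[R]_m -> R) (y z : 'rV[R]_m).

(** The partial derivatives have compact support, hence are uniformly continuous, which makes the
    Taylor remainder uniform in y. The factor m counts the coordinates. *)
Lemma c1c_uniform_taylor f (e : R) : c1c f -> 0 < e -> exists2 d : R, 0 < d &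
  forall y z, `|z - y| < d -> `|f z - (f y + linform (\row_a partial a f y) (z - y))| <= m%:R * e * `|z - y|.
Proof.
move=> cf e0.
have /choice[d Hd] : forall a : 'I_m, exists d : R, 0 < d /\ forall y z, `|y - z| < d -> `|partial a f y - partial a f z| < e.
  by move=> a; have [d d0 H] := cc_uniform (c1c_partial a cf) e0; exists d.
have [D D0 HD] : exists2 D : R, 0 < D & forall a, D <= d a.
  have S0 : 0 <= \sum_a (d a)^-1 by apply: sumr_ge0 => a _; rewrite invr_ge0 ltW //; case: (Hd a).
  have S1 : 0 < 1 + \sum_a (d a)^-1 by rewrite ltr_wpDr.
  exists (1 + \sum_a (d a)^-1)^-1; first by rewrite invr_gt0.
  move=> a; have [da _] := Hd a; rewrite -[leRHS]invrK lef_pV2 ?posrE ?invr_gt0 //.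
  rewrite (bigD1 a) //= addrCA lerDl addr_ge0 // sumr_ge0 // => b _.
  by rewrite invr_ge0 ltW //; case: (Hd b).
exists D => // y z zy.
have [t /andP[t0 t1] E] := @MVT_line R _ f (fun t => \sum_a partial a f (y + t *: (z - y)) * (z - y) ord0 a) y (z - y)
  (fun t _ => Ck_derive (z - y) (@openT _) cf.1 I).
have -> : f z - (f y + linform (\row_a partial a f y) (z - y)) =
    \sum_a (partial a f (y + t *: (z - y)) - partial a f y) * (z - y) ord0 a.
  rewrite opprD addrA; have -> : f z - f y = f (y + (z - y)) - f y by congr (f _ - _); rewrite addrCA subrr addr0.
  rewrite E /linform -sumrB; apply: eq_bigr => a _; rewrite [(\row__ _) _ _]mxE; ring.
apply: (le_trans (ler_norm_sum _ _ _)).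
apply: (@le_trans _ _ (\sum_(a < m) e * `|z - y|)); last first.
  by rewrite sumr_const card_ord -mulrA mulr_natl.
apply: ler_sum => a _; rewrite normrM; apply: ler_pM => //; last exact: coord_le_norm.
apply: ltW; have [_ H] := Hd a; apply: H; rewrite addrAC subrr add0r; apply: (@lt_le_trans _ _ D) => //.
by rewrite normrZ ger0_norm // (le_lt_trans _ zy) // ler_piMl.
Qed.

Lemma c1c_approx f (B e : R) : c1c f -> 0 < e -> exists2 q : 'rV[R]_m -> R, (forall N, isCk N setT q) &
  forall y, `|y| <= B -> `|q y - f y| <= e /\ forall a, `|partial a q y - partial a f y| <= e.
Proof.
move=> cf e0; have [C C1 HC] := @bspline_bounds R.
pose P : R := (5 * C) ^+ m; have P0 : 0 < P by rewrite exprn_gt0 // mulr_gt0 // (lt_le_trans ltr01).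
(* At distance 2 h the Taylor remainder is at most 2 m e1 h, and [qi_approx] multiplies the relative
   error by P; the product P * (2 m e1) stays below e. *)
pose e1 : R := e / (2 * (m%:R + 1) * P).
have m0 : 0 < (m%:R + 1 : R) by rewrite ltr_wpDl.
have e10 : 0 < e1 by rewrite divr_gt0 // !mulr_gt0.
have [d d0 Hd] := c1c_uniform_taylor cf e10.
pose h : R := Num.min (d / 3) 1; have h0 : 0 < h by rewrite lt_min divr_gt0 ?ltr01.
have h1 : h <= 1 by rewrite ge_min lexx orbT.
have hd : 2 * h < d by have : h <= d / 3 by [rewrite ge_min lexx]; lra.
(* The grid must cover the ball of radius B with the margin of two cells demanded by [qi_approx],
   strictly; hence three successors. *)
pose N : nat := (Num.Def.archi_bound (`|B| / h)).+3.
have hN : `|B| < h * (N%:R - 2).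
  have := archi_boundP (divr_ge0 (normr_ge0 B) (ltW h0)); rewrite ltr_pdivrMr // mulrC => H.
  apply: (lt_le_trans H); rewrite ler_wpM2l ?(ltW h0) // /N -addn3 natrD; lra.
exists (qi h N f) => [k|y yB]; first exact: Ck_qi.
have yN : `|y| < h * (N%:R - 2) by apply: le_lt_trans hN; apply: (le_trans yB); exact: ler_norm.
pose l := \row_a partial a f y; pose e2 : R := 2 * m%:R * e1.
have e20 : 0 <= e2 by rewrite /e2 mulr_ge0 ?(ltW e10) // mulr_ge0.
have K z : `|z - y| <= 2 * h -> `|f z - (f y + linform l (z - y))| <= e2 * h.
  move=> zy; apply: (le_trans (Hd y z (le_lt_trans zy hd))).
  have -> : e2 * h = m%:R * e1 * (2 * h) by rewrite /e2; ring.
  by rewrite ler_wpM2l // mulr_ge0 // ltW.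
have [A1 A2] := qi_approx h0 C1 HC yN e20 K.
have Pe : P * e2 <= e.
  have -> : P * e2 = e * (m%:R / (m%:R + 1)).
    by rewrite /e2 /e1; field; rewrite !gt_eqF.
  by rewrite ler_piMr ?(ltW e0) // ler_pdivrMr // mul1r lerDl.
split.
  apply: (le_trans A1); apply: (@le_trans _ _ (P * e2 * 1)); last by rewrite mulr1.
  by rewrite ler_wpM2l // mulr_ge0 // ltW.
by move=> a; have := A2 a; rewrite mxE => H; apply: le_trans H Pe.
Qed.

End EuclideanSmoothing.

Import HBNNSimple.

(** The integral of a nonnegative function is a supremum over simple functions below it, hence
    monotone for arbitrary functions. This matters because rho may fail to be measurable. *)
Lemma le_integral_lower d (T : measurableType d) (R : realType) (mu : {measure set T -> \bar R}) (f h : T -> \bar R) :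
  (forall x, 0 <= f x)%E -> (forall x, f x <= h x)%E -> (\int[mu]_x f x <= \int[mu]_x h x)%E.
Proof.
move=> f0 fh; have h0 x : (0 <= h x)%E by exact: le_trans (fh x).
rewrite !ge0_integralTE //; apply: le_ereal_sup => _ [k /= kf <-]; exists k => // x.
exact: le_trans (kf x) (fh x).
Qed.

Lemma poincare_slack (R : realType) (J W e : R) : 0 <= W -> e <= 1 -> J + 2 * ((1 + e) * W) <= J + 4 * W + 1.
Proof. move=> W0 e1; have : e * W <= W by rewrite ler_piMl. by lra. Qed.

Section ManifoldSmoothing.
Context {R : realType} {n : nat} {M : ptopologicalType} (X : complexManifold R n M) (g : kahlerMetric X).
Implicit Types (x : M) (psi : M -> R).
Let hM : hausdorff_space M := haus (X := X).
Let VC := @volm_compact R n M X g.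
Let gq psi x := gpair g psi psi x.

Lemma gpairDr f h k x : CM X 1 f -> CM X 1 h -> gpair g k (fun z => f z + h z) x = gpair g k f x + gpair g k h x.
Proof. by move=> Cf Ch; rewrite ![gpair g k _ _]gpairC gpairDl. Qed.

(** Young's inequality 2 <da, db> <= e |da|^2 + |db|^2 / e, derived from Cauchy-Schwarz. *)
Lemma gq_add (a b : M -> R) (e : R) x : 0 < e -> CM X 1 a -> CM X 1 b ->
  gq (fun z => a z + b z) x <= (1 + e) * gq a x + (1 + e^-1) * gq b x.
Proof.
move=> e0 Ca Cb; rewrite /gq gpairDl // !gpairDr // [gpair g b a x]gpairC.
have := gpair_cs g a b x; have := gpair_ge0 g a x; have := gpair_ge0 g b x.
set p := gpair g a a x; set q := gpair g b b x; set r := gpair g a b x => q0 p0 rpq.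
have ei : e * e^-1 = 1 by rewrite mulfV // gt_eqF.
have ie : 0 < e^-1 by rewrite invr_gt0.
have pq : (e * p) * (e^-1 * q) = p * q by rewrite mulrACA ei mul1r.
have u0 : 0 <= e * p by rewrite mulr_ge0 // ltW.
have v0 : 0 <= e^-1 * q by rewrite mulr_ge0 // ltW.
suff : 2 * r <= e * p + e^-1 * q by lra.
move: pq u0 v0; move: (e * p) (e^-1 * q) => s t st s0 t0.
rewrite leNgt; apply/negP => h; have : (s + t) ^+ 2 < (2 * r) ^+ 2 by rewrite ltr_pXn2r ?nnegrE //; lra.
have -> : (2 * r) ^+ 2 = 4 * r ^+ 2 by ring.
have : 0 <= (s - t) ^+ 2 by exact: sqr_ge0.
have -> : (s + t) ^+ 2 = (s - t) ^+ 2 + 4 * (s * t) by ring.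
by rewrite st; lra.
Qed.

(** The compact set is fixed before e, so that its volume bounds the error uniformly in
    [poincare_c1]. *)
Definition approximable psi := CM X 1 psi /\ exists2 K : set M, compact K & forall e : R, 0 < e ->
  exists h : M -> R, [/\ forall N, CM X N h, forall x, h x != 0 -> K x &
    CM X 1 (fun x => h x - psi x) /\ forall x, `|h x - psi x| <= e /\ gq (fun x => h x - psi x) x <= e ^+ 2].

Lemma approximableD a b : approximable a -> approximable b -> approximable (fun x => a x + b x).
Proof.
move=> [Ca [K cK HK]] [Cb [L cL HL]]; split; first exact: CMD.
exists (K `|` L) => [|e e0]; first exact: compactU.
have e2 : 0 < e / 2 by rewrite divr_gt0.
have [h [Ch hK [Ch' Hh]]] := HK _ e2; have [k [Ck kL [Ck' Hk]]] := HL _ e2.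
have E : (fun x => h x + k x - (a x + b x)) = (fun x => (h x - a x) + (k x - b x)) by apply/funext => x; ring.
exists (fun x => h x + k x); split.
- by move=> N; exact: CMD.
- move=> x; have [->|/hK] := eqVneq (h x) 0; last by left.
  by rewrite add0r => /kL; right.
rewrite E; split; first exact: CMD.
move=> x; have [h1 h2] := Hh x; have [k1 k2] := Hk x; split.
  have -> : h x + k x - (a x + b x) = (h x - a x) + (k x - b x) by ring.
  by apply: (le_trans (ler_normD _ _)); lra.
have := gq_add x ltr01 Ch' Ck'; rewrite invr1 => H; apply: (le_trans H).
have -> : e ^+ 2 = (1 + 1) * (e / 2) ^+ 2 + (1 + 1) * (e / 2) ^+ 2 by field.
by apply: lerD; rewrite ler_wpM2l // addr_ge0.
Qed.

Lemma approximable0 : approximable (fun=> 0).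
Proof.
split; first exact: CM_cst.
exists set0 => [|e e0]; first exact: compact0.
exists (fun=> 0); split; [by move=> N; exact: CM_cst|by move=> x; rewrite eqxx|].
have -> : (fun x : M => 0 - 0 : R) = (fun=> 0) by apply/funext => x; rewrite subr0.
split; first exact: CM_cst.
by move=> x; rewrite subr0 normr0 /gq gpair_cstl sqr_ge0 ltW.
Qed.

Lemma metric_bound l (K : set 'rV[R]_(n + n)) : compact K -> K `<=` cod X l -> exists2 C : R, 0 < C &
  forall z (p : 'rV[R]_(n + n)) (e : R), K z -> (forall a, `|p ord0 a| <= e) -> bilin (invmx (metric g l z)) p p <= C * e ^+ 2.
Proof.
move=> cK Kl; have ab a b : exists C : R, forall z, K z -> `|invmx (metric g l z) a b| <= C.
  have c : compact ((fun z => invmx (metric g l z) a b) @` K).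
    apply: continuous_compact => //; apply: continuous_in_subspaceT => z /set_mem/Kl cz.
    have C : isCk 0 (cod X l) (fun z => invmx (metric g l z) a b).
      apply: Ck_invmx => [|w cw|c d]; [exact: cod_open| |by apply/isCkP; exact: metric_smooth].
      by have := gram_unitmx (gram_metric g cw); rewrite unitmxE unitfE.
    exact: (Ck_continuous C).
  have [C [_ HC]] := @compact_bounded R R^o _ c; exists (`|C| + 1) => z Kz; apply: HC; last by exists z.
  by rewrite (le_lt_trans (ler_norm C)) // ltrDl.
have /choice[C HC] : forall a, exists C : 'I_(n + n) -> R, forall b z, K z -> `|invmx (metric g l z) a b| <= C b.
  by move=> a; have /choice[C H] := ab a; exists C.
exists (1 + \sum_a \sum_b `|C a b|); first by rewrite ltr_wpDr // sumr_ge0 // => a _; rewrite sumr_ge0.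
move=> z p e Kz pe; rewrite bilinE mulrDl mul1r ler_wpDl ?sqr_ge0 // mulr_suml; apply: ler_sum => a _.
rewrite mulr_suml; apply: ler_sum => b _; apply: (le_trans (ler_norm _)); rewrite !normrM mulrAC expr2 mulrC.
have e0 : 0 <= e by exact: le_trans (pe a).
have h1 : `|invmx (metric g l z) a b| <= `|C a b| by apply: (le_trans (HC a b z Kz)); exact: ler_norm.
have h2 : `|p ord0 a| * `|p ord0 b| <= e * e by apply: ler_pM; rewrite ?pe.
exact: (ler_pM (normr_ge0 _) (mulr_ge0 (normr_ge0 _) (normr_ge0 _)) h1 h2).
Qed.

Lemma approximable_chart l psi (K : set M) : compact K -> K `<=` dom X l -> (forall x, psi x != 0 -> K x) ->
  CM X 1 psi -> approximable psi.
Proof.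
move=> cK Kl pK Cp; split=> //; pose f := loc (X := X) l psi.
have cf : c1c f := loc_c1c cK Kl pK Cp.
have [chi [U [K' [Cchi c01 [oU KU c1 cK' [Kl' cs]]]]]] := bump_rV (ch_compact cK Kl) (@cod_open _ _ _ X l) (ch_sub Kl).
exists (inv X l @` K') => [|e e0]; first exact: inv_compact.
have cchi : c1c chi by split; [exact: Cchi|split; [move=> y; exact: (Ck_continuous (Cchi 0%N))|exists K']].
have /choice[D HD] : forall a, exists D : R, 0 <= D /\ forall y, `|partial a chi y| <= D.
  by move=> a; have [D D0 H] := cc_bounded (c1c_partial a cchi); exists D.
pose D1 : R := 1 + \sum_a D a.
have S0 : 0 <= \sum_a D a by apply: sumr_ge0 => a _; case: (HD a).
have D10 : 1 <= D1 by rewrite lerDl.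
have [C C0 HC] := metric_bound cK' Kl'.
have [B B0 KB] := compact_rbox cK'.
pose C1 : R := C + 1; have C10 : 1 <= C1 by rewrite lerDr ltW.
(* [D1] pays for differentiating the cutoff, [C1] for comparing the inverse metric with the
   coordinates on the compact set. *)
pose e1 : R := e / (D1 * C1).
have DC : 0 < D1 * C1 by rewrite mulr_gt0 // (lt_le_trans ltr01).
have e10 : 0 < e1 by rewrite divr_gt0.
have [q Cq Hq] := c1c_approx B cf e10.
pose r y := chi y * (q y - f y).
have oT : open [set: 'rV[R]_(n + n)] := openT.
have rs y : r y != 0 -> K' y by rewrite mulf_eq0 negb_or => /andP[/cs].
have Cr : isCk 1 setT r by apply: CkM => //; apply: CkB => //; case: cf.
have fchi y : chi y * f y = f y.
  have [->|/(loc_supp pK) Ky] := eqVneq (f y) 0; first by rewrite mulr0.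
  by rewrite c1 ?mul1r //; exact: KU.
have E : (fun x => glob X l (fun y => chi y * q y) x - psi x) = glob X l r.
  apply/funext => x; rewrite /glob; case: asboolP => dx.
    by rewrite /r mulrBr fchi /f /loc asboolT ?chK //; exact: ch_cod.
  by rewrite sub0r; apply/eqP; rewrite oppr_eq0; apply/negPn/negP => /pK/Kl.
exists (glob X l (fun y => chi y * q y)); split.
- by move=> N; apply: (glob_CM cK' Kl') => [y|]; [rewrite mulf_eq0 negb_or => /andP[/cs]|exact: CkM].
- by apply: glob_supp => y; rewrite mulf_eq0 negb_or => /andP[/cs].
rewrite E; have Cg := glob_CM cK' Kl' rs Cr; split=> // x.
have Ex : glob X l (fun y => chi y * q y) x - psi x = glob X l r x by exact: (congr1 (@^~ x) E).
rewrite Ex.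
have e1e : D1 * e1 <= e.
  have -> : D1 * e1 = e / C1 by rewrite /e1; field; rewrite !gt_eqF // (lt_le_trans ltr01).
  by rewrite ler_pdivrMr ?(lt_le_trans ltr01) // ler_peMr // ltW.
have rb y : K' y -> `|r y| <= e1 /\ forall a, `|partial a r y| <= D1 * e1.
  move=> Ky; have yB : `|y| <= B by apply/rboxP => //; exact: KB.
  have [h1 h2] := Hq y yB; have /andP[k0 k1] := c01 y; split.
    by rewrite normrM -[e1]mul1r; apply: ler_pM => //; rewrite ger0_norm.
  move=> a; have dq : derivable q y (delta_mx ord0 a) by exact: (Ck_derivable (Cq 1%N)).
  have df : derivable f y (delta_mx ord0 a) by exact: c1c_derivable.
  rewrite /r partialM; [|exact: c1c_derivable|exact: (derivableB dq df)].
  have -> : partial a (fun z => q z - f z) y = partial a q y - partial a f y by exact: (deriveB dq df).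
  apply: (le_trans (ler_normD _ _)); rewrite !normrM /D1 mulrDl mul1r addrC; apply: lerD.
    by rewrite -[leRHS]mul1r; apply: ler_pM => //; rewrite ger0_norm.
  apply: ler_pM => //; have [_ H] := HD a; apply: (le_trans (H y)).
  by rewrite (bigD1 a) //= lerDl sumr_ge0 // => b _; case: (HD b).
have [Kx|nK] := pselect ((inv X l @` K') x); last first.
  have r0 : glob X l r x = 0 by apply/eqP/negPn/negP => /(glob_supp rs).
  rewrite r0 normr0; split; first exact: ltW.
  have -> : gq (glob X l r) x = 0; last exact: sqr_ge0.
  apply/eqP/negPn/negP => /(gpair_supp (compact_closed hM (inv_compact cK' Kl')) (glob_supp rs)); exact: nK.
have [y Ky xy] := Kx; have cy := Kl' _ Ky; have dx : dom X l x by rewrite -xy; exact: inv_dom.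
have cx : ch X l x = y by rewrite -xy invK.
have [h1 h2] := rb y Ky; split.
  rewrite /glob asboolT // cx; apply: (le_trans h1); apply: le_trans e1e; by rewrite ler_peMl // ltW.
rewrite /gq (gpairE g Cg Cg dx) /gp cx.
have -> : drow (lc X l (glob X l r)) y = drow r y.
  apply: (drow_ext (@cod_open _ _ _ X l) cy) => z cz; rewrite /lc /= /glob asboolT ?invK //; exact: inv_dom.
have := HC y (drow r y) (D1 * e1) Ky; rewrite -/(bilin _ _ _) => H; apply: (le_trans (H _)).
  by move=> a; rewrite mxE.
have -> : D1 * e1 = e / C1 by rewrite /e1; field; rewrite !gt_eqF // (lt_le_trans ltr01).
have C1p : 0 < C1 by exact: lt_le_trans ltr01 C10.
rewrite exprMn exprVn mulrCA ler_piMr ?sqr_ge0 // ler_pdivrMr ?exprn_gt0 // mul1r.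
apply: (@le_trans _ _ C1); first by rewrite lerDl.
by rewrite expr2 ler_peMr // ltW.
Qed.

Lemma c1_approximable psi : CM X 1 psi -> cc psi -> approximable psi.
Proof.
move=> Cp [_ [K cK pK]]; have [N [c [Hc c1]]] := partition_of_unity X cK.
have E : psi = (fun x => \sum_(i < N) (c i).1 x * psi x).
  apply/funext => x; rewrite -mulr_suml; have [->|/pK Kx] := eqVneq (psi x) 0; first by rewrite mulr0.
  by rewrite c1 // mul1r.
rewrite E; elim: N {c1 E} => [|N IH].
  by under eq_fun do rewrite big_ord0; exact: approximable0.
under eq_fun do rewrite big_ord_recr /=; apply: approximableD => //.
have [Cc _ [L [cL Ll cLs]]] := Hc N; apply: (approximable_chart cL Ll); last exact: CMM.
by move=> x; rewrite mulf_eq0 negb_or => /andP[/cLs].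
Qed.

Lemma plateau (K : set M) : compact K -> exists chi : M -> R,
  [/\ forall N, CM X N chi, cc chi, forall x, 0 <= chi x & forall x, K x -> chi x = 1].
Proof.
move=> cK; have [N [c [Hc c1]]] := partition_of_unity X cK.
exists (fun x => \sum_(i < N) (c i).1 x); split=> //.
- by move=> k; apply: CM_sum => i; case: (Hc i).
- apply: cc_sum => i _; have [Cc _ [L [cL _ Ls]]] := Hc i; split; first exact: CM_continuous (Cc 0%N).
  by exists L.
- by move=> x; apply: sumr_ge0 => i _; have [_ /(_ x) /andP[h _] _] := Hc i.
Qed.

Variables (rho : M -> R) (rho_ge0 : forall x, 0 <= rho x) (poinc : weighted_poincare g rho).

(** Nothing bounds rho, so the left side cannot be handled by a limit of approximations. Instead a
    smooth approximation h is raised by a multiple of a plateau to a smooth function [k] lying above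
    psi: monotonicity settles the left side, and only the Dirichlet integral has to be estimated. *)
Lemma poincare_c1 psi : CM X 1 psi -> cc psi -> (forall x, 0 <= psi x) ->
  (\int[volm g]_x (rho x * psi x ^+ 2)%:E <= (Int (volm g) (gpair g psi psi))%:E)%E.
Proof.
move=> Cp cp p0; have [_ [K cK HK]] := c1_approximable Cp cp; have [_ [L cL pL]] := cp.
have cKL : compact (K `|` L) by exact: compactU.
have [chi [Cchi cchi chi0 chi1]] := plateau cKL.
pose V := fine (volm g (K `|` L)); pose D := Int (volm g) (gq chi); pose J := Int (volm g) (gpair g psi psi).
have V0 : 0 <= V by rewrite fine_ge0.
have Cchi1 := Cchi 1%N.
have cq f : CM X 1 f -> cc f -> cc (gq f) by move=> Cf cf; exact: gpair_cc.
have D0 : 0 <= D by apply: Int_ge0 => x; exact: gpair_ge0.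
have J0 : 0 <= J by apply: Int_ge0 => x; exact: gpair_ge0.
apply/lee_addgt0Pr => e0 e00.
(* The squared error e^2 gets multiplied by 1 + 1/e when the cross term is split, which leaves an
   error of order e; [C] collects the constants. *)
pose C := J + 4 * (V + D) + 1.
have pos (a b : R) : 0 <= a -> 0 <= b -> 0 < a + 4 * b + 1 by move=> a0 b0; rewrite ltr_wpDl // addr_ge0 // mulr_ge0.
have C0 : 0 < C := pos _ _ J0 (addr_ge0 V0 D0).
pose e := Num.min 1 (e0 / C); have e_gt0 : 0 < e by rewrite lt_min ltr01 divr_gt0.
have e1 : e <= 1 by rewrite ge_min lexx.
have eC : e * C <= e0 by rewrite -ler_pdivlMr // ge_min lexx orbT.
have [h [Ch hK [Chp Hh]]] := HK e e_gt0.
pose k x := h x + e * chi x.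
have Ck N : CM X N k by apply: CMD => //; exact: CMZ.
have ch : cc h by split; [exact: CM_continuous (Ch 0%N)|exists K].
have ck : cc k by apply: ccD => //; exact: ccZ.
have pk x : psi x <= k x.
  rewrite /k; have [Kx|nK] := pselect ((K `|` L) x).
    by rewrite chi1 // mulr1; have [+ _] := Hh x; rewrite ler_norml => /andP[? _]; lra.
  have -> : psi x = 0 by apply/eqP/negPn/negP => /pL ?; apply: nK; right.
  have -> : h x = 0 by apply/eqP/negPn/negP => /hK ?; apply: nK; left.
  by rewrite add0r mulr_ge0 // ltW.
apply: (@le_trans _ _ (\int[volm g]_x (rho x * k x ^+ 2)%:E)%E).
  apply: le_integral_lower => x; rewrite lee_fin; first by rewrite mulr_ge0 // sqr_ge0.
  by rewrite ler_wpM2l // ler_pXn2r ?nnegrE // (le_trans (p0 x)).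
have sk : smooth_function (X := X) k by move=> N i; apply/isCkP; exact: Ck.
have kc : compact (closure [set x | k x != 0]).
  have [_ [P cP kP]] := ck; apply: (subclosed_compact _ cP); first exact: closed_closure.
  have clP : closed P by exact: compact_closed.
  by rewrite [X in _ `<=` X](closure_id P).1 //; apply: closure_subset => x /= /kP.
have := poinc sk kc; rewrite !integral_volume => H; apply: (le_trans H).
have -> : (\int[volm g]_x (norm_grad g k x ^+ 2)%:E = (Int (volm g) (gq k))%:E)%E.
  rewrite (Int_EFin hM VC (cq _ (Ck 1%N) ck)); apply: eq_integral => x _.
  by rewrite norm_gradE sqr_sqrtr // gpair_ge0.
rewrite -EFinD lee_fin -/J; pose s x := (h x - psi x) + e * chi x.
have Cs : CM X 1 s by apply: CMD => //; exact: CMZ.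
have cs : cc s by apply: ccD; [exact: ccB|exact: ccZ].
have kE : k = (fun x => psi x + s x) by apply/funext => x; rewrite /k /s; ring.
have b1 x : gq k x <= (1 + e) * gq psi x + (1 + e^-1) * gq s x by rewrite kE; exact: gq_add.
have cZ (a : R) f : CM X 1 f -> cc f -> cc (fun x => a * gq f x) by move=> Cf cf; apply: ccZ; exact: cq.
have I1 : Int (volm g) (gq k) <= (1 + e) * J + (1 + e^-1) * Int (volm g) (gq s).
  have -> : (1 + e) * J = Int (volm g) (fun x => (1 + e) * gq psi x) by rewrite (IntZ hM VC) //; exact: cq.
  have -> : (1 + e^-1) * Int (volm g) (gq s) = Int (volm g) (fun x => (1 + e^-1) * gq s x).
    by rewrite (IntZ hM VC) //; exact: cq.
  rewrite -(IntD hM VC); [|exact: cZ|exact: cZ].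
  by apply: (Int_le hM VC) => //; [exact: (cq _ (Ck 1%N) ck)|apply: ccD; exact: cZ].
have chp : cc (fun x => h x - psi x) by exact: ccB.
have I2 : Int (volm g) (gq s) <= 2 * (e ^+ 2 * V) + 2 * (e ^+ 2 * D).
  have b2 x : gq s x <= 2 * gq (fun x => h x - psi x) x + 2 * (e ^+ 2 * gq chi x).
    have := gq_add x ltr01 Chp (CMZ e Cchi1); rewrite invr1 => B; apply: (le_trans B).
    have -> : gq (fun z => e * chi z) x = e ^+ 2 * gq chi x.
      by rewrite /gq gpairZl // gpairC gpairZl // mulrA -expr2.
    by rewrite lexx.
  have c3 : cc (fun x => 2 * (e ^+ 2 * gq chi x)) by apply: ccZ; exact: cZ.
  have c4 : cc (fun x => e ^+ 2 * gq chi x) by exact: cZ.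
  apply: (@le_trans _ _ (Int (volm g) (fun x => 2 * gq (fun x => h x - psi x) x + 2 * (e ^+ 2 * gq chi x)))).
    exact: (Int_le hM VC (cq _ Cs cs) (ccD (cZ 2 _ Chp chp) c3) b2).
  rewrite (IntD hM VC (cZ 2 _ Chp chp) c3).
  have -> : Int (volm g) (fun x => 2 * gq (fun x => h x - psi x) x) = 2 * Int (volm g) (gq (fun x => h x - psi x)).
    by apply: (IntZ hM VC); exact: cq.
  have -> : Int (volm g) (fun x => 2 * (e ^+ 2 * gq chi x)) = 2 * (e ^+ 2 * D).
    by rewrite -(IntZ hM VC (e ^+ 2) (cq _ Cchi1 cchi)); exact: (IntZ hM VC).
  rewrite lerD2r ler_wpM2l //.
  apply: (le_trans (ler_norm _)); apply: (Int_bound hM VC) => //; first exact: cq.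
    apply: gpair_supp; first by exact: compact_closed.
    move=> x; apply: contra_neqP => nK.
    have -> : psi x = 0 by apply/eqP/negPn/negP => /pL ?; apply: nK; right.
    have -> : h x = 0 by apply/eqP/negPn/negP => /hK ?; apply: nK; left.
    by rewrite subrr.
  by move=> x; rewrite ger0_norm ?gpair_ge0 //; have [] := Hh x.
apply: (le_trans I1).
have ie0 : 0 < e^-1 by rewrite invr_gt0.
apply: (@le_trans _ _ ((1 + e) * J + (1 + e^-1) * (2 * (e ^+ 2 * V) + 2 * (e ^+ 2 * D)))).
  by rewrite lerD2l ler_wpM2l // addr_ge0 // ltW.
have -> : (1 + e^-1) * (2 * (e ^+ 2 * V) + 2 * (e ^+ 2 * D)) = e * (2 * ((1 + e) * (V + D))).
  by field; rewrite gt_eqF.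
rewrite mulrDl mul1r -addrA lerD2l; apply: le_trans eC; rewrite -mulrDr ler_wpM2l ?(ltW e_gt0) // /C.
exact: poincare_slack (addr_ge0 V0 D0) e1.
Qed.

End ManifoldSmoothing.

(** * Smoothed maxima and quadratic forms *)

Section SmoothMax.
Context {R : realType}.
Implicit Types (s t : R).

Definition psq t : R := Num.max t 0 ^+ 2.

Lemma is_derive_psq t : is_derive t 1 psq (2 * Num.max t 0).
Proof.
have [t0|t0|->] := ltgtP t 0.
- rewrite mulr0.
  have D0 : is_derive t 1 (cst (0 : R)) (0 : R) by exact: is_derive_cst.
  apply: near_eq_is_derive D0.
  by near=> s; rewrite /psq max_r ?expr0n // ltW //; near: s; exact: lt_nbhsl.
- have D1 := @is_deriveX R R (id : R -> R) 2 t 1 _ (is_derive_id t (1 : R)).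
  have <- : (2%:R * t ^+ 1) *: (1 : R) = 2 * t by rewrite -[_ *: 1]/(_ * 1) mulr1 expr1.
  apply: near_eq_is_derive D1.
  by near=> s; rewrite /psq max_l ?exprfctE // ltW //; near: s; exact: lt_nbhsr.
- rewrite mulr0.
  have H : (fun h : R => h^-1 *: ((psq \o shift 0) (h *: 1) - psq 0)) @ 0^' --> (0 : R).
    apply/cvgrPdist_le => e e0; near=> h.
    have hn0 : h != 0 by near: h; exact: nbhs_dnbhs_neq.
    rewrite sub0r normrN /= addr0 [h *: 1]mulr1 /psq maxxx expr0n subr0 -[_ *: _]/(_ * _) normrM normfV.
    rewrite ler_pdivrMl ?normr_gt0 //.
    have h0 : 0 <= Num.max h 0 by rewrite le_max lexx orbT.
    have hh : Num.max h 0 <= `|h| by rewrite ge_max ler_norm normr_ge0.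
    rewrite ger0_norm ?sqr_ge0 // expr2; apply: ler_pM => //; apply: (le_trans hh).
    by near: h; exact: dnbhs0_le.
  by split; [apply/cvg_ex; exists 0|exact: cvg_lim].
Unshelve. all: by end_near. Qed.

(** A C^1 positive part: it vanishes for t <= 0 and its slope [dtheta] rises linearly from 0 to 1 on
    [0, s]. The function b + theta s (a - b) is then a smoothed maximum whose differential is a
    convex combination of those of a and b. *)
Definition theta s t : R := (psq t - psq (t - s)) / (2 * s).
Definition dtheta s t : R := (Num.max t 0 - Num.max (t - s) 0) / s.

Lemma is_derive_theta s : 0 < s -> forall t, is_derive t 1 (theta s) (dtheta s t).
Proof.
move=> s0 t; have D1 := is_derive_psq t; have D2 := is_derive_psq (t - s).
have A : is_derive t 1 (fun x : R => x - s) 1.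
  have -> : (fun x : R => x - s) = (fun x => - s + x * 1) by apply/funext => x; rewrite mulr1 addrC.
  exact: is_derive_affine.
have D3 : is_derive t 1 (fun x => psq (x - s)) (2 * Num.max (t - s) 0).
  by rewrite -[X in is_derive _ _ _ X]mulr1; apply: (@is_derive1_comp R psq (fun x => x - s)).
have D4 := is_deriveZ (2 * s)^-1 (is_deriveB D1 D3).
have -> : theta s = (2 * s)^-1 *: (psq - (fun x => psq (x - s))) by apply/funext => x; rewrite /theta mulrC.
apply: (is_derive_eq D4); rewrite /dtheta -[_ *: _]/(_ * _); field; exact: lt0r_neq0.
Qed.

Lemma maxr0E t : Num.max t 0 = (t + `|t|) / 2.
Proof. by have [t0|t0] := leP t 0; rewrite ?(ler0_norm t0) ?(gtr0_norm t0); field. Qed.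

Lemma dtheta_continuous s : continuous (dtheta s).
Proof.
have c : continuous (fun t : R => Num.max t 0).
  move=> t; under eq_fun do rewrite maxr0E.
  by apply: cvgMl; apply: cvgD; [exact: cvg_id|apply: cvg_norm; exact: cvg_id].
move=> t; apply: cvgMl; apply: cvgB; first exact: c.
have c2 : {for t, continuous (fun x : R => x - s)} by apply: cvgB; [exact: cvg_id|exact: cvg_cst].
exact: (continuous_comp c2 (c (t - s))).
Qed.

Lemma dtheta_itv s t : 0 < s -> 0 <= dtheta s t <= 1.
Proof.
move=> s0; rewrite /dtheta divr_ge0 ?ler_pdivrMr ?mul1r ?(ltW s0) //=.
  by have [a|a] := leP t 0; have [b|b] := leP (t - s) 0; lra.
by have [a|a] := leP t 0; have [b|b] := leP (t - s) 0; lra.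
Qed.

Lemma theta_le0 s t : 0 < s -> t <= 0 -> theta s t = 0.
Proof. by move=> s0 t0; rewrite /theta /psq !max_r ?subrr ?mul0r //; lra. Qed.

Lemma theta_ge0 s t : 0 < s -> 0 <= theta s t.
Proof.
move=> s0; have h : Num.max (t - s) 0 <= Num.max t 0.
  by have [a|a] := leP t 0; have [b|b] := leP (t - s) 0; lra.
rewrite /theta divr_ge0 ?mulr_ge0 ?(ltW s0) // subr_ge0 /psq.
by rewrite !expr2; apply: ler_pM => //; rewrite le_max lexx orbT.
Qed.

Lemma theta_ge s t : 0 < s -> t - s / 2 <= theta s t.
Proof.
move=> s0; have [t0|t0] := leP t 0; first by rewrite theta_le0 //; lra.
have s2 : 0 < 2 * s by rewrite mulr_gt0.
rewrite /theta ler_pdivlMr // /psq (max_l (ltW t0)).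
have [b|b] := leP (t - s) 0.
  by rewrite expr0n subr0; have := sqr_ge0 (t - s); rewrite sqrrB; nra.
by rewrite sqrrB; nra.
Qed.

End SmoothMax.

Section QuadraticForms.
Context {R : realType} {m : nat}.
Implicit Types (A G : 'M[R]_m) (p q v w y z : 'rV[R]_m).

Lemma bilin_convex A p q (t : R) : gram A -> bilin A p p <= 1 -> bilin A q q <= 1 -> 0 <= t <= 1 ->
  bilin A ((1 - t) *: p + t *: q) ((1 - t) *: p + t *: q) <= 1.
Proof.
move=> gA hp hq /andP[t0 t1]; rewrite bilinDl !bilinDr !bilinZl !bilinZr (bilin_sym q p gA.1).
have := cauchy_schwarz p q gA; have := gram_ge0 p gA; have := gram_ge0 q gA; move: hp hq.
move: (bilin A p p) (bilin A q q) (bilin A p q) => P Q C P1 Q1 Q0 P0 h.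
have C1 : C <= 1.
  rewrite leNgt; apply/negP => c1; have : 1 < C ^+ 2 by rewrite expr2; nra.
  by have : P * Q <= 1 by [nra]; lra.
have u : 0 <= 1 - t by lra.
have a1 := ler_wpM2l (mulr_ge0 u u) P1; have a2 := ler_wpM2l (mulr_ge0 u t0) C1.
have a3 := ler_wpM2l (mulr_ge0 t0 t0) Q1; lra.
Qed.

Lemma linform_cs A p w : gram A -> linform p w ^+ 2 <= bilin (invmx A) p p * bilin A w w.
Proof.
move=> gA; have uA := gram_unitmx gA; have := cauchy_schwarz p (w *m A) (gram_invmx gA).
have -> : bilin (invmx A) p (w *m A) = linform p w.
  rewrite /bilin trmx_mul gA.1 mulmxA -(mulmxA p) mulVmx // mulmx1 mxE.
  by apply: eq_bigr => a _; rewrite mxE.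
by rewrite -[bilin _ (w *m A) _]bilinMl mulmxV // -bilinMr mul1mx gA.1.
Qed.

(** Let T be the left side and v = w A G^-1. Then T = A(w, v) and A(v, v) <= 2 T, so Cauchy-Schwarz
    for A gives T^2 <= 2 T A(w, w). *)
Lemma gram_inv_le A G w : gram A -> gram G -> (forall v, bilin A v v <= 2 * bilin G v v) ->
  bilin (invmx G) (w *m A) (w *m A) <= 2 * bilin A w w.
Proof.
move=> gA gG AG; have uG := gram_unitmx gG; have gI := gram_invmx gG.
set p := w *m A; set v := p *m invmx G.
have e1 : bilin G v v = bilin (invmx G) p p by rewrite -bilinMl mulVmx // -bilinMr mul1mx gI.1.
have e2 : bilin A w v = bilin (invmx G) p p.
  by rewrite -bilinMr gI.1 bilinMl.
have := cauchy_schwarz w v gA; have := AG v; rewrite e1 e2; have := gram_ge0 p gI; have := gram_ge0 w gA.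
move: (bilin (invmx G) p p) (bilin A w w) (bilin A v v) => T Q V Q0 T0 VT h.
have h2 : T * T <= 2 * Q * T by have := ler_wpM2l Q0 VT; rewrite -expr2; lra.
have [T1|T1] := ltP 0 T; first by rewrite -(ler_pM2r T1).
by apply: (le_trans T1); rewrite mulr_ge0.
Qed.

Lemma Ck_quad N (V : set 'rV[R]_m) A y : open V -> isCk N V (fun z => bilin A (z - y) (z - y)).
Proof.
move=> oV; have Cc a : isCk N V (fun z => (z - y) ord0 a).
  by under eq_fun do rewrite !mxE; apply: CkB => //; [exact: Ck_coord|exact: Ck_cst].
under eq_fun do rewrite bilinE; apply: Ck_sum => // a _; apply: Ck_sum => // b _.
by apply: CkM => //; apply: CkM => //; exact: Ck_cst.
Qed.

Lemma is_derive_quad A y z v : A^T = A ->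
  is_derive z v (fun z => bilin A (z - y) (z - y)) (2 * bilin A (z - y) v).
Proof.
move=> sA; apply/is_derive_lineP.
have -> : (fun s : R => bilin A (z + s *: v - y) (z + s *: v - y)) =
    (fun s => bilin A (z - y) (z - y) + s * (2 * bilin A (z - y) v + s * bilin A v v)).
  apply/funext => s; have -> : z + s *: v - y = (z - y) + s *: v by rewrite addrAC.
  move: (z - y) => w; rewrite bilinDl !bilinDr !bilinZl !bilinZr (bilin_sym v w sA); ring.
have D1 := is_derive_affine 0 (2 * bilin A (z - y) v) (bilin A v v).
have D2 := is_deriveM (is_derive_id (0 : R) (1 : R)) D1.
have D3 := is_deriveD (is_derive_cst (bilin A (z - y) (z - y)) (0 : R) (1 : R)) D2.
apply: (is_derive_eq D3); rewrite add0r scale0r add0r mul0r addr0 -[_ *: _]/(_ * _); exact: mulr1.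
Qed.

Lemma norm_le_quad A : gram A -> exists2 C : R, 0 < C & forall w, `|w| <= Num.sqrt (C * bilin A w w).
Proof.
move=> gA; have gI := gram_invmx gA; have d0 a : 0 <= invmx A a a by rewrite -bilin_delta; exact: gram_ge0.
exists (1 + \sum_a invmx A a a) => [|w]; first by rewrite ltr_wpDr // sumr_ge0.
apply: norm_le_coord => [|a]; first exact: sqrtr_ge0.
rewrite -sqrtr_sqr; apply: ler_wsqrtr.
have -> : w ord0 a = linform (delta_mx ord0 a) w.
  rewrite /linform (bigD1 a) //= mxE !eqxx mul1r big1 ?addr0 // => b ba.
  by rewrite mxE (negbTE ba) andbF mul0r.
apply: (le_trans (linform_cs _ _ gA)); rewrite ler_wpM2r ?gram_ge0 // bilin_delta (bigD1 a) //= addrCA lerDl.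
by rewrite addr_ge0 // sumr_ge0.
Qed.

Lemma drow_theta (V : set 'rV[R]_m) (a b : 'rV[R]_m -> R) (s : R) z c : 0 < s -> V z -> isCk 1 V a -> isCk 1 V b ->
  partial c (fun y => b y + theta s (a y - b y)) z =
  (1 - dtheta s (a z - b z)) * partial c b z + dtheta s (a z - b z) * partial c a z.
Proof.
move=> s0 Vz Ca Cb; have dir h : isCk 1 V h -> is_derive z (delta_mx ord0 c) h (partial c h z).
  by move=> Ch; apply/derivableP; exact: (Ck_derivable Ch).
have da := dir _ Ca; have db := dir _ Cb; have dab := is_deriveB da db.
have dt := is_derive_comp1 dab (is_derive_theta s0 (a z - b z)).
rewrite /partial (derive_val (is_derive := is_deriveD db dt)) -/(partial c b z) -/(partial c a z); ring.
Qed.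

Lemma compact_quad A y (r : R) : gram A -> compact [set z | bilin A (z - y) (z - y) <= r].
Proof.
move=> gA; have [C C0 HC] := norm_le_quad gA.
have cl : closed [set z | bilin A (z - y) (z - y) <= r].
  have cq : continuous (fun z => bilin A (z - y) (z - y)).
    by move=> z; exact: (Ck_continuous (Ck_quad 0 A y (@openT _))).
  by apply: (@closed_comp _ _ _ [set t : R | t <= r]) => [z _|]; [exact: cq|exact: closed_le].
have [D D0 HD] : exists2 D : R, 0 <= D & forall z, bilin A (z - y) (z - y) <= r -> `|z| <= D.
  exists (`|y| + Num.sqrt (C * r)) => [|z zr]; first by rewrite addr_ge0 // sqrtr_ge0.
  have -> : z = y + (z - y) by rewrite addrCA subrr addr0.
  apply: (le_trans (ler_normD _ _)); rewrite lerD2l; apply: (le_trans (HC _)); apply: ler_wsqrtr.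
  by rewrite ler_wpM2l // ltW.
have cR : compact (rbox (m := m) D) by exact: compact_cbox.
apply: (subclosed_compact cl cR) => z /= zr.
exact/(rboxP _ D0)/HD.
Qed.

End QuadraticForms.

(** * Chains of coordinate segments and the Riemannian distance *)

Section Reach.
Context {R : realType} {n : nat} {M : ptopologicalType} (X : complexManifold R n M) (g : kahlerMetric X).
Implicit Types (x : M) (f : M -> R) (y z w : 'rV[R]_(n + n)) (i j l : nat).
Let hM : hausdorff_space M := haus (X := X).

(* Points joined by a chain of coordinate segments of total length at most t. *)
Inductive reach : M -> M -> R -> Prop :=
| reach_edge l y w (c : R) : 0 <= c ->
    (forall s : R, 0 <= s <= 1 -> cod X l (y + s *: w) /\ bilin (metric g l (y + s *: w)) w w <= c ^+ 2) ->
    reach (inv X l y) (inv X l (y + w)) c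
| reach_trans (a b d : M) (s t : R) : reach a b s -> reach b d t -> reach a d (s + t).

Lemma reach_ge0 (a b : M) (t : R) : reach a b t -> 0 <= t.
Proof. by elim=> // *; exact: addr_ge0. Qed.

Lemma reach_sym (a b : M) (t : R) : reach a b t -> reach b a t.
Proof.
elim=> [l y w c c0 H|x z d s t0 _ h1 _ h2]; last by rewrite addrC; exact: reach_trans h2 h1.
have -> : inv X l y = inv X l (y + w + - w) by rewrite addrK.
apply: reach_edge => // s /andP[s0 s1].
have -> : y + w + s *: - w = y + (1 - s) *: w by rewrite scalerN scalerBl scale1r addrA.
by rewrite bilinNl bilinNr opprK; apply: H; rewrite subr_ge0 s1 lerBlDr lerDl.
Qed.

Lemma reach_refl x : reach x x 0.
Proof.
have [l dl] := chart_cover X x; have E : x = inv X l (ch X l x + 0) by rewrite addr0 chK.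
rewrite {2}E -{1}(chK dl); apply: reach_edge => // s _; rewrite scaler0 addr0 bilin0l expr0n lexx; split=> //.
exact: ch_cod.
Qed.

Definition unit_grad f := [/\ CM X 1 f, cc f, forall x, 0 <= f x & forall x, gpair g f f x <= 1].

Lemma gp_le1 f l z : unit_grad f -> cod X l z -> bilin (invmx (metric g l z)) (drow (lc X l f) z) (drow (lc X l f) z) <= 1.
Proof. by move=> [Cf _ _ f1] cz; have := f1 (inv X l z); rewrite -[gpair _ _ _ _]/(lc X l (gpair g f f) z) lc_gpair. Qed.

(** Along a segment the derivative of f is bounded by the dual norm of df, at most 1, times the norm
    of the velocity, at most c. *)
Lemma reach_lip f (a b : M) (t : R) : unit_grad f -> reach a b t -> f b <= f a + t.
Proof.
move=> uf; have [Cf _ _ _] := uf; elim=> [l y w c c0 H|x z d s t0 _ h1 _ h2]; last by lra.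
clear t; have [t t01 E] := @MVT_line R _ (lc X l f) (fun t => \sum_a partial a (lc X l f) (y + t *: w) * w ord0 a) y w
  (fun t ht => Ck_derive w (@cod_open _ _ _ X l) (Cf l) (H t ht).1).
have [cz Hz] := H t t01; have := linform_cs (drow (lc X l f) (y + t *: w)) w (gram_metric g cz).
have -> : linform (drow (lc X l f) (y + t *: w)) w = \sum_a partial a (lc X l f) (y + t *: w) * w ord0 a.
  by apply: eq_bigr => a0 _; rewrite mxE.
rewrite -E -lerBlDl /lc /= => h; have {}h : (f (inv X l (y + w)) - f (inv X l y)) ^+ 2 <= c ^+ 2.
  apply: (le_trans h); rewrite -[leRHS]mul1r; apply: ler_pM => //; last exact: (gp_le1 uf cz).
    exact: gram_ge0 (gram_invmx (gram_metric g cz)).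
  exact: gram_ge0 (gram_metric g cz).
rewrite leNgt; apply/negP => h2; move: h; rewrite leNgt => /negP; apply.
by rewrite ltr_pXn2r ?nnegrE // ltW // (le_lt_trans c0).
Qed.

Lemma jac_coef l i z a b : overlap X l i z -> jac X l i z a b = partial a (fun v => trans X l i v ord0 b) z.
Proof.
move=> Oz; have [dc _] := Ck_differentiable (@openT _) (Ck_coord 1 setT b) (I : setT (trans X l i z)).
have := congr1 (fun A : 'rV[R]_(n + n) => A ord0 a) (drow_trans Oz dc); rewrite [LHS]mxE => ->.
rewrite mxE (bigD1 b) //= mxE partial_coord eqxx mul1r mxE big1 ?addr0 // => c cb.
by rewrite mxE partial_coord (negbTE cb) mul0r.
Qed.

Lemma line_continuous (y w : 'rV[R]_(n + n)) : continuous (fun s : R => y + s *: w).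
Proof. by move=> s; apply: cvgD; [exact: cvg_cst|exact: scalel_continuous]. Qed.

Lemma is_derive_segment l i y w (s : R) : overlap X l i (y + s *: w) ->
  is_derive s 1 (ch X i \o (fun s : R => inv X l (y + s *: w)) : R -> 'rV[R]_(n + n)) (w *m jac X l i (y + s *: w)).
Proof.
move=> Os; apply: (@is_derive_line R _ _ (trans X l i) y w s).
have d := trans_diff Os; apply: DeriveDef; first exact: diff_derivable.
by rewrite deriveE // diff_jacobian jacE.
Qed.

(** Connects chains with the distance in which completeness is stated. A coordinate segment is a C^1
    curve in every chart around its points, since transition maps are smooth, and its speed is at
    most c. *)
Lemma reach_length (a b : M) (t : R) : reach a b t -> exists L, piecewise_length g a b L /\ (L <= t%:E)%E.
Proof.
elim=> [l y w c0 c00 H|x z d s t0 _ [L1 [p1 h1]] _ [L2 [p2 h2]]]; last first.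
  by exists (L1 + L2)%E; split; [exact: piecewise_cat p1 p2|rewrite EFinD; exact: leeD].
pose c (s : R) := inv X l (y + s *: w).
have Ov s i : 0 <= s <= 1 -> dom X i (c s) -> overlap X l i (y + s *: w) by move=> /H[].
clear t; have C : C1_curve (X := X) c.
  move=> t t01; have [ct _] := H t t01; split.
    by apply: continuous_comp; [exact: line_continuous|exact: inv_cont].
  move=> i di; have Ot := Ov _ _ t01 di.
  have nO : \forall s \near t, overlap X l i (y + s *: w).
    by apply: (@line_continuous y w t); apply: open_nbhs_nbhs; split=> //; exact: overlap_open.
  split; first by near=> s; have Os : overlap X l i (y + s *: w) by [near: s]; case: (is_derive_segment Os).
  apply: (@continuous_near _ _ (fun s : R => w *m jac X l i (y + s *: w))).
    near=> s; have Os : overlap X l i (y + s *: w) by near: s.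
    by rewrite (derive_val (is_derive := is_derive_segment Os)).
  apply: continuous_rV => b0.
  apply: (@continuous_near _ _ (fun s : R => \sum_a w ord0 a * partial a (fun v => trans X l i v ord0 b0) (y + s *: w))).
    near=> s; have Os : overlap X l i (y + s *: w) by near: s.
    by rewrite mxE; apply: eq_bigr => a0 _; rewrite (jac_coef _ _ Os).
  have oO := @overlap_open _ _ _ X l i.
  have C0 : isCk 0 (overlap X l i) (fun z => \sum_a w ord0 a * partial a (fun v => trans X l i v ord0 b0) z).
    by apply: Ck_sum => // a0 _; apply: CkZ => //; exact: (Ck_partial (trans_Ck 1 l i b0) a0).
  apply: (@continuous_comp _ _ _ (fun s : R => y + s *: w)
    (fun z => \sum_a w ord0 a * partial a (fun v => trans X l i v ord0 b0) z)); first exact: line_continuous.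
  exact: (Ck_continuous C0 Ot).
have sp s : 0 <= s <= 1 -> speed g c s <= c0.
  move=> s01; have [dc _] := chart_atP (X := X) (c s); have Os := Ov _ _ s01 dc.
  rewrite /speed; set i := chart_at (c s) in dc Os *.
  rewrite (_ : 'D_1 _ s = w *m jac X l i (y + s *: w)); last exact: (derive_val (is_derive := is_derive_segment Os)).
  have [cs Hs] := H s s01; rewrite -[leRHS](ger0_norm c00) -sqrtr_sqr; apply: ler_wsqrtr; apply: le_trans Hs.
  by rewrite (jac_compat g Os) bilinMr bilinMl.
have P : piecewise_length g (c 0) (c 1) (curve_length g c) by exact: piecewise_one.
have E0 : c 0 = inv X l y by rewrite /c scale0r addr0.
have E1 : c 1 = inv X l (y + w) by rewrite /c scale1r.
exists (curve_length g c); rewrite -E0 -E1; split=> //; rewrite /curve_length.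
apply: (@le_trans _ _ (\int[@lebesgue_measure R]_(t in `[0%R, 1%R]) (c0%:E))%E).
  rewrite integral_mkcond [leRHS]integral_mkcond; apply: le_integral_lower => s; rewrite /patch; case: ifP => //.
    by move=> _; rewrite lee_fin sqrtr_ge0.
  by move=> /set_mem /=; rewrite in_itv /= lee_fin => /sp.
by rewrite integral_cst //= lebesgue_measure_itv /= lte_fin ltr01 oppr0 adde0 mule1.
Unshelve. all: by end_near. Qed.

Lemma reach_dist (a b : M) (t : R) : reach a b t -> (riemannian_dist g a b <= t%:E)%E.
Proof. by move=> /reach_length[L [p h]]; apply: le_trans h; apply: ereal_inf_lbound. Qed.

Definition adapted x l (r : R) := [/\ 0 < r, dom X l x & let A := metric g l (ch X l x) in
  forall z, bilin A (z - ch X l x) (z - ch X l x) <= r ^+ 2 -> cod X l z /\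
    forall v, bilin A v v <= 2 * bilin (metric g l z) v v /\ bilin (metric g l z) v v <= 2 * bilin A v v].

Lemma adapted_ex x : exists l r, adapted x l r.
Proof.
have [l dl] := chart_cover X x; have cy := ch_cod dl; set y := ch X l x in cy.
pose A := metric g l y; have gA : gram A := gram_metric g cy.
(* If all m^2 entries of the metric move by at most e, the form at v moves by at most m^2 e |v|^2 <=
   m^2 e C A(v, v), which this choice keeps below A(v, v) / 2. *)
have [C C0 HC] := norm_le_quad gA; pose m : R := (n + n)%:R; pose e : R := (2 * (m * m + 1) * C)^-1.
have m0 : 0 <= m by exact: ler0n.
have mm : 0 < m * m + 1 by rewrite ltr_wpDl // mulr_ge0.
have e0 : 0 < e by rewrite invr_gt0 !mulr_gt0.
have nc : \forall z \near y, forall a b, `|metric g l z a b - A a b| <= e.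
  apply: (@filter_forall _ _ (fun a z => forall b, `|metric g l z a b - A a b| <= e) (nbhs y)) => a.
  apply: (@filter_forall _ _ (fun b z => `|metric g l z a b - A a b| <= e) (nbhs y)) => b.
  have Cab : isCk 0 (cod X l) (fun z => metric g l z a b) by apply/isCkP; exact: metric_smooth.
  have /(@cvgrPdist_le _ R _ (nbhs y) _ _ (metric g l y a b)) /(_ _ e0) := Ck_continuous Cab cy.
  by apply: filterS => z; rewrite distrC.
have nco : \forall z \near y, cod X l z by apply: open_nbhs_nbhs; split=> //; exact: cod_open.
have [r0 r00 Hr] := (nbhs_rV _ _).1 (filterI nco nc).
have s0 : 0 < Num.sqrt C by rewrite sqrtr_gt0.
exists l, (r0 / 2 / Num.sqrt C); split=> //; first by rewrite !divr_gt0.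
cbv zeta; rewrite -/y -/A => z zr; have [] := Hr z.
  apply: (le_lt_trans (HC _)); apply: (@le_lt_trans _ _ (r0 / 2)); last by lra.
  have r20 : 0 <= r0 / 2 by rewrite divr_ge0 // ltW.
  rewrite -[leRHS](ger0_norm r20) -sqrtr_sqr; apply: ler_wsqrtr; move: zr.
  have -> : (r0 / 2 / Num.sqrt C) ^+ 2 = (r0 / 2) ^+ 2 / C by rewrite exprMn exprVn sqr_sqrtr // ltW.
  by rewrite ler_pdivlMr // mulrC.
move=> cz Hz; split=> // v.
have b1 : `|bilin (metric g l z) v v - bilin A v v| <= 2^-1 * bilin A v v.
  rewrite -bilinN -bilinD bilinE; apply: (le_trans (ler_norm_sum _ _ _)).
  have v2 : `|v| * `|v| <= C * bilin A v v.
    have q0 : 0 <= C * bilin A v v by rewrite mulr_ge0 ?gram_ge0 // ltW.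
    by rewrite -[leRHS]sqr_sqrtr // expr2; apply: ler_pM.
  apply: (@le_trans _ _ (\sum_(a < n + n) \sum_(b < n + n) e * (`|v| * `|v|))).
    apply: ler_sum => a _; apply: (le_trans (ler_norm_sum _ _ _)); apply: ler_sum => b _.
    rewrite !normrM mulrAC mulrC; have h1 : `|(metric g l z - A) a b| <= e by have := Hz a b; rewrite !mxE.
    exact: (ler_pM (normr_ge0 _) (mulr_ge0 (normr_ge0 _) (normr_ge0 _)) h1
      (ler_pM (normr_ge0 _) (normr_ge0 _) (coord_le_norm _ _) (coord_le_norm _ _))).
  rewrite !sumr_const card_ord -!mulrnA -[_ *+ _]mulr_natr natrM -/m.
  apply: (@le_trans _ _ (e * (C * bilin A v v) * (m * m))).
    by rewrite ler_wpM2r ?mulr_ge0 // ler_wpM2l // ltW.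
  have -> : e * (C * bilin A v v) * (m * m) = (m * m / (m * m + 1)) * (2^-1 * bilin A v v).
    by rewrite /e; field; rewrite !gt_eqF.
  apply: ler_piMl; first by rewrite mulr_ge0 ?gram_ge0 // invr_ge0.
  by rewrite ler_pdivrMr // mul1r lerDl.
have := gram_ge0 v gA; move: b1; rewrite ler_norml; move: (bilin A v v) (bilin (metric g l z) v v) => P Q.
by move=> /andP[h1 h2] P0; split; lra.
Qed.

(** The segment stays in the adapted ball, where the metric is at most twice A, so its length is at
    most the square root of 2 times s; 2 * s is a convenient upper bound. *)
Lemma adapted_reach x l r z (s : R) : adapted x l r -> 0 <= s <= r ->
  bilin (metric g l (ch X l x)) (z - ch X l x) (z - ch X l x) <= s ^+ 2 -> reach x (inv X l z) (2 * s).
Proof.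
move=> [r0 dl H] /andP[s0 sr] zs; have {1}-> : x = inv X l (ch X l x) by rewrite chK.
move: zs H; set y := ch X l x; set A := metric g l y => zs H.
have gA : gram A := gram_metric g (ch_cod dl).
have -> : z = y + (z - y) by rewrite addrCA subrr addr0.
apply: reach_edge => [|t /andP[t0 t1]]; first by rewrite mulr_ge0.
have q0 := gram_ge0 (z - y) gA.
have qr : bilin A (y + t *: (z - y) - y) (y + t *: (z - y) - y) <= r ^+ 2.
  rewrite addrAC subrr add0r bilinZl bilinZr mulrA.
  apply: (@le_trans _ _ (s ^+ 2)); last by rewrite lerXn2r ?nnegrE // ltW.
  by apply: le_trans zs; rewrite ler_piMl // mulr_ile1.
have [c Hv] := H _ qr; split=> //; have [_ h] := Hv (z - y); apply: (le_trans h).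
have s2 := sqr_ge0 s; rewrite exprMn; lra.
Qed.

(** The link between the topology of M and chains: it turns topological convergence of a sequence
    into short chains to the limit. *)
Lemma near_reach x (e : R) : 0 < e -> \forall z \near x, exists2 t : R, t <= e & reach x z t.
Proof.
move=> e0; have [l [r Ha]] := adapted_ex x; have [r0 dl _] := Ha.
pose s := Num.min r (e / 2); have s0 : 0 < s by rewrite lt_min r0 divr_gt0.
pose A := metric g l (ch X l x).
have cq : continuous (fun z => bilin A (z - ch X l x) (z - ch X l x)).
  by move=> z; exact: (Ck_continuous (Ck_quad 0 A _ (@openT _))).
have cx : {for x, continuous (fun z : M => bilin A (ch X l z - ch X l x) (ch X l z - ch X l x))}.
  apply: (@continuous_comp M _ _ (ch X l) (fun v => bilin A (v - ch X l x) (v - ch X l x))); [exact: ch_cont|exact: cq].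
have n1 : \forall z \near x, bilin A (ch X l z - ch X l x) (ch X l z - ch X l x) < s ^+ 2.
  by apply: (cvgr_lt _ cx); rewrite subrr bilin0l exprn_gt0.
have n2 : \forall z \near x, dom X l z by apply: open_nbhs_nbhs; split=> //; exact: dom_open.
near=> z; exists (2 * s); first by rewrite mulrC -ler_pdivlMr // ge_min lexx orbT.
have dz : dom X l z by near: z.
rewrite -(chK dz); apply: (adapted_reach Ha); first by rewrite (ltW s0) ge_min lexx.
by apply: ltW; near: z.
Unshelve. all: by end_near. Qed.

End Reach.

Lemma gluing_gap (R : realType) (c s u v : R) : 0 < s -> c + s - v - s / 2 <= u -> v + u <= c -> False.
Proof. by move=> s0 h1 h2; lra. Qed.

(** * Unbounded cutoffs with bounded gradient *)

Section Cutoffs.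
Context {R : realType} {n : nat} {M : ptopologicalType} (X : complexManifold R n M) (g : kahlerMetric X).
Implicit Types (x : M) (f : M -> R) (i j l : nat).
Let hM : hausdorff_space M := haus (X := X).
Let Fc := unit_grad g.

Lemma unit_grad0 : Fc (fun=> 0).
Proof.
split; [exact: CM_cst|exact: cc0|by []|by move=> x; rewrite gpair_cstl ler01].
Qed.

(** The gradient of the smoothed maximum is a convex combination of two vectors of the unit ball.
    The loss s concerns a only: h lies above b exactly. *)
Lemma smooth_max (a b : M -> R) (s : R) : 0 < s -> Fc a -> Fc b ->
  exists2 h, Fc h & forall x, b x <= h x /\ a x - s <= h x.
Proof.
move=> s0 Fa Fb; have [Ca [_ [K cK aK]] a0 a1] := Fa; have [Cb [_ [L cL bL]] b0 b1] := Fb.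
pose h x := b x + theta s (a x - b x).
have Ct : CM X 1 (fun x => theta s (a x - b x)).
  by move=> i; apply: (C1_comp1 (@cod_open _ _ _ X i) (is_derive_theta s0) (@dtheta_continuous _ s)); exact: (CMB Ca Cb).
have Ch : CM X 1 h by exact: CMD.
exists h; last first.
  by move=> x; rewrite /h; have := theta_ge0 (a x - b x) s0; have := theta_ge (a x - b x) s0; split; lra.
split=> //.
- split; first exact: (CM_continuous Ch).
  exists (K `|` L) => [|x]; first exact: compactU.
  apply: contra_neqP => nKL; rewrite /h; have -> : a x = 0 by apply/eqP/negPn/negP => /aK ?; apply: nKL; left.
  have bx : b x = 0 by apply/eqP/negPn/negP => /bL ?; apply: nKL; right.
  by rewrite bx subrr add0r theta_le0.
- by move=> x; rewrite addr_ge0 // theta_ge0.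
move=> x; have [dc _] := chart_atP (X := X) x; rewrite (gpairE g Ch Ch dc) /gp; set l := chart_at x in dc *.
have cy := ch_cod dc.
have -> : drow (lc X l h) (ch X l x) = (1 - dtheta s (a x - b x)) *: drow (lc X l b) (ch X l x) +
    dtheta s (a x - b x) *: drow (lc X l a) (ch X l x).
  apply/rowP => c; rewrite !mxE (drow_theta c s0 cy (Ca l) (Cb l)) /lc /= chK //.
by apply: bilin_convex; [exact: gram_invmx (gram_metric g cy)|exact: gp_le1|exact: gp_le1|exact: dtheta_itv].
Qed.

(** The smoothed maximum never falls below its second argument, so each member of the family loses s
    once, when it is inserted, and the losses do not accumulate. *)
Lemma max_family (F : nat -> M -> R) k (s : R) : 0 < s -> (forall i, Fc (F i)) ->
  exists2 H, Fc H & forall i, (i < k)%N -> forall x, F i x - s <= H x.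
Proof.
move=> s0 FF; elim: k => [|k [H FH hH]]; first by exists (fun=> 0); first exact: unit_grad0.
have [h Fh Hh] := smooth_max s0 (FF k) FH; exists h => // i; rewrite ltnS leq_eqVlt => /orP[/eqP->|ik] x.
  by have [] := Hh x.
by have [h1 _] := Hh x; exact: le_trans (hH i ik x) h1.
Qed.

Lemma max_cover (K : set M) (c s : R) : compact K -> 0 < s -> (forall x, K x -> exists2 f, Fc f & c < f x) ->
  exists2 H, Fc H & forall x, K x -> c - s <= H x.
Proof.
move=> cK s0 HK; have /choice[f Hf] : forall x, exists f, Fc f /\ (K x -> c < f x).
  move=> x; have [/HK[f Ff fx]|nK] := pselect (K x); first by exists f.
  by exists (fun=> 0); split=> //; exact: unit_grad0.
have cK' : cover_compact K by rewrite -compact_cover.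
have [||D _ KD] := cK' M setT (fun x => [set: M] `&` f x @^-1` [set t : R | c < t]).
- move=> x _; apply: open_preim; [exact: openT| |exact: open_gt].
  by move=> t _; have [[Cf _ _ _] _] := Hf x; exact: (CM_continuous Cf).
- by move=> x Kx; exists x => //; split=> //; have [_ /(_ Kx)] := Hf x.
pose r := enum_fset D; have [H FH hH] := max_family (size r) s0 (fun i => (Hf (nth point r i)).1).
exists H => // x Kx; have [z /= zD [_ Bz]] := KD x Kx.
have zi : (index z r < size r)%N by rewrite index_mem.
have := hH _ zi x; rewrite nth_index // => h; apply: le_trans h; rewrite lerD2r; exact: ltW.
Qed.

(** The coefficient 1/(4 r) gives a differential of A-dual norm at most 1/2 on the adapted ball. The
    factor 2 between the metrics at x and at z leaves a squared norm of at most 1/2. *)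
Lemma grad_paraboloid x l (r c : R) z : adapted g x l r ->
  bilin (metric g l (ch X l x)) (z - ch X l x) (z - ch X l x) < r ^+ 2 ->
  let q := (fun z => c - (4 * r)^-1 * bilin (metric g l (ch X l x)) (z - ch X l x) (z - ch X l x)) in
  bilin (invmx (metric g l z)) (drow q z) (drow q z) <= 1.
Proof.
set y := ch X l x; set A := metric g l y; move=> Ha zr; cbv zeta; set q := fun z : 'rV[R]_(n + n) => _.
have [r0 dl H] := Ha; have gA : gram A := gram_metric g (ch_cod dl).
have [cz Hv] := H z (ltW zr).
have -> : drow q z = (- (2 * r)^-1) *: ((z - y) *m A).
  apply/rowP => a; rewrite [LHS]mxE [RHS]mxE.
  have d1 := is_derive_quad y z (delta_mx ord0 a) gA.1.
  have d2 := is_deriveB (is_derive_cst c z (delta_mx ord0 a)) (is_deriveZ (4 * r)^-1 d1).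
  have -> : ((z - y) *m A) ord0 a = bilin A (z - y) (delta_mx ord0 a).
    by rewrite /bilin trmx_delta -colE !mxE.
  rewrite /partial /q (derive_val (is_derive := d2)) -[_ *: _]/(_ * _); field; exact: lt0r_neq0.
rewrite bilinZl bilinZr mulrA mulrNN -expr2.
have h := gram_inv_le (z - y) gA (gram_metric g cz) (fun v => (Hv v).1).
apply: (@le_trans _ _ ((2 * r)^-1 ^+ 2 * (2 * r ^+ 2))).
  by rewrite ler_wpM2l ?sqr_ge0 // (le_trans h) // ler_wpM2l // ltW.
have -> : (2 * r)^-1 ^+ 2 * (2 * r ^+ 2) = 2^-1 by field; exact: lt0r_neq0.
by lra.
Qed.

(* If no such point existed, the functions of unit gradient would almost attain the value c on a whole
   small ball around x, and gluing a paraboloid of slope less than 1 on top of them would exceed c at x. *)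
Lemma descent x (c : R) : (forall f, Fc f -> f x <= c) ->
  exists (a : M) (t : R), [/\ 0 < t, reach g x a t & forall f, Fc f -> f a <= c - t / 128].
Proof.
move=> xc; apply: contrapT => nex.
have [l [r Ha]] := adapted_ex g x; have [r0 dl Hr] := Ha.
pose y := ch X l x; pose A := metric g l y; have cy : cod X l y := ch_cod dl.
have gA : gram A := gram_metric g cy.
(* If the claim fails at the points of the closed ball with t = 2 r, then t / 128 = s, so admissible
   functions exceed c - s there, and a single one [H] exceeds c - 2 s on the whole ball. *)
pose Q z := bilin A (z - y) (z - y); pose s := r / 64; have s0 : 0 < s by rewrite divr_gt0.
pose K : set 'rV[R]_(n + n) := [set z | Q z <= r ^+ 2].
pose K' : set 'rV[R]_(n + n) := [set z | Q z <= (r / 2) ^+ 2].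
have cK : compact K by exact: compact_quad.
have cK' : compact K' by exact: compact_quad.
have Kl : K `<=` cod X l by move=> z /Hr[].
have rr : (r / 2) ^+ 2 < r ^+ 2 by rewrite ltr_pXn2r ?nnegrE ?divr_ge0 ?(ltW r0) //; lra.
have K'K : K' `<=` K by move=> z h; apply: (le_trans h); exact: ltW.
have Kl' : K' `<=` cod X l by move=> z /K'K/Kl.
have ball a : (inv X l @` K) a -> exists2 f, Fc f & c - s < f a.
  move=> [z Kz <-]; apply: contrapT => nf; apply: nex; exists (inv X l z), (2 * r); split.
  - by rewrite mulr_gt0.
  - by apply: (adapted_reach Ha) => //; rewrite (ltW r0) lexx.
  - move=> f Ff; rewrite leNgt; apply/negP => h; apply: nf; exists f => //.
    by have <- : c - 2 * r / 128 = c - s by rewrite /s; field.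
have [H FH HK] := max_cover (inv_compact cK Kl) s0 ball; have [CH cH H0 H1] := FH.
(* Outside the half-radius ball the paraboloid has dropped by at least r / 16 = 4 s, hence lies
   below c - 3 s and below [H]: the glued function agrees with [H] there. At x it is at least c + s
   - s / 2, which exceeds c. *)
pose q z := c + s - (4 * r)^-1 * Q z.
pose h z := if Q z < r ^+ 2 then theta s (q z - lc X l H z) else 0.
have CQ N V : open V -> isCk N V Q by exact: Ck_quad.
have Cq N V : open V -> isCk N V q.
  by move=> oV; apply: CkB => //; [exact: Ck_cst|apply: CkZ => //; exact: CQ].
have Qc : continuous Q by move=> z; exact: (Ck_continuous (CQ 0%N _ (@openT _))).
have qB z : ~ K' z -> K z -> q z - lc X l H z <= 0.
  move=> nz Kz; have hz := HK (inv X l z) (imageP _ Kz); rewrite /lc /= /q.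
  have Qz : (r / 2) ^+ 2 < Q z by rewrite ltNge; apply/negP.
  have : (4 * r)^-1 * (r / 2) ^+ 2 <= (4 * r)^-1 * Q z by rewrite ler_wpM2l ?ltW // invr_gt0 mulr_gt0.
  have -> : (4 * r)^-1 * (r / 2) ^+ 2 = 4 * s by rewrite /s; field; exact: lt0r_neq0.
  move: hz; move: ((4 * r)^-1 * Q z) (H (inv X l z)) => u v; lra.
have hK z : h z != 0 -> K' z.
  apply: contra_neqP => nz; rewrite /h; case: ifP => // zr; rewrite theta_le0 // qB //; exact: ltW.
have oB : open [set z | Q z < r ^+ 2].
  by apply: (@open_comp _ _ Q [set t : R | t < r ^+ 2]) => [z _|]; [exact: Qc|exact: open_lt].
have Bl z : Q z < r ^+ 2 -> cod X l z by move=> /ltW/Kl.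
have Chl : isCk 1 [set z | Q z < r ^+ 2] (lc X l H) by apply: Ck_sub (CH l); move=> z /Bl.
have Ch : isCk 1 setT h.
  apply: Ck_bigcup => z _; have [zr|zr] := ltP (Q z) (r ^+ 2).
    exists [set z | Q z < r ^+ 2] => //.
    apply: (@Ck_ext _ _ _ _ (fun z => theta s (q z - lc X l H z))) => //.
      by move=> v; rewrite inE /= => vr; rewrite /h vr.
    by apply: (C1_comp1 oB (is_derive_theta s0) (@dtheta_continuous _ s)); apply: CkB => //; exact: Cq.
  exists (~` K'); first by rewrite /K' /=; apply/negP; rewrite -ltNge; exact: lt_le_trans zr.
  have oK' : open (~` K') by apply: closed_openC; apply: compact_closed => //; exact: haus_rV.
  apply: (@Ck_ext _ _ _ _ (cst 0)) => //; last exact: Ck_cst.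
  by move=> v; rewrite inE /= => nv; apply/eqP; rewrite eq_sym; apply/negPn/negP => /hK.
pose F a := H a + glob X l h a.
have Cg : CM X 1 (glob X l h) by exact: (glob_CM cK' Kl' hK Ch).
have CF : CM X 1 F by exact: CMD.
have h0 z : 0 <= h z by rewrite /h; case: ifP => // _; exact: theta_ge0.
have cKM : compact (inv X l @` K') by exact: inv_compact.
have FF : Fc F.
  split=> //.
  - apply: ccD => //; split; first exact: (CM_continuous Cg).
    by exists (inv X l @` K') => //; exact: glob_supp.
  - by move=> a; rewrite addr_ge0 // /glob; case: asboolP.
  move=> a; have [[z zr za]|nz] := pselect ((inv X l @` [set z | Q z < r ^+ 2]) a); last first.
    have oU : open (~` (inv X l @` K')) by apply: closed_openC; exact: compact_closed.
    have Ua : (~` (inv X l @` K')) a.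
      by move=> [z Kz za]; apply: nz; exists z => //; exact: le_lt_trans rr.
    have FU b : (~` (inv X l @` K')) b -> F b = H b.
      by move=> Ub; rewrite /F; have -> : glob X l h b = 0; [apply/eqP/negPn/negP => /(glob_supp hK)|rewrite addr0].
    by rewrite (gpair_local g F oU Ua FU) gpairC (gpair_local g H oU Ua FU).
  have cz := Bl _ zr; have da : dom X l a by rewrite -za; exact: inv_dom.
  rewrite (gpairE g CF CF da) /gp -za invK //.
  have -> : drow (lc X l F) z = (1 - dtheta s (q z - lc X l H z)) *: drow (lc X l H) z +
      dtheta s (q z - lc X l H z) *: drow q z.
    rewrite (@drow_ext _ _ [set z | Q z < r ^+ 2] _ (fun z => lc X l H z + theta s (q z - lc X l H z))) //; last first.
      by move=> v /= vr; have cv := Bl _ vr; rewrite /F /lc /= /glob asboolT ?invK /h ?vr //; exact: inv_dom.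
    by apply/rowP => b; rewrite !mxE (drow_theta b s0 zr (Cq 1%N _ oB) Chl).
  apply: bilin_convex; [exact: gram_invmx (gram_metric g cz)|exact: (gp_le1 FH)| |exact: dtheta_itv].
  exact: (grad_paraboloid (c + s) Ha zr).
have Q0 : Q y = 0 by rewrite /Q subrr bilin0l.
have := xc F FF; rewrite /F /glob asboolT // /h -/y Q0 exprn_gt0 // /lc /= chK //.
have := theta_ge (q y - H x) s0; rewrite /q Q0 mulr0 subr0 => h1 h2; exact: (gluing_gap s0 h1 h2).
Qed.

Lemma inv_small (e : R) : 0 < e -> exists j : nat, j.+1%:R^-1 < e.
Proof.
move=> e0; exists (Num.Def.archi_bound e^-1); have := archi_boundP (ltW (etrans (invr_gt0 e) e0)).
move=> h; rewrite invf_plt ?posrE ?ltr0n //; apply: (lt_trans h).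
by rewrite ltr_nat.
Qed.

(* Ekeland's variational principle for the supremum of the functions of unit gradient. *)
Lemma unit_grad_unbounded : complete_manifold g -> forall x (B : R), exists2 f, Fc f & B < f x.
Proof.
move=> cpl x0 B; apply: contrapT => nex.
pose bd x := exists b, forall f, Fc f -> f x <= b.
have frac (r m : R) : 0 < r -> 0 < m -> 0 < r / m by exact: divr_gt0.
have bd0 : bd x0 by exists B => f Ff; rewrite leNgt; apply/negP => h; apply: nex; exists f.
pose N x := sup [set r : R | exists2 f, Fc f & f x = r].
have ne x : [set r : R | exists2 f, Fc f & f x = r] !=set0 by exists 0, (fun=> 0) => //; exact: unit_grad0.
have Nub x f : bd x -> Fc f -> f x <= N x.
  move=> [b Hb] Ff; apply: sup_upper_bound; last by exists f.
  by split; [exact: ne|exists b => _ [h Fh <-]; exact: Hb].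
have Nle x b : (forall f, Fc f -> f x <= b) -> N x <= b.
  by move=> H; apply: ge_sup => // _ [f Ff <-]; exact: H.
have N0 x : bd x -> 0 <= N x by move=> bx; exact: (Nub x (fun=> 0) bx unit_grad0).
have bdr x y t : bd x -> reach g x y t -> bd y /\ N y <= N x + t.
  move=> bx r; have H f : Fc f -> f y <= N x + t.
    by move=> Ff; apply: (le_trans (reach_lip Ff r)); rewrite lerD2r; exact: Nub.
  by split; [exists (N x + t)|exact: Nle].
(* The slope 1/256 is half of the slope 1/128 provided by [descent], which leaves room for the error
   made when a descent from the limit point is transferred to a nearby term of the sequence. *)
pose S x y := exists2 t : R, reach g x y t & N y + t / 256 <= N x.
have Srefl x : S x x by exists 0; [exact: reach_refl|rewrite mul0r addr0].
have Strans x y z : S x y -> S y z -> S x z.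
  by move=> [t r1 h1] [u r2 h2]; exists (t + u); [exact: reach_trans r1 r2|lra].
have Sbd x y : bd x -> S x y -> bd y by move=> bx [t r _]; case: (bdr _ _ _ bx r).
have /choice[G HG] : forall p : M * nat, exists y, bd p.1 -> S p.1 y /\ forall z, S p.1 z -> N y <= N z + p.2.+1%:R^-1.
  move=> [x k] /=; have [bx|nb] := pselect (bd x); last by exists x.
  have e0 : 0 < (k.+1%:R^-1 : R) by rewrite invr_gt0.
  pose E := [set r : R | exists2 z, S x z & N z = r].
  have hE : has_inf E.
    split; first by exists (N x), x.
    by exists 0 => _ [z Sz <-]; apply: N0; exact: Sbd Sz.
  have [_ [y Sy <-] yE] := inf_adherent e0 hE; exists y => _; split=> // z Sz; apply: ltW.
  by apply: (lt_le_trans yE); rewrite lerD2r; apply: ge_inf; [case: hE|exists z].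
pose xs := nat_rect (fun=> M) x0 (fun k x => G (x, k)).
have bx k : bd (xs k).
  by elim: k => [//|k IH] /=; have [Sk _] := HG (xs k, k) IH; exact: Sbd IH Sk.
have Sxs j k : (j <= k)%N -> S (xs j) (xs k).
  elim: k => [|k IH]; first by rewrite leqn0 => /eqP ->.
  rewrite leq_eqVlt => /orP[/eqP->//|jk]; apply: (Strans _ _ _ (IH jk)).
  by have [] := HG (xs k, k) (bx k).
have SN x y : S x y -> N y <= N x by move=> [t /reach_ge0 t0 h]; lra.
pose E := [set r : R | exists k, N (xs k) = r].
have hE : has_inf E.
  by split; [exists (N (xs 0%N)), 0%N|exists 0 => _ [k <-]; exact: N0].
have infE k : inf E <= N (xs k) by apply: ge_inf; [case: hE|exists k].
have dist e : 0 < e -> exists K, forall j k, (K <= j)%N -> (j <= k)%N -> exists2 t : R, reach g (xs j) (xs k) t & t < e.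
  move=> e0; have e1 : 0 < e / 256 := frac e 256 e0 (ltr0n _ 256).
  have [_ [K <-] hK] := inf_adherent e1 hE; exists K => j k Kj jk.
  have [t rt ht] := Sxs j k jk; exists t => //.
  by have := infE k; have := SN _ _ (Sxs K j Kj); lra.
have [e e0|xl xcv] := cpl xs.
  have [K HK] := dist e e0; exists K => j k Kj Kk; have [jk|/ltnW kj] := leqP j k.
    by have [t rt te] := HK j k Kj jk; apply: (le_lt_trans (reach_dist rt)); rewrite lte_fin.
  by have [t rt te] := HK k j Kk kj; apply: (le_lt_trans (reach_dist (reach_sym rt))); rewrite lte_fin.
have bl : bd xl.
  have [K _ HK] : \forall k \near \oo, exists2 t : R, t <= 1 & reach g xl (xs k) t.
    exact: (xcv _ (near_reach g xl ltr01)).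
  by have [t _ rt] := HK K (leqnn K); have [] := bdr _ _ _ (bx K) (reach_sym rt).
(* Descending from the limit lowers the supremum by t / 128. A chain from xs j through a later term
   and the limit to y costs at most t / 512 more, so y still lies below xs j for [S]; yet its value
   undercuts the almost minimal choice xs j.+1 by more than the tolerance 1/(j+1) < t / 512. *)
have [y [t [t0 rt ht]]] := descent (fun f Ff => Nub xl f bl Ff).
have Ny := Nle _ _ ht; have e0 : 0 < t / 512 := frac t 512 t0 (ltr0n _ 512).
have [j hj] := inv_small e0.
have [K _ HK] : \forall k \near \oo, exists2 u : R, u <= t / 512 & reach g xl (xs k) u.
  exact: (xcv _ (near_reach g xl e0)).
pose k := maxn K j.+1; have [u ue ru] := HK k (leq_maxl _ _); have u0 := reach_ge0 ru.
have [_ Nk] := bdr _ _ _ (bx k) (reach_sym ru).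
have jk : (j <= k)%N by apply: ltnW; exact: leq_maxr.
have [v rv hv] := Sxs j k jk.
have Sy : S (xs j) y.
  exists (v + u + t); last by lra.
  by apply: (reach_trans _ rt); apply: (reach_trans rv); exact: reach_sym.
have [_ /(_ y Sy)] := HG (xs j, j) (bx j); rewrite -[G _]/(xs j.+1) /= => h.
have := SN _ _ (Sxs j.+1 k (leq_maxr _ _)); move: h hj; move: (_^-1) => w; lra.
Qed.

End Cutoffs.

(** * Elementary inequalities *)

Section Arithmetic.
Context {R : realType}.
Implicit Types (a b q s t : R).

Lemma quad_form_ge0 (A B E s t : R) : 0 <= A -> 0 <= E -> B ^+ 2 <= A * E -> 0 <= s ^+ 2 * A + 2 * s * t * B + t ^+ 2 * E.
Proof.
move=> A0 E0 h; rewrite leNgt; apply/negP => neg.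
have X0 : 0 <= s ^+ 2 * A by rewrite mulr_ge0 // sqr_ge0.
have Y0 : 0 <= t ^+ 2 * E by rewrite mulr_ge0 // sqr_ge0.
have h1 : (2 * s * t * B) ^+ 2 <= 4 * (s ^+ 2 * A) * (t ^+ 2 * E).
  have -> : (2 * s * t * B) ^+ 2 = 4 * (s * t) ^+ 2 * B ^+ 2 by ring.
  have -> : 4 * (s ^+ 2 * A) * (t ^+ 2 * E) = 4 * (s * t) ^+ 2 * (A * E) by ring.
  by rewrite ler_wpM2l // mulr_ge0 // sqr_ge0.
move: neg X0 Y0 h1; move: (s ^+ 2 * A) (t ^+ 2 * E) (2 * s * t * B) => X Y Z neg X0 Y0 h1.
have : (X + Y) ^+ 2 < (- Z) ^+ 2 by rewrite ltr_pXn2r ?nnegrE //; lra.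
have -> : (X + Y) ^+ 2 = (X - Y) ^+ 2 + 4 * X * Y by ring.
by rewrite sqrrN; have := sqr_ge0 (X - Y); lra.
Qed.

(** When A = |Y|^2, B = <Y, Z> and E = |Z|^2, the difference of the two sides is |c Y + (1 - k q)
    Z|^2 / (2 c). Cauchy-Schwarz between the three numbers is all that remains of the vectors. *)
Lemma absorb (q k A B E : R) : 0 < q / 2 - k * q ^+ 2 / 4 -> 0 <= A -> 0 <= E -> B ^+ 2 <= A * E ->
  let c := q / 2 - k * q ^+ 2 / 4 in
  c / 2 * A - (k + (k * q - 1) ^+ 2 / (2 * c)) * E <= q / 2 * A + B - k * (E + q * B + q ^+ 2 / 4 * A).
Proof.
move=> c0 A0 E0 h; cbv zeta; set c := _ - _ in c0 *.
have := quad_form_ge0 c (1 - k * q) A0 E0 h.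
have c20 : 0 < 2 * c by rewrite mulr_gt0.
have E1 : q / 2 * A + B - k * (E + q * B + q ^+ 2 / 4 * A) - (c / 2 * A - (k + (k * q - 1) ^+ 2 / (2 * c)) * E) =
    (c ^+ 2 * A + 2 * c * (1 - k * q) * B + (1 - k * q) ^+ 2 * E) / (2 * c).
  have -> : q / 2 * A = (c + k * q ^+ 2 / 4) * A by rewrite /c subrK.
  by field; rewrite lt0r_neq0.
by move=> H; rewrite -subr_ge0 E1 divr_ge0 // ltW.
Qed.

Lemma powRD_le (q a b : R) : 0 <= q -> 0 <= a -> 0 <= b -> (a + b) `^ q <= 2 `^ q * (a `^ q + b `^ q).
Proof.
move=> q0 a0 b0; have mono (s t : R) : 0 <= s -> s <= t -> s `^ q <= t `^ q.
  by move=> s0 st; apply: (ge0_ler_powR q0); rewrite ?nnegrE // (le_trans s0).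
rewrite mulrDr -!powRM //; have [ab|/ltW ba] := leP a b.
  apply: (@le_trans _ _ ((2 * b) `^ q)); last by rewrite lerDr powR_ge0.
  by apply: mono; [rewrite addr_ge0|lra].
apply: (@le_trans _ _ ((2 * a) `^ q)); last by rewrite lerDl powR_ge0.
by apply: mono; [rewrite addr_ge0|lra].
Qed.

Lemma powR_half (q a : R) : 0 < a -> a ^+ 2 * (a `^ (q / 2 - 1)) ^+ 2 = a `^ q.
Proof.
move=> a0; have an0 : a != 0 by rewrite lt0r_neq0.
have E : a * a `^ (q / 2 - 1) = a `^ (q / 2).
  rewrite -[X in X * _](powRr1 (ltW a0)) -powRD; first by rewrite addrC subrK.
  by rewrite an0 implybT.
rewrite -exprMn E expr2 -powRD; first by congr (_ `^ _); field.
by rewrite an0 implybT.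
Qed.

(** Provides a regularization e so small, relative to the volume V of a support, that adding it to
    the energy costs at most 1 in the integral. *)
Lemma small_power (q V : R) : 0 < q -> 0 <= V -> exists e : R, [/\ 0 < e, e <= 1 & e `^ q * V <= 1].
Proof.
move=> q0 V0; have V1 : 0 < V + 1 by rewrite ltr_wpDl.
pose d := (V + 1)^-1 `^ q^-1; have d0 : 0 < d by rewrite powR_gt0 // invr_gt0.
exists (Num.min 1 d); split; [by rewrite lt_min ltr01|by rewrite ge_min lexx|].
apply: (@le_trans _ _ ((V + 1)^-1 * V)); last by rewrite ler_pdivrMl // mulr1 lerDl.
rewrite ler_wpM2r //; apply: (@le_trans _ _ (d `^ q)).
  apply: (ge0_ler_powR (ltW q0)); rewrite ?nnegrE ?(ltW d0) ?le_min ?ler01 ?(ltW d0) //.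
  by rewrite ge_min lexx orbT.
by rewrite /d -powRrM mulVf ?lt0r_neq0 // powRr1 // invr_ge0 ltW.
Qed.

Lemma sub1_le_sqr (B s : R) : 1 <= B -> B <= s -> B - 1 <= s ^+ 2.
Proof. by move=> B1 Bs; rewrite expr2; nra. Qed.

Lemma atan_le2 (t : R) : `|atan t| <= 2.
Proof.
have h1 := atan_ltpi2 t; have h2 := atan_gtNpi2 t; have h3 := pihalf_lt2 R.
by rewrite ler_norml; apply/andP; split; lra.
Qed.

End Arithmetic.

Lemma ge0_integral_add_indic (R : realType) d (T : measurableType d) (mu : {measure set T -> \bar R}) (W : T -> R)
    (L : set T) (a b : R) :
  measurable_fun setT W -> measurable L -> (forall t, 0 <= W t) -> 0 <= a -> 0 <= b ->
  (\int[mu]_t (a * (W t + b * \1_L t))%:E = a%:E * (\int[mu]_t (W t)%:E + b%:E * mu L))%E.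
Proof.
move=> mW mL W0 a0 b0.
have m1 : measurable_fun setT (fun t => (W t)%:E) by apply/measurable_EFinP.
have m2 : measurable_fun setT (fun t => (\1_L t : R)%:E) by apply/measurable_EFinP; exact: measurable_indic.
under eq_integral do rewrite EFinM EFinD EFinM.
rewrite ge0_integralZl_EFin //; last 2 first.
- by move=> t _; rewrite adde_ge0 ?mule_ge0 ?lee_fin.
- by apply: emeasurable_funD => //; exact: measurable_funeM.
rewrite ge0_integralD //; last 3 first.
- by move=> t _; rewrite lee_fin.
- by move=> t _; rewrite mule_ge0 ?lee_fin.
- exact: measurable_funeM.
by rewrite ge0_integralZl_EFin // integral_indic // setIT.
Qed.

(** * The Liouville argument *)

Section Liouville.
Context {R : realType} {n : nat} {M : ptopologicalType} (X : complexManifold R n M) (g : kahlerMetric X).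
Implicit Types (x : M) (f phi : M -> R).
Let hM : hausdorff_space M := haus (X := X).
Let VC := @volm_compact R n M X g.

Lemma bump_near x (P : set M) : (\forall z \near x, P z) ->
  exists b : M -> R, [/\ cc b, forall z, 0 <= b z <= 1, b x = 1 & forall z, b z != 0 -> P z].
Proof.
move=> nP; have [l dl] := chart_cover X x; have cy := ch_cod dl.
pose V := cod X l `&` inv X l @^-1` (P^°).
have oV : open V by apply: open_preim; [exact: cod_open|exact: inv_cont|exact: open_interior].
have yV : [set ch X l x] `<=` V by move=> _ ->; split; rewrite ?/preimage /= ?chK.
have [chi [U [K [Cchi c01 [oU KU c1 cK [KV cs]]]]]] := bump_rV (@compact_set1 _ (ch X l x)) oV yV.
have Kl : K `<=` cod X l by move=> z /KV[].
exists (glob X l chi); split.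
- split; first exact: (CM_continuous (glob_CM cK Kl cs (Cchi 0%N))).
  by exists (inv X l @` K); [exact: inv_compact|exact: glob_supp].
- by move=> z; rewrite /glob; case: asboolP => // _; rewrite lexx ler01.
- by rewrite /glob asboolT // c1 //; exact: KU.
- by move=> z /(glob_supp cs)[w Kw <-]; have [_ h] := KV _ Kw; exact: interior_subset h.
Qed.

Lemma near_gt f x (c : R) : continuous f -> c < f x -> \forall z \near x, c < f z.
Proof.
move=> cf h; apply: (@open_nbhs_nbhs _ x [set z | c < f z]); split=> //.
by apply: (@open_comp _ _ f [set t | c < t]) => [w _|]; [exact: cf|exact: open_gt].
Qed.

Lemma constant_of_locally f x : continuous f -> (forall z, f z = f x -> \forall w \near z, f w = f z) ->
  forall z, f z = f x.
Proof.
move=> cf H z; have con := manifold_connected X.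
have A : [set z | f z = f x] = [set: M].
  apply: con; first by exists x.
    exists [set z | f z = f x]; last by rewrite setTI.
    by rewrite openE => w /= fw; have := H w fw; apply: filterS => v /= ->; exact: fw.
  exists [set z | f z = f x]; last by rewrite setTI.
  by apply: (@closed_comp _ _ f [set t | t = f x]) => [w _|]; [exact: cf|exact: closed_eq].
have : [set z | f z = f x] z by rewrite A.
by [].
Qed.

Lemma locally_constant f x : CM X 1 f -> (\forall z \near x, gpair g f f z = 0) -> \forall z \near x, f z = f x.
Proof.
move=> Cf nf; have [l dl] := chart_cover X x; have cy := ch_cod dl.
pose V := cod X l `&` inv X l @^-1` ([set z | gpair g f f z = 0]^°).
have oV : open V by apply: open_preim; [exact: cod_open|exact: inv_cont|exact: open_interior].
have yV : V (ch X l x) by split; rewrite ?/preimage /= ?chK.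
have [r r0 Hr] := (nbhs_rV _ _).1 (open_nbhs_nbhs (conj oV yV)).
have n1 : \forall z \near x, `|ch X l z - ch X l x| < r.
  by have /(@cvgrPdist_lt _ _ _ (nbhs x) _ _ (ch X l x)) /(_ _ r0) := ch_cont dl; apply: filterS => z; rewrite distrC.
have n2 : \forall z \near x, dom X l z by apply: open_nbhs_nbhs; split=> //; exact: dom_open.
near=> z; have zr : `|ch X l z - ch X l x| < r by near: z.
have dz : dom X l z by near: z.
pose y := ch X l x; pose w := ch X l z - y.
have Hw (t : R) : 0 <= t <= 1 -> V (y + t *: w).
  move=> /andP[t0 t1]; apply: Hr; rewrite addrAC subrr add0r normrZ ger0_norm //.
  by apply: le_lt_trans zr; rewrite ler_piMl.
have [t t01 E] := @MVT_line R _ (lc X l f) (fun t => \sum_a partial a (lc X l f) (y + t *: w) * w ord0 a) y w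
  (fun t ht => Ck_derive w (@cod_open _ _ _ X l) (Cf l) (Hw t ht).1).
have [cv gv] := Hw t t01; have g0 : gpair g f f (inv X l (y + t *: w)) = 0 := interior_subset gv.
have d0 : drow (lc X l f) (y + t *: w) = 0.
  apply/eqP/negPn/negP => /((gram_invmx (gram_metric g cv)).2); rewrite -/(gp g l f f (y + t *: w)) -(lc_gpair g Cf Cf cv).
  by rewrite /lc /= g0 ltxx.
have yz : y + w = ch X l z by rewrite /w addrCA subrr addr0.
move: E; rewrite yz /lc /= /y !chK // big1 ?subr0 => [/eqP|a _]; first by rewrite subr_eq0 => /eqP.
by have := congr1 (fun v : 'rV[R]_(n + n) => v ord0 a) d0; rewrite !mxE => ->; rewrite mul0r.
Unshelve. all: by end_near. Qed.

Variables (rho : M -> R) (rho_ge0 : forall x, 0 <= rho x) (poinc : weighted_poincare g rho).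
Variables (u : M -> R) (uP : pluriharmonic (X := X) u).
Let Cu : CM X 1 u.
Proof. by move=> i; apply: (@Ck_le _ _ 2) => //; apply/isCkP; exact: (uP.1 i). Qed.
Let G := energy g u.
Let CG : CM X 1 G := CM_energy g uP.
Let G0 x : 0 <= G x := energy_ge0 g u x.

Section Caccioppoli.
Variables (q k : R) (k0 : 0 < k) (kq : k * q < 2) (q0 : 0 < q).
Hypothesis ric : ricci_ge g (fun x => - k * rho x).
Variables (phi : M -> R) (Cphi : CM X 1 phi) (cphi : cc phi) (phi0 : forall x, 0 <= phi x).
Variables (e : R) (e0 : 0 < e).

Let F x := G x + e.
Let F0 x : 0 < F x. Proof. by rewrite ltr_wpDl. Qed.
Let CF : CM X 1 F. Proof. by apply: CMD => //; exact: CM_cst. Qed.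
(** The only real power that is differentiated. The other powers are products: F K is F^(q/2), and F
    K^2 is F^(q-1). *)
Let K x := F x `^ (q / 2 - 1).
Let CK : CM X 1 K. Proof. exact: CM_powR. Qed.
Let H x := F x * K x.
Let CH : CM X 1 H. Proof. exact: CMM. Qed.

Let gF h x : CM X 1 h -> gpair g F h x = gpair g G h x.
Proof. by move=> Ch; rewrite /F gpairDl // ?gpair_cstl ?addr0 //; exact: CM_cst. Qed.

Let gK h x : CM X 1 h -> F x * gpair g K h x = (q / 2 - 1) * K x * gpair g G h x.
Proof.
move=> Ch; rewrite (gpair_compl (phi := fun t => t `^ (q / 2 - 1)) g h CF (is_derive1_powR (q / 2 - 1) (F0 x))) gF //.
have E : F x * F x `^ (q / 2 - 1 - 1) = K x.
  rewrite -[X in X * _](powRr1 (ltW (F0 x))) -powRD; first by rewrite addrC subrK.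
  by rewrite lt0r_neq0 ?implybT.
by rewrite -E; ring.
Qed.

Let gH h x : CM X 1 h -> gpair g H h x = q / 2 * K x * gpair g G h x.
Proof. by move=> Ch; rewrite /H gpairMl // gK // gF //; ring. Qed.

(** [A], [B], [E] are |Y|^2, <Y, Z>, |Z|^2 for Y = phi K dG and Z = H dphi. The gradients of both
    test functions, [psi] for Poincaré and [eta] for Bochner, enter through these three only. *)
Let A x := phi x ^+ 2 * K x ^+ 2 * gpair g G G x.
Let B x := phi x * (F x * K x ^+ 2) * gpair g phi G x.
Let E x := H x ^+ 2 * gpair g phi phi x.
Let psi x := phi x * H x.
Let eta x := psi x * phi x * K x.
Let Cpsi : CM X 1 psi. Proof. exact: CMM. Qed.
Let Ceta : CM X 1 eta. Proof. by apply: CMM => //; exact: CMM. Qed.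

Let geta x : gpair g eta G x = 2 * B x + (q - 1) * A x.
Proof.
rewrite /eta gpairMl //; last exact: CMM.
rewrite gpairMl // /psi gpairMl // gH //.
have -> : phi x * H x * phi x * gpair g K G x = phi x ^+ 2 * K x * (F x * gpair g K G x) by rewrite /H; ring.
by rewrite gK // /A /B /H; field.
Qed.

Let gpsi x : gpair g psi psi x = E x + q * B x + q ^+ 2 / 4 * A x.
Proof.
have e1 h : CM X 1 h -> gpair g psi h x = H x * gpair g phi h x + phi x * (q / 2 * K x * gpair g G h x).
  by move=> Ch; rewrite /psi gpairMl // gH.
rewrite e1 // [gpair g phi psi x]gpairC [gpair g G psi x]gpairC !e1 // [gpair g G phi x]gpairC.
by rewrite /E /A /B /H; field.
Qed.

Let cA : cc A.
Proof.
have -> : A = (fun x => (K x ^+ 2 * gpair g G G x * phi x) * phi x) by apply/funext => x; rewrite /A; ring.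
apply: ccM => //; apply: (CM_continuous (N := 0)); apply: CMM; last exact: CMle Cphi.
apply: CMM; first by apply: CMM; exact: CMle CK.
by apply: CM0; exact: gpair_continuous.
Qed.

Let cE : cc E.
Proof.
rewrite /E; apply: ccM; last exact: gpair_cc.
exact: (CM_continuous (CMM CH CH)).
Qed.

Let cB : cc B.
Proof.
have -> : B = (fun x => (F x * K x ^+ 2 * gpair g phi G x) * phi x) by apply/funext => x; rewrite /B; ring.
apply: ccM => //; apply: (CM_continuous (N := 0)); apply: CMM.
  by apply: CMM; [exact: CMle CF|apply: CMM; exact: CMle CK].
by apply: CM0; exact: gpair_continuous.
Qed.

(** Bochner's formula identifies the integral of [P] with that of [f], the part of A/2 not covered
    by eta S. The curvature bound makes f at most k rho psi^2, and Poincaré bounds the integral of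
    the latter by k times that of [Q]. What remains is the algebraic inequality [absorb]. *)
Lemma caccioppoli : let c := q / 2 - k * q ^+ 2 / 4 in
  c / 2 * Int (volm g) A <= (k + (k * q - 1) ^+ 2 / (2 * c)) * Int (volm g) E.
Proof.
cbv zeta; have c0 : 0 < q / 2 - k * q ^+ 2 / 4.
  have -> : q / 2 - k * q ^+ 2 / 4 = q / 4 * (2 - k * q) by field.
  by rewrite mulr_gt0 ?divr_gt0 // subr_gt0.
have [_ [L cL phiL]] := cphi.
have etaL x : eta x != 0 -> L x by rewrite !mulf_eq0 !negb_or => /andP[/andP[_ /phiL]].
have [S [cS IS HS]] := bochner_formula uP ric Ceta cL etaL.
have cpsi : cc psi by apply: ccMr => //; exact: (CM_continuous CH).
have psi0 x : 0 <= psi x by rewrite /psi /H !mulr_ge0 // ?powR_ge0 // ltW.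
pose f x := 2^-1 * A x - eta x * S x.
have cf : cc f by apply: ccB => //; exact: ccZ.
(* The positive part of f divided by k. It is continuous, dominates f / k and lies below rho psi^2,
   for which it stands in since rho psi^2 is not known to be integrable or measurable. *)
pose m x := (2 * k)^-1 * (f x + `|f x|).
have cm : cc m by apply: ccZ; apply: ccD => //; exact: cc_norm.
have frho x : f x <= k * (rho x * psi x ^+ 2).
  have r0 : 0 <= k * (rho x * psi x ^+ 2) by rewrite mulr_ge0 ?(ltW k0) // mulr_ge0 // sqr_ge0.
  have [Lx|nL] := pselect (L x); last first.
    have p0 : phi x = 0 by apply/eqP/negPn/negP => /phiL.
    have -> : f x = 0 by rewrite /f /A /eta /psi p0; ring.
    exact: r0.
  have eta0 : 0 <= eta x by exact: (mulr_ge0 (mulr_ge0 (psi0 x) (phi0 x)) (powR_ge0 _ _)).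
  have h := ler_wpM2l eta0 (HS x e Lx e0).
  (* The curvature term carries G = F - e rather than F; the resulting correction in e has the
     favourable sign and is dropped by means of [E2]. *)
  have E1 : eta x * (gpair g G G x / (2 * F x) + - k * rho x * G x) =
      2^-1 * A x - k * (rho x * (psi x ^+ 2 - e * (phi x ^+ 2 * (F x * K x ^+ 2)))).
    by rewrite /eta /psi /A /H /F; field; have := F0 x; rewrite /F => /lt0r_neq0.
  have E2 : 0 <= k * (rho x * (e * (phi x ^+ 2 * (F x * K x ^+ 2)))).
    exact: (mulr_ge0 (ltW k0) (mulr_ge0 (rho_ge0 x) (mulr_ge0 (ltW e0) (mulr_ge0 (sqr_ge0 _) (mulr_ge0 (ltW (F0 x)) (sqr_ge0 _)))))).
  move: h; rewrite -/G -/(F x) E1 /f; move: E2; rewrite mulrBr mulrBr.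
  move: (eta x * S x) (2^-1 * A x) (k * (rho x * psi x ^+ 2)) (k * _) => s1 s2 s3 s4; lra.
have m0 x : 0 <= m x.
  by rewrite /m mulr_ge0 ?invr_ge0 ?mulr_ge0 ?(ltW k0) //; have := lerNnormlW (lexx `|f x|); lra.
have mrho x : m x <= rho x * psi x ^+ 2.
  rewrite /m ler_pdivrMl ?mulr_gt0 // -mulrA; have := frho x.
  have r0 : 0 <= k * (rho x * psi x ^+ 2) by rewrite mulr_ge0 ?(ltW k0) // mulr_ge0 // sqr_ge0.
  by move: r0; move: (k * _) (f x) => s t s0 ts; have [t0|t0] := leP 0 t; [rewrite ger0_norm //|rewrite ltr0_norm //]; lra.
have Im : Int (volm g) m <= Int (volm g) (gpair g psi psi).
  rewrite -lee_fin (Int_EFin hM VC cm); apply: le_trans (poincare_c1 rho_ge0 poinc Cpsi cpsi psi0).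
  by apply: le_integral_lower => x; rewrite lee_fin.
have ckm : cc (fun x => k * m x) by exact: ccZ.
have If : Int (volm g) f <= k * Int (volm g) m.
  rewrite -(IntZ hM VC k cm); apply: (Int_le hM VC) => // x.
  have -> : k * m x = 2^-1 * (f x + `|f x|) by rewrite /m; field; rewrite lt0r_neq0.
  by have := ler_norm (f x); lra.
pose P x := q / 2 * A x + B x; pose Q x := E x + q * B x + q ^+ 2 / 4 * A x.
have cP : cc P by apply: ccD => //; exact: ccZ.
have cQ : cc Q by apply: ccD; [apply: ccD => //; exact: ccZ|exact: ccZ].
have QE : gpair g psi psi = Q by apply/funext => x; exact: gpsi.
have cb : cc (fun x => 2^-1 * gpair g eta G x + eta x * S x).
  apply: (ccD _ cS); apply: ccZ; apply: (gpair_cc g Ceta CG).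
  by apply: ccMr; [exact: (CM_continuous CK)|apply: ccM => //; exact: (CM_continuous Cpsi)].
have IP : Int (volm g) P = Int (volm g) f.
  have -> : P = (fun x => f x + (2^-1 * gpair g eta G x + eta x * S x)).
    by apply/funext => x; rewrite geta /P /f; field.
  by rewrite (IntD hM VC cf cb) [X in _ + X]IS addr0.
have IQ : Int (volm g) P <= k * Int (volm g) Q.
  rewrite IP -QE; apply: (le_trans If); rewrite ler_wpM2l //; exact: ltW.
set c := q / 2 - k * q ^+ 2 / 4 in c0 *; set c' := k + _.
rewrite -(IntZ hM VC (c / 2) cA) -(IntZ hM VC c' cE) -subr_ge0 -(IntB hM VC); [|exact: ccZ|exact: ccZ].
have cPQ : cc (fun x => k * Q x - P x) by apply: ccB => //; exact: ccZ.
apply: (@le_trans _ _ (Int (volm g) (fun x => k * Q x - P x))).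
  by rewrite (IntB hM VC (ccZ k cQ) cP) (IntZ hM VC k cQ) subr_ge0.
apply: (Int_le hM VC cPQ (ccB (ccZ c' cE) (ccZ (c / 2) cA))) => x.
have A0 : 0 <= A x by exact: (mulr_ge0 (mulr_ge0 (sqr_ge0 _) (sqr_ge0 _)) (gpair_ge0 g G x)).
have E0 : 0 <= E x by exact: (mulr_ge0 (sqr_ge0 _) (gpair_ge0 g phi x)).
have BAE : B x ^+ 2 <= A x * E x.
  have -> : B x ^+ 2 = (phi x * (F x * K x ^+ 2)) ^+ 2 * gpair g phi G x ^+ 2 by rewrite /B exprMn.
  have -> : A x * E x = (phi x * (F x * K x ^+ 2)) ^+ 2 * (gpair g phi phi x * gpair g G G x) by rewrite /A /E /H; ring.
  by rewrite ler_wpM2l ?sqr_ge0 ?gpair_cs.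
have := absorb c0 A0 E0 BAE; rewrite -/c /P /Q -/c'.
move: (c / 2 * A x) (c' * E x) (q / 2 * A x + B x) (k * _) => s1 s2 s3 s4; lra.
Qed.

End Caccioppoli.

Section FiniteEnergy.
Variables (q : R) (q0 : 0 < q) (Wfin : (\int[volm g]_x (G x `^ q)%:E < +oo)%E) (cpl : complete_manifold g).
Let I0 := fine (\int[volm g]_x (G x `^ q)%:E).

(** The indicator term accounts for the constant e added to the energy, which contributes only on
    the support of the cutoff. *)
Lemma energy_bound f (L : set M) (c d : R) : cc f -> compact L -> 0 <= c -> 0 <= d -> (forall x, 0 <= f x) ->
  (forall x, f x <= c * (G x `^ q + d * \1_L x)) -> Int (volm g) f <= c * (I0 + d * fine (volm g L)).
Proof.
move=> cf cL c0 d0 f0 fb; rewrite -lee_fin (Int_EFin hM VC cf).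
have mG : measurable_fun setT (G : borel M -> measurableTypeR R) := continuous_borelR (CM_continuous CG).
have mL : measurable (L : set (borel M)) by apply: measurable_compact.
have W0 : (0 <= \int[volm g]_x (G x `^ q)%:E)%E by apply: integral_ge0 => x _; rewrite lee_fin powR_ge0.
apply: (@le_trans _ _ (\int[volm g]_x (c * (G x `^ q + d * \1_L x))%:E)%E).
  by apply: le_integral_lower => x; rewrite lee_fin.
have -> : (\int[volm g]_x (c * (G x `^ q + d * \1_L x))%:E = c%:E * (\int[volm g]_x (G x `^ q)%:E + d%:E * volm g L))%E.
  apply: ge0_integral_add_indic => // [|x]; [exact: (measurableT_comp (measurable_powR q) mG)|exact: powR_ge0].
have fV : (volm g L \is a fin_num)%E by rewrite ge0_fin_numE // VC.
have fW : (\int[volm g]_x (G x `^ q)%:E)%E \is a fin_num by rewrite ge0_fin_numE.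
rewrite /I0; move: fV fW; move: (volm g L) (\int[volm g]_x (G x `^ q)%:E)%E => [v| |] [w| |] //= _ _.
Qed.

Lemma unbounded_near x (B : R) z f (t : R) : unit_grad g f -> B < f x -> t <= 1 -> reach g x z t -> B - 1 <= f z.
Proof. by move=> Ff Bf t1 /reach_sym r; have := reach_lip Ff r; lra. Qed.

Lemma unbounded_absurd (m D : R) : 0 < m -> (forall B : R, 1 <= B -> (B - 1) * m <= D) -> False.
Proof.
move=> m0 H; have D0 : 0 <= D by have := H 1 (lexx _); rewrite subrr mul0r.
have B1 : 1 <= 2 + D / m by have := divr_ge0 D0 (ltW m0); lra.
have := H _ B1; have -> : (2 + D / m - 1) * m = D + m by field; rewrite lt0r_neq0.
by lra.
Qed.

(** If dG did not vanish at x, the left side of [caccioppoli] would grow without bound with the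
    values of the cutoff near x, while the right side stays bounded because the cutoff has gradient
    at most 1 and the energy is integrable. *)
Lemma energy_grad0 (k : R) x : 0 < k -> k * q < 2 -> ricci_ge g (fun x => - k * rho x) -> 0 < G x -> gpair g G G x = 0.
Proof.
move=> k0 kq ric Gx; apply/eqP/negPn/negP => gn0.
have gx : 0 < gpair g G G x by rewrite lt0r gn0 gpair_ge0.
pose c0 := G x / 2; pose c2 := 2 * G x; pose c1 := gpair g G G x / 2.
have c00 : 0 < c0 by rewrite divr_gt0.
have c10 : 0 < c1 by rewrite divr_gt0.
have c20 : 0 < c2 + 1 by rewrite ltr_wpDl // mulr_ge0.
have n1 : \forall z \near x, c0 < G z by apply: near_gt; [exact: (CM_continuous CG)|rewrite /c0; lra].
have n2 : \forall z \near x, - c2 < - G z.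
  apply: near_gt; last by rewrite /c2; lra.
  by have := CM_continuous (CMZ (-1) CG); under eq_fun do rewrite mulN1r.
have n3 : \forall z \near x, c1 < gpair g G G z.
  by apply: near_gt; [exact: gpair_continuous|rewrite /c1; lra].
have n4 := near_reach g x ltr01.
have [b [cb b01 bx bP]] := bump_near (filterI (filterI n1 n2) (filterI n3 n4)).
have b0 z : 0 <= b z by have /andP[] := b01 z.
have Ib : 0 < Int (volm g) b.
  rewrite ltNge; apply/negP => Ib; have := Int_eq0 hM VC (@volm_open_gt0 _ _ _ X g) cb b0 Ib x.
  by rewrite bx => /eqP; rewrite oner_eq0.
(* A lower bound for F^(q-2) |dG|^2 where b does not vanish. The power is written as F^q / F^2, with
   F^q bounded below and F^2 above, so that the sign of q - 2 does not matter. *)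
pose m := c0 `^ q / (c2 + 1) ^+ 2 * c1.
have m0 : 0 < m by rewrite /m mulr_gt0 // divr_gt0 ?exprn_gt0 // powR_gt0.
pose a0 := q / 2 - k * q ^+ 2 / 4.
have a00 : 0 < a0.
  have -> : a0 = q / 4 * (2 - k * q) by rewrite /a0; field.
  by rewrite mulr_gt0 ?divr_gt0 // subr_gt0.
pose c' := k + (k * q - 1) ^+ 2 / (2 * a0).
have c'0 : 0 <= c' by rewrite /c' addr_ge0 ?(ltW k0) // divr_ge0 ?sqr_ge0 // mulr_ge0 // ltW.
have p2 : 0 <= 2 `^ q :> R by exact: powR_ge0.
apply: (@unbounded_absurd (a0 / 2 * (m * Int (volm g) b)) (c' * (2 `^ q * (I0 + 1)))).
  by apply: mulr_gt0; [rewrite divr_gt0|exact: mulr_gt0].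
move=> B B1; have [f Ff Bf] := unit_grad_unbounded cpl x (B + 1).
have [Cf cf f0 f1] := Ff; have [_ [L cL fL]] := cf.
pose V := fine (volm g L); have V0 : 0 <= V by rewrite fine_ge0.
(* The regularization is chosen after the cutoff f, because the volume of its support enters; e^q V
   <= 1 makes the final bound independent of B. *)
have [e [e0 e1 eV]] := small_power q0 V0.
pose A z := f z ^+ 2 * ((G z + e) `^ (q / 2 - 1)) ^+ 2 * gpair g G G z.
pose E z := ((G z + e) * (G z + e) `^ (q / 2 - 1)) ^+ 2 * gpair g f f z.
have F0 z : 0 < G z + e by rewrite ltr_wpDl.
have AE : a0 / 2 * Int (volm g) A <= c' * Int (volm g) E := caccioppoli k0 kq q0 ric Cf cf f0 e0.
have CF : CM X 1 (fun z => G z + e) by apply: CMD => //; exact: CM_cst.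
have CK : CM X 1 (fun z => (G z + e) `^ (q / 2 - 1)) by exact: CM_powR.
have cE : cc E.
  by rewrite /E; apply: ccM; [exact: (CM_continuous (CMM (CMM CF CK) (CMM CF CK)))|exact: gpair_cc].
have cA : cc A.
  have -> : A = (fun z => (f z * ((G z + e) `^ (q / 2 - 1)) ^+ 2 * gpair g G G z) * f z).
    by apply/funext => z; rewrite /A; ring.
  apply: ccM => //; apply: (CM_continuous (N := 0)); apply: CMM; last by apply: CM0; exact: gpair_continuous.
  by apply: CMM; [exact: CMle Cf|exact: CMle (CMM CK CK)].
have E0 z : 0 <= E z by exact: (mulr_ge0 (sqr_ge0 _) (gpair_ge0 g f z)).
have IE : Int (volm g) E <= 2 `^ q * (I0 + 1).
  have h : Int (volm g) E <= 2 `^ q * (I0 + e `^ q * V).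
    apply: energy_bound => //; first exact: powR_ge0.
    move=> z; have [Lz|nL] := pselect (L z).
      rewrite indicE mem_set // mulr1 /E exprMn powR_half //.
      apply: (le_trans _ (powRD_le (ltW q0) (G0 z) (ltW e0))).
      by rewrite ler_piMr // powR_ge0.
    have -> : E z = 0.
      rewrite /E; have -> : gpair g f f z = 0; last by rewrite mulr0.
      by apply/eqP/negPn/negP => /(gpair_supp (compact_closed hM cL) fL).
    by rewrite mulr_ge0 // addr_ge0 ?powR_ge0 // mulr_ge0 // ?powR_ge0.
  by apply: (le_trans h); rewrite ler_wpM2l // lerD2l.
apply: (@le_trans _ _ (a0 / 2 * Int (volm g) A)); last by apply: (le_trans AE); rewrite ler_wpM2l.
rewrite mulrCA ler_wpM2l ?divr_ge0 ?(ltW a00) // mulrA -(IntZ hM VC _ cb); apply: (Int_le hM VC) => // [|z].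
  exact: ccZ.
have A0 : 0 <= A z by exact: (mulr_ge0 (mulr_ge0 (sqr_ge0 _) (sqr_ge0 _)) (gpair_ge0 g G z)).
have [->|/bP[[z1 z2] [z3 [t t1 rt]]]] := eqVneq (b z) 0; first by rewrite mulr0.
have fz : B <= f z.
  by have := unbounded_near Ff Bf t1 rt; rewrite addrK.
have B10 : 0 <= B - 1 by rewrite subr_ge0.
apply: (@le_trans _ _ ((B - 1) * m)).
  exact: (ler_piMr (mulr_ge0 B10 (ltW m0)) (proj2 (andP (b01 z)))).
have h1 : B - 1 <= f z ^+ 2 := sub1_le_sqr B1 fz.
have h2 : c0 `^ q / (c2 + 1) ^+ 2 <= ((G z + e) `^ (q / 2 - 1)) ^+ 2.
  rewrite ler_pdivrMr ?exprn_gt0 //.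
  apply: (@le_trans _ _ ((G z + e) `^ q)).
    have cGe : c0 <= G z + e by apply: (le_trans (ltW z1)); rewrite lerDl ltW.
    by apply: (ge0_ler_powR (ltW q0)); rewrite ?nnegrE ?(ltW c00) ?(ltW (F0 z)).
  rewrite -(powR_half q (F0 z)) mulrC ler_wpM2l ?sqr_ge0 //.
  have Gc2 : G z + e <= c2 + 1 by apply: lerD e1; rewrite ltW // -ltrN2.
  by rewrite !expr2; apply: ler_pM; rewrite ?(ltW (F0 z)).
have h3 : 0 <= c0 `^ q / (c2 + 1) ^+ 2 by rewrite divr_ge0 ?sqr_ge0 ?powR_ge0.
rewrite /A /m mulrA; exact: (ler_pM (mulr_ge0 B10 h3) (ltW c10) (ler_pM B10 h3 h1 h2) (ltW z3)).
Qed.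

(** For a cutoff f, pairing du with d(f atan u) gives f c / (1 + u^2) plus atan(u) <df, du>, with
    total integral 0. The arctangent is bounded, unlike u, while its derivative stays positive. So
    the second term is bounded by a multiple of the finite volume, whereas the first grows with
    f. *)
Lemma energy_const_absurd (c : R) : 0 < c -> (forall z, G z = c) -> M -> False.
Proof.
move=> c0 Gc x.
pose at_ z := atan (u z); pose w z := (1 + u z ^+ 2)^-1.
have w0 z : 0 < 1 + u z ^+ 2 by rewrite ltr_pwDl // sqr_ge0.
have dc : continuous (fun t : R => (1 + t ^+ 2)^-1).
  move=> t; apply: cvgV; first by rewrite gt_eqF // ltr_pwDl // sqr_ge0.
  by apply: cvgD; [exact: cvg_cst|exact: exprn_continuous].
have Cat : CM X 1 at_.
  by move=> i; apply: (C1_comp1 (@cod_open _ _ _ X i) (@is_derive1_atan R) dc (Cu i)).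
have cw : continuous w.
  move=> z; apply: (@continuous_comp _ _ _ u (fun t : R => (1 + t ^+ 2)^-1)); last exact: dc.
  exact: (CM_continuous Cu).
have [b [cb b01 bx bP]] := bump_near (near_reach g x ltr01).
have b0 z : 0 <= b z by have /andP[] := b01 z.
have cbw : cc (fun z => w z * b z) by exact: ccM.
have Ib : 0 < Int (volm g) (fun z => w z * b z).
  rewrite ltNge; apply/negP => Ib.
  have bw0 z : 0 <= w z * b z by rewrite mulr_ge0 // invr_ge0 ltW.
  have := Int_eq0 hM VC (@volm_open_gt0 _ _ _ X g) cbw bw0 Ib x.
  by rewrite bx mulr1 => /eqP; rewrite invr_eq0 gt_eqF.
have s0 : 0 <= Num.sqrt c := sqrtr_ge0 c.
have cq : 0 < c `^ q by rewrite powR_gt0.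
apply: (@unbounded_absurd (c * Int (volm g) (fun z => w z * b z)) (2 * Num.sqrt c / c `^ q * I0)).
  by rewrite mulr_gt0.
move=> B B1; have [f Ff Bf] := unit_grad_unbounded cpl x B; have [Cf cf f0 f1] := Ff.
have [_ [L cL _]] := cf.
pose N z := `|at_ z * gpair g f u z|.
have cgf : cc (gpair g f u) by exact: gpair_cc.
have cN : cc N by apply: cc_norm; apply: ccM => //; exact: (CM_continuous Cat).
have IN : Int (volm g) N <= 2 * Num.sqrt c / c `^ q * I0.
  rewrite -[I0]addr0 -(mul0r (fine (volm g L))); apply: energy_bound => //.
  - by rewrite divr_ge0 ?mulr_ge0 // ltW.
  - by move=> z; exact: normr_ge0.
  move=> z; rewrite mul0r addr0 Gc divfK ?gt_eqF // /N normrM; apply: ler_pM => //.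
    exact: atan_le2.
  rewrite -sqrtr_sqr; apply: ler_wsqrtr; apply: (le_trans (gpair_cs g f u z)).
  by have := Gc z; rewrite /G /energy => ->; rewrite ler_piMl // ltW.
apply: le_trans IN; rewrite mulrA -(IntZ hM VC _ cbw).
have Cfa : CM X 1 (fun z => f z * at_ z) by exact: CMM.
have cfa : cc (fun z => f z * at_ z) by apply: ccMr => //; exact: (CM_continuous Cat).
have div := divergence_theorem g uP Cfa cfa.
have cg : cc (gpair g (fun z => f z * at_ z) u) by exact: gpair_cc.
have cT : cc (fun z => (B - 1) * c * (w z * b z)) by exact: ccZ.
rewrite -subr_le0 -(IntB hM VC cT cN) -div; apply: (Int_le hM VC) => // [|z]; first exact: ccB.
rewrite gpairMl // /at_ (gpair_compl (phi := atan) g u Cu (is_derive1_atan (u z))) -/(at_ z) -/(w z).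
have -> : gpair g u u z = c by exact: Gc.
have hN : - N z <= at_ z * gpair g f u z by rewrite lerNl /N -normrN ler_norm.
have hb : (B - 1) * c * (w z * b z) <= f z * (w z * c).
  have wz : 0 <= w z by rewrite invr_ge0 ltW.
  have -> : (B - 1) * c * (w z * b z) = ((B - 1) * b z) * (w z * c) by ring.
  rewrite ler_wpM2r ?mulr_ge0 ?(ltW c0) //.
  have [->|/bP[t t1 rt]] := eqVneq (b z) 0; first by rewrite mulr0.
  apply: (@le_trans _ _ (B - 1)); last exact: (unbounded_near Ff Bf t1 rt).
  by rewrite ler_piMr ?subr_ge0 //; have /andP[] := b01 z.
by rewrite addrC lerD.
Qed.

(** Where G is positive its gradient vanishes, so a positive level set of G is open as well as
    closed, and connectedness makes G constant. That case is excluded, hence G = 0 and u is locally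
    constant. *)
Lemma liouville (k : R) : 0 < k -> k * q < 2 -> ricci_ge g (fun x => - k * rho x) -> exists c : R, forall x, u x = c.
Proof.
move=> k0 kq ric; have GG := energy_grad0 k0 kq ric.
have [[x Gx]|nex] := pselect (exists x, 0 < G x).
  exfalso; apply: (energy_const_absurd Gx _ x); apply: (constant_of_locally (CM_continuous CG)) => z Gz.
  apply: (locally_constant CG); have nG : \forall w \near z, 0 < G w.
    by apply: near_gt; [exact: (CM_continuous CG)|rewrite Gz].
  by apply: filterS nG => w; exact: GG.
exists (u point); apply: (constant_of_locally (CM_continuous Cu)) => z _.
apply: (locally_constant Cu); apply: filterE => w; apply/eqP; rewrite eq_le -/(energy g u w) G0 andbT leNgt.
by apply/negP => Gw; apply: nex; exists w.
Qed.

End FiniteEnergy.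

End Liouville.

Unset Implicit Arguments.

Theorem theorem1p3 (R : realType) (n : nat) (M : ptopologicalType)
  (X : complexManifold R n M) (g : kahlerMetric X)
  (M_complete : complete_manifold g)
  (rho : M -> R) (rho_ge0 : forall x, 0 <= rho x)
  (rho_poincare : weighted_poincare g rho)
  (p : R) (p_gt1 : 1 < p)
  (u : M -> R) (u_pluriharmonic : pluriharmonic (X := X) u)
  (u_energy : (\int[volume g]_x (norm_grad g u x `^ p)%:E < +oo)%E)
  (k : R)
  (k_ge2 : 2 <= p -> k < 4 / p)
  (k_lt2 : p < 2 -> k < 4 * p / (4 - p) ^+ 2)
  (M_ricci : ricci_ge g (fun x => - k * rho x)) :
  exists c : R, forall x, u x = c.
Proof.
have p0 : 0 < p by exact: lt_trans p_gt1.
(* For p < 2 the assumed bound is the stronger one: 4 p / (4 - p)^2 <= 4 / p amounts to p <= 4 -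
   p. *)
have kp : k < 4 / p.
  have [p2|p2] := leP 2 p; first exact: k_ge2.
  apply: (lt_trans (k_lt2 p2)); have p4 : 0 < 4 - p by lra.
  rewrite ltr_pdivrMr ?exprn_gt0 // mulrAC ltr_pdivlMr //.
  have -> : 4 * (4 - p) ^+ 2 = 4 * p * p + 32 * (2 - p) by ring.
  by rewrite ltrDl; lra.
have m4 : Num.max k 0 < 4 / p by rewrite gt_max kp divr_gt0.
have k1 : k <= Num.max k 0 by rewrite le_max lexx.
have k0 : 0 <= Num.max k 0 by rewrite le_max lexx orbT.
(* The constant k may be negative or zero, but [liouville] needs a positive one. The midpoint of
   max(k, 0) and 4 / p is positive, still below 4 / p, and at least k, so the curvature bound
   persists because rho is nonnegative. *)
pose K := (Num.max k 0 + 4 / p) / 2.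
have kK : k <= K by rewrite /K; move: m4 k1; move: (Num.max k 0) (4 / p) => a b; lra.
have K0 : 0 < K by rewrite /K; move: m4 k0; move: (Num.max k 0) (4 / p) => a b; lra.
have Kp : K < 4 / p by rewrite /K; move: m4; move: (Num.max k 0) (4 / p) => a b; lra.
have Kq : K * (p / 2) < 2.
  by move: Kp; rewrite ltr_pdivlMr // mulrA ltr_pdivrMr //; lra.
have ric : ricci_ge g (fun x => - K * rho x).
  move=> i z cz v; apply: le_trans (M_ricci i z cz v); rewrite ler_wpM2r //.
    exact: gram_ge0 (gram_metric g cz).
  by rewrite !mulNr lerN2 ler_wpM2r.
(* |du|^p is the power p / 2 of the energy |du|^2, so the exponent is q = p / 2 and the condition K
   < 4 / p becomes K q < 2. *)
have fin : (\int[volm g]_x (energy g u x `^ (p / 2))%:E < +oo)%E.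
  move: u_energy; rewrite integral_volume; under eq_integral => x _ do
    rewrite norm_gradE -powR12_sqrt ?gpair_ge0 // -powRrM [2^-1 * p]mulrC.
  by [].
have q0 : 0 < p / 2 by rewrite divr_gt0.
exact: (liouville rho_ge0 rho_poincare u_pluriharmonic q0 fin M_complete K0 Kq ric).
Qed.
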